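(* The tritronquée solution $y_t$ of $y''=6y^2+z$ is free of singularities in the sector $\{z:\arg z\in(-\tfrac{3}{5}\pi,\pi)\}$ (Dubrovin's conjecture).
   Context: The Painlevé equation $P_I$ is written as $y''=6y^2+z$. Under the change of variables $$x=\frac{e^{i\pi/4}}{30}(24z)^{5/4},\qquad y(z)=i\sqrt{\frac z6}\left(1-\frac{4}{25x^2}+h(x)\right)$$ (so that $\arg x=\frac{\pi}{4}+\frac54\arg z$, and in particular $x\in i\mathbb{R}^+$ corresponds to $\arg z=\pi/5$), $P_I$ becomes $$h''+\frac1x h'-h=\frac{h^2}{2}+\frac{392}{625x^4}.$$ The tritronquée $y_t$ is the solution of $P_I$ which corresponds, through this change of variables, to the unique solution $h$ with the behavior $h(x)=O(x^{-4})$ as $x\to+i\infty$ (i.e. $|z|\to\infty$ along $\arg z=\pi/5$). *)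

(* Defs.v *)
(* Stdlib reals with Coquelicot's complex numbers and complex derivative. *)
From Stdlib Require Import Reals.
From Coquelicot Require Import Coquelicot.
Open Scope R_scope.

Definition cis (t : R) : C := (cos t, sin t).

(* Principal argument, in (-PI, PI]; the value at z = 0 is junk. *)
Definition Carg (z : C) : R :=
  if Rle_dec 0 (Im z) then acos (Re z / Cmod z) else - acos (Re z / Cmod z).

(* Principal branch of z^a, meaningful for z <> 0 only. *)
Definition Cpower (z : C) (a : R) : C :=
  (RtoC (Rpower (Cmod z) a) * cis (a * Carg z))%C.

Definition sector (a b : R) (z : C) : Prop := z <> RtoC 0 /\ a < Carg z < b.

(* Complex differentiability of y on the open set D makes y holomorphic there,
   so a solution on D has no singularity in D. Values outside D are irrelevant. *)
Definition solves_PI (D : C -> Prop) (y : C -> C) : Prop :=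
  open D /\
  exists y' y'' : C -> C, forall z : C, D z ->
    is_derive (K := C_AbsRing) (V := C_NormedModule) y z (y' z) /\
    is_derive (K := C_AbsRing) (V := C_NormedModule) y' z (y'' z) /\
    y'' z = (6 * y z ^ 2 + z)%C.

Definition solves_normalized_PI (E : C -> Prop) (h : C -> C) : Prop :=
  open E /\
  exists h' h'' : C -> C, forall x : C, E x ->
    x <> RtoC 0 /\
    is_derive (K := C_AbsRing) (V := C_NormedModule) h x (h' x) /\
    is_derive (K := C_AbsRing) (V := C_NormedModule) h' x (h'' x) /\
    (h'' x + 1 / x * h' x - h x = h x ^ 2 / 2 + 392 / (625 * x ^ 4))%C.

(* With the principal branches below, arg x = PI/4 + 5/4 arg z; the ray
   arg z = PI/5 is mapped onto the positive imaginary axis. *)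
Definition x_of_z (z : C) : C :=
  (cis (PI / 4) / 30 * Cpower (24 * z) (5 / 4))%C.

Definition y_of_h (h : C -> C) (z : C) : C :=
  (Ci * Cpower (z / 6) (1 / 2) *
   (1 - 4 / (25 * x_of_z z ^ 2) + h (x_of_z z)))%C.

Definition ray (z_arg : R) (t : R) : C := (RtoC t * cis z_arg)%C.

(* A solution h near the end of the positive imaginary axis with
   h(x) = O(x^(-4)) as x -> +i oo along that axis. *)
Definition decaying_at_iinfty (E : C -> Prop) (h : C -> C) : Prop :=
  solves_normalized_PI E h /\
  exists M T : R, 0 < T /\ forall t : R, T < t ->
    E (Ci * t)%C /\ Cmod (h (Ci * t)%C) <= M * Cmod (/ (Ci * t) ^ 4)%C.

(* y is a solution on an open set D containing the end of the ray
   arg z = PI/5, and near that end it corresponds to a decaying h. *)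
Definition is_tritronquee (D : C -> Prop) (y : C -> C) : Prop :=
  solves_PI D y /\
  exists (E : C -> Prop) (h : C -> C), decaying_at_iinfty E h /\
  exists T : R, 0 < T /\ forall t : R, T < t ->
    D (ray (PI / 5) t) /\
    locally (ray (PI / 5) t) (fun z : C => y z = y_of_h h z).

(* Equality near the end of the ray arg z = PI/5: y1 and y2 are then analytic
   continuations of one another. *)
Definition same_near_ray_end (y1 y2 : C -> C) : Prop :=
  exists T : R, 0 < T /\ forall t : R, T < t ->
    locally (ray (PI / 5) t) (fun z : C => y1 z = y2 z).

(* Main.v *)
Require Import Defs.
From Stdlib Require Import Reals Lra Lia Psatz ClassicalEpsilon.
From Coquelicot Require Import Coquelicot.
Open Scope R_scope.

(** Rotate by s = e^(-i pi/5) z and y = - e^(-2 i pi/5) W, so that W'' = s - 6 W^2, and put x = i xi, so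
    that H(xi) = h(x) solves H'' + H'/xi + H = - H^2/2 - c/xi^4 with c = 392/625. The sector becomes
    |arg s| < 4 pi/5, which lies in |arg xi| < pi.

    For Re xi > -del, |xi + del| > 18/5, a contraction along horizontal half-lines gives a solution H with
    explicit bounds. Its mirror image conj H(- conj xi) solves the same equation, and on the strip where
    both are defined the difference is a small multiple of a recessive solution behaving like
    e^(i xi) xi^(-1/2). A contraction along vertical half-lines extends
    this exponentially small correction to the whole left upper quadrant; by conjugation H extends
    to |xi| > 3.62 in the slit plane, which covers |s| > 1.775 in the sector.

    Inside, W is continued along the positive axis to s = 0. Around a known centre, the majorant
    (n+1) rho^(-n-2) for Taylor coefficients yields discs of explicit radius, and
    the weighted energy |W' - P'|^2 + 12 P |W - P|^2, P an approximating polynomial with P' >= 0, controls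
    the data from centre to centre. The disc at 0 has radius 9/5 > 1.775, so it overlaps
    the outer region; uniqueness along arcs |s| = const glues the two.

    Two solutions of size O(xi^(-4)) on the ray differ by xi^(-1/2) d with d'' + d = O(xi^(-2)) d and
    d -> 0, and the energy |d|^2 + |d'|^2 cannot tend to 0 unless d = 0. *)

(** * Complex and real-parameter derivatives *)

(** No Cauchy theory enters. Holomorphy is handled through complex derivatives and mean value
    inequalities: limits are differentiated by uniform convergence of derivatives, and the identity
    theorem is replaced by a Gronwall estimate for the difference of two solutions along a path. The
    difficulty is quantitative. The asymptotic analysis must come far enough inward to meet a Taylor
    disc at the origin, and the margin between |s| = 1.775 and 9/5 is small; so every constant is
    explicit and little can be wasted. The delicate directions are the edges arg s = 4 pi/5 and -4
    pi/5, where exp(i xi), or its conjugate counterpart, is no longer small and power-law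
    asymptotics do not control the solution. The exponential is still damped along vertical
    half-lines, and the bound 2 for the connection coefficient is then enough to continue up to the
    negative axis of [xi]. On the positive s-axis the linearized equation is oscillatory, so the
    energy of the error grows only linearly and one polynomial suffices. *)

Definition Cd (f : C -> C) (z l : C) : Prop :=
  forall eps, 0 < eps -> exists del, 0 < del /\ forall w : C, Cmod (w - z) < del ->
    Cmod (f w - f z - l * (w - z)) <= eps * Cmod (w - z).

(** Componentwise, so that the real calculus and its automation apply to each part. [Rd_re_im] gives
    the equivalent epsilon-delta form, needed for composition with [Cd]. *)
Definition Rd (f : R -> C) (t : R) (l : C) : Prop :=
  is_derive (fun u => Re (f u)) t (Re l) /\ is_derive (fun u => Im (f u)) t (Im l).

Definition Copen (D : C -> Prop) : Prop :=
  forall z, D z -> exists r, 0 < r /\ forall w : C, Cmod (w - z) < r -> D w.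

(** The uniform structure of C is that of a product, whose balls are squares; the factor [sqrt 2]
    compares them with round discs. *)
Lemma locally_Cmod (z : C) (P : C -> Prop) :
  @locally C_UniformSpace z P <->
  exists r, 0 < r /\ forall w : C, Cmod (w - z) < r -> P w.
Proof.
split.
- intros [e He]. exists e. split; [apply cond_pos|].
  intros w Hw. apply He. now apply C_NormedModule_mixin_compat1.
- intros [r [Hr H]].
  assert (Hs : 0 < sqrt 2) by (apply sqrt_lt_R0; lra).
  assert (Hp : 0 < r / sqrt 2) by (apply Rdiv_lt_0_compat; lra).
  exists (mkposreal _ Hp). intros w Hw. apply H.
  apply C_NormedModule_mixin_compat2 in Hw. simpl in Hw.
  replace r with (sqrt 2 * (r / sqrt 2)); [exact Hw|field; lra].
Qed.

Lemma open_Copen (D : C -> Prop) : @open C_UniformSpace D <-> Copen D.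
Proof.
split; intros H z Hz; specialize (H z Hz); now apply locally_Cmod.
Qed.

Ltac Csimp := unfold Re, Im, Cminus, Cplus, Copp, Cmult, RtoC; simpl; ring.

Lemma Cmod_minus_sym (a b : C) : Cmod (a - b) = Cmod (b - a).
Proof. rewrite <- Cmod_opp. f_equal. ring. Qed.

Lemma Cmod_tri_minus (a b : C) : Cmod (a - b) <= Cmod a + Cmod b.
Proof. unfold Cminus. eapply Rle_trans; [apply Cmod_triangle|]. rewrite Cmod_opp. lra. Qed.

Lemma Cmod_rev_tri (a b : C) : Cmod a - Cmod b <= Cmod (a - b).
Proof.
assert (H := Cmod_triangle (a - b) b).
replace (a - b + b)%C with a in H by ring. lra.
Qed.

Lemma Cmod_RtoC_nonneg (r : R) : 0 <= r -> Cmod r = r.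
Proof. intros. rewrite Cmod_R. now apply Rabs_pos_eq. Qed.

Lemma Ceq (a b : C) : Re a = Re b -> Im a = Im b -> a = b.
Proof. destruct a, b; simpl; intros; subst; reflexivity. Qed.

Lemma im_le_Cmod (c : C) : Rabs (Im c) <= Cmod c.
Proof. eapply Rle_trans; [|apply Rmax_Cmod]. apply Rmax_r. Qed.

Lemma Cmod_le_re_im (c : C) : Cmod c <= Rabs (Re c) + Rabs (Im c).
Proof.
replace c with (RtoC (Re c) + Ci * RtoC (Im c))%C at 1.
- eapply Rle_trans; [apply Cmod_triangle|]. rewrite Cmod_mult, Cmod_Ci, !Cmod_R. lra.
- apply Ceq; destruct c; simpl; ring.
Qed.

(** Over [C_AbsRing] the neighbourhoods in [is_derive] are those of the absolute ring, hence already
    discs for [Cmod]. Besides the linearity conditions, only the order of the factors [l] and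
    [w - z] differs. *)
Lemma Cd_is_derive (f : C -> C) (z l : C) :
  Cd f z l <-> is_derive (K := C_AbsRing) (V := C_NormedModule) f z l.
Proof.
split.
- intros H. split.
  + split.
    * intros x y. apply (@scal_distr_r C_AbsRing C_NormedModule).
    * intros k x. change (@scal C_AbsRing C_NormedModule (k * x)%C l = scal k (scal x l)).
      symmetry. apply (@scal_assoc C_AbsRing C_NormedModule).
    * exists (Cmod l + 1). split; [pose proof (Cmod_ge_0 l); lra|].
      intros x. change (Cmod (x * l) <= (Cmod l + 1) * Cmod x).
      rewrite Cmod_mult.
      pose proof (Cmod_ge_0 x). nra.
  + intros x Hx.
    assert (E : z = x).
    { apply (@is_filter_lim_locally_unique C_AbsRing (AbsRing_NormedModule C_AbsRing)). exact Hx. }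
    subst x. intros eps. destruct (H eps (cond_pos eps)) as [d [Hd Hw]].
    exists (mkposreal d Hd). intros w Hb.
    change (Cmod (w - z) < d) in Hb. specialize (Hw w Hb).
    change (Cmod (f w - f z - (w - z) * l) <= eps * Cmod (w - z)).
    replace (f w - f z - (w - z) * l)%C with (f w - f z - l * (w - z))%C by ring. exact Hw.
- intros [_ H] eps Heps.
  assert (Hz : is_filter_lim (@locally (AbsRing_UniformSpace C_AbsRing) z) z) by (intros P HP; exact HP).
  destruct (H z Hz (mkposreal eps Heps)) as [d Hd].
  exists d. split; [apply cond_pos|]. intros w Hw. specialize (Hd w Hw). simpl in Hd.
  change (Cmod (f w - f z - (w - z) * l) <= eps * Cmod (w - z)) in Hd.
  replace (f w - f z - l * (w - z))%C with (f w - f z - (w - z) * l)%C by ring. exact Hd.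
Qed.

Lemma Cd_ext_loc (f g : C -> C) (z l : C) (r : R) :
  0 < r -> (forall w : C, Cmod (w - z) < r -> f w = g w) -> Cd f z l -> Cd g z l.
Proof.
intros Hr E H eps He. destruct (H eps He) as [d [Hd Hw]].
exists (Rmin d r). split; [now apply Rmin_pos|]. intros w Hm.
rewrite <- !E.
- apply Hw. eapply Rlt_le_trans; [exact Hm|apply Rmin_l].
- replace (z - z)%C with (RtoC 0) by ring. rewrite Cmod_0. exact Hr.
- eapply Rlt_le_trans; [exact Hm|apply Rmin_r].
Qed.

Lemma Cd_ext (f g : C -> C) (z l : C) : (forall w, f w = g w) -> Cd f z l -> Cd g z l.
Proof. intros E. apply (Cd_ext_loc f g z l 1); [lra|auto]. Qed.

Lemma Cd_eq (f : C -> C) (z l l' : C) : l = l' -> Cd f z l -> Cd f z l'.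
Proof. now intros ->. Qed.

Lemma Cd_const (c z : C) : Cd (fun _ => c) z 0%C.
Proof.
intros eps He. exists 1. split; [lra|]. intros w _.
replace (c - c - 0 * (w - z))%C with (RtoC 0) by ring. rewrite Cmod_0.
pose proof (Cmod_ge_0 (w - z)). nra.
Qed.

Lemma Cd_id (z : C) : Cd (fun w => w) z 1%C.
Proof.
intros eps He. exists 1. split; [lra|]. intros w _.
replace (w - z - 1 * (w - z))%C with (RtoC 0) by ring. rewrite Cmod_0.
pose proof (Cmod_ge_0 (w - z)). nra.
Qed.

Lemma Cd_plus (f g : C -> C) (z a b : C) :
  Cd f z a -> Cd g z b -> Cd (fun w => f w + g w)%C z (a + b)%C.
Proof.
intros Hf Hg eps He.
destruct (Hf (eps / 2)) as [d1 [Hd1 H1]]; [lra|].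
destruct (Hg (eps / 2)) as [d2 [Hd2 H2]]; [lra|].
exists (Rmin d1 d2). split; [now apply Rmin_pos|]. intros w Hw.
specialize (H1 w (Rlt_le_trans _ _ _ Hw (Rmin_l _ _))).
specialize (H2 w (Rlt_le_trans _ _ _ Hw (Rmin_r _ _))).
replace (f w + g w - (f z + g z) - (a + b) * (w - z))%C
  with ((f w - f z - a * (w - z)) + (g w - g z - b * (w - z)))%C by ring.
eapply Rle_trans; [apply Cmod_triangle|]. lra.
Qed.

Lemma Cd_lip (f : C -> C) (z l : C) : Cd f z l ->
  exists d, 0 < d /\ forall w : C, Cmod (w - z) < d ->
    Cmod (f w - f z) <= (Cmod l + 1) * Cmod (w - z).
Proof.
intros H. destruct (H 1) as [d [Hd Hw]]; [lra|]. exists d. split; [exact Hd|].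
intros w Hm. specialize (Hw w Hm).
replace (f w - f z)%C with ((f w - f z - l * (w - z)) + l * (w - z))%C by ring.
eapply Rle_trans; [apply Cmod_triangle|]. rewrite Cmod_mult. lra.
Qed.

Lemma Cd_cont (f : C -> C) (z l : C) : Cd f z l ->
  forall eps, 0 < eps -> exists d, 0 < d /\ forall w : C, Cmod (w - z) < d -> Cmod (f w - f z) < eps.
Proof.
intros H eps He. destruct (Cd_lip _ _ _ H) as [d [Hd Hw]].
pose proof (Cmod_ge_0 l).
exists (Rmin d (eps / (Cmod l + 2))). split.
- apply Rmin_pos; [exact Hd|]. apply Rdiv_lt_0_compat; lra.
- intros w Hm.
  specialize (Hw w (Rlt_le_trans _ _ _ Hm (Rmin_l _ _))).
  assert (Hm2 := Rlt_le_trans _ _ _ Hm (Rmin_r _ _)).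
  apply (Rmult_lt_compat_r (Cmod l + 2)) in Hm2; [|lra].
  replace (eps / (Cmod l + 2) * (Cmod l + 2)) with eps in Hm2 by (field; lra).
  pose proof (Cmod_ge_0 (w - z)). nra.
Qed.

Lemma Cd_comp (f g : C -> C) (z a b : C) :
  Cd g z b -> Cd f (g z) a -> Cd (fun w => f (g w)) z (a * b)%C.
Proof.
intros Hg Hf eps He.
pose proof (Cmod_ge_0 a) as Ha. pose proof (Cmod_ge_0 b) as Hb.
assert (He1 : 0 < eps / (2 * (Cmod b + 1))) by (apply Rdiv_lt_0_compat; lra).
assert (He2 : 0 < eps / (2 * (Cmod a + 1))) by (apply Rdiv_lt_0_compat; lra).
destruct (Hf _ He1) as [d1 [Hd1 H1]].
destruct (Hg _ He2) as [d2 [Hd2 H2]].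
destruct (Cd_lip _ _ _ Hg) as [d3 [Hd3 H3]].
destruct (Cd_cont _ _ _ Hg _ Hd1) as [d4 [Hd4 H4]].
exists (Rmin (Rmin d2 d3) d4). split; [repeat apply Rmin_pos; assumption|].
intros w Hw.
assert (W4 := Rlt_le_trans _ _ _ Hw (Rmin_r _ _)).
assert (W0 := Rlt_le_trans _ _ _ Hw (Rmin_l _ _)).
assert (W2 := Rlt_le_trans _ _ _ W0 (Rmin_l _ _)).
assert (W3 := Rlt_le_trans _ _ _ W0 (Rmin_r _ _)).
specialize (H1 (g w) (H4 w W4)). specialize (H2 w W2). specialize (H3 w W3).
replace (f (g w) - f (g z) - a * b * (w - z))%C
  with ((f (g w) - f (g z) - a * (g w - g z)) + a * (g w - g z - b * (w - z)))%C by ring.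
eapply Rle_trans; [apply Cmod_triangle|]. rewrite Cmod_mult.
set (X := Cmod (w - z)) in *. assert (HX : 0 <= X) by apply Cmod_ge_0.
apply Rle_trans with (eps / (2 * (Cmod b + 1)) * ((Cmod b + 1) * X) + Cmod a * (eps / (2 * (Cmod a + 1)) * X)).
- apply Rplus_le_compat.
  + eapply Rle_trans; [exact H1|]. apply Rmult_le_compat_l; lra.
  + apply Rmult_le_compat_l; lra.
- replace (eps / (2 * (Cmod b + 1)) * ((Cmod b + 1) * X)) with (eps / 2 * X) by (field; lra).
  replace (Cmod a * (eps / (2 * (Cmod a + 1)) * X)) with (eps / 2 * X * (Cmod a / (Cmod a + 1))) by (field; lra).
  assert (Cmod a / (Cmod a + 1) <= 1).
  { apply (Rmult_le_reg_r (Cmod a + 1)); [lra|]. replace (Cmod a / (Cmod a + 1) * (Cmod a + 1)) with (Cmod a) by (field; lra). lra. }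
  assert (0 <= eps / 2 * X) by nra. nra.
Qed.

Lemma Cd_scal (k : C) (f : C -> C) (z l : C) : Cd f z l -> Cd (fun w => k * f w)%C z (k * l)%C.
Proof.
intros H. apply (Cd_comp (fun w => k * w)%C f); [exact H|].
intros eps He. exists 1. split; [lra|]. intros w _.
match goal with |- Cmod ?e <= _ => replace e with (RtoC 0) by ring end.
rewrite Cmod_0. pose proof (Cmod_ge_0 (w - f z)). nra.
Qed.

Lemma Cd_opp (f : C -> C) (z l : C) : Cd f z l -> Cd (fun w => - f w)%C z (- l)%C.
Proof.
intros H. apply (Cd_ext (fun w => RtoC (-1) * f w)%C).
- intros w. apply Ceq; destruct (f w); simpl; ring.
- eapply Cd_eq; [|apply Cd_scal; exact H]. apply Ceq; destruct l; simpl; ring.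
Qed.

Lemma Cd_minus (f g : C -> C) (z a b : C) :
  Cd f z a -> Cd g z b -> Cd (fun w => f w - g w)%C z (a - b)%C.
Proof. intros Hf Hg. apply Cd_plus; [exact Hf|]. now apply Cd_opp. Qed.

Lemma Cd_square (z : C) : Cd (fun w => w * w)%C z (2 * z)%C.
Proof.
intros eps He. exists eps. split; [exact He|]. intros w Hw.
replace (w * w - z * z - 2 * z * (w - z))%C with ((w - z) * (w - z))%C by ring.
rewrite Cmod_mult. pose proof (Cmod_ge_0 (w - z)). nra.
Qed.

(* Polarization [fg = ((f+g)^2 - (f-g)^2)/4] reduces products to squares. *)
Lemma Cd_mult (f g : C -> C) (z a b : C) :
  Cd f z a -> Cd g z b -> Cd (fun w => f w * g w)%C z (a * g z + f z * b)%C.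
Proof.
intros Hf Hg.
apply (Cd_ext (fun w => / 4 * ((f w + g w) * (f w + g w) - (f w - g w) * (f w - g w)))%C).
- intros w. field.
- eapply Cd_eq; [|apply Cd_scal, Cd_minus].
  2: apply (Cd_comp (fun w => w * w)%C (fun w => f w + g w)%C); [apply Cd_plus; [exact Hf|exact Hg]|apply Cd_square].
  2: apply (Cd_comp (fun w => w * w)%C (fun w => f w - g w)%C); [apply Cd_minus; [exact Hf|exact Hg]|apply Cd_square].
  simpl. field.
Qed.

Lemma Cd_inv_id (z : C) : z <> RtoC 0 -> Cd (fun w => / w)%C z (- / (z * z))%C.
Proof.
intros Hz eps He.
assert (Hm : 0 < Cmod z) by now apply Cmod_gt_0.
assert (H3 : 0 < Cmod z * (Cmod z * Cmod z)) by (repeat apply Rmult_lt_0_compat; assumption).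
exists (Rmin (Cmod z / 2) (eps * (Cmod z * (Cmod z * Cmod z)) / 2)). split.
- apply Rmin_pos; [lra|]. apply Rdiv_lt_0_compat; [|lra]. now apply Rmult_lt_0_compat.
- intros w Hw.
  assert (W1 := Rlt_le_trans _ _ _ Hw (Rmin_l _ _)).
  assert (W2 := Rlt_le_trans _ _ _ Hw (Rmin_r _ _)).
  assert (Hwm : Cmod z / 2 <= Cmod w).
  { pose proof (Cmod_rev_tri z (z - w)) as H. replace (z - (z - w))%C with w in H by ring.
    rewrite (Cmod_minus_sym z w) in H. lra. }
  assert (Hw0 : w <> RtoC 0) by (apply Cmod_gt_0; lra).
  replace (/ w - / z - - / (z * z) * (w - z))%C
    with ((w - z) * ((w - z) * / (w * (z * z))))%C by (field; auto).
  rewrite !Cmod_mult, Cmod_inv, !Cmod_mult by (repeat apply Cmult_neq_0; assumption).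
  set (X := Cmod (w - z)) in *. assert (HX : 0 <= X) by apply Cmod_ge_0.
  rewrite (Rmult_comm X). apply Rmult_le_compat_r; [exact HX|].
  apply (Rmult_le_reg_r (Cmod w * (Cmod z * Cmod z))).
  + apply Rmult_lt_0_compat; [lra|nra].
  + replace (X * / (Cmod w * (Cmod z * Cmod z)) * (Cmod w * (Cmod z * Cmod z))) with X by (field; lra).
    apply Rle_trans with (eps * (Cmod z / 2 * (Cmod z * Cmod z))); [lra|].
    apply Rmult_le_compat_l; [lra|]. apply Rmult_le_compat_r; [nra|exact Hwm].
Qed.

Lemma Cd_inv (f : C -> C) (z l : C) : f z <> RtoC 0 -> Cd f z l ->
  Cd (fun w => / f w)%C z (- / (f z * f z) * l)%C.
Proof. intros H Hf. apply (Cd_comp (fun w => / w)%C f); [exact Hf|]. now apply Cd_inv_id. Qed.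

Lemma Rd_re_im (f : R -> C) (t : R) (l : C) :
  Rd f t l <-> (forall eps, 0 < eps -> exists d, 0 < d /\ forall u, Rabs (u - t) < d ->
    Cmod (f u - f t - RtoC (u - t) * l) <= eps * Rabs (u - t)).
Proof.
split.
- intros [H1 H2] eps He.
  apply is_derive_Reals in H1. apply is_derive_Reals in H2.
  destruct (H1 (eps / 2)) as [d1 W1]; [lra|]. destruct (H2 (eps / 2)) as [d2 W2]; [lra|].
  exists (Rmin d1 d2). split; [apply Rmin_pos; apply cond_pos|]. intros u Hu.
  assert (U1 := Rlt_le_trans _ _ _ Hu (Rmin_l _ _)).
  assert (U2 := Rlt_le_trans _ _ _ Hu (Rmin_r _ _)).
  destruct (Req_dec (u - t) 0) as [E|E].
  + replace u with t by lra.
    match goal with |- Cmod ?e <= _ => replace e with (RtoC 0) end.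
    * rewrite Cmod_0. pose proof (Rabs_pos (t - t)). nra.
    * apply Ceq; simpl; ring.
  + assert (K : forall (g : R -> R) l', Rabs ((g (t + (u - t)) - g t) / (u - t) - l') < eps / 2 ->
       Rabs (g u - g t - (u - t) * l') <= eps / 2 * Rabs (u - t)).
    { intros g l' Hg. replace (t + (u - t)) with u in Hg by ring.
      replace (g u - g t - (u - t) * l') with (((g u - g t) / (u - t) - l') * (u - t)) by (field; exact E).
      rewrite Rabs_mult. apply Rmult_le_compat_r; [apply Rabs_pos|lra]. }
    specialize (W1 (u - t) E U1). specialize (W2 (u - t) E U2).
    apply (K (fun u => Re (f u))) in W1. apply (K (fun u => Im (f u))) in W2.
    eapply Rle_trans; [apply Cmod_le_re_im|].
    replace (Re (f u - f t - RtoC (u - t) * l)) with (Re (f u) - Re (f t) - (u - t) * Re l) by Csimp.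
    replace (Im (f u - f t - RtoC (u - t) * l)) with (Im (f u) - Im (f t) - (u - t) * Im l) by Csimp.
    lra.
- intros H.
  assert (K : forall (g : R -> R) l', (forall eps, 0 < eps -> exists d, 0 < d /\ forall u, Rabs (u - t) < d ->
    Rabs (g u - g t - (u - t) * l') <= eps * Rabs (u - t)) -> is_derive g t l').
  { intros g l' Hg. apply is_derive_Reals. intros eps He.
    destruct (Hg (eps / 2)) as [d [Hd W]]; [lra|]. exists (mkposreal d Hd). intros h Hh Hd'.
    simpl in Hd'. specialize (W (t + h)). replace (t + h - t) with h in W by ring. specialize (W Hd').
    replace ((g (t + h) - g t) / h - l') with ((g (t + h) - g t - h * l') / h) by (field; exact Hh).
    unfold Rdiv. rewrite Rabs_mult, Rabs_inv.
    assert (0 < Rabs h) by now apply Rabs_pos_lt.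
    apply (Rmult_lt_reg_r (Rabs h)); [assumption|].
    rewrite Rmult_assoc, Rinv_l by lra. nra. }
  split; apply K; intros eps He; destruct (H eps He) as [d [Hd W]]; exists d; (split; [exact Hd|]);
    intros u Hu; specialize (W u Hu); (eapply Rle_trans; [|exact W]).
  + replace (Re (f u) - Re (f t) - (u - t) * Re l) with (Re (f u - f t - RtoC (u - t) * l)) by Csimp.
    apply re_le_Cmod.
  + replace (Im (f u) - Im (f t) - (u - t) * Im l) with (Im (f u - f t - RtoC (u - t) * l)) by Csimp.
    apply im_le_Cmod.
Qed.

Lemma Cd_Rd (f : C -> C) (g : R -> C) (t : R) (a b : C) :
  Cd f (g t) a -> Rd g t b -> Rd (fun u => f (g u)) t (a * b)%C.
Proof.
intros Hf Hg. apply Rd_re_im. intros eps He.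
pose proof (Cmod_ge_0 a) as Ha. pose proof (Cmod_ge_0 b) as Hb.
assert (He1 : 0 < eps / (2 * (Cmod b + 1))) by (apply Rdiv_lt_0_compat; lra).
assert (He2 : 0 < eps / (2 * (Cmod a + 1))) by (apply Rdiv_lt_0_compat; lra).
destruct (Hf _ He1) as [d1 [Hd1 H1]].
destruct (proj1 (Rd_re_im _ _ _) Hg _ He2) as [d2 [Hd2 H2]].
destruct (proj1 (Rd_re_im _ _ _) Hg 1 Rlt_0_1) as [d3 [Hd3 H3]].
assert (Hd4 : 0 < d1 / (Cmod b + 1)) by (apply Rdiv_lt_0_compat; lra).
exists (Rmin (Rmin d2 d3) (d1 / (Cmod b + 1))). split; [repeat apply Rmin_pos; assumption|].
intros u Hw.
assert (W4 := Rlt_le_trans _ _ _ Hw (Rmin_r _ _)).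
assert (W0 := Rlt_le_trans _ _ _ Hw (Rmin_l _ _)).
assert (W2 := Rlt_le_trans _ _ _ W0 (Rmin_l _ _)).
assert (W3 := Rlt_le_trans _ _ _ W0 (Rmin_r _ _)).
specialize (H2 u W2). specialize (H3 u W3).
set (X := Rabs (u - t)) in *. assert (HX : 0 <= X) by apply Rabs_pos.
assert (G : Cmod (g u - g t) <= (Cmod b + 1) * X).
{ replace (g u - g t)%C with ((g u - g t - RtoC (u - t) * b) + RtoC (u - t) * b)%C by ring.
  eapply Rle_trans; [apply Cmod_triangle|]. rewrite Cmod_mult, Cmod_R. fold X. nra. }
assert (G1 : Cmod (g u - g t) < d1).
{ eapply Rle_lt_trans; [exact G|].
  apply (Rmult_lt_compat_l (Cmod b + 1)) in W4; [|lra].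
  replace ((Cmod b + 1) * (d1 / (Cmod b + 1))) with d1 in W4 by (field; lra). exact W4. }
specialize (H1 (g u) G1).
replace (f (g u) - f (g t) - RtoC (u - t) * (a * b))%C
  with ((f (g u) - f (g t) - a * (g u - g t)) + a * (g u - g t - RtoC (u - t) * b))%C by ring.
eapply Rle_trans; [apply Cmod_triangle|]. rewrite Cmod_mult.
apply Rle_trans with (eps / (2 * (Cmod b + 1)) * ((Cmod b + 1) * X) + Cmod a * (eps / (2 * (Cmod a + 1)) * X)).
- apply Rplus_le_compat.
  + eapply Rle_trans; [exact H1|]. apply Rmult_le_compat_l; lra.
  + apply Rmult_le_compat_l; lra.
- replace (eps / (2 * (Cmod b + 1)) * ((Cmod b + 1) * X)) with (eps / 2 * X) by (field; lra).
  replace (Cmod a * (eps / (2 * (Cmod a + 1)) * X)) with (eps / 2 * X * (Cmod a / (Cmod a + 1))) by (field; lra).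
  assert (Cmod a / (Cmod a + 1) <= 1).
  { apply (Rmult_le_reg_r (Cmod a + 1)); [lra|]. replace (Cmod a / (Cmod a + 1) * (Cmod a + 1)) with (Cmod a) by (field; lra). lra. }
  assert (0 <= eps / 2 * X) by nra. nra.
Qed.

Lemma Rd_eq (f : R -> C) (t : R) (l l' : C) : l = l' -> Rd f t l -> Rd f t l'.
Proof. now intros ->. Qed.

Lemma Rd_ext (f g : R -> C) (t : R) (l : C) : (forall u, f u = g u) -> Rd f t l -> Rd g t l.
Proof.
intros E [H1 H2]. split; (eapply is_derive_ext; [|eassumption]); intros u; simpl; now rewrite E.
Qed.

Lemma Rd_const (c : C) (t : R) : Rd (fun _ => c) t 0%C.
Proof. split; apply @is_derive_const. Qed.

Lemma Rd_real (f : R -> R) (t l : R) : is_derive f t l -> Rd (fun u => RtoC (f u)) t (RtoC l).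
Proof. intros H. split; [exact H|]. change (is_derive (fun _ : R => 0) t 0). apply @is_derive_const. Qed.

Lemma Rd_plus (f g : R -> C) (t : R) (a b : C) :
  Rd f t a -> Rd g t b -> Rd (fun u => f u + g u)%C t (a + b)%C.
Proof. intros [H1 H2] [H3 H4]. split; now apply @is_derive_plus. Qed.

Lemma Rd_opp (f : R -> C) (t : R) (a : C) : Rd f t a -> Rd (fun u => - f u)%C t (- a)%C.
Proof. intros [H1 H2]. split; now apply @is_derive_opp. Qed.

Lemma Rd_minus (f g : R -> C) (t : R) (a b : C) :
  Rd f t a -> Rd g t b -> Rd (fun u => f u - g u)%C t (a - b)%C.
Proof. intros H1 H2. apply Rd_plus; [exact H1|now apply Rd_opp]. Qed.

Lemma is_derive_Rmult (f g : R -> R) (t a b : R) :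
  is_derive f t a -> is_derive g t b -> is_derive (fun u => f u * g u) t (a * g t + f t * b).
Proof. intros H1 H2. apply (@is_derive_mult R_AbsRing f g t a b H1 H2). intros; apply Rmult_comm. Qed.

Lemma is_derive_eq (f : R -> R) (t a b : R) : a = b -> is_derive f t a -> is_derive f t b.
Proof. now intros ->. Qed.

Lemma Rd_mult (f g : R -> C) (t : R) (a b : C) :
  Rd f t a -> Rd g t b -> Rd (fun u => f u * g u)%C t (a * g t + f t * b)%C.
Proof.
intros [H1 H2] [H3 H4]. split.
- eapply is_derive_eq; [|apply (is_derive_minus (V := R_NormedModule)
    (fun u => Re (f u) * Re (g u)) (fun u => Im (f u) * Im (g u))); apply is_derive_Rmult; eassumption].
  unfold minus, plus, opp; simpl. unfold Re, Im. ring.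
- eapply is_derive_eq; [|apply (is_derive_plus (V := R_NormedModule)
    (fun u => Re (f u) * Im (g u)) (fun u => Im (f u) * Re (g u))); apply is_derive_Rmult; eassumption].
  unfold plus; simpl. unfold Re, Im. ring.
Qed.

Lemma incr_der (f f' : R -> R) (a b : R) : a <= b ->
  (forall t, a <= t <= b -> is_derive f t (f' t)) -> (forall t, a <= t <= b -> 0 <= f' t) -> f a <= f b.
Proof.
intros Hab Hd Hp. destruct (Req_dec a b) as [->|Hne]; [lra|].
destruct (MVT_gen f a b f') as [c [Hc E]].
- intros x Hx. rewrite Rmin_left, Rmax_right in Hx by lra. apply Hd. lra.
- intros x Hx. rewrite Rmin_left, Rmax_right in Hx by lra.
  apply continuity_pt_filterlim. apply (@ex_derive_continuous R_AbsRing R_NormedModule).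
  eexists. apply Hd. lra.
- rewrite Rmin_left, Rmax_right in Hc by lra. specialize (Hp c Hc). nra.
Qed.

(** Mean value inequality for complex values: projecting [f] on the direction of its total increment
    [v] reduces it to the monotonicity of a real function. The comparison function [M], in place of
    a constant, later turns explicit primitives into integral bounds. *)
Lemma Rd_bound (f f' : R -> C) (M M' : R -> R) (a b : R) : a <= b ->
  (forall t, a <= t <= b -> Rd f t (f' t)) -> (forall t, a <= t <= b -> is_derive M t (M' t)) ->
  (forall t, a <= t <= b -> Cmod (f' t) <= M' t) -> Cmod (f b - f a) <= M b - M a.
Proof.
intros Hab Hf HM Hle.
set (v := (f b - f a)%C).
destruct (Req_dec (Cmod v) 0) as [E|E].
- rewrite E. assert (M a <= M b); [|lra]. apply (incr_der M M'); auto.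
  intros t Ht. eapply Rle_trans; [apply Cmod_ge_0|apply Hle; exact Ht].
- assert (Hv : 0 < Cmod v) by (pose proof (Cmod_ge_0 v); lra).
  assert (G : forall t, a <= t <= b ->
    is_derive (fun t => Cmod v * M t - (Re v * Re (f t) + Im v * Im (f t))) t
      (Cmod v * M' t - (Re v * Re (f' t) + Im v * Im (f' t)))).
  { intros t Ht. destruct (Hf t Ht) as [H1 H2].
    apply @is_derive_minus; [now apply is_derive_scal, HM|].
    apply @is_derive_plus; now apply is_derive_scal. }
  assert (K : forall w, Re v * Re w + Im v * Im w <= Cmod v * Cmod w).
  { intros w. eapply Rle_trans; [apply Rle_abs|].
    replace (Re v * Re w + Im v * Im w) with (Re (Cconj v * w)).
    - eapply Rle_trans; [apply re_le_Cmod|]. rewrite Cmod_mult, Cmod_conj. lra.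
    - unfold Cconj. Csimp. }
  assert (I := incr_der _ _ a b Hab G). cbv beta in I.
  assert (S : Re v * (Re (f b) - Re (f a)) + Im v * (Im (f b) - Im (f a)) = Cmod v * Cmod v).
  {
    replace (Re (f b) - Re (f a)) with (Re v) by (unfold v; Csimp).
    replace (Im (f b) - Im (f a)) with (Im v) by (unfold v; Csimp).
    replace (Cmod v * Cmod v) with (Cmod v ^ 2) by ring. rewrite Cmod2_alt. ring. }
  apply (Rmult_le_reg_l (Cmod v)); [exact Hv|].
  apply Rminus_le.
  assert (I2 : Cmod v * M a - (Re v * Re (f a) + Im v * Im (f a)) <= Cmod v * M b - (Re v * Re (f b) + Im v * Im (f b))).
  { apply I. intros t Ht. specialize (K (f' t)). specialize (Hle t Ht).
    assert (Cmod v * Cmod (f' t) <= Cmod v * M' t) by (apply Rmult_le_compat_l; lra). lra. }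
  lra.
Qed.

Lemma Rd_line (z w : C) (t : R) : Rd (fun u => z + RtoC u * w)%C t w.
Proof.
split; unfold Re, Im; simpl; (auto_derive; [auto|ring]).
Qed.

Lemma Cd_seg_bound (f f' : C -> C) (z w : C) (M : R) :
  (forall t, 0 <= t <= 1 -> Cd f (z + RtoC t * (w - z))%C (f' (z + RtoC t * (w - z))%C)) ->
  (forall t, 0 <= t <= 1 -> Cmod (f' (z + RtoC t * (w - z))%C) <= M) ->
  Cmod (f w - f z) <= M * Cmod (w - z).
Proof.
intros Hd Hb.
assert (H := Rd_bound (fun t => f (z + RtoC t * (w - z))%C)
  (fun t => f' (z + RtoC t * (w - z)) * (w - z))%C (fun t => M * Cmod (w - z) * t) (fun _ => M * Cmod (w - z)) 0 1).
simpl in H.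
replace (z + 1 * (w - z))%C with w in H by ring.
replace (z + 0 * (w - z))%C with z in H by ring.
replace (M * Cmod (w - z)) with (M * Cmod (w - z) * 1 - M * Cmod (w - z) * 0) by ring.
apply H; [lra| | |].
- intros t Ht. apply (Cd_Rd f); [now apply Hd|]. apply Rd_line.
- intros t Ht. auto_derive; auto. ring.
- intros t Ht. rewrite Cmod_mult. apply Rmult_le_compat_r; [apply Cmod_ge_0|now apply Hb].
Qed.

Lemma ball_seg (z w : C) (r : R) (t : R) : Cmod (w - z) < r -> 0 <= t <= 1 ->
  Cmod (z + RtoC t * (w - z) - z) < r.
Proof.
intros Hw Ht. replace (z + RtoC t * (w - z) - z)%C with (RtoC t * (w - z))%C by ring.
rewrite Cmod_mult, Cmod_RtoC_nonneg by lra. pose proof (Cmod_ge_0 (w - z)). nra.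
Qed.

(** * Limits of complex sequences and differentiation of limits *)

Definition Clim (u : nat -> C) : C := (real (Lim_seq (fun n => Re (u n))), real (Lim_seq (fun n => Im (u n)))).

Lemma Rlim_cauchy (u : nat -> R) (e : nat -> R) :
  is_lim_seq e 0 -> (forall n m, (n <= m)%nat -> Rabs (u m - u n) <= e n) ->
  is_lim_seq u (real (Lim_seq u)) /\ forall n, Rabs (u n - real (Lim_seq u)) <= e n.
Proof.
intros He Hu.
assert (Hc : ex_finite_lim_seq u).
{ apply ex_lim_seq_cauchy_corr. intros eps.
  apply is_lim_seq_spec in He. destruct (He eps) as [N HN]. exists N. intros n m Hn Hm.
  assert (K : forall a b, (a <= b)%nat -> (N <= a)%nat -> Rabs (u b - u a) < eps).
  { intros a b Hab Ha. eapply Rle_lt_trans; [now apply Hu|].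
    specialize (HN a Ha). rewrite Rminus_0_r in HN. eapply Rle_lt_trans; [apply Rle_abs|exact HN]. }
  destruct (Nat.le_ge_cases n m) as [H|H]; [rewrite Rabs_minus_sym|]; apply K; auto. }
destruct Hc as [l Hl].
assert (E := is_lim_seq_unique _ _ Hl). rewrite E. simpl. split; [exact Hl|].
intros n.
assert (L : is_lim_seq (fun m => Rabs (u m - u n)) (Rabs (l - u n))).
{ apply (is_lim_seq_abs _ (Finite (l - u n))). apply is_lim_seq_minus'; [exact Hl|apply is_lim_seq_const]. }
rewrite Rabs_minus_sym.
refine (is_lim_seq_le_loc _ (fun _ => e n) _ _ _ L (is_lim_seq_const _)).
exists n. intros m Hm. now apply Hu.
Qed.

(** The rate [e] serves both as Cauchy modulus and, unchanged, as error bound for the limit. [Clim]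
    is total, so such a rate is what gives it a meaning. *)
Lemma Clim_cauchy (u : nat -> C) (e : nat -> R) :
  is_lim_seq e 0 -> (forall n m, (n <= m)%nat -> Cmod (u m - u n) <= e n) ->
  forall n, Cmod (u n - Clim u) <= e n.
Proof.
intros He Hu.
destruct (Rlim_cauchy (fun n => Re (u n)) e He) as [R1 _].
{ intros n m H. eapply Rle_trans; [|now apply (Hu n m)].
  replace (Re (u m) - Re (u n)) with (Re (u m - u n)) by Csimp. apply re_le_Cmod. }
destruct (Rlim_cauchy (fun n => Im (u n)) e He) as [I1 _].
{ intros n m H. eapply Rle_trans; [|now apply (Hu n m)].
  replace (Im (u m) - Im (u n)) with (Im (u m - u n)) by Csimp. apply im_le_Cmod. }
intros n. apply le_epsilon. intros eps Heps.
apply is_lim_seq_spec in R1. apply is_lim_seq_spec in I1.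
assert (H2 : 0 < eps / 2) by lra.
destruct (R1 (mkposreal _ H2)) as [N1 W1]. destruct (I1 (mkposreal _ H2)) as [N2 W2].
set (m := Nat.max n (Nat.max N1 N2)).
specialize (W1 m ltac:(unfold m; lia)). specialize (W2 m ltac:(unfold m; lia)). simpl in W1, W2.
specialize (Hu n m ltac:(unfold m; lia)).
replace (u n - Clim u)%C with (- (u m - u n) + (u m - Clim u))%C by ring.
eapply Rle_trans; [apply Cmod_triangle|]. rewrite Cmod_opp.
apply Rplus_le_compat; [exact Hu|].
eapply Rle_trans; [apply Cmod_le_re_im|].
replace (Re (u m - Clim u)) with (Re (u m) - real (Lim_seq (fun n => Re (u n)))) by (unfold Clim; Csimp).
replace (Im (u m - Clim u)) with (Im (u m) - real (Lim_seq (fun n => Im (u n)))) by (unfold Clim; Csimp).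
lra.
Qed.

Lemma le_lim_0 (x : R) (e : nat -> R) : is_lim_seq e 0 -> (forall n, x <= e n) -> x <= 0.
Proof.
intros He H. refine (is_lim_seq_le_loc (fun _ => x) e x 0 _ (is_lim_seq_const _) He).
exists 0%nat. intros n _. apply H.
Qed.

Lemma Clim_le (u : nat -> C) (e : nat -> R) (l : C) :
  is_lim_seq e 0 -> (forall n, Cmod (u n - l) <= e n) -> Clim u = l.
Proof.
intros He Hu. apply Ceq; unfold Clim; simpl.
- rewrite (is_lim_seq_unique _ (Re l)); [reflexivity|].
  apply (is_lim_seq_le_le_loc (fun n => Re l - e n) _ (fun n => Re l + e n)).
  + exists 0%nat. intros n _. specialize (Hu n). pose proof (re_le_Cmod (u n - l)) as K.
    replace (Re (u n - l)) with (Re (u n) - Re l) in K by Csimp.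
    apply Rabs_le_between in K. lra.
  + replace (Finite (Re l)) with (Finite (Re l - 0)) by (f_equal; ring). apply is_lim_seq_minus'; [apply is_lim_seq_const|exact He].
  + replace (Finite (Re l)) with (Finite (Re l + 0)) by (f_equal; ring). apply is_lim_seq_plus'; [apply is_lim_seq_const|exact He].
- rewrite (is_lim_seq_unique _ (Im l)); [reflexivity|].
  apply (is_lim_seq_le_le_loc (fun n => Im l - e n) _ (fun n => Im l + e n)).
  + exists 0%nat. intros n _. specialize (Hu n). pose proof (im_le_Cmod (u n - l)) as K.
    replace (Im (u n - l)) with (Im (u n) - Im l) in K by Csimp.
    apply Rabs_le_between in K. lra.
  + replace (Finite (Im l)) with (Finite (Im l - 0)) by (f_equal; ring). apply is_lim_seq_minus'; [apply is_lim_seq_const|exact He].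
  + replace (Finite (Im l)) with (Finite (Im l + 0)) by (f_equal; ring). apply is_lim_seq_plus'; [apply is_lim_seq_const|exact He].
Qed.

(** By the mean value inequality [f m - f N] varies by at most [eps/4 * |w - z|] on a segment once
    both derivatives are uniformly close to [g']. Letting [m] grow transfers the difference quotient
    of [f N] to [g]. *)
Lemma Cd_limit (D : C -> Prop) (f f' : nat -> C -> C) (g g' : C -> C) (e : nat -> R) :
  Copen D -> is_lim_seq e 0 ->
  (forall n z, D z -> Cd (f n) z (f' n z)) ->
  (forall z, D z -> forall eps, 0 < eps -> exists N, forall n, (N <= n)%nat -> Cmod (f n z - g z) <= eps) ->
  (forall n z, D z -> Cmod (f' n z - g' z) <= e n) ->
  forall z, D z -> Cd g z (g' z).
Proof.
intros HD He Hd Hf Hf' z Hz eps Heps.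
destruct (HD z Hz) as [r [Hr Hball]].
apply is_lim_seq_spec in He.
assert (H8 : 0 < eps / 8) by lra.
destruct (He (mkposreal _ H8)) as [N HN]. simpl in HN.
assert (Hen : forall m, (N <= m)%nat -> e m <= eps / 8).
{ intros m Hm. specialize (HN m Hm). rewrite Rminus_0_r in HN. pose proof (Rle_abs (e m)). lra. }
destruct (Hd N z Hz (eps / 8) H8) as [d [Hdp Hw]].
exists (Rmin r d). split; [now apply Rmin_pos|]. intros w Hwm.
assert (Wr := Rlt_le_trans _ _ _ Hwm (Rmin_l _ _)).
assert (Wd := Rlt_le_trans _ _ _ Hwm (Rmin_r _ _)).
specialize (Hw w Wd).
assert (Dw : D w) by now apply Hball.
set (X := Cmod (w - z)) in *. assert (HX : 0 <= X) by apply Cmod_ge_0.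
destruct (Req_dec X 0) as [E0|E0].
{ assert (E : w = z). { apply Cmod_eq_0 in E0. replace w with (w - z + z)%C by ring. rewrite E0. ring. }
  subst w. replace (g z - g z - g' z * (z - z))%C with (RtoC 0) by ring. rewrite Cmod_0. nra. }
assert (HXp : 0 < eps / 8 * X) by (apply Rmult_lt_0_compat; lra).
destruct (Hf z Hz _ HXp) as [N1 K1]. destruct (Hf w Dw _ HXp) as [N2 K2].
set (m := Nat.max N (Nat.max N1 N2)).
specialize (K1 m ltac:(unfold m; lia)). specialize (K2 m ltac:(unfold m; lia)).
assert (S : Cmod ((f m w - f N w) - (f m z - f N z)) <= (eps / 4) * Cmod (w - z)).
{ apply (Cd_seg_bound (fun x => f m x - f N x)%C (fun x => f' m x - f' N x)%C).
  - intros t Ht. assert (D (z + RtoC t * (w - z))%C) by (apply Hball; now apply ball_seg).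
    apply Cd_minus; now apply Hd.
  - intros t Ht. assert (Dt : D (z + RtoC t * (w - z))%C) by (apply Hball; now apply ball_seg).
    set (x := (z + RtoC t * (w - z))%C) in *.
    replace (f' m x - f' N x)%C with ((f' m x - g' x) - (f' N x - g' x))%C by ring.
    eapply Rle_trans; [apply Cmod_tri_minus|].
    pose proof (Hf' m x Dt). pose proof (Hf' N x Dt).
    pose proof (Hen m ltac:(unfold m; lia)). pose proof (Hen N ltac:(lia)). lra. }
fold X in S.
assert (T : Cmod (f' N z - g' z) <= eps / 8).
{ eapply Rle_trans; [apply Hf'; exact Hz|]. apply Hen. lia. }
(* Five errors: two from replacing [g] by [f m], one from the mean value inequality, one from the
   differentiability of [f N], one from [f' N z - g' z]. Together they stay below [eps * X]. *)
replace (g w - g z - g' z * (w - z))%C with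
  (- (f m w - g w) + (f m z - g z) + ((f m w - f N w) - (f m z - f N z))
   + (f N w - f N z - f' N z * (w - z)) + (f' N z - g' z) * (w - z))%C by ring.
repeat (eapply Rle_trans; [apply Cmod_triangle|]; apply Rle_trans with (2:=Req_le _ _ eq_refl)).
assert (A1 := Cmod_triangle (- (f m w - g w) + (f m z - g z) + ((f m w - f N w) - (f m z - f N z))
   + (f N w - f N z - f' N z * (w - z))) ((f' N z - g' z) * (w - z))).
assert (A2 := Cmod_triangle (- (f m w - g w) + (f m z - g z) + ((f m w - f N w) - (f m z - f N z)))
   (f N w - f N z - f' N z * (w - z))).
assert (A3 := Cmod_triangle (- (f m w - g w) + (f m z - g z)) ((f m w - f N w) - (f m z - f N z))).
assert (A4 := Cmod_triangle (- (f m w - g w)) (f m z - g z)).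
rewrite Cmod_opp in A4. rewrite Cmod_mult in A1. fold X in A1.
assert (Cmod (f' N z - g' z) * X <= eps / 8 * X) by (apply Rmult_le_compat_r; lra).
rewrite Cmod_mult. fold X. lra.
Qed.

Lemma cis_add (a b : R) : cis (a + b) = (cis a * cis b)%C.
Proof. unfold cis. apply Ceq; simpl; rewrite ?cos_plus, ?sin_plus; ring. Qed.

Lemma Cmod_cis (t : R) : Cmod (cis t) = 1.
Proof.
unfold Cmod, cis; simpl. replace (cos t * (cos t * 1) + sin t * (sin t * 1)) with 1.
- apply sqrt_1.
- pose proof (sin2_cos2 t) as H. unfold Rsqr in H. lra.
Qed.

Lemma cis_0 : cis 0 = RtoC 1.
Proof. unfold cis. rewrite cos_0, sin_0. reflexivity. Qed.

Lemma cis_neq_0 (t : R) : cis t <> RtoC 0.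
Proof. apply Cmod_gt_0. rewrite Cmod_cis. lra. Qed.

Lemma exp_le_compat (a b : R) : a <= b -> exp a <= exp b.
Proof. intros [H| ->]; [left; now apply exp_increasing|lra]. Qed.

(** * Exponential, logarithm and powers on the slit plane *)

Definition cexp (z : C) : C := (RtoC (exp (Re z)) * cis (Im z))%C.

Lemma cexp_add (a b : C) : cexp (a + b) = (cexp a * cexp b)%C.
Proof.
unfold cexp. replace (Re (a + b)) with (Re a + Re b) by Csimp.
replace (Im (a + b)) with (Im a + Im b) by Csimp.
rewrite cis_add, exp_plus, RtoC_mult. ring.
Qed.

Lemma Cmod_cexp (z : C) : Cmod (cexp z) = exp (Re z).
Proof.
unfold cexp. rewrite Cmod_mult, Cmod_cis, Cmod_R, Rabs_pos_eq; [ring|]. left; apply exp_pos.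
Qed.

Lemma cexp_neq_0 (z : C) : cexp z <> RtoC 0.
Proof. apply Cmod_gt_0. rewrite Cmod_cexp. apply exp_pos. Qed.

Lemma cexp_0 : cexp 0 = RtoC 1.
Proof. unfold cexp. simpl. rewrite exp_0, cis_0. ring. Qed.

Lemma Rd_cexp_line (h : C) (t : R) : Rd (fun u => cexp (RtoC u * h)) t (h * cexp (RtoC t * h))%C.
Proof.
destruct h as [x y].
assert (E : forall u, cexp (RtoC u * (x, y)) = (exp (u * x) * cos (u * y), exp (u * x) * sin (u * y))).
{ intros u. unfold cexp. replace (Re (RtoC u * (x, y))) with (u * x) by Csimp.
  replace (Im (RtoC u * (x, y))) with (u * y) by Csimp. unfold cis. apply Ceq; Csimp. }
apply (Rd_ext (fun u => (exp (u * x) * cos (u * y), exp (u * x) * sin (u * y)))); [intros u; now rewrite E|].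
rewrite E. split; unfold Re, Im; simpl; (auto_derive; [auto|ring]).
Qed.

(** Two integrations along the segment from 0 to [h]: the first bounds [cexp (t h) - 1] by [3 |h|],
    using [exp 1 <= 3], and the second bounds the remainder by [3 |h|^2]. The addition formula then
    carries the derivative to every point. *)
Lemma Cd_cexp_0 : Cd cexp 0 1.
Proof.
intros eps He. exists (Rmin 1 (eps / 3)). split; [apply Rmin_pos; lra|]. intros h Hh.
replace (h - 0)%C with h in * by ring.
assert (H1 := Rlt_le_trans _ _ _ Hh (Rmin_l _ _)).
assert (H2 := Rlt_le_trans _ _ _ Hh (Rmin_r _ _)).
set (X := Cmod h) in *. assert (HX : 0 <= X) by apply Cmod_ge_0.
assert (B : forall t, 0 <= t <= 1 -> Cmod (cexp (RtoC t * h) - 1) <= 3 * X).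
{ intros t Ht.
  assert (K := Rd_bound (fun u => cexp (RtoC u * h)) (fun u => h * cexp (RtoC u * h))%C
    (fun u => 3 * X * u) (fun _ => 3 * X) 0 t). cbv beta in K.
  replace (RtoC 0 * h)%C with (RtoC 0) in K by ring. rewrite cexp_0 in K.
  apply Rle_trans with (3 * X * t - 3 * X * 0); [|nra]. apply K; [lra| | |].
  - intros u _. apply Rd_cexp_line.
  - intros u _. auto_derive; auto. ring.
  - intros u Hu. rewrite Cmod_mult, Cmod_cexp. fold X.
    assert (exp (Re (RtoC u * h)) <= 3); [|nra].
    apply Rle_trans with (exp 1); [|apply exp_le_3].
    apply exp_le_compat.
    replace (Re (RtoC u * h)) with (u * Re h) by Csimp.
    pose proof (re_le_Cmod h) as Hr. apply Rabs_le_between in Hr. fold X in Hr. nra. }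
assert (K := Rd_bound (fun u => cexp (RtoC u * h) - RtoC u * h)%C (fun u => h * cexp (RtoC u * h) - h)%C
    (fun u => 3 * X * X * u) (fun _ => 3 * X * X) 0 1). cbv beta in K.
rewrite cexp_0.
replace (cexp h - 1 - 1 * h)%C with (cexp (RtoC 1 * h) - RtoC 1 * h - (cexp (RtoC 0 * h) - RtoC 0 * h))%C.
2:{ replace (RtoC 1 * h)%C with h by ring. replace (RtoC 0 * h)%C with (RtoC 0) by ring. rewrite cexp_0. ring. }
apply Rle_trans with (3 * X * X * 1 - 3 * X * X * 0); [|nra]. apply K; [lra| | |].
- intros t _. apply Rd_minus; [apply Rd_cexp_line|].
  apply (Rd_ext (fun u => 0 + RtoC u * h)%C); [intros; ring|apply Rd_line].
- intros t _. auto_derive; auto. ring.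
- intros t Ht. replace (h * cexp (RtoC t * h) - h)%C with (h * (cexp (RtoC t * h) - 1))%C by ring.
  rewrite Cmod_mult. fold X. specialize (B t Ht). nra.
Qed.

Lemma Cd_cexp (z : C) : Cd cexp z (cexp z).
Proof.
apply (Cd_ext (fun w => cexp z * cexp (w - z))%C).
- intros w. rewrite <- cexp_add. f_equal. ring.
- eapply Cd_eq; [|apply Cd_scal, (Cd_comp cexp (fun w => w - z)%C)].
  2: apply Cd_minus; [apply Cd_id|apply Cd_const].
  2: { replace (z - z)%C with (RtoC 0) by ring. apply Cd_cexp_0. }
  simpl. ring.
Qed.

Lemma polar_form (z : C) : z <> RtoC 0 ->
  z = (RtoC (Cmod z) * cis (Carg z))%C /\ - PI < Carg z <= PI.
Proof.
intros Hz. assert (Hm : 0 < Cmod z) by now apply Cmod_gt_0.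
pose proof (Cmod2_alt z) as H2.
set (q := Re z / Cmod z).
assert (Hq : Re z = q * Cmod z) by (unfold q; field; lra).
assert (Hq2 : q * q <= 1).
{ apply (Rmult_le_reg_r (Cmod z ^ 2)); [nra|]. rewrite H2 at 2.
  pose proof (Rle_0_sqr (Im z)) as K. unfold Rsqr in K.
  replace (q * q * Cmod z ^ 2) with (Re z ^ 2) by (rewrite Hq; ring). lra. }
assert (Hq1 : -1 <= q <= 1) by nra.
assert (Ha := acos_bound q).
assert (Hc := cos_acos q Hq1).
assert (Hs := sin_acos q Hq1).
assert (Hsq : sqrt (1 - Rsqr q) * Cmod z = Rabs (Im z)).
{ rewrite <- (sqrt_Rsqr (Cmod z)) by lra. rewrite <- sqrt_mult; [|unfold Rsqr; lra|apply Rle_0_sqr].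
  rewrite <- sqrt_Rsqr_abs. f_equal. unfold Rsqr. rewrite Hq in H2. nra. }
unfold Carg. fold q. destruct (Rle_dec 0 (Im z)) as [Hi|Hi].
- rewrite Rabs_pos_eq in Hsq by exact Hi. split; [|pose proof PI_RGT_0; lra].
  apply Ceq; unfold cis; simpl; rewrite Hc, Hs.
  + change (Re z = Cmod z * q - 0 * sqrt (1 - q²)). lra.
  + change (Im z = Cmod z * sqrt (1 - q²) + 0 * q). lra.
- rewrite Rabs_left in Hsq by lra. split.
  + apply Ceq; unfold cis; simpl; rewrite cos_neg, sin_neg, Hc, Hs.
    * change (Re z = Cmod z * q - 0 * - sqrt (1 - q²)). lra.
    * change (Im z = Cmod z * - sqrt (1 - q²) + 0 * q). lra.
  + split; [|pose proof PI_RGT_0; lra].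
    destruct (Req_dec (acos q) PI) as [E|E]; [|lra].
    exfalso. rewrite E, cos_PI in Hc. rewrite <- Hc in Hsq.
    replace (1 - Rsqr (-1)) with 0 in Hsq by (unfold Rsqr; ring). rewrite sqrt_0 in Hsq. lra.
Qed.

Lemma Carg_polar (r t : R) : 0 < r -> - PI < t <= PI -> Carg (RtoC r * cis t) = t.
Proof.
intros Hr Ht. unfold Carg.
replace (Im (RtoC r * cis t)) with (r * sin t) by (unfold cis; Csimp).
replace (Re (RtoC r * cis t)) with (r * cos t) by (unfold cis; Csimp).
rewrite Cmod_mult, Cmod_cis, Cmod_RtoC_nonneg by lra.
replace (r * cos t / (r * 1)) with (cos t) by (field; lra).
destruct (Rle_dec 0 (r * sin t)) as [H|H].
- destruct (Rle_lt_dec 0 t) as [H0|H0]; [apply acos_cos; lra|].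
  exfalso. assert (sin t < 0); [|nra]. apply sin_lt_0_var; lra.
- destruct (Rle_lt_dec 0 t) as [H0|H0].
  + exfalso. assert (0 <= sin t); [apply sin_ge_0; lra|nra].
  + rewrite <- cos_neg. rewrite acos_cos by lra. ring.
Qed.

Definition Clog (z : C) : C := (ln (Cmod z), Carg z).

Definition slit (z : C) : Prop := 0 < Re z \/ Im z <> 0.

Lemma slit_neq_0 (z : C) : slit z -> z <> RtoC 0.
Proof. intros H E. subst. destruct H as [H|H]; simpl in H; lra. Qed.

Lemma slit_Carg (z : C) : slit z <-> (z <> RtoC 0 /\ - PI < Carg z < PI).
Proof.
split.
- intros H. assert (Hz := slit_neq_0 _ H). split; [exact Hz|].
  destruct (polar_form z Hz) as [E Hb]. split; [lra|].
  destruct (Req_dec (Carg z) PI) as [E1|E1]; [|lra].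
  exfalso. rewrite E1 in E. unfold cis in E. rewrite cos_PI, sin_PI in E.
  pose proof (Cmod_ge_0 z). destruct H as [H|H]; rewrite E in H.
  + revert H. replace (Re (RtoC (Cmod z) * (-1, 0))) with (- Cmod z) by Csimp. lra.
  + apply H. Csimp.
- intros [Hz Hb]. assert (Hm : 0 < Cmod z) by now apply Cmod_gt_0.
  destruct (polar_form z Hz) as [E _]. set (t := Carg z) in *.
  destruct (Req_dec t 0) as [E0|E0].
  + left. rewrite E, E0, cis_0. replace (Re (RtoC (Cmod z) * 1)) with (Cmod z) by Csimp. exact Hm.
  + right. rewrite E. replace (Im (RtoC (Cmod z) * cis t)) with (Cmod z * sin t) by (unfold cis; Csimp).
    apply Rmult_integral_contrapositive_currified; [lra|].
    destruct (Rle_lt_dec 0 t).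
    * assert (0 < sin t) by (apply sin_gt_0; lra). lra.
    * assert (sin t < 0) by (apply sin_lt_0_var; lra). lra.
Qed.

Lemma Copen_re_gt (c : R) : Copen (fun z => c < Re z).
Proof.
intros z Hz. exists (Re z - c). split; [lra|]. intros w Hw.
pose proof (re_le_Cmod (w - z)) as H. replace (Re (w - z)) with (Re w - Re z) in H by Csimp.
apply Rabs_le_between in H. lra.
Qed.
Lemma Copen_im_gt (c : R) : Copen (fun z => c < Im z).
Proof.
intros z Hz. exists (Im z - c). split; [lra|]. intros w Hw.
pose proof (im_le_Cmod (w - z)) as H. replace (Im (w - z)) with (Im w - Im z) in H by Csimp.
apply Rabs_le_between in H. lra.
Qed.
Lemma Copen_re_lt (c : R) : Copen (fun z => Re z < c).
Proof.
intros z Hz. exists (c - Re z). split; [lra|]. intros w Hw.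
pose proof (re_le_Cmod (w - z)) as H. replace (Re (w - z)) with (Re w - Re z) in H by Csimp.
apply Rabs_le_between in H. lra.
Qed.
Lemma Copen_im_lt (c : R) : Copen (fun z => Im z < c).
Proof.
intros z Hz. exists (c - Im z). split; [lra|]. intros w Hw.
pose proof (im_le_Cmod (w - z)) as H. replace (Im (w - z)) with (Im w - Im z) in H by Csimp.
apply Rabs_le_between in H. lra.
Qed.
Lemma Copen_mod_gt (a : C) (c : R) : Copen (fun z => c < Cmod (z - a)).
Proof.
intros z Hz. exists (Cmod (z - a) - c). split; [lra|]. intros w Hw.
pose proof (Cmod_rev_tri (z - a) (z - w)) as H. replace (z - a - (z - w))%C with (w - a)%C in H by ring.
rewrite (Cmod_minus_sym z w) in H. lra.
Qed.
Lemma Copen_mod_lt (a : C) (c : R) : Copen (fun z => Cmod (z - a) < c).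
Proof.
intros z Hz. exists (c - Cmod (z - a)). split; [lra|]. intros w Hw.
replace (w - a)%C with (w - z + (z - a))%C by ring.
eapply Rle_lt_trans; [apply Cmod_triangle|]. lra.
Qed.
Lemma Copen_and (D E : C -> Prop) : Copen D -> Copen E -> Copen (fun z => D z /\ E z).
Proof.
intros HD HE z [H1 H2]. destruct (HD z H1) as [r [Hr K1]]. destruct (HE z H2) as [s [Hs K2]].
exists (Rmin r s). split; [now apply Rmin_pos|]. intros w Hw. split.
- apply K1. eapply Rlt_le_trans; [exact Hw|apply Rmin_l].
- apply K2. eapply Rlt_le_trans; [exact Hw|apply Rmin_r].
Qed.
Lemma Copen_or (D E : C -> Prop) : Copen D -> Copen E -> Copen (fun z => D z \/ E z).
Proof.
intros HD HE z [H|H]; [destruct (HD z H) as [r [Hr K]]|destruct (HE z H) as [r [Hr K]]];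
 exists r; (split; [exact Hr|]); intros w Hw; [left|right]; auto.
Qed.
Lemma Copen_ext (D E : C -> Prop) : (forall z, D z <-> E z) -> Copen D -> Copen E.
Proof.
intros H HD z Hz. destruct (HD z) as [r [Hr K]]; [now apply H|].
exists r. split; [exact Hr|]. intros w Hw. now apply H, K.
Qed.
Lemma Copen_preim (D : C -> Prop) (f : C -> C) (E : C -> Prop) : Copen D -> Copen E ->
  (forall z, E z -> exists l, Cd f z l) -> Copen (fun z => E z /\ D (f z)).
Proof.
intros HD HE Hf z [H1 H2]. destruct (HE z H1) as [r [Hr K1]]. destruct (Hf z H1) as [l Hl].
destruct (HD _ H2) as [s [Hs K2]]. destruct (Cd_cont _ _ _ Hl s Hs) as [d [Hd K3]].
exists (Rmin r d). split; [now apply Rmin_pos|]. intros w Hw. split.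
- apply K1. eapply Rlt_le_trans; [exact Hw|apply Rmin_l].
- apply K2, K3. eapply Rlt_le_trans; [exact Hw|apply Rmin_r].
Qed.
Lemma Copen_slit : Copen slit.
Proof.
apply Copen_or; [apply Copen_re_gt|].
apply (Copen_ext (fun z => Im z < 0 \/ 0 < Im z)).
- intros z. lra.
- apply Copen_or; [apply Copen_im_lt|apply Copen_im_gt].
Qed.

(** A branch of the logarithm near 1 written with [atan], which is smooth there, whereas [Carg]
    rests on [acos], singular on the real axis. [Carg_mult_near] reduces [Clog] at any point of the
    slit plane to this branch. *)
Definition log1 (q : C) : C := (ln (Cmod q), atan (Im q / Re q)).

Lemma Rd_log1_line (h : C) (t : R) : Cmod h <= 1 / 2 -> 0 <= t <= 1 ->
  Rd (fun u => log1 (1 + RtoC u * h)) t (h / (1 + RtoC t * h))%C.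
Proof.
intros Hh Ht. destruct h as [x y].
assert (Hx := re_le_Cmod (x, y)). simpl in Hx. apply Rabs_le_between in Hx.
assert (Hp : 0 < 1 + t * x) by nra.
assert (Hq : 0 < (1 + t * x) ^ 2 + (t * y) ^ 2) by nra.
unfold log1. split.
- apply (is_derive_ext (fun u => / 2 * ln ((1 + u * x) ^ 2 + (u * y) ^ 2)) _ t).
  + intros u. unfold Re at 1. unfold fst at 1. unfold Cmod.
    replace (fst (1 + RtoC u * (x, y))%C ^ 2 + snd (1 + RtoC u * (x, y))%C ^ 2) with ((1 + u * x) ^ 2 + (u * y) ^ 2) by Csimp.
    destruct (Rle_lt_or_eq_dec 0 ((1 + u * x) ^ 2 + (u * y) ^ 2)) as [H|H]; [apply Rplus_le_le_0_compat; apply pow2_ge_0| |].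
    * rewrite <- Rpower_sqrt by exact H. unfold Rpower. rewrite ln_exp. reflexivity.
    * rewrite <- H, sqrt_0. unfold ln. destruct (Rlt_dec 0 0); [exfalso; lra|]. now rewrite Rmult_0_r.
  + auto_derive; [simpl in Hq; lra|]. unfold Re, Cdiv, Cinv, Cmult. simpl. field. simpl in Hq; lra.
- apply (is_derive_ext (fun u => atan ((u * y) / (1 + u * x))) _ t).
  + intros u. unfold Im at 1. unfold snd at 1. f_equal. f_equal; [|f_equal]; Csimp.
  + auto_derive; [lra|]. unfold Im, Cdiv, Cinv, Cmult. simpl. field. split; [|lra]. intros E. simpl in Hq. lra.
Qed.

Lemma Cd_log1 : forall h : C, Cmod h <= 1 / 2 -> Cmod (log1 (1 + h) - h) <= 2 * Cmod h * Cmod h.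
Proof.
intros h Hh. set (X := Cmod h) in *. assert (HX : 0 <= X) by apply Cmod_ge_0.
assert (K := Rd_bound (fun u => log1 (1 + RtoC u * h) - RtoC u * h)%C (fun u => h / (1 + RtoC u * h) - h)%C
    (fun u => 2 * X * X * u) (fun _ => 2 * X * X) 0 1). cbv beta in K.
replace (log1 (1 + h) - h)%C with (log1 (1 + RtoC 1 * h) - RtoC 1 * h - (log1 (1 + RtoC 0 * h) - RtoC 0 * h))%C.
2:{ replace (1 + RtoC 0 * h)%C with (RtoC 1) by ring.
    replace (log1 1) with (RtoC 0). { replace (RtoC 1 * h)%C with h by ring. ring. }
    unfold log1. rewrite Cmod_1, ln_1. simpl. unfold Rdiv. rewrite Rmult_0_l, atan_0. reflexivity. }
apply Rle_trans with (2 * X * X * 1 - 2 * X * X * 0); [|nra]. apply K; [lra| | |].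
- intros t Ht. apply Rd_minus; [now apply Rd_log1_line|].
  apply (Rd_ext (fun u => 0 + RtoC u * h)%C); [intros; ring|apply Rd_line].
- intros t _. auto_derive; auto. ring.
- intros t Ht.
  assert (Hl : 1 / 2 <= Cmod (1 + RtoC t * h)).
  { pose proof (Cmod_rev_tri 1 (- (RtoC t * h))) as H. rewrite Cmod_opp, Cmod_mult, Cmod_1, Cmod_RtoC_nonneg in H by lra.
    fold X in H. replace (1 - - (RtoC t * h))%C with (1 + RtoC t * h)%C in H by ring. nra. }
  assert (Hn : (1 + RtoC t * h)%C <> RtoC 0) by (apply Cmod_gt_0; lra).
  replace (h / (1 + RtoC t * h) - h)%C with (- (RtoC t * (h * h) * / (1 + RtoC t * h)))%C by (field; exact Hn).
  rewrite Cmod_opp, !Cmod_mult, Cmod_inv, Cmod_RtoC_nonneg by (exact Hn || lra). fold X.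
  assert (/ Cmod (1 + RtoC t * h) <= 2).
  { replace 2 with (/ (1 / 2)) by field. apply Rinv_le_contravar; lra. }
  assert (0 < / Cmod (1 + RtoC t * h)) by (apply Rinv_0_lt_compat; lra).
  assert (0 <= X * X) by nra.
  assert (t * (X * X) <= X * X) by nra.
  replace (2 * X * X) with (X * X * 2) by ring.
  apply Rmult_le_compat; nra.
Qed.

(** The argument of [q] is at most [2 |q - 1|] in absolute value, so the sum of the two arguments
    stays inside (-PI, PI) and no multiple of 2 PI appears. *)
Lemma Carg_mult_near (z q : C) : slit z -> Cmod (q - 1) <= 1 / 2 ->
  Cmod (q - 1) * 2 < PI - Rabs (Carg z) -> Clog (z * q) = (Clog z + log1 q)%C.
Proof.
intros Hz Hq Hs. apply slit_Carg in Hz. destruct Hz as [Hz Hb].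
destruct (polar_form z Hz) as [E _].
assert (Hm : 0 < Cmod z) by now apply Cmod_gt_0.
assert (Hrq : 1 / 2 <= Re q).
{ pose proof (re_le_Cmod (q - 1)) as H. replace (Re (q - 1)) with (Re q - 1) in H by Csimp.
  apply Rabs_le_between in H. lra. }
assert (Hqm : 0 < Cmod q) by (pose proof (re_le_Cmod q) as H; apply Rabs_le_between in H; lra).
set (a := atan (Im q / Re q)).
assert (Hab : - PI / 2 < a < PI / 2) by apply atan_bound.
assert (Ha : q = (RtoC (Cmod q) * cis a)%C).
{ assert (Hc : 0 < cos a) by (apply cos_gt_0; lra).
  assert (Ht : sin a = Im q / Re q * cos a).
  { rewrite <- (tan_atan (Im q / Re q)). fold a. unfold tan. field. lra. }
  assert (Hk : Im q * cos a = sin a * Re q) by (rewrite Ht; field; lra).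
  pose proof (sin2_cos2 a) as H1. unfold Rsqr in H1.
  assert (Hmod : Cmod q = Re q / cos a).
  { assert (Hp : 0 < Re q / cos a) by (apply Rdiv_lt_0_compat; lra).
    assert (Hsq : (Cmod q) ^ 2 = (Re q / cos a) ^ 2).
    { rewrite Cmod2_alt. apply (Rmult_eq_reg_r (cos a ^ 2)); [|nra].
      replace ((Re q / cos a) ^ 2 * cos a ^ 2) with (Re q ^ 2) by (field; lra).
      replace ((Re q ^ 2 + Im q ^ 2) * cos a ^ 2) with (Re q ^ 2 * cos a ^ 2 + (Im q * cos a) ^ 2) by ring.
      rewrite Hk. replace (Re q ^ 2 * cos a ^ 2 + (sin a * Re q) ^ 2) with (Re q ^ 2 * (sin a * sin a + cos a * cos a)) by ring.
      rewrite H1. ring. }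
    nra. }
  rewrite Hmod. apply Ceq.
  - replace (Re (RtoC (Re q / cos a) * cis a)) with (Re q / cos a * cos a) by (unfold cis; Csimp). field. lra.
  - replace (Im (RtoC (Re q / cos a) * cis a)) with (sin a * Re q / cos a) by (unfold cis, Im, Re, Rdiv; simpl; ring).
    rewrite <- Hk. field. lra. }
assert (Hal : Rabs a <= 2 * Cmod (q - 1)).
{ assert (L := Cd_log1 (q - 1) Hq). replace (1 + (q - 1))%C with q in L by ring.
  assert (L2 : Cmod (log1 q) <= 2 * Cmod (q - 1)).
  { replace (log1 q) with ((log1 q - (q - 1)) + (q - 1))%C by ring.
    eapply Rle_trans; [apply Cmod_triangle|]. pose proof (Cmod_ge_0 (q - 1)). nra. }
  eapply Rle_trans; [|exact L2]. apply (im_le_Cmod (log1 q)). }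
assert (Hsum : - PI < Carg z + a < PI).
{ apply Rabs_le_between in Hal. unfold Rabs in Hs. destruct (Rcase_abs (Carg z)); lra. }
apply Ceq.
- change (ln (Cmod (z * q)) = ln (Cmod z) + ln (Cmod q)). rewrite Cmod_mult. now apply ln_mult.
- change (Carg (z * q) = Carg z + a).
  replace (z * q)%C with (RtoC (Cmod z * Cmod q) * cis (Carg z + a))%C.
  + apply Carg_polar; [now apply Rmult_lt_0_compat|lra].
  + rewrite E at 3. rewrite Ha at 2. rewrite cis_add, RtoC_mult. ring.
Qed.

Lemma Cd_Clog (z : C) : slit z -> Cd Clog z (/ z)%C.
Proof.
intros Hz. assert (Hn := slit_neq_0 _ Hz). assert (Hm : 0 < Cmod z) by now apply Cmod_gt_0.
assert (Hp : 0 < PI - Rabs (Carg z)).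
{ apply slit_Carg in Hz. unfold Rabs. destruct (Rcase_abs (Carg z)); lra. }
(* The first bound keeps [1 + h] in the domain of [log1], the second keeps the argument of the
   product away from the cut. *)
set (m := Rmin (1 / 2) ((PI - Rabs (Carg z)) / 3)).
assert (Hmp : 0 < m) by (apply Rmin_pos; lra).
intros eps He. exists (Rmin (m * Cmod z) (eps * (Cmod z * Cmod z) / 2)). split.
{ apply Rmin_pos; [nra|]. apply Rdiv_lt_0_compat; [|lra]. apply Rmult_lt_0_compat; nra. }
intros w Hw.
assert (W1 := Rlt_le_trans _ _ _ Hw (Rmin_l _ _)).
assert (W2 := Rlt_le_trans _ _ _ Hw (Rmin_r _ _)).
set (h := ((w - z) / z)%C).
assert (Eh : Cmod h * Cmod z = Cmod (w - z)).
{ unfold h. rewrite <- Cmod_mult. f_equal. field. exact Hn. }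
assert (Hh : Cmod h < m) by (apply (Rmult_lt_reg_r (Cmod z)); lra).
assert (M1 : m <= 1 / 2) by apply Rmin_l. assert (M2 : m <= (PI - Rabs (Carg z)) / 3) by apply Rmin_r.
assert (Ew : w = (z * (1 + h))%C) by (unfold h; field; exact Hn).
assert (K : Clog w = (Clog z + log1 (1 + h))%C).
{ rewrite Ew. apply Carg_mult_near; [exact Hz| |]; replace (1 + h - 1)%C with h by ring; lra. }
rewrite K. replace (Clog z + log1 (1 + h) - Clog z - / z * (w - z))%C with (log1 (1 + h) - h)%C
  by (unfold h at 2; field; exact Hn).
eapply Rle_trans; [apply Cd_log1; lra|]. rewrite <- Eh.
pose proof (Cmod_ge_0 h).
assert (2 * Cmod h <= eps * Cmod z).
{ apply (Rmult_le_reg_r (Cmod z)); [lra|]. rewrite Rmult_assoc, Eh. lra. }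
nra.
Qed.

Lemma Cpower_cexp (z : C) (a : R) : Cpower z a = cexp (RtoC a * Clog z).
Proof.
unfold Cpower, cexp, Rpower. replace (Re (RtoC a * Clog z)) with (a * ln (Cmod z)) by (unfold Clog; Csimp).
replace (Im (RtoC a * Clog z)) with (a * Carg z) by (unfold Clog; Csimp). reflexivity.
Qed.

Lemma Cpower_add (z : C) (a b : R) : Cpower z (a + b) = (Cpower z a * Cpower z b)%C.
Proof. rewrite !Cpower_cexp, <- cexp_add. f_equal. rewrite RtoC_plus. ring. Qed.

Lemma Cpower_0 (z : C) : Cpower z 0 = RtoC 1.
Proof. rewrite Cpower_cexp. replace (RtoC 0 * Clog z)%C with (RtoC 0) by ring. apply cexp_0. Qed.

Lemma Cpower_1 (z : C) : z <> RtoC 0 -> Cpower z 1 = z.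
Proof.
intros Hz. destruct (polar_form z Hz) as [E _]. unfold Cpower.
rewrite Rpower_1 by now apply Cmod_gt_0. rewrite Rmult_1_l. now symmetry.
Qed.

Lemma Cpower_neq_0 (z : C) (a : R) : Cpower z a <> RtoC 0.
Proof. rewrite Cpower_cexp. apply cexp_neq_0. Qed.

Lemma Cmod_Cpower (z : C) (a : R) : Cmod (Cpower z a) = Rpower (Cmod z) a.
Proof.
rewrite Cpower_cexp, Cmod_cexp. unfold Rpower. f_equal. unfold Clog. Csimp.
Qed.

Lemma Cd_Cpower (a : R) (z : C) : slit z -> Cd (fun w => Cpower w a) z (RtoC a * Cpower z (a - 1))%C.
Proof.
intros Hz. assert (Hn := slit_neq_0 _ Hz).
apply (Cd_ext (fun w => cexp (RtoC a * Clog w))).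
- intros w. symmetry. apply Cpower_cexp.
- eapply Cd_eq; [|apply (Cd_comp cexp (fun w => RtoC a * Clog w)%C)].
  2: apply Cd_scal, Cd_Clog; exact Hz.
  2: apply Cd_cexp.
  simpl. rewrite <- Cpower_cexp.
  replace a with (a - 1 + 1) at 1 by ring. rewrite Cpower_add, (Cpower_1 z Hn). field. exact Hn.
Qed.

(** * Integrals of complex-valued functions of a real variable *)

Definition CInt (f : R -> C) (a b : R) : C :=
  (RInt (fun t => Re (f t)) a b, RInt (fun t => Im (f t)) a b).

Definition Rcont (f : R -> C) (t : R) : Prop :=
  continuous (fun u => Re (f u)) t /\ continuous (fun u => Im (f u)) t.

Lemma Rd_Rcont (f : R -> C) (t : R) (l : C) : Rd f t l -> Rcont f t.
Proof.
intros [H1 H2]. split; apply (@ex_derive_continuous R_AbsRing R_NormedModule); eexists; eassumption.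
Qed.

Lemma RInt_derive_at (f : R -> R) (e0 t : R) : 0 < e0 -> 0 <= t ->
  (forall u, - e0 < u -> continuous f u) -> is_derive (fun N => RInt f 0 N) t (f t).
Proof.
intros He Ht Hc. apply (is_derive_RInt f (fun N => RInt f 0 N) 0 t); [|apply Hc; lra].
exists (mkposreal e0 He). intros y Hy. apply (@RInt_correct R_CompleteNormedModule), (@ex_RInt_continuous R_CompleteNormedModule).
intros z Hz. apply Hc. change (Rabs (y - t) < e0) in Hy. apply Rabs_lt_between in Hy.
assert (Rmin 0 y > - e0) by (apply Rmin_glb_lt; lra). lra.
Qed.

(** The margin [e0] to the left of 0 makes the primitive differentiable from both sides at its base
    point, as [Rd] demands. *)
Definition halfcont (f : R -> C) : Prop := exists e0, 0 < e0 /\ forall u, - e0 < u -> Rcont f u.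

Lemma CInt_Rd (f : R -> C) (t : R) : halfcont f -> 0 <= t -> Rd (fun N => CInt f 0 N) t (f t).
Proof.
intros [e0 [He Hc]] Ht. split; simpl.
- apply (RInt_derive_at (fun u => Re (f u)) e0 t He Ht). intros u Hu. now apply Hc.
- apply (RInt_derive_at (fun u => Im (f u)) e0 t He Ht). intros u Hu. now apply Hc.
Qed.

Lemma CInt_0 (f : R -> C) : CInt f 0 0 = RtoC 0.
Proof. unfold CInt. rewrite !RInt_point. reflexivity. Qed.

(* [dom_int m b]: [m] has a pointwise majorant whose primitive certifies that its integral over
   [0, oo) is at most [b]; no improper integral is needed. *)
Definition dom_int (m : R -> R) (b : R) : Prop :=
  exists M M' : R -> R, (forall r, 0 <= r -> is_derive M r (M' r)) /\
    (forall r, 0 <= r -> m r <= M' r) /\ (forall r, 0 <= r -> M r - M 0 <= b).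

Lemma dom_int_le (m m' : R -> R) (b b' : R) : dom_int m b -> (forall r, 0 <= r -> m' r <= m r) -> b <= b' ->
  dom_int m' b'.
Proof.
intros [M [M' [H1 [H2 H3]]]] Hm Hb. exists M, M'. split; [exact H1|split].
- intros r Hr. eapply Rle_trans; [now apply Hm|now apply H2].
- intros r Hr. specialize (H3 r Hr). lra.
Qed.

Lemma dom_int_scal (k : R) (m : R -> R) (b : R) : 0 <= k -> dom_int m b -> dom_int (fun r => k * m r) (k * b).
Proof.
intros Hk [M [M' [H1 [H2 H3]]]]. exists (fun r => k * M r), (fun r => k * M' r). split; [|split].
- intros r Hr. now apply is_derive_scal, H1.
- intros r Hr. apply Rmult_le_compat_l; auto.
- intros r Hr. specialize (H3 r Hr). nra.
Qed.

Lemma dom_int_plus (m n : R -> R) (a b : R) : dom_int m a -> dom_int n b -> dom_int (fun r => m r + n r) (a + b).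
Proof.
intros [M [M' [H1 [H2 H3]]]] [N [N' [G1 [G2 G3]]]].
exists (fun r => M r + N r), (fun r => M' r + N' r). split; [|split].
- intros r Hr. apply @is_derive_plus; auto.
- intros r Hr. specialize (H2 r Hr). specialize (G2 r Hr). lra.
- intros r Hr. specialize (H3 r Hr). specialize (G3 r Hr). lra.
Qed.

Lemma CInt_bound (f : R -> C) (m : R -> R) (b N : R) : halfcont f -> 0 <= N ->
  (forall r, 0 <= r -> Cmod (f r) <= m r) -> dom_int m b -> Cmod (CInt f 0 N) <= b.
Proof.
intros Hf HN Hm [M [M' [H1 [H2 H3]]]].
replace (CInt f 0 N) with (CInt f 0 N - CInt f 0 0)%C by (rewrite CInt_0; ring).
eapply Rle_trans; [|apply (H3 N HN)].
apply (Rd_bound (fun N => CInt f 0 N) f M M' 0 N HN).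
- intros t Ht. apply CInt_Rd; [exact Hf|lra].
- intros t Ht. apply H1. lra.
- intros t Ht. eapply Rle_trans; [apply Hm; lra|apply H2; lra].
Qed.

Lemma CInt_unique (f F : R -> C) (N : R) : halfcont f -> 0 <= N ->
  (forall t, 0 <= t <= N -> Rd F t (f t)) -> CInt f 0 N = (F N - F 0)%C.
Proof.
intros Hf HN HF.
assert (K := Rd_bound (fun N => CInt f 0 N - F N)%C (fun t => f t - f t)%C (fun _ => 0) (fun _ => 0) 0 N HN).
cbv beta in K. rewrite CInt_0 in K.
assert (Z : Cmod (CInt f 0 N - F N - (0 - F 0)) <= 0 - 0).
{ apply K.
  - intros t Ht. apply Rd_minus; [apply CInt_Rd; [exact Hf|lra]|now apply HF].
  - intros. apply @is_derive_const.
  - intros. replace (f t - f t)%C with (RtoC 0) by ring. rewrite Cmod_0. lra. }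
assert (E : Cmod (CInt f 0 N - F N - (0 - F 0)) = 0) by (pose proof (Cmod_ge_0 (CInt f 0 N - F N - (0 - F 0))); lra).
apply Cmod_eq_0 in E.
replace (CInt f 0 N) with (CInt f 0 N - F N - (0 - F 0) + (F N - F 0))%C by ring. rewrite E. ring.
Qed.

(* Bounded holomorphic functions with bounded first two derivatives, the class on which the
   integral operators act. *)
Definition hol2 (D : C -> Prop) (f : C -> C) : Prop :=
  exists (f' f'' : C -> C) (M : R), forall z, D z ->
    Cd f z (f' z) /\ Cd f' z (f'' z) /\ Cmod (f z) <= M /\ Cmod (f' z) <= M /\ Cmod (f'' z) <= M.

Lemma hol2_const (D : C -> Prop) (c : C) : hol2 D (fun _ => c).
Proof.
exists (fun _ => RtoC 0), (fun _ => RtoC 0), (Cmod c). intros z _.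
rewrite Cmod_0. repeat split; try apply Cd_const; try apply Cmod_ge_0. lra.
Qed.

Lemma hol2_sub (D E : C -> Prop) (f : C -> C) : (forall z, E z -> D z) -> hol2 D f -> hol2 E f.
Proof. intros HE [f' [f'' [M H]]]. exists f', f'', M. auto. Qed.

Lemma hol2_plus (D : C -> Prop) (f g : C -> C) : hol2 D f -> hol2 D g -> hol2 D (fun z => f z + g z)%C.
Proof.
intros [f' [f'' [M H]]] [g' [g'' [N G]]].
exists (fun z => f' z + g' z)%C, (fun z => f'' z + g'' z)%C, (M + N). intros z Hz.
destruct (H z Hz) as [H1 [H2 [H3 [H4 H5]]]]. destruct (G z Hz) as [G1 [G2 [G3 [G4 G5]]]].
split; [now apply Cd_plus|]. split; [now apply Cd_plus|].
repeat split; (eapply Rle_trans; [apply Cmod_triangle|]); lra.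
Qed.

Lemma hol2_mult (D : C -> Prop) (f g : C -> C) : hol2 D f -> hol2 D g -> hol2 D (fun z => f z * g z)%C.
Proof.
intros [f' [f'' [M H]]] [g' [g'' [N G]]].
exists (fun z => f' z * g z + f z * g' z)%C,
  (fun z => (f'' z * g z + f' z * g' z) + (f' z * g' z + f z * g'' z))%C, (4 * (M * N)). intros z Hz.
destruct (H z Hz) as [H1 [H2 [H3 [H4 H5]]]]. destruct (G z Hz) as [G1 [G2 [G3 [G4 G5]]]].
split; [now apply Cd_mult|]. split; [now apply Cd_plus; apply Cd_mult|].
assert (K : forall a b, Cmod a <= M -> Cmod b <= N -> Cmod (a * b) <= M * N).
{ intros a b Ha Hb. rewrite Cmod_mult. apply Rmult_le_compat; auto using Cmod_ge_0. }
assert (P := K _ _ H3 G3). assert (0 <= M * N) by (eapply Rle_trans; [apply Cmod_ge_0|exact P]).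
repeat split.
- lra.
- eapply Rle_trans; [apply Cmod_triangle|]. pose proof (K _ _ H4 G3). pose proof (K _ _ H3 G4). lra.
- eapply Rle_trans; [apply Cmod_triangle|]. apply Rle_trans with ((M * N + M * N) + (M * N + M * N)); [|lra].
  apply Rplus_le_compat; (eapply Rle_trans; [apply Cmod_triangle|]); apply Rplus_le_compat; apply K; assumption.
Qed.

Definition stable (D : C -> Prop) (e : C) : Prop := forall z r, D z -> 0 <= r -> D (z + RtoC r * e)%C.

Lemma hol2_Cd (D : C -> Prop) (f : C -> C) : hol2 D f -> exists f', forall z, D z -> Cd f z (f' z).
Proof. intros [f' [f'' [M H]]]. exists f'. intros z Hz. now apply H. Qed.

Lemma Copen_ray_back (D : C -> Prop) (e z : C) : Copen D -> stable D e -> D z -> Cmod e = 1 ->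
  exists e0, 0 < e0 /\ forall u, - e0 < u -> D (z + RtoC u * e)%C.
Proof.
intros HD Hs Hz He. destruct (HD z Hz) as [r [Hr H]]. exists r. split; [exact Hr|].
intros u Hu. destruct (Rle_lt_dec 0 u) as [H0|H0]; [now apply Hs|].
apply H. replace (z + RtoC u * e - z)%C with (RtoC u * e)%C by ring.
rewrite Cmod_mult, He, Cmod_R, Rabs_left by lra. lra.
Qed.

Definition dl (f : C -> C) (f' : C -> C) (D : C -> Prop) := forall z, D z -> Cd f z (f' z).

Lemma ray_halfcont (D : C -> Prop) (e z : C) (k k' : R -> R) (f f' : C -> C) :
  Copen D -> stable D e -> Cmod e = 1 -> (forall r, is_derive k r (k' r)) -> dl f f' D -> D z ->
  halfcont (fun r => RtoC (k r) * f (z + RtoC r * e)%C)%C.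
Proof.
intros HD Hs He Hk Hf Hz. destruct (Copen_ray_back D e z HD Hs Hz He) as [e0 [H0 H]].
exists e0. split; [exact H0|]. intros u Hu. eapply Rd_Rcont. apply Rd_mult.
- apply Rd_real, Hk.
- apply (Cd_Rd f); [apply Hf, H, Hu|apply Rd_line].
Qed.

Definition Jn (k : R -> R) (e : C) (f : C -> C) (N : R) (z : C) : C :=
  CInt (fun r => RtoC (k r) * f (z + RtoC r * e)%C)%C 0 N.

(** The improper integral of [k(r) f(z + r e)] over the half-line, as a limit through integer end
    points. For [k] the fundamental solution of a constant coefficient operator this is variation of
    constants from infinity. *)
Definition J (k : R -> R) (e : C) (f : C -> C) (z : C) : C := Clim (fun n => Jn k e f (INR n) z).

Lemma lim_inv_S (A : R) : is_lim_seq (fun n => A / (1 + INR n)) 0.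
Proof.
replace (Finite 0) with (Rbar_mult A (Finite 0)) by (simpl; f_equal; ring).
apply (is_lim_seq_scal_l (fun n => / (1 + INR n)) A (Finite 0)).
replace (Finite 0) with (Rbar_inv p_infty) by reflexivity.
apply is_lim_seq_inv; [|discriminate].
apply (is_lim_seq_ext (fun n => INR (S n))).
- intros n. rewrite S_INR. ring.
- apply (is_lim_seq_incr_1 INR). apply is_lim_seq_INR.
Qed.

(** * Integral operators along half-lines *)

Section Jop.
Variables (D : C -> Prop) (e : C).
Hypothesis HD : Copen D.
Hypothesis Hs : stable D e.
Hypothesis He : Cmod e = 1.

Lemma Jn_cauchy (k k' : R -> R) (f f' : C -> C) (A : R) (z : C) (n m : R) :
  (forall r, is_derive k r (k' r)) -> dl f f' D -> D z -> 0 <= n <= m ->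
  (forall r, 0 <= r -> Cmod (RtoC (k r) * f (z + RtoC r * e)%C) <= A / (1 + r) ^ 2) ->
  Cmod (Jn k e f m z - Jn k e f n z) <= A / (1 + n).
Proof.
intros Hk Hf Hz Hn Hb.
assert (HA : 0 <= A).
{ specialize (Hb 0 (Rle_refl 0)). replace (A / (1 + 0) ^ 2) with A in Hb by field.
  eapply Rle_trans; [apply Cmod_ge_0|exact Hb]. }
assert (K := Rd_bound (fun N => Jn k e f N z) (fun r => RtoC (k r) * f (z + RtoC r * e)%C)%C
  (fun r => - A / (1 + r)) (fun r => A / (1 + r) ^ 2) n m). cbv beta in K.
eapply Rle_trans; [apply K|].
- lra.
- intros t Ht. apply CInt_Rd; [|lra]. eapply ray_halfcont; eauto.
- intros t Ht. auto_derive; [lra|]. field. lra.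
- intros t Ht. apply Hb. lra.
- assert (0 <= A / (1 + m)). { apply Rmult_le_pos; [exact HA|]. left. apply Rinv_0_lt_compat. lra. }
  unfold Rdiv in *. lra.
Qed.

Lemma J_tail (k k' : R -> R) (f f' : C -> C) (A : R) (z : C) (n : nat) :
  (forall r, is_derive k r (k' r)) -> dl f f' D -> D z ->
  (forall r, 0 <= r -> Cmod (RtoC (k r) * f (z + RtoC r * e)%C) <= A / (1 + r) ^ 2) ->
  Cmod (Jn k e f (INR n) z - J k e f z) <= A / (1 + INR n).
Proof.
intros Hk Hf Hz Hb.
apply (Clim_cauchy (fun n => Jn k e f (INR n) z) (fun n => A / (1 + INR n)) (lim_inv_S A)).
intros a b Hab. apply (Jn_cauchy k k' f f'); auto. split; [apply pos_INR|now apply le_INR].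
Qed.

Lemma J_bound (k k' : R -> R) (f f' : C -> C) (A : R) (z : C) (m : R -> R) (b : R) :
  (forall r, is_derive k r (k' r)) -> dl f f' D -> D z ->
  (forall r, 0 <= r -> Cmod (RtoC (k r) * f (z + RtoC r * e)%C) <= A / (1 + r) ^ 2) ->
  (forall r, 0 <= r -> Cmod (RtoC (k r) * f (z + RtoC r * e)%C) <= m r) -> dom_int m b ->
  Cmod (J k e f z) <= b.
Proof.
intros Hk Hf Hz Hb Hm Hd. apply Rminus_le. apply (le_lim_0 _ _ (lim_inv_S A)). intros n.
assert (H1 := J_tail k k' f f' A z n Hk Hf Hz Hb).
assert (H2 : Cmod (Jn k e f (INR n) z) <= b).
{ apply (CInt_bound _ m); auto using pos_INR. eapply ray_halfcont; eauto. }
pose proof (Cmod_rev_tri (J k e f z) (J k e f z - Jn k e f (INR n) z)) as H3.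
replace (J k e f z - (J k e f z - Jn k e f (INR n) z))%C with (Jn k e f (INR n) z) in H3 by ring.
rewrite (Cmod_minus_sym (J k e f z)) in H3. lra.
Qed.

Lemma Jn_plus (k k' : R -> R) (f f' g g' : C -> C) (z : C) (N : R) (s : C) :
  (forall r, is_derive k r (k' r)) -> dl f f' D -> dl g g' D -> D z -> 0 <= N ->
  Jn k e (fun z => f z + s * g z)%C N z = (Jn k e f N z + s * Jn k e g N z)%C.
Proof.
intros Hk Hf Hg Hz HN. unfold Jn at 1.
rewrite (CInt_unique _ (fun N => Jn k e f N z + s * Jn k e g N z)%C N).
- unfold Jn. rewrite !CInt_0. ring.
- apply (ray_halfcont D e z k k' (fun z => f z + s * g z)%C (fun z => f' z + s * g' z)%C); auto.
  intros x Hx. apply Cd_plus; [now apply Hf|]. now apply Cd_scal, Hg.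
- exact HN.
- intros t Ht. eapply Rd_eq; [|apply Rd_plus; [|apply Rd_mult; [apply Rd_const|]]];
  [|apply CInt_Rd; [eapply ray_halfcont; eauto|lra]|apply CInt_Rd; [eapply ray_halfcont; eauto|lra]].
  simpl. ring.
Qed.

Lemma J_minus (k k' : R -> R) (f f' g g' : C -> C) (A : R) (z : C) :
  (forall r, is_derive k r (k' r)) -> dl f f' D -> dl g g' D -> D z ->
  (forall r, 0 <= r -> Cmod (RtoC (k r) * f (z + RtoC r * e)%C) <= A / (1 + r) ^ 2) ->
  (forall r, 0 <= r -> Cmod (RtoC (k r) * g (z + RtoC r * e)%C) <= A / (1 + r) ^ 2) ->
  J k e (fun z => f z - g z)%C z = (J k e f z - J k e g z)%C.
Proof.
intros Hk Hf Hg Hz Bf Bg.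
apply (Clim_le _ (fun n => (2 * A) / (1 + INR n)) _ (lim_inv_S _)). intros n.
replace (Jn k e (fun z => f z - g z)%C (INR n) z) with (Jn k e f (INR n) z - Jn k e g (INR n) z)%C.
- assert (H1 := J_tail k k' f f' A z n Hk Hf Hz Bf). assert (H2 := J_tail k k' g g' A z n Hk Hg Hz Bg).
  match goal with |- Cmod ?x <= _ => replace x with
   ((Jn k e f (INR n) z - J k e f z) - (Jn k e g (INR n) z - J k e g z))%C by ring end.
  eapply Rle_trans; [apply Cmod_tri_minus|]. unfold Rdiv in *. lra.
- assert (H := Jn_plus k k' f f' g g' z (INR n) (Copp 1) Hk Hf Hg Hz (pos_INR n)).
  replace (Jn k e f (INR n) z - Jn k e g (INR n) z)%C with (Jn k e f (INR n) z + (Copp 1) * Jn k e g (INR n) z)%C by ring.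
  rewrite <- H. unfold Jn, CInt. f_equal; apply RInt_ext; intros; f_equal; f_equal; ring.
Qed.

(** As [f (z + r e)] has r-derivative [e f'], integration by parts moves the derivative onto the
    kernel, and the result contains [f] and [k'] only. So derivatives of the operator are estimated
    through bounds on [f]; the bound [M] on [f''] just justifies differentiation under the integral
    sign. *)
Lemma Jn_Cd (k k' : R -> R) (f f' f'' : C -> C) (M kap : R) (N : R) :
  (forall r, is_derive k r (k' r)) -> (forall r, is_derive k' r (Derive k' r)) ->
  dl f f' D -> dl f' f'' D -> (forall z, D z -> Cmod (f'' z) <= M) -> (forall r, 0 <= r -> Rabs (k r) <= kap) ->
  0 <= N -> forall z, D z ->
  Cd (Jn k e f N) z (/ e * (RtoC (k N) * f (z + RtoC N * e)%C - RtoC (k 0) * f z - Jn k' e f N z))%C.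
Proof.
intros Hk Hk' Hf Hf' HM Hkap HN z Hz.
assert (He0 : e <> RtoC 0) by (apply Cmod_gt_0; lra).
apply (Cd_eq _ _ (Jn k e f' N z)).
{ assert (H := CInt_unique (fun r => RtoC (k r) * (e * f' (z + RtoC r * e)%C))%C
    (fun r => RtoC (k r) * f (z + RtoC r * e)%C - Jn k' e f r z)%C N).
  assert (G : CInt (fun r => RtoC (k r) * (e * f' (z + RtoC r * e)%C))%C 0 N = (e * Jn k e f' N z)%C).
  { rewrite (CInt_unique _ (fun N => e * Jn k e f' N z)%C N).
    - unfold Jn. rewrite !CInt_0. ring.
    - apply (ray_halfcont D e z k k' (fun z => e * f' z)%C (fun z => e * f'' z)%C); auto.
      intros x Hx. now apply Cd_scal, Hf'.
    - exact HN.
    - intros t Ht. eapply Rd_eq; [|apply Rd_mult; [apply Rd_const|apply CInt_Rd; [eapply ray_halfcont; eauto|lra]]].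
      simpl. ring. }
  rewrite G in H. clear G.
  assert (H2 : (e * Jn k e f' N z)%C = (RtoC (k N) * f (z + RtoC N * e)%C - Jn k' e f N z - (RtoC (k 0) * f (z + RtoC 0 * e)%C - Jn k' e f 0 z))%C).
  { apply H.
    - apply (ray_halfcont D e z k k' (fun z => e * f' z)%C (fun z => e * f'' z)%C); auto.
      intros x Hx. now apply Cd_scal, Hf'.
    - exact HN.
    - intros t Ht. eapply Rd_eq; [|apply Rd_minus; [apply Rd_mult; [apply Rd_real, Hk|apply (Cd_Rd f); [apply Hf, Hs; [exact Hz|lra]|apply Rd_line]]|apply CInt_Rd; [apply (ray_halfcont D e z k' (Derive k') f f'); auto|lra]]].
      simpl. ring. }
  replace (Jn k e f' N z) with (/ e * (e * Jn k e f' N z))%C by (field; exact He0).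
  rewrite H2. unfold Jn at 2. rewrite CInt_0. replace (z + RtoC 0 * e)%C with z by ring. ring. }
intros eps Heps. destruct (HD z Hz) as [r0 [Hr0 Hball]].
assert (HM0 : 0 <= M) by (eapply Rle_trans; [apply Cmod_ge_0|apply (HM z Hz)]).
assert (Hk0 : 0 <= kap) by (eapply Rle_trans; [apply Rabs_pos|apply (Hkap 0); lra]).
set (T := kap * M * N + 1). assert (HT : 0 < T) by (unfold T; assert (0 <= kap * M * N) by (repeat apply Rmult_le_pos; auto); lra).
exists (Rmin r0 (eps / T)). split; [apply Rmin_pos; [exact Hr0|apply Rdiv_lt_0_compat; lra]|].
intros w Hw. assert (W1 := Rlt_le_trans _ _ _ Hw (Rmin_l _ _)). assert (W2 := Rlt_le_trans _ _ _ Hw (Rmin_r _ _)).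
assert (Dw : D w) by now apply Hball.
set (X := Cmod (w - z)) in *. assert (HX : 0 <= X) by apply Cmod_ge_0.
(* Second-order Taylor remainder, uniform in [r], from two applications of the segment bound. *)
assert (Q : forall r, 0 <= r -> Cmod (f (w + RtoC r * e)%C - f (z + RtoC r * e)%C - (w - z) * f' (z + RtoC r * e)%C) <= M * X * X).
{ intros r Hr. set (z1 := (z + RtoC r * e)%C). set (w1 := (w + RtoC r * e)%C).
  assert (Ed : (w1 - z1 = w - z)%C) by (unfold w1, z1; ring).
  assert (Dseg : forall t, 0 <= t <= 1 -> D (z1 + RtoC t * (w1 - z1))%C).
  { intros t Ht. replace (z1 + RtoC t * (w1 - z1))%C with ((z + RtoC t * (w - z)) + RtoC r * e)%C by (rewrite Ed; unfold z1; ring).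
    apply Hs; [|exact Hr]. apply Hball. now apply ball_seg. }
  replace (f w1 - f z1 - (w - z) * f' z1)%C with ((f w1 - f' z1 * w1) - (f z1 - f' z1 * z1))%C by (rewrite <- Ed; ring).
  assert (S := Cd_seg_bound (fun x => f x - f' z1 * x)%C (fun x => f' x - f' z1)%C z1 w1 (M * X)).
  cbv beta in S. rewrite Ed in S. fold X in S. apply S; rewrite <- Ed.
  - intros t Ht. eapply Cd_eq; [|apply Cd_minus; [apply Hf, Dseg; exact Ht|apply Cd_scal, Cd_id]]. ring.
  - intros t Ht. set (x := (z1 + RtoC t * (w1 - z1))%C).
    assert (U := Cd_seg_bound f' f'' z1 x M).
    assert (Ex : (x - z1 = RtoC t * (w - z))%C) by (unfold x; rewrite Ed; ring).
    eapply Rle_trans; [apply U|].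
    + intros s Hs'. apply Hf'. replace (z1 + RtoC s * (x - z1))%C with (z1 + RtoC (s * t) * (w1 - z1))%C
        by (rewrite Ex, Ed, RtoC_mult; ring). apply Dseg. nra.
    + intros s Hs'. apply HM. replace (z1 + RtoC s * (x - z1))%C with (z1 + RtoC (s * t) * (w1 - z1))%C
        by (rewrite Ex, Ed, RtoC_mult; ring). apply Dseg. nra.
    + rewrite Ex, Cmod_mult, Cmod_RtoC_nonneg by lra. fold X. apply Rmult_le_compat_l; [exact HM0|]. nra. }
assert (K := Rd_bound (fun N => Jn k e f N w - Jn k e f N z - (w - z) * Jn k e f' N z)%C
  (fun r => RtoC (k r) * f (w + RtoC r * e)%C - RtoC (k r) * f (z + RtoC r * e)%C - (w - z) * (RtoC (k r) * f' (z + RtoC r * e)%C))%C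
  (fun r => kap * (M * X * X) * r) (fun _ => kap * (M * X * X)) 0 N HN). cbv beta in K.
replace (Jn k e f N w - Jn k e f N z - Jn k e f' N z * (w - z))%C with
  (Jn k e f N w - Jn k e f N z - (w - z) * Jn k e f' N z - (Jn k e f 0 w - Jn k e f 0 z - (w - z) * Jn k e f' 0 z))%C
  by (unfold Jn; rewrite !CInt_0; ring).
apply Rle_trans with (kap * (M * X * X) * N - kap * (M * X * X) * 0).
- apply K.
  + intros t Ht. apply Rd_minus; [apply Rd_minus|].
    * apply CInt_Rd; [eapply ray_halfcont; eauto|lra].
    * apply CInt_Rd; [eapply ray_halfcont; eauto|lra].
    * eapply Rd_eq; [|apply Rd_mult; [apply Rd_const|apply CInt_Rd; [eapply ray_halfcont; eauto|lra]]]. simpl. ring.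
  + intros t Ht. auto_derive; auto. ring.
  + intros t Ht.
    match goal with |- Cmod ?x <= _ => replace x with (RtoC (k t) * (f (w + RtoC t * e)%C - f (z + RtoC t * e)%C - (w - z) * f' (z + RtoC t * e)%C))%C by ring end.
    rewrite Cmod_mult, Cmod_R. apply Rmult_le_compat; auto using Rabs_pos, Cmod_ge_0.
    * apply Hkap. lra.
    * apply Q. lra.
- replace (kap * (M * X * X) * N - kap * (M * X * X) * 0) with ((kap * M * N) * X * X) by ring.
  apply Rmult_le_compat_r; [exact HX|].
  apply (Rmult_lt_compat_l T) in W2; [|exact HT]. replace (T * (eps / T)) with eps in W2 by (field; lra).
  unfold T in W2. nra.
Qed.

(** The boundary term at [N] and the tail of the integral both vanish like [kap * A / (1 + N)],
    uniformly in [z], so [Cd_limit] applies to the formula of [Jn_Cd]. *)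
Lemma J_Cd (k k' : R -> R) (f : C -> C) (kap A : R) :
  (forall r, is_derive k r (k' r)) -> (forall r, is_derive k' r (Derive k' r)) ->
  hol2 D f -> (forall r, 0 <= r -> Rabs (k r) <= kap) -> (forall r, 0 <= r -> Rabs (k' r) <= kap) ->
  (forall z r, D z -> 0 <= r -> Cmod (f (z + RtoC r * e)%C) <= A / (1 + r) ^ 2) ->
  forall z, D z -> Cd (J k e f) z (- / e * (RtoC (k 0) * f z + J k' e f z))%C.
Proof.
intros Hk Hk' [f' [f'' [M Hf]]] Bk Bk' BA.
assert (He0 : e <> RtoC 0) by (apply Cmod_gt_0; lra).
assert (Hkap : 0 <= kap) by (eapply Rle_trans; [apply Rabs_pos|apply (Bk 0); lra]).
assert (F1 : dl f f' D) by (intros z Hz; now apply Hf).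
assert (F2 : dl f' f'' D) by (intros z Hz; now apply Hf).
assert (TB : forall (h : R -> R) z, (forall r, 0 <= r -> Rabs (h r) <= kap) -> D z ->
  forall r, 0 <= r -> Cmod (RtoC (h r) * f (z + RtoC r * e)%C) <= (kap * A) / (1 + r) ^ 2).
{ intros h z Hh Hz r Hr. rewrite Cmod_mult, Cmod_R. unfold Rdiv. rewrite Rmult_assoc.
  apply Rmult_le_compat; auto using Rabs_pos, Cmod_ge_0. }
intros z0 Hz0.
assert (HA : 0 <= A).
{ specialize (BA z0 0 Hz0 (Rle_refl 0)). replace (A / (1 + 0) ^ 2) with A in BA by field.
  eapply Rle_trans; [apply Cmod_ge_0|exact BA]. }
revert z0 Hz0.
apply (Cd_limit D (fun n => Jn k e f (INR n))
  (fun n z => / e * (RtoC (k (INR n)) * f (z + RtoC (INR n) * e)%C - RtoC (k 0) * f z - Jn k' e f (INR n) z))%C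
  (J k e f) (fun z => - / e * (RtoC (k 0) * f z + J k' e f z))%C (fun n => (2 * (kap * A)) / (1 + INR n)) HD (lim_inv_S _)).
- intros n z Hz. apply (Jn_Cd k k' f f' f'' M kap); auto using pos_INR. intros x Hx. now apply Hf.
- intros z Hz eps Heps.
  assert (L := lim_inv_S (kap * A)). apply is_lim_seq_spec in L. destruct (L (mkposreal eps Heps)) as [N HN].
  exists N. intros n Hn. eapply Rle_trans; [apply (J_tail k k' f f' (kap * A) z n); auto|].
  specialize (HN n Hn). simpl in HN. rewrite Rminus_0_r in HN. pose proof (Rle_abs (kap * A / (1 + INR n))). lra.
- intros n z Hz.
  match goal with |- Cmod ?x <= _ => replace x with (/ e * (RtoC (k (INR n)) * f (z + RtoC (INR n) * e)%C - (Jn k' e f (INR n) z - J k' e f z)))%C by ring end.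
  rewrite Cmod_mult, Cmod_inv by exact He0. rewrite He, Rinv_1, Rmult_1_l.
  eapply Rle_trans; [apply Cmod_tri_minus|].
  assert (H1 := J_tail k' (Derive k') f f' (kap * A) z n Hk' F1 Hz (TB k' z Bk' Hz)).
  assert (H2 := TB k z Bk Hz (INR n) (pos_INR n)).
  assert (H3 : kap * A / (1 + INR n) ^ 2 <= kap * A / (1 + INR n)).
  { apply Rmult_le_compat_l; [now apply Rmult_le_pos|]. apply Rinv_le_contravar; pose proof (pos_INR n); nra. }
  unfold Rdiv in *. lra.
Qed.
End Jop.

Lemma geom_cauchy (u : nat -> C) (a q : R) : 0 <= q < 1 -> 0 <= a ->
  (forall n, Cmod (u (S n) - u n) <= a * q ^ n) ->
  forall n, Cmod (u n - Clim u) <= a / (1 - q) * q ^ n.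
Proof.
intros Hq Ha Hu. apply Clim_cauchy.
- replace (Finite 0) with (Rbar_mult (a / (1 - q)) (Finite 0)) by (simpl; f_equal; ring).
  apply is_lim_seq_scal_l. apply is_lim_seq_geom. rewrite Rabs_pos_eq; lra.
- assert (K : forall n k, Cmod (u (n + k)%nat - u n) <= a / (1 - q) * (q ^ n - q ^ (n + k))).
  { intros n k. induction k.
    - rewrite Nat.add_0_r. replace (u n - u n)%C with (RtoC 0) by ring. rewrite Cmod_0. lra.
    - rewrite Nat.add_succ_r. specialize (Hu (n + k)%nat).
      replace (u (S (n + k)) - u n)%C with ((u (S (n + k)) - u (n + k)%nat) + (u (n + k)%nat - u n))%C by ring.
      eapply Rle_trans; [apply Cmod_triangle|].
      replace (a / (1 - q) * (q ^ n - q ^ S (n + k))) with (a * q ^ (n + k) + a / (1 - q) * (q ^ n - q ^ (n + k))) by (simpl; field; lra).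
      lra. }
  intros n m H. replace m with (n + (m - n))%nat by lia. eapply Rle_trans; [apply K|].
  apply Rmult_le_compat_l.
  + apply Rmult_le_pos; [lra|]. left. apply Rinv_0_lt_compat. lra.
  + assert (0 <= q ^ (n + (m - n))) by (apply pow_le; lra). lra.
Qed.

Lemma lim_geom_scal (a q : R) : 0 <= q < 1 -> is_lim_seq (fun n => a * q ^ n) 0.
Proof.
intros Hq. replace (Finite 0) with (Rbar_mult a (Finite 0)) by (simpl; f_equal; ring).
apply is_lim_seq_scal_l. apply is_lim_seq_geom. rewrite Rabs_pos_eq; lra.
Qed.

Lemma dom_int_inv_sq (a : R) : 0 <= a -> dom_int (fun r => a / (1 + r) ^ 2) a.
Proof.
intros Ha. exists (fun r => - a / (1 + r)), (fun r => a / (1 + r) ^ 2). split; [|split].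
- intros r Hr. auto_derive; [lra|]. field. lra.
- intros; lra.
- intros r Hr. assert (0 <= a / (1 + r)). { apply Rmult_le_pos; [exact Ha|]. left. apply Rinv_0_lt_compat. lra. }
  unfold Rdiv in *. rewrite Rplus_0_r, Rinv_1. lra.
Qed.

Lemma J_ext (k : R -> R) (e : C) (f g : C -> C) (z : C) :
  (forall r, 0 <= r -> f (z + RtoC r * e)%C = g (z + RtoC r * e)%C) -> J k e f z = J k e g z.
Proof.
intros H. unfold J, Clim, Jn, CInt. simpl.
assert (E : forall n (P : C -> R), RInt (fun r => P (RtoC (k r) * f (z + RtoC r * e))%C) 0 (INR n) =
  RInt (fun r => P (RtoC (k r) * g (z + RtoC r * e))%C) 0 (INR n)).
{ intros n P. apply RInt_ext. intros x Hx. rewrite Rmin_left in Hx by apply pos_INR. rewrite H by lra. reflexivity. }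
f_equal; f_equal; apply Lim_seq_ext; intros n.
- apply (E n Re).
- apply (E n Im).
Qed.

Lemma J_scal (D : C -> Prop) (e : C) (k k' : R -> R) (f f' : C -> C) (A : R) (c z : C) :
  Copen D -> stable D e -> Cmod e = 1 ->
  (forall r, is_derive k r (k' r)) -> dl f f' D -> D z ->
  (forall r, 0 <= r -> Cmod (RtoC (k r) * f (z + RtoC r * e)%C) <= A / (1 + r) ^ 2) ->
  J k e (fun z => c * f z)%C z = (c * J k e f z)%C.
Proof.
intros HD Hs He Hk Hf Hz Hb.
apply (Clim_le _ (fun n => (Cmod c * A) / (1 + INR n)) _ (lim_inv_S _)). intros n.
replace (Jn k e (fun z => c * f z)%C (INR n) z) with (c * Jn k e f (INR n) z)%C.
- rewrite <- (Cmod_opp (_ - _)). replace (- (c * Jn k e f (INR n) z - c * J k e f z))%C with (c * - (Jn k e f (INR n) z - J k e f z))%C by ring.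
  rewrite Cmod_mult, Cmod_opp. unfold Rdiv. rewrite Rmult_assoc. apply Rmult_le_compat_l; [apply Cmod_ge_0|].
  now apply (J_tail D e HD Hs He k k' f f' A z n).
- unfold Jn at 2. rewrite (CInt_unique _ (fun N => c * Jn k e f N z)%C (INR n)).
  + unfold Jn. rewrite !CInt_0. ring.
  + apply (ray_halfcont D e z k k' (fun z => c * f z)%C (fun z => c * f' z)%C); auto.
    intros x Hx. now apply Cd_scal, Hf.
  + apply pos_INR.
  + intros t Ht. eapply Rd_eq; [|apply Rd_mult; [apply Rd_const|apply CInt_Rd; [eapply ray_halfcont; eauto|lra]]].
    simpl. ring.
Qed.

(** * Contraction principle for quadratic integral equations *)

Section FixedPoint.
Variables (D : C -> Prop) (e : C) (K K1 K2 : R -> R) (kap : R).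
Variables (al be ga : C -> C) (w : C -> R) (B q0 A Wb : R) (C0 : C).
Definition NB (z : C) : R := Cmod (al z) + Cmod (be z) * (B * w z) + Cmod (ga z) * (B * w z) ^ 2.
Definition LB (z : C) : R := Cmod (be z) * (B * w z) + 2 * Cmod (ga z) * (B * w z) ^ 2.
Definition G (phi : C -> C) (z : C) : C := (al z + be z * phi z + ga z * (phi z * phi z))%C.

Hypothesis HD : Copen D.
Hypothesis Hs : stable D e.
Hypothesis He : Cmod e = 1.
Hypothesis HK : forall r, is_derive K r (K1 r).
Hypothesis HK1 : forall r, is_derive K1 r (K2 r).
Hypothesis HK2 : forall r, is_derive K2 r (Derive K2 r).
Hypothesis HK0 : K 0 = 0.
Hypothesis HK10 : K1 0 = 1.
Hypothesis Bk : forall r, 0 <= r -> Rabs (K r) <= 1.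
Hypothesis Bk1 : forall r, 0 <= r -> Rabs (K1 r) <= 1.
Hypothesis Bk2 : forall r, 0 <= r -> Rabs (K2 r) <= kap.
Hypothesis Hal : hol2 D al.
Hypothesis Hbe : hol2 D be.
Hypothesis Hga : hol2 D ga.
Hypothesis HB : 0 <= B.
Hypothesis Hw : forall z, D z -> 0 <= w z <= Wb.
Hypothesis Hq0 : 0 <= q0 < 1.
Hypothesis HNB : forall z, D z -> dom_int (fun r => Rabs (K r) * NB (z + RtoC r * e)%C) (B * w z - Cmod C0).
Hypothesis HLB : forall z, D z -> dom_int (fun r => Rabs (K r) * LB (z + RtoC r * e)%C) (q0 * (B * w z)).
Hypothesis TNB : forall z r, D z -> 0 <= r -> NB (z + RtoC r * e)%C <= A / (1 + r) ^ 2.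
Hypothesis TLB : forall z r, D z -> 0 <= r -> LB (z + RtoC r * e)%C <= A / (1 + r) ^ 2.

(* [NB] bounds [|G phi|] for [|phi| <= B w], and [LB] is the corresponding Lipschitz bound. *)
Definition small (phi : C -> C) : Prop := hol2 D phi /\ forall z, D z -> Cmod (phi z) <= B * w z.

Lemma dk_ex (k k' : R -> R) : (forall r, is_derive k r (k' r)) -> forall r, is_derive k r (Derive k r).
Proof. intros H r. apply Derive_correct. eexists. apply H. Qed.

Lemma kap_pos : 0 <= kap.
Proof. eapply Rle_trans; [apply Rabs_pos|apply (Bk2 0); lra]. Qed.

Lemma Bw_pos (z : C) : D z -> 0 <= B * w z.
Proof. intros Hz. apply Rmult_le_pos; [exact HB|]. now apply Hw. Qed.

Lemma A_pos (z : C) : D z -> 0 <= A.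
Proof.
intros Hz. pose proof (TNB z 0 Hz (Rle_refl 0)) as H. replace (A / (1 + 0) ^ 2) with A in H by field.
eapply Rle_trans; [|exact H]. pose proof (Bw_pos _ (Hs z 0 Hz (Rle_refl 0))). unfold NB.
repeat apply Rplus_le_le_0_compat; auto using Cmod_ge_0; apply Rmult_le_pos; auto using Cmod_ge_0.
apply pow_le. assumption.
Qed.

Lemma G_hol2 (phi : C -> C) : hol2 D phi -> hol2 D (G phi).
Proof. intros H. repeat apply hol2_plus; auto; repeat apply hol2_mult; auto. Qed.

Lemma G_bound (phi : C -> C) (z : C) : D z -> Cmod (phi z) <= B * w z -> Cmod (G phi z) <= NB z.
Proof.
intros Hz H. unfold G, NB. pose proof (Cmod_ge_0 (phi z)).
eapply Rle_trans; [apply Cmod_triangle|]. apply Rplus_le_compat.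
- eapply Rle_trans; [apply Cmod_triangle|]. apply Rplus_le_compat_l. rewrite Cmod_mult.
  apply Rmult_le_compat_l; auto using Cmod_ge_0.
- rewrite !Cmod_mult. apply Rmult_le_compat_l; auto using Cmod_ge_0. nra.
Qed.

Lemma G_diff (a b : C -> C) (th : R) (z : C) : D z -> Cmod (a z) <= B * w z -> Cmod (b z) <= B * w z ->
  Cmod (a z - b z) <= th * (B * w z) -> Cmod (G a z - G b z) <= th * LB z.
Proof.
intros Hz Ha Hb Hab. unfold G, LB.
replace (al z + be z * a z + ga z * (a z * a z) - (al z + be z * b z + ga z * (b z * b z)))%C
  with (be z * (a z - b z) + ga z * ((a z + b z) * (a z - b z)))%C by ring.
pose proof (Bw_pos z Hz) as Hp.
eapply Rle_trans; [apply Cmod_triangle|]. rewrite !Cmod_mult.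
assert (Hsum : Cmod (a z + b z) <= 2 * (B * w z)) by (eapply Rle_trans; [apply Cmod_triangle|]; lra).
pose proof (Cmod_ge_0 (a z - b z)). pose proof (Cmod_ge_0 (be z)). pose proof (Cmod_ge_0 (ga z)). pose proof (Cmod_ge_0 (a z + b z)).
replace (th * (Cmod (be z) * (B * w z) + 2 * Cmod (ga z) * (B * w z) ^ 2)) with
  (Cmod (be z) * (th * (B * w z)) + Cmod (ga z) * (2 * (B * w z) * (th * (B * w z)))) by ring.
apply Rplus_le_compat; apply Rmult_le_compat_l; auto. apply Rmult_le_compat; auto.
Qed.

Lemma tail_of (k : R -> R) (f : C -> C) (c z : C) (kp a : R) : D z -> 0 <= kp ->
  (forall r, 0 <= r -> Rabs (k r) <= kp) -> (forall r, 0 <= r -> Cmod (f (z + RtoC r * e)%C) <= a / (1 + r) ^ 2) ->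
  forall r, 0 <= r -> Cmod (RtoC (k r) * f (z + RtoC r * e)%C) <= (kp * a) / (1 + r) ^ 2.
Proof.
intros Hz Hk Hb Hf r Hr. rewrite Cmod_mult, Cmod_R. unfold Rdiv. rewrite Rmult_assoc.
apply Rmult_le_compat; auto using Rabs_pos, Cmod_ge_0.
Qed.

Lemma small_tail (phi : C -> C) (z : C) (r : R) : small phi -> D z -> 0 <= r ->
  Cmod (G phi (z + RtoC r * e)%C) <= A / (1 + r) ^ 2.
Proof.
intros [H1 H2] Hz Hr. assert (D (z + RtoC r * e)%C) by now apply Hs.
eapply Rle_trans; [apply G_bound; auto|]. now apply TNB.
Qed.

Lemma J_small_bound (k k' : R -> R) (kp : R) (phi : C -> C) (z : C) :
  (forall r, is_derive k r (k' r)) -> (forall r, 0 <= r -> Rabs (k r) <= kp) -> small phi -> D z ->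
  Cmod (J k e (G phi) z) <= kp * A.
Proof.
intros Hk Hb Hp Hz.
assert (0 <= kp) by (eapply Rle_trans; [apply Rabs_pos|apply (Hb 0); lra]).
destruct (hol2_Cd _ _ (G_hol2 _ (proj1 Hp))) as [g' Hg].
assert (T : forall r, 0 <= r -> Cmod (RtoC (k r) * G phi (z + RtoC r * e)%C) <= (kp * A) / (1 + r) ^ 2).
{ apply (tail_of k (G phi) 0 z kp A); auto. intros; now apply small_tail. }
apply (J_bound D e HD Hs He k k' (G phi) g' (kp * A) z _ _ Hk Hg Hz T T).
apply dom_int_inv_sq. apply Rmult_le_pos; [assumption|]. eapply A_pos; eauto.
Qed.

(** Keeping [Cmod C0] apart serves twice: the ball is preserved by the iteration, and the solution
    is located near its limit [C0]. *)
Lemma JK_center (phi : C -> C) (z : C) : small phi -> D z -> Cmod (J K e (G phi) z) <= B * w z - Cmod C0.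
Proof.
intros Hp Hz.
destruct (hol2_Cd _ _ (G_hol2 _ (proj1 Hp))) as [g' Hg].
apply (J_bound D e HD Hs He K K1 (G phi) g' (1 * A) z (fun r => Rabs (K r) * NB (z + RtoC r * e)%C)); auto.
- apply (tail_of K (G phi) 0 z 1 A); auto; try lra. intros; now apply small_tail.
- intros r Hr. rewrite Cmod_mult, Cmod_R. apply Rmult_le_compat_l; [apply Rabs_pos|].
  assert (D (z + RtoC r * e)%C) by now apply Hs. apply G_bound; auto. now apply Hp.
Qed.

Lemma JK_small (phi : C -> C) (z : C) : small phi -> D z -> Cmod (C0 + J K e (G phi) z) <= B * w z.
Proof.
intros Hp Hz. eapply Rle_trans; [apply Cmod_triangle|]. pose proof (JK_center phi z Hp Hz). lra.
Qed.

(** [C0] is the limit prescribed along the half-line. The formulas [step1] and [step2] are the first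
    two derivatives after integration by parts: [K 0 = 0] removes the boundary term from the first,
    [K1 0 = 1] produces the term [G phi z] of the second. *)
Definition step (phi : C -> C) (z : C) : C := (C0 + J K e (G phi) z)%C.
Definition step1 (phi : C -> C) (z : C) : C := (- / e * J K1 e (G phi) z)%C.
Definition step2 (phi : C -> C) (z : C) : C := (/ e * / e * (G phi z + J K2 e (G phi) z))%C.

Lemma e_neq : e <> RtoC 0.
Proof. apply Cmod_gt_0. lra. Qed.

Lemma step_Cd (phi : C -> C) (z : C) : small phi -> D z -> Cd (step phi) z (step1 phi z).
Proof.
intros Hp Hz. unfold step.
eapply Cd_eq; [|apply Cd_plus; [apply Cd_const|
 apply (J_Cd D e HD Hs He K K1 (G phi) 1 A); auto]].
- unfold step1. rewrite HK0. ring.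
- exact (dk_ex _ _ HK1).
- now apply G_hol2, Hp.
- intros; now apply small_tail.
Qed.

Lemma step1_Cd (phi : C -> C) (z : C) : small phi -> D z -> Cd (step1 phi) z (step2 phi z).
Proof.
intros Hp Hz. unfold step1.
eapply Cd_eq; [|apply Cd_scal;
 apply (J_Cd D e HD Hs He K1 K2 (G phi) (Rmax 1 kap) A); auto].
- unfold step2. rewrite HK10. field. apply e_neq.
- now apply G_hol2, Hp.
- intros r Hr. eapply Rle_trans; [now apply Bk1|apply Rmax_l].
- intros r Hr. eapply Rle_trans; [now apply Bk2|apply Rmax_r].
- intros; now apply small_tail.
Qed.

Lemma Cmod_e (x : C) : Cmod (- / e * x) = Cmod x.
Proof. rewrite Cmod_mult, Cmod_opp, Cmod_inv by apply e_neq. rewrite He. field. Qed.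

Lemma Cmod_ee (x : C) : Cmod (/ e * / e * x) = Cmod x.
Proof. rewrite !Cmod_mult, Cmod_inv by apply e_neq. rewrite He. field. Qed.

Lemma small_0 : small (fun _ => RtoC 0).
Proof. split; [apply hol2_const|]. intros z Hz. rewrite Cmod_0. now apply Bw_pos. Qed.

Lemma Bw_le (z : C) : D z -> B * w z <= B * Wb.
Proof. intros Hz. apply Rmult_le_compat_l; [exact HB|]. now apply Hw. Qed.

Lemma small_step (phi : C -> C) : small phi -> small (step phi).
Proof.
intros Hp. split; [|intros z Hz; now apply JK_small].
destruct (G_hol2 _ (proj1 Hp)) as [g1 [g2 [M HM]]].
exists (step1 phi), (step2 phi), (Rmax (B * Wb) (Rmax (1 * A) (M + kap * A))). intros z Hz.
split; [now apply step_Cd|]. split; [now apply step1_Cd|].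
split; [|split].
- eapply Rle_trans; [now apply JK_small|]. eapply Rle_trans; [now apply Bw_le|]. apply Rmax_l.
- eapply Rle_trans; [|apply Rmax_r]. eapply Rle_trans; [|apply Rmax_l]. unfold step1. rewrite Cmod_e.
  now apply (J_small_bound K1 K2).
- eapply Rle_trans; [|apply Rmax_r]. eapply Rle_trans; [|apply Rmax_r]. unfold step2. rewrite Cmod_ee.
  eapply Rle_trans; [apply Cmod_triangle|]. apply Rplus_le_compat; [now apply HM|].
  now apply (J_small_bound K2 (Derive K2)).
Qed.

(** The kernel is arbitrary because the estimate is used for [K], with the contraction factor [q0],
    and also for [K1] and [K2], with a mere bound, so that the derivatives of the iterates converge
    too. *)
Lemma J_contract (k k' : R -> R) (kp b : R) (f g : C -> C) (th : R) (z : C) (m : R -> R) :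
  (forall r, is_derive k r (k' r)) -> (forall r, 0 <= r -> Rabs (k r) <= kp) ->
  small f -> small g -> 0 <= th -> (forall z, D z -> Cmod (f z - g z) <= th * (B * w z)) -> D z ->
  (forall r, 0 <= r -> Rabs (k r) * LB (z + RtoC r * e)%C <= m r) -> dom_int m b ->
  Cmod (J k e (G f) z - J k e (G g) z) <= th * b.
Proof.
intros Hk Hb Hf Hg Hth Hfg Hz Hm Hd.
assert (Hkp : 0 <= kp) by (eapply Rle_trans; [apply Rabs_pos|apply (Hb 0); lra]).
destruct (hol2_Cd _ _ (G_hol2 _ (proj1 Hf))) as [f' Hf'].
destruct (hol2_Cd _ _ (G_hol2 _ (proj1 Hg))) as [g' Hg'].
assert (Tf : forall r, 0 <= r -> Cmod (RtoC (k r) * G f (z + RtoC r * e)%C) <= (kp * A) / (1 + r) ^ 2)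
 by (apply (tail_of k (G f) 0 z kp A); auto; intros; now apply small_tail).
assert (Tg : forall r, 0 <= r -> Cmod (RtoC (k r) * G g (z + RtoC r * e)%C) <= (kp * A) / (1 + r) ^ 2)
 by (apply (tail_of k (G g) 0 z kp A); auto; intros; now apply small_tail).
rewrite <- (J_minus D e HD Hs He k k' (G f) f' (G g) g' (kp * A) z); auto.
assert (HL : forall r, 0 <= r -> Cmod (G f (z + RtoC r * e)%C - G g (z + RtoC r * e)%C) <= th * LB (z + RtoC r * e)%C).
{ intros r Hr. assert (D (z + RtoC r * e)%C) by now apply Hs.
  apply G_diff; auto; [now apply Hf|now apply Hg]. }
apply (J_bound D e HD Hs He k k' (fun z => G f z - G g z)%C (fun z => f' z - g' z)%C (kp * (th * A)) z (fun r => th * m r)); auto.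
- intros x Hx. now apply Cd_minus; [apply Hf'|apply Hg'].
- apply (tail_of k (fun z => G f z - G g z)%C 0 z kp (th * A)); auto. intros r Hr.
  eapply Rle_trans; [now apply HL|]. unfold Rdiv. rewrite Rmult_assoc. apply Rmult_le_compat_l; [exact Hth|]. now apply TLB.
- intros r Hr. rewrite Cmod_mult, Cmod_R. eapply Rle_trans; [apply Rmult_le_compat_l; [apply Rabs_pos|now apply HL]|].
  rewrite <- Rmult_assoc, (Rmult_comm (Rabs (k r))), Rmult_assoc. apply Rmult_le_compat_l; auto.
- now apply dom_int_scal.
Qed.

Lemma step_contract (f g : C -> C) (th : R) (z : C) :
  small f -> small g -> 0 <= th -> (forall z, D z -> Cmod (f z - g z) <= th * (B * w z)) -> D z ->
  Cmod (step f z - step g z) <= th * q0 * (B * w z).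
Proof.
intros Hf Hg Hth Hfg Hz. unfold step.
replace (C0 + J K e (G f) z - (C0 + J K e (G g) z))%C with (J K e (G f) z - J K e (G g) z)%C by ring.
rewrite Rmult_assoc.
apply (J_contract K K1 1 (q0 * (B * w z)) f g th z (fun r => Rabs (K r) * LB (z + RtoC r * e)%C)); auto.
intros; lra.
Qed.

Lemma Jk_contract (k k' : R -> R) (kp : R) (f g : C -> C) (th : R) (z : C) :
  (forall r, is_derive k r (k' r)) -> (forall r, 0 <= r -> Rabs (k r) <= kp) ->
  small f -> small g -> 0 <= th -> (forall z, D z -> Cmod (f z - g z) <= th * (B * w z)) -> D z ->
  Cmod (J k e (G f) z - J k e (G g) z) <= th * (kp * A).
Proof.
intros Hk Hb Hf Hg Hth Hfg Hz.
assert (Hkp : 0 <= kp) by (eapply Rle_trans; [apply Rabs_pos|apply (Hb 0); lra]).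
assert (HA := A_pos z Hz).
apply (J_contract k k' kp (kp * A) f g th z (fun r => (kp * A) / (1 + r) ^ 2)); auto.
- intros r Hr. unfold Rdiv. rewrite Rmult_assoc.
  assert (0 <= LB (z + RtoC r * e)%C).
  { assert (Dr : D (z + RtoC r * e)%C) by now apply Hs. pose proof (Bw_pos _ Dr). unfold LB.
    apply Rplus_le_le_0_compat; [apply Rmult_le_pos; auto using Cmod_ge_0|].
    apply Rmult_le_pos; [apply Rmult_le_pos; [lra|apply Cmod_ge_0]|]. now apply pow_le. }
  apply Rmult_le_compat; auto using Rabs_pos.
- apply dom_int_inv_sq. now apply Rmult_le_pos.
Qed.

Definition iter (n : nat) : C -> C := Nat.iter n step (fun _ => RtoC 0).
Definition fixp (z : C) : C := Clim (fun n => iter n z).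

Lemma small_iter (n : nat) : small (iter n).
Proof. induction n; [apply small_0|]. simpl. now apply small_step. Qed.

Lemma iter_diff (n : nat) (z : C) : D z -> Cmod (iter (S n) z - iter n z) <= q0 ^ n * (B * w z).
Proof.
revert z. induction n; intros z Hz.
- simpl. replace (step (fun _ => 0%C) z - 0)%C with (step (fun _ => 0%C) z) by ring. rewrite Rmult_1_l.
  apply JK_small; [apply small_0|exact Hz].
- change (iter (S (S n))) with (step (iter (S n))). change (iter (S n) z) with (step (iter n) z).
  eapply Rle_trans; [apply (step_contract _ _ (q0 ^ n)); auto using small_iter; apply pow_le; lra|].
  simpl. lra.
Qed.

Lemma iter_fixp (n : nat) (z : C) : D z -> Cmod (iter n z - fixp z) <= / (1 - q0) * q0 ^ n * (B * w z).
Proof.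
intros Hz. replace (/ (1 - q0) * q0 ^ n * (B * w z)) with ((B * w z) / (1 - q0) * q0 ^ n) by (unfold Rdiv; ring).
apply (geom_cauchy (fun n => iter n z)); auto; [now apply Bw_pos|].
intros m. rewrite Rmult_comm. now apply iter_diff.
Qed.

Lemma fixp_bound (z : C) : D z -> Cmod (fixp z) <= B * w z.
Proof.
intros Hz. apply Rminus_le. apply (le_lim_0 _ (fun n => (B * w z) / (1 - q0) * q0 ^ n)); [now apply lim_geom_scal|].
intros n. assert (H := iter_fixp n z Hz). assert (H2 := proj2 (small_iter n) z Hz).
pose proof (Cmod_rev_tri (fixp z) (fixp z - iter n z)) as H3.
replace (fixp z - (fixp z - iter n z))%C with (iter n z) in H3 by ring.
rewrite (Cmod_minus_sym (fixp z)) in H3. unfold Rdiv. lra.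
Qed.

Lemma q_pow_nonneg (n : nat) : 0 <= q0 ^ n.
Proof. apply pow_le. lra. Qed.

(** The first two derivatives of the iterates depend on the iterates through [G] and the operators
    with kernels [K1] and [K2], hence are Cauchy at the rate [q0 ^ n] as well. Two uses of
    [Cd_limit] differentiate the limit twice. *)
Lemma fixp_hol2 : hol2 D fixp.
Proof.
assert (HX : forall z, D z -> 0 <= A) by (intros z; apply A_pos).
(* The sign of [A] is read off at a point of [D], so an empty [D] is treated apart. *)
destruct (excluded_middle_informative (exists z, D z)) as [[z0 Hz0]|Hno].
2:{ exists (fun _ => RtoC 0), (fun _ => RtoC 0), 0. intros z Hz. exfalso. apply Hno. now exists z. }
assert (HA : 0 <= A) by now apply (HX z0). clear HX.
assert (Hkp := kap_pos).
set (d1 n := step1 (iter n)). set (d2 n := step2 (iter n)).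
assert (E1 : forall n z, D z -> Cmod (d1 n z - Clim (fun n => d1 n z)) <= (1 * A) / (1 - q0) * q0 ^ n).
{ intros n z Hz. apply (geom_cauchy (fun n => d1 n z)); auto; [lra|]. intros m. unfold d1, step1.
  replace (- / e * J K1 e (G (iter (S m))) z - - / e * J K1 e (G (iter m)) z)%C with
    (- / e * (J K1 e (G (iter (S m))) z - J K1 e (G (iter m)) z))%C by ring.
  rewrite Cmod_e, (Rmult_comm _ (q0 ^ m)).
  apply (Jk_contract K1 K2); auto using small_iter, q_pow_nonneg. intros x Hx. now apply iter_diff. }
assert (E2 : forall n z, D z -> Cmod (d2 n z - Clim (fun n => d2 n z)) <= (A + kap * A) / (1 - q0) * q0 ^ n).
{ intros n z Hz. apply (geom_cauchy (fun n => d2 n z)); auto; [nra|]. intros m. unfold d2, step2.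
  replace (/ e * / e * (G (iter (S m)) z + J K2 e (G (iter (S m))) z) - / e * / e * (G (iter m) z + J K2 e (G (iter m)) z))%C with
    (/ e * / e * ((G (iter (S m)) z - G (iter m) z) + (J K2 e (G (iter (S m))) z - J K2 e (G (iter m)) z)))%C by ring.
  rewrite Cmod_ee. eapply Rle_trans; [apply Cmod_triangle|]. rewrite (Rmult_comm _ (q0 ^ m)), Rmult_plus_distr_l.
  apply Rplus_le_compat.
  - apply Rle_trans with (q0 ^ m * LB z).
    + apply G_diff; auto; try (now apply small_iter). now apply iter_diff.
    + apply Rmult_le_compat_l; [apply q_pow_nonneg|].
      pose proof (TLB z 0 Hz (Rle_refl 0)) as T. replace (z + RtoC 0 * e)%C with z in T by ring.
      replace (A / (1 + 0) ^ 2) with A in T by field. exact T.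
  - apply (Jk_contract K2 (Derive K2)); auto using small_iter, q_pow_nonneg. intros x Hx. now apply iter_diff. }
assert (LC : forall (u : nat -> C -> C) (l : C -> C) (b : R), (forall n z, D z -> Cmod (u n z - l z) <= b * q0 ^ n) ->
   forall z, D z -> forall eps, 0 < eps -> exists N, forall n, (N <= n)%nat -> Cmod (u n z - l z) <= eps).
{ intros u l b H z Hz eps Heps. assert (L := lim_geom_scal b q0 Hq0). apply is_lim_seq_spec in L.
  destruct (L (mkposreal eps Heps)) as [N HN]. exists N. intros n Hn. specialize (HN n Hn). simpl in HN.
  rewrite Rminus_0_r in HN. pose proof (Rle_abs (b * q0 ^ n)). specialize (H n z Hz). lra. }
destruct (G_hol2 _ (proj1 (small_iter 0))) as [g1 [g2 [M HM]]].
exists (fun z => Clim (fun n => d1 n z)), (fun z => Clim (fun n => d2 n z)),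
  (Rmax (B * Wb) (Rmax (1 * A + (1 * A) / (1 - q0)) (M + kap * A + (A + kap * A) / (1 - q0)))).
intros z Hz. split; [|split; [|split; [|split]]].
- revert z Hz. apply (Cd_limit D (fun n => iter (S n)) d1 fixp (fun z => Clim (fun n => d1 n z)) (fun n => (1 * A) / (1 - q0) * q0 ^ n)); auto.
  + now apply lim_geom_scal.
  + intros n z Hz. apply step_Cd; auto using small_iter.
  + apply (LC (fun n => iter (S n)) fixp (/ (1 - q0) * (B * Wb))). intros n z Hz.
    eapply Rle_trans; [now apply iter_fixp|]. simpl. pose proof (Bw_le z Hz). pose proof (Bw_pos z Hz). pose proof (q_pow_nonneg n).
    assert (0 < / (1 - q0)) by (apply Rinv_0_lt_compat; lra).
    replace (/ (1 - q0) * (q0 * q0 ^ n) * (B * w z)) with (/ (1 - q0) * q0 ^ n * (q0 * (B * w z))) by ring.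
    replace (/ (1 - q0) * (B * Wb) * q0 ^ n) with (/ (1 - q0) * q0 ^ n * (B * Wb)) by ring.
    apply Rmult_le_compat_l; [apply Rmult_le_pos; lra|]. nra.
- revert z Hz. apply (Cd_limit D d1 d2 (fun z => Clim (fun n => d1 n z)) (fun z => Clim (fun n => d2 n z)) (fun n => (A + kap * A) / (1 - q0) * q0 ^ n)); auto.
  + now apply lim_geom_scal.
  + intros n z Hz. apply step1_Cd; auto using small_iter.
  + apply (LC d1 _ _ E1).
- eapply Rle_trans; [now apply fixp_bound|]. eapply Rle_trans; [now apply Bw_le|]. apply Rmax_l.
- eapply Rle_trans; [|apply Rmax_r]. eapply Rle_trans; [|apply Rmax_l].
  specialize (E1 0%nat z Hz). simpl in E1.
  assert (Cmod (d1 0%nat z) <= 1 * A) by (unfold d1, step1; rewrite Cmod_e; apply (J_small_bound K1 K2); auto using small_iter).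
  pose proof (Cmod_rev_tri (Clim (fun n => d1 n z)) (d1 0%nat z)) as T. rewrite Cmod_minus_sym in T. lra.
- eapply Rle_trans; [|apply Rmax_r]. eapply Rle_trans; [|apply Rmax_r].
  specialize (E2 0%nat z Hz). simpl in E2.
  assert (Cmod (d2 0%nat z) <= M + kap * A).
  { unfold d2, step2; rewrite Cmod_ee. eapply Rle_trans; [apply Cmod_triangle|].
    apply Rplus_le_compat; [now apply HM|apply (J_small_bound K2 (Derive K2)); auto using small_iter]. }
  pose proof (Cmod_rev_tri (Clim (fun n => d2 n z)) (d2 0%nat z)) as T. rewrite Cmod_minus_sym in T. lra.
Qed.

Lemma small_fixp : small fixp.
Proof. split; [apply fixp_hol2|intros z Hz; now apply fixp_bound]. Qed.

Lemma fixp_eq (z : C) : D z -> step fixp z = fixp z.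
Proof.
intros Hz.
assert (Z : Cmod (step fixp z - fixp z) <= 0).
{ apply (le_lim_0 _ (fun n => 2 * ((B * w z) / (1 - q0)) * q0 ^ n)); [now apply lim_geom_scal|]. intros n.
  assert (H1 := iter_fixp (S n) z Hz).
  assert (H2 := step_contract fixp (iter n) (/ (1 - q0) * q0 ^ n) z small_fixp (small_iter n)).
  assert (Hi : 0 < / (1 - q0)) by (apply Rinv_0_lt_compat; lra). pose proof (q_pow_nonneg n). pose proof (Bw_pos z Hz).
  assert (P : 0 <= / (1 - q0) * q0 ^ n * (B * w z)) by (apply Rmult_le_pos; [apply Rmult_le_pos; lra|assumption]).
  replace (step fixp z - fixp z)%C with ((step fixp z - step (iter n) z) + (iter (S n) z - fixp z))%C by (simpl; ring).
  eapply Rle_trans; [apply Cmod_triangle|].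
  apply Rle_trans with (/ (1 - q0) * q0 ^ n * q0 * (B * w z) + / (1 - q0) * q0 ^ S n * (B * w z)).
  - apply Rplus_le_compat; [|exact H1]. apply H2; auto; [apply Rmult_le_pos; lra|].
    intros x Hx. rewrite Cmod_minus_sym. now apply iter_fixp.
  - simpl. unfold Rdiv. nra. }
assert (E : Cmod (step fixp z - fixp z) = 0) by (pose proof (Cmod_ge_0 (step fixp z - fixp z)); lra).
apply Cmod_eq_0 in E. replace (step fixp z) with (step fixp z - fixp z + fixp z)%C by ring. rewrite E. ring.
Qed.

Lemma fixed_unique (f g : C -> C) : small f -> small g ->
  (forall z, D z -> step f z = f z) -> (forall z, D z -> step g z = g z) -> forall z, D z -> f z = g z.
Proof.
intros Hf Hg Ef Eg z Hz.
assert (P : forall n x, D x -> Cmod (f x - g x) <= 2 * q0 ^ n * (B * w x)).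
{ induction n; intros x Hx.
  - simpl. eapply Rle_trans; [apply Cmod_tri_minus|]. pose proof (proj2 Hf x Hx). pose proof (proj2 Hg x Hx). lra.
  - rewrite <- (Ef x Hx), <- (Eg x Hx).
    eapply Rle_trans; [apply (step_contract f g (2 * q0 ^ n)); auto; pose proof (q_pow_nonneg n); lra|]. simpl. lra. }
assert (Z : Cmod (f z - g z) <= 0).
{ apply (le_lim_0 _ (fun n => (2 * (B * w z)) * q0 ^ n)); [now apply lim_geom_scal|]. intros n. specialize (P n z Hz). lra. }
assert (E : Cmod (f z - g z) = 0) by (pose proof (Cmod_ge_0 (f z - g z)); lra).
apply Cmod_eq_0 in E. replace (f z) with (f z - g z + g z)%C by ring. rewrite E. ring.
Qed.

(** The linear relation between the kernels passes to the integrals; this expresses the second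
    derivative of a fixed point through the first and the fixed point itself. *)
Lemma J_kernel_eq (p q : R) (phi : C -> C) (z : C) : (forall r, K2 r = p * K1 r + q * K r) -> small phi -> D z ->
  J K2 e (G phi) z = (RtoC p * J K1 e (G phi) z + RtoC q * J K e (G phi) z)%C.
Proof.
intros E Hp Hz.
destruct (hol2_Cd _ _ (G_hol2 _ (proj1 Hp))) as [g' Hg].
assert (T : forall (k : R -> R) kp, 0 <= kp -> (forall r, 0 <= r -> Rabs (k r) <= kp) ->
   forall r, 0 <= r -> Cmod (RtoC (k r) * G phi (z + RtoC r * e)%C) <= (kp * A) / (1 + r) ^ 2).
{ intros k kp Hkp Hk. apply (tail_of k (G phi) 0 z kp A); auto. intros; now apply small_tail. }
apply (Clim_le _ (fun n => (Rabs p * (1 * A) + Rabs q * (1 * A)) / (1 + INR n)) _ (lim_inv_S _)). intros n.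
replace (Jn K2 e (G phi) (INR n) z) with (RtoC p * Jn K1 e (G phi) (INR n) z + RtoC q * Jn K e (G phi) (INR n) z)%C.
- assert (H1 := J_tail D e HD Hs He K1 K2 (G phi) g' (1 * A) z n HK1 Hg Hz (T K1 1 Rle_0_1 Bk1)).
  assert (H0 := J_tail D e HD Hs He K K1 (G phi) g' (1 * A) z n HK Hg Hz (T K 1 Rle_0_1 Bk)).
  match goal with |- Cmod ?x <= _ => replace x with
   (RtoC p * (Jn K1 e (G phi) (INR n) z - J K1 e (G phi) z) + RtoC q * (Jn K e (G phi) (INR n) z - J K e (G phi) z))%C by ring end.
  eapply Rle_trans; [apply Cmod_triangle|]. rewrite !Cmod_mult, !Cmod_R. unfold Rdiv in *. rewrite Rmult_plus_distr_r, !(Rmult_assoc (Rabs _)).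
  apply Rplus_le_compat; apply Rmult_le_compat_l; auto using Rabs_pos.
- unfold Jn at 3. rewrite (CInt_unique _ (fun N => RtoC p * Jn K1 e (G phi) N z + RtoC q * Jn K e (G phi) N z)%C (INR n)).
  + unfold Jn. rewrite !CInt_0. ring.
  + eapply ray_halfcont; eauto.
  + apply pos_INR.
  + intros t Ht. eapply Rd_eq; [|apply Rd_plus; (apply Rd_mult; [apply Rd_const|]);
      [apply CInt_Rd; [eapply (ray_halfcont D e z K1 K2); eauto|lra]|apply CInt_Rd; [eapply (ray_halfcont D e z K K1); eauto|lra]]].
    simpl. rewrite E, RtoC_plus, !RtoC_mult. ring.
Qed.

(* A fixed point solves the second-order equation [e^2 phi'' = G phi - p e phi' + q (phi - C0)]. *)
Lemma fixed_ode (p q : R) (phi : C -> C) (z : C) : (forall r, K2 r = p * K1 r + q * K r) -> small phi ->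
  (forall z, D z -> step phi z = phi z) -> D z ->
  Cd phi z (step1 phi z) /\ Cd (step1 phi) z (step2 phi z) /\
  (e * e * step2 phi z = G phi z - RtoC p * e * step1 phi z + RtoC q * (phi z - C0))%C /\
  Cmod (step1 phi z) <= A.
Proof.
intros E Hp Hfix Hz. split; [|split; [|split]].
- destruct (HD z Hz) as [r [Hr Hball]].
  apply (Cd_ext_loc (step phi) phi z _ r Hr); [|now apply step_Cd]. intros x Hx. now apply Hfix, Hball.
- now apply step1_Cd.
- assert (E2 := J_kernel_eq p q phi z E Hp Hz).
  assert (E3 : J K e (G phi) z = (phi z - C0)%C) by (rewrite <- (Hfix z Hz); unfold step; ring).
  unfold step2, step1. rewrite E2, E3. field. apply e_neq.
- unfold step1. rewrite Cmod_e. rewrite <- (Rmult_1_l A). now apply (J_small_bound K1 K2).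
Qed.

(** Here [|K1| <= 1] drops the kernel, so a certified integral of [NB] bounds the derivative
    pointwise; this keeps the decay in [z] that the constant [A] has lost. *)
Lemma step1_bound (phi : C -> C) (z : C) (b : R) : small phi -> D z ->
  dom_int (fun r => NB (z + RtoC r * e)%C) b -> Cmod (step1 phi z) <= b.
Proof.
intros Hp Hz Hd. unfold step1. rewrite Cmod_e.
destruct (hol2_Cd _ _ (G_hol2 _ (proj1 Hp))) as [g' Hg].
apply (J_bound D e HD Hs He K1 K2 (G phi) g' (1 * A) z (fun r => NB (z + RtoC r * e)%C)); auto.
- apply (tail_of K1 (G phi) 0 z 1 A); auto; try lra. intros; now apply small_tail.
- intros r Hr. assert (D (z + RtoC r * e)%C) by now apply Hs.
  rewrite Cmod_mult, Cmod_R. apply Rle_trans with (1 * NB (z + RtoC r * e)%C); [|lra].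
  apply Rmult_le_compat; auto using Rabs_pos, Cmod_ge_0. apply G_bound; auto. now apply Hp.
Qed.
End FixedPoint.

(** With [ker_0], [ker_10] and [ker_ode], [K] is the fundamental solution of a second-order equation
    with constant coefficients, which turns fixed points into solutions of a differential
    equation. *)
Record kernel (K K1 K2 : R -> R) (kap p q : R) : Prop := {
  ker_d : forall r, is_derive K r (K1 r);
  ker_d1 : forall r, is_derive K1 r (K2 r);
  ker_d2 : forall r, is_derive K2 r (Derive K2 r);
  ker_0 : K 0 = 0;
  ker_10 : K1 0 = 1;
  ker_b : forall r, 0 <= r -> Rabs (K r) <= 1;
  ker_b1 : forall r, 0 <= r -> Rabs (K1 r) <= 1;
  ker_b2 : forall r, 0 <= r -> Rabs (K2 r) <= kap;
  ker_ode : forall r, K2 r = p * K1 r + q * K r }.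

(** [w] is the weight of the norm and [B] the radius of the ball. [ct_NB] makes the ball invariant
    and [ct_LB] gives the contraction factor [q0]; [ct_TNB] and [ct_TLB] are crude tail bounds that
    ensure convergence of the integrals. *)
Record contr (D : C -> Prop) (e : C) (K : R -> R) (al be ga : C -> C) (w : C -> R) (B q0 A Wb : R) (C0 : C) : Prop := {
  ct_open : Copen D;
  ct_stable : stable D e;
  ct_e : Cmod e = 1;
  ct_al : hol2 D al;
  ct_be : hol2 D be;
  ct_ga : hol2 D ga;
  ct_B : 0 <= B;
  ct_w : forall z, D z -> 0 <= w z <= Wb;
  ct_q : 0 <= q0 < 1;
  ct_NB : forall z, D z -> dom_int (fun r => Rabs (K r) * NB al be ga w B (z + RtoC r * e)%C) (B * w z - Cmod C0);
  ct_LB : forall z, D z -> dom_int (fun r => Rabs (K r) * LB be ga w B (z + RtoC r * e)%C) (q0 * (B * w z));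
  ct_TNB : forall z r, D z -> 0 <= r -> NB al be ga w B (z + RtoC r * e)%C <= A / (1 + r) ^ 2;
  ct_TLB : forall z r, D z -> 0 <= r -> LB be ga w B (z + RtoC r * e)%C <= A / (1 + r) ^ 2 }.

Definition fixsol (D : C -> Prop) (e : C) (K : R -> R) (al be ga : C -> C) (w : C -> R) (B : R) (C0 : C) (phi : C -> C) : Prop :=
  small D w B phi /\ forall z, D z -> step e K al be ga C0 phi z = phi z.

Section Packaged.
Variables (D : C -> Prop) (e : C) (K K1 K2 : R -> R) (kap p q : R).
Variables (al be ga : C -> C) (w : C -> R) (B q0 A Wb : R) (C0 : C).
Hypothesis HK : kernel K K1 K2 kap p q.
Hypothesis HC : contr D e K al be ga w B q0 A Wb C0.

Lemma fixsol_exists : exists phi, fixsol D e K al be ga w B C0 phi.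
Proof.
destruct HK, HC. exists (fixp e K al be ga C0). split; [eapply (small_fixp D e K K1 K2) with (al := al) (be := be) (ga := ga) (w := w) (B := B) (q0 := q0) (A := A) (Wb := Wb) (C0 := C0); eassumption|].
intros z Hz. eapply (fixp_eq D e K K1 K2) with (al := al) (be := be) (ga := ga) (w := w) (B := B) (q0 := q0) (A := A) (Wb := Wb) (C0 := C0); eassumption.
Qed.

Lemma fixsol_unique (f g : C -> C) : fixsol D e K al be ga w B C0 f -> fixsol D e K al be ga w B C0 g ->
  forall z, D z -> f z = g z.
Proof. intros [Hf Ef] [Hg Eg] z Hz. destruct HK, HC. eapply (fixed_unique D e K K1) with (al := al) (be := be) (ga := ga) (w := w) (B := B) (q0 := q0) (A := A) (Wb := Wb) (C0 := C0); eassumption. Qed.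

Lemma fixsol_ode (phi : C -> C) : fixsol D e K al be ga w B C0 phi ->
  exists phi1 phi2 : C -> C, forall z, D z -> Cd phi z (phi1 z) /\ Cd phi1 z (phi2 z) /\
    (e * e * phi2 z = G al be ga phi z - RtoC p * e * phi1 z + RtoC q * (phi z - C0))%C /\
    Cmod (phi z) <= B * w z /\ Cmod (phi1 z) <= A /\
    (forall b, dom_int (fun r => NB al be ga w B (z + RtoC r * e)%C) b -> Cmod (phi1 z) <= b).
Proof.
intros [Hf Ef]. destruct HK, HC. exists (step1 e K1 al be ga phi), (step2 e K2 al be ga phi). intros z Hz.
assert (F : Cd phi z (step1 e K1 al be ga phi z) /\ Cd (step1 e K1 al be ga phi) z (step2 e K2 al be ga phi z) /\
  (e * e * step2 e K2 al be ga phi z = G al be ga phi z - RtoC p * e * step1 e K1 al be ga phi z + RtoC q * (phi z - C0))%C /\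
  Cmod (step1 e K1 al be ga phi z) <= A).
{ eapply (fixed_ode D e K K1 K2) with (al := al) (be := be) (ga := ga) (w := w) (B := B); eassumption. }
destruct F as [H1 [H2 [H3 H4]]].
split; [exact H1|]. split; [exact H2|]. split; [exact H3|]. split; [now apply Hf|]. split; [exact H4|].
intros b Hb. eapply (step1_bound D e K1 K2) with (al := al) (be := be) (ga := ga) (w := w) (B := B) (A := A); eassumption.
Qed.

Lemma fixsol_center (phi : C -> C) (z : C) : fixsol D e K al be ga w B C0 phi -> D z ->
  Cmod (phi z - C0) <= B * w z - Cmod C0.
Proof.
intros [Hf Ef] Hz. destruct HK, HC. rewrite <- (Ef z Hz). unfold step.
replace (C0 + J K e (G al be ga phi) z - C0)%C with (J K e (G al be ga phi) z) by ring.
eapply (JK_center D e K K1) with (w := w); eassumption.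
Qed.
End Packaged.

(** * The two kernels, negative powers and a reference integral *)

Lemma kernel_sin : kernel sin cos (fun r => - sin r) 1 0 (-1).
Proof.
split; try (intros r; auto_derive; auto; ring).
- intros r. apply Derive_correct. auto_derive. auto.
- apply sin_0.
- apply cos_0.
- intros r _. apply Rabs_le. pose proof (SIN_bound r). lra.
- intros r _. apply Rabs_le. pose proof (COS_bound r). lra.
- intros r _. apply Rabs_le. pose proof (SIN_bound r). lra.
- intros r. ring.
Qed.

(** With [e = Ci] these coefficients give [v'' + 2 i v' = - G v]. Integrating from infinity excludes
    the solution exp(-2 i z), which grows upwards, and leaves a bounded kernel. *)
Lemma kernel_exp : kernel (fun r => (1 - exp (- (2 * r))) / 2) (fun r => exp (- (2 * r))) (fun r => - 2 * exp (- (2 * r))) 2 (-2) 0.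
Proof.
assert (E : forall r, 0 <= r -> 0 < exp (- (2 * r)) <= 1).
{ intros r Hr. split; [apply exp_pos|]. rewrite <- exp_0. apply exp_le_compat. lra. }
split; try (intros r; auto_derive; auto; lra).
- intros r. apply Derive_correct. auto_derive. auto.
- rewrite Rmult_0_r, Ropp_0, exp_0. lra.
- rewrite Rmult_0_r, Ropp_0, exp_0. reflexivity.
- intros r Hr. specialize (E r Hr). apply Rabs_le. lra.
- intros r Hr. specialize (E r Hr). apply Rabs_le. lra.
- intros r Hr. specialize (E r Hr). apply Rabs_le. lra.
- intros r. ring.
Qed.

Lemma Rpower_pos (x p : R) : 0 < Rpower x p.
Proof. apply exp_pos. Qed.

Lemma Rpower_le_1 (x p : R) : 1 <= x -> p <= 0 -> Rpower x p <= 1.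
Proof.
intros Hx Hp. unfold Rpower. rewrite <- exp_0. apply exp_le_compat.
assert (0 <= ln x). { rewrite <- ln_1. apply ln_le; lra. } nra.
Qed.

Lemma Rpower_anti (x y p : R) : 0 < y <= x -> p <= 0 -> Rpower x p <= Rpower y p.
Proof.
intros H Hp. unfold Rpower. apply exp_le_compat.
assert (ln y <= ln x) by (apply ln_le; lra). nra.
Qed.

Lemma Rpower_neg_nat (x : R) (n : nat) : 0 < x -> Rpower x (- INR n) = / x ^ n.
Proof. intros H. rewrite Rpower_Ropp, Rpower_pow by exact H. reflexivity. Qed.

Lemma hol2_Cpower (D : C -> Prop) (p : R) : p <= 0 -> (forall z, D z -> slit z /\ 1 <= Cmod z) ->
  hol2 D (fun z => Cpower z p).
Proof.
intros Hp HD.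
exists (fun z => RtoC p * Cpower z (p - 1))%C, (fun z => RtoC p * (RtoC (p - 1) * Cpower z (p - 1 - 1)))%C,
  (1 + Rabs p + Rabs p * Rabs (p - 1)).
intros z Hz. destruct (HD z Hz) as [Hs H1].
pose proof (Rabs_pos p). pose proof (Rabs_pos (p - 1)). assert (0 <= Rabs p * Rabs (p - 1)) by nra.
split; [now apply Cd_Cpower|]. split; [now apply Cd_scal, Cd_Cpower|].
rewrite !Cmod_mult, !Cmod_R, !Cmod_Cpower.
assert (B : forall q, q <= 0 -> 0 < Rpower (Cmod z) q <= 1) by (intros q Hq; split; [apply Rpower_pos|now apply Rpower_le_1]).
destruct (B p Hp). destruct (B (p - 1)); [lra|]. destruct (B (p - 1 - 1)); [lra|].
split; [|split]; [lra|nra|]. rewrite <- Rmult_assoc. nra.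
Qed.

(** With [x = r / sqrt (a^2 + r^2)] the integrand is the derivative of [(x - x^3/3) / a^4], and [x]
    stays below 1. *)
Lemma dom_int_m5 (a : R) : 0 < a -> dom_int (fun r => / sqrt (a * a + r * r) ^ 5) (2 / 3 * / a ^ 4).
Proof.
intros Ha.
assert (Hp : forall r, 0 < a * a + r * r) by (intros; nra).
exists (fun r => / a ^ 4 * (r / sqrt (a * a + r * r) - (r / sqrt (a * a + r * r)) ^ 3 / 3)),
  (fun r => / sqrt (a * a + r * r) ^ 5). split; [|split].
- intros r _. assert (Hs : 0 < sqrt (a * a + r * r)) by now apply sqrt_lt_R0.
  assert (Hsq : sqrt (a * a + r * r) ^ 2 = a * a + r * r) by (simpl; rewrite Rmult_1_r, sqrt_sqrt; [reflexivity|left; apply Hp]).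
  set (t := sqrt (a * a + r * r)) in *.
  assert (Hd : is_derive (fun r => r / sqrt (a * a + r * r)) r (a * a / t ^ 3)).
  { auto_derive; fold t.
    - repeat split; auto. lra.
    - replace (a * a) with (t ^ 2 - r * r) by lra. field. lra. }
  apply (is_derive_eq _ _ (/ a ^ 4 * (a * a / t ^ 3 - (INR 3 * (a * a / t ^ 3) * (r / t) ^ 2) / 3))).
  + replace ((r / t) ^ 2) with (1 - a * a / t ^ 2) by (field_simplify; [rewrite Hsq; f_equal; ring|lra|lra]).
    simpl. field. lra.
  + apply is_derive_scal, @is_derive_minus; [exact Hd|].
    apply (is_derive_ext (fun r => / 3 * (r / sqrt (a * a + r * r)) ^ 3)); [intros; simpl; field|].
    * apply Rgt_not_eq, sqrt_lt_R0, Hp.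
    * eapply is_derive_eq; [|apply is_derive_scal, is_derive_pow, Hd]. simpl. fold t. field. lra.
- intros; lra.
- intros r Hr. assert (Hs : 0 < sqrt (a * a + r * r)) by now apply sqrt_lt_R0.
  assert (Hx : 0 <= r / sqrt (a * a + r * r) <= 1).
  { split; [apply Rmult_le_pos; [exact Hr|left; now apply Rinv_0_lt_compat]|].
    apply (Rmult_le_reg_r (sqrt (a * a + r * r))); [exact Hs|].
    replace (r / sqrt (a * a + r * r) * sqrt (a * a + r * r)) with r by (field; lra).
    rewrite Rmult_1_l. rewrite <- (sqrt_Rsqr r) at 1 by exact Hr. apply sqrt_le_1_alt. unfold Rsqr. nra. }
  set (x := r / sqrt (a * a + r * r)) in *.
  replace (0 / sqrt (a * a + 0 * 0)) with 0 by (unfold Rdiv; ring).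
  assert (0 < / a ^ 4) by (apply Rinv_0_lt_compat, pow_lt; exact Ha).
  assert (x - x ^ 3 / 3 <= 2 / 3).
  { assert (0 <= (1 - x) * (1 - x) * (2 + x)) by (apply Rmult_le_pos; nra). nra. }
  replace (/ a ^ 4 * (x - x ^ 3 / 3) - / a ^ 4 * (0 - 0 ^ 3 / 3)) with (/ a ^ 4 * (x - x ^ 3 / 3)) by (field; lra).
  nra.
Qed.

(** * The solution in the right half-plane *)

(* [phi = z^(1/2) (H + cP/z^4)] satisfies [phi'' + phi = alp + bep phi + gap phi^2]. The overlap of
   width [2 del] of [Dp] with its mirror image leaves room for the connection formula; [RR] and [Bp]
   are small enough for the outer region to reach the inner disc. *)
Definition del : R := 1 / 100.
Definition RR : R := 18 / 5.
Definition cP : R := 392 / 625.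

Definition Dp (z : C) : Prop := - del < Re z /\ RR < Cmod (z + RtoC del).

(** For [H = z^(-1/2) phi - cP z^(-4)] the forcing [- cP/z^4] cancels and leaves [16 cP z^(-6)],
    hence the exponent -11/2; the coefficient -1/4 in [bep] comes from removing the first
    derivative. One integration of the source gives the exponent -9/2 of the weight [wp]. *)
Definition alp (z : C) : C := (RtoC (16 * cP) * Cpower z (-11/2) + RtoC (- (cP * cP / 2)) * Cpower z (-15/2))%C.
Definition bep (z : C) : C := (RtoC (-1/4) * Cpower z (-2) + RtoC cP * Cpower z (-4))%C.
Definition gap (z : C) : C := (RtoC (-1/2) * Cpower z (-1/2))%C.
(** The modulus is measured from [- del]: on [Dp] the distance to that point increases along
    rightward half-lines, which fails for [Cmod z] in the strip left of the imaginary axis. *)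
Definition wp (z : C) : R := Rpower (Cmod (z + RtoC del)) (-9/2).

Lemma Dp_open : Copen Dp.
Proof.
apply (Copen_ext (fun z => - del < Re z /\ RR < Cmod (z - RtoC (- del)))).
- intros z. unfold Dp. replace (z - RtoC (- del))%C with (z + RtoC del)%C by (rewrite RtoC_opp; ring). reflexivity.
- apply Copen_and; [apply Copen_re_gt|apply Copen_mod_gt].
Qed.

Lemma shift_mod (z : C) (r : R) : - del < Re z -> 0 <= r ->
  Cmod (z + RtoC del) * Cmod (z + RtoC del) + r * r <= Cmod (z + RtoC r + RtoC del) * Cmod (z + RtoC r + RtoC del).
Proof.
intros Hz Hr.
replace (Cmod (z + RtoC del) * Cmod (z + RtoC del)) with (Cmod (z + RtoC del) ^ 2) by ring.
replace (Cmod (z + RtoC r + RtoC del) * Cmod (z + RtoC r + RtoC del)) with (Cmod (z + RtoC r + RtoC del) ^ 2) by ring.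
rewrite !Cmod2_alt.
replace (Re (z + RtoC del)) with (Re z + del) by Csimp. replace (Im (z + RtoC del)) with (Im z) by Csimp.
replace (Re (z + RtoC r + RtoC del)) with (Re z + r + del) by Csimp. replace (Im (z + RtoC r + RtoC del)) with (Im z) by Csimp.
nra.
Qed.

Lemma shift_sqrt (z : C) (r : R) : - del < Re z -> 0 <= r ->
  sqrt (Cmod (z + RtoC del) * Cmod (z + RtoC del) + r * r) <= Cmod (z + RtoC r + RtoC del).
Proof.
intros Hz Hr. rewrite <- (sqrt_Rsqr (Cmod (z + RtoC r + RtoC del))) by apply Cmod_ge_0.
apply sqrt_le_1_alt. unfold Rsqr. now apply shift_mod.
Qed.

Lemma Dp_stable : stable Dp 1.
Proof.
intros z r [H1 H2] Hr. replace (z + RtoC r * 1)%C with (z + RtoC r)%C by ring. split.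
- replace (Re (z + RtoC r)) with (Re z + r) by Csimp. lra.
- pose proof (shift_mod z r H1 Hr). pose proof (Cmod_ge_0 (z + RtoC r + RtoC del)). unfold RR in *. nra.
Qed.

Lemma Dp_mod (z : C) : Dp z -> Cmod (z + RtoC del) - del <= Cmod z.
Proof.
intros _. pose proof (Cmod_triangle z (RtoC del)) as H. rewrite (Cmod_RtoC_nonneg del) in H by (unfold del; lra). lra.
Qed.

Lemma Dp_slit (z : C) : Dp z -> slit z /\ 1 <= Cmod z.
Proof.
intros H. pose proof (Dp_mod z H) as H0. destruct H as [H1 H2]. unfold RR, del in *. split; [|lra].
destruct (Rlt_dec 0 (Re z)) as [Hp|Hp]; [now left|]. right. intros E.
pose proof (Cmod_le_re_im (z + RtoC (1 / 100))) as H.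
replace (Re (z + RtoC (1/100))) with (Re z + 1/100) in H by Csimp. replace (Im (z + RtoC (1/100))) with (Im z) in H by Csimp.
rewrite E, Rabs_R0 in H. rewrite Rabs_pos_eq in H by lra. lra.
Qed.

(** The quotient [(b - del) / b] is at least [1 - del/RR = 359/360], and (359/360)^(-8) < 1.023.
    This factor is the whole price of replacing [Cmod z] by the shifted modulus. *)
Lemma Rpower_shift (b t p : R) : RR <= b -> b - del <= t -> -8 <= p <= 0 ->
  Rpower t p <= 1023 / 1000 * Rpower b p.
Proof.
intros Hb Ht Hp. unfold RR, del in *.
eapply Rle_trans; [apply (Rpower_anti t (359/360 * b)); lra|].
unfold Rpower. rewrite ln_mult by lra. rewrite Rmult_plus_distr_l, exp_plus.
apply Rmult_le_compat_r; [left; apply exp_pos|].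
change (Rpower (359/360) p <= 1023/1000).
apply Rle_trans with (Rpower (359/360) (-8)).
- unfold Rpower. apply exp_le_compat. assert (ln (359/360) < 0) by (rewrite <- ln_1; apply ln_increasing; lra). nra.
- replace (-8) with (- INR 8) by (simpl; lra). rewrite Rpower_neg_nat by lra. lra.
Qed.

Lemma Rpower_RR (b : R) (n : nat) : RR <= b -> Rpower b (- INR n) <= / RR ^ n.
Proof.
intros Hb. unfold RR in *. rewrite Rpower_neg_nat by lra. apply Rinv_le_contravar; [apply pow_lt; lra|].
apply pow_incr. lra.
Qed.

Definition Bp : R := 15 / 2.

(** The source dominates: [16 cP] is about 10.04, and 111/10 collects the rest. Integration
    multiplies by 2/3, so 7.4 <= [Bp] makes the ball invariant and 2/3 <= [Bp / 10] gives the
    contraction factor 1/10. *)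
Lemma NBp_le (z : C) : Dp z ->
  NB alp bep gap wp Bp z <= 111 / 10 * Rpower (Cmod (z + RtoC del)) (-11/2) /\
  LB bep gap wp Bp z <= 1 * Rpower (Cmod (z + RtoC del)) (-11/2).
Proof.
intros Hz. pose proof (Dp_mod z Hz) as Hm. assert (HR : RR <= Cmod (z + RtoC del)) by (left; apply Hz).
set (b := Cmod (z + RtoC del)) in *. set (N := Rpower b (-11/2)).
assert (HN : 0 < N) by apply Rpower_pos.
assert (S : forall p, -8 <= p <= 0 -> Rpower (Cmod z) p <= 1023/1000 * Rpower b p) by (intros; now apply Rpower_shift).
assert (A1 : Cmod (Cpower z (-11/2)) <= 1023/1000 * N) by (rewrite Cmod_Cpower; apply S; lra).
assert (Q : forall n : nat, Rpower b (-11/2 - INR n) <= N * / RR ^ n).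
{ intros n. unfold Rminus. rewrite Rpower_plus. apply Rmult_le_compat_l; [left; exact HN|]. now apply Rpower_RR. }
assert (A2 : Cmod (Cpower z (-15/2)) <= 1023/1000 * (N * / RR ^ 2)).
{ rewrite Cmod_Cpower. eapply Rle_trans; [apply S; lra|]. apply Rmult_le_compat_l; [lra|].
  replace (-15/2) with (-11/2 - INR 2) by (simpl; lra). apply Q. }
assert (W : forall p (n : nat), -8 <= p <= 0 -> p + -9/2 = -11/2 - INR n ->
   Cmod (Cpower z p) * wp z <= 1023/1000 * (N * / RR ^ n)).
{ intros p n Hp E. rewrite Cmod_Cpower. unfold wp. fold b.
  apply Rle_trans with (1023/1000 * Rpower b p * Rpower b (-9/2)).
  - apply Rmult_le_compat_r; [left; apply Rpower_pos|now apply S].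
  - rewrite Rmult_assoc, <- Rpower_plus, E. apply Rmult_le_compat_l; [lra|apply Q]. }
assert (W2 := W (-2) 1%nat ltac:(lra) ltac:(simpl; lra)).
assert (W4 := W (-4) 3%nat ltac:(lra) ltac:(simpl; lra)).
assert (Wg : Cmod (Cpower z (-1/2)) * (wp z * wp z) <= 1023/1000 * (N * / RR ^ 4)).
{ rewrite Cmod_Cpower. unfold wp. fold b.
  apply Rle_trans with (1023/1000 * Rpower b (-1/2) * (Rpower b (-9/2) * Rpower b (-9/2))).
  - apply Rmult_le_compat_r; [pose proof (Rpower_pos b (-9/2)); nra|apply S; lra].
  - rewrite Rmult_assoc, <- !Rpower_plus. replace (-1/2 + (-9/2 + -9/2)) with (-11/2 - INR 4) by (simpl; lra).
    apply Rmult_le_compat_l; [lra|apply Q]. }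
assert (Bal : Cmod (alp z) <= 16 * cP * (1023/1000 * N) + cP * cP / 2 * (1023/1000 * (N * / RR ^ 2))).
{ unfold alp. eapply Rle_trans; [apply Cmod_triangle|]. rewrite !Cmod_mult, !Cmod_R.
  rewrite (Rabs_pos_eq (16 * cP)) by (unfold cP; lra). rewrite Rabs_Ropp, (Rabs_pos_eq (cP * cP / 2)) by (unfold cP; lra).
  apply Rplus_le_compat; apply Rmult_le_compat_l; auto; unfold cP; lra. }
assert (Hw : 0 < wp z) by apply Rpower_pos.
assert (Bbe : Cmod (bep z) * wp z <= 1/4 * (1023/1000 * (N * / RR ^ 1)) + cP * (1023/1000 * (N * / RR ^ 3))).
{ unfold bep. apply Rle_trans with ((1/4 * Cmod (Cpower z (-2)) + cP * Cmod (Cpower z (-4))) * wp z).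
  - apply Rmult_le_compat_r; [lra|]. eapply Rle_trans; [apply Cmod_triangle|]. rewrite !Cmod_mult, !Cmod_R.
    rewrite (Rabs_pos_eq cP) by (unfold cP; lra). replace (-1/4) with (-(1/4)) by lra. rewrite Rabs_Ropp, (Rabs_pos_eq (1/4)) by lra. lra.
  - rewrite Rmult_plus_distr_r, !Rmult_assoc. apply Rplus_le_compat; apply Rmult_le_compat_l; auto; unfold cP; lra. }
assert (Bga : Cmod (gap z) * (wp z * wp z) <= 1/2 * (1023/1000 * (N * / RR ^ 4))).
{ unfold gap. rewrite Cmod_mult, Cmod_R. replace (-1/2) with (-(1/2)) by lra. rewrite Rabs_Ropp, (Rabs_pos_eq (1/2)) by lra.
  rewrite Rmult_assoc. apply Rmult_le_compat_l; [lra|]. replace (- (1/2)) with (-1/2) by lra. exact Wg. }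
unfold NB, LB, Bp.
replace (Cmod (gap z) * (15 / 2 * wp z) ^ 2) with (225/4 * (Cmod (gap z) * (wp z * wp z))) by field.
replace (2 * Cmod (gap z) * (15 / 2 * wp z) ^ 2) with (225/2 * (Cmod (gap z) * (wp z * wp z))) by field.
replace (Cmod (bep z) * (15 / 2 * wp z)) with (15/2 * (Cmod (bep z) * wp z)) by field.
unfold RR, cP in *. split; lra.
Qed.

(** Half a power is monotone and taken out of the integral at its starting value; the remaining
    fifth power is what [dom_int_m5] integrates. *)
Lemma dom_int_wp (z : C) (k : R) (m : R -> R) : Dp z -> 0 <= k ->
  (forall r, 0 <= r -> m r <= k * Rpower (Cmod (z + RtoC r + RtoC del)) (-11/2)) ->
  dom_int m (2 / 3 * k * wp z).
Proof.
intros Hz Hk Hm. set (a := Cmod (z + RtoC del)).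
assert (Ha : 0 < a) by (destruct Hz; unfold RR, a in *; lra).
assert (E : wp z = Rpower a (-1/2) * / a ^ 4).
{ unfold wp. fold a. replace (-9/2) with (-1/2 + - INR 4) by (simpl; lra). rewrite Rpower_plus, Rpower_neg_nat by exact Ha. reflexivity. }
replace (2 / 3 * k * wp z) with (k * Rpower a (-1/2) * (2/3 * / a ^ 4)) by (rewrite E; ring).
eapply dom_int_le; [apply (dom_int_scal (k * Rpower a (-1/2))); [|apply (dom_int_m5 a Ha)]|intros r Hr|apply Rle_refl].
- apply Rmult_le_pos; [exact Hk|left; apply Rpower_pos].
- eapply Rle_trans; [now apply Hm|]. rewrite Rmult_assoc. apply Rmult_le_compat_l; [exact Hk|].
  assert (Hz1 : - del < Re z) by apply Hz.
  pose proof (shift_sqrt z r Hz1 Hr) as Hs. fold a in Hs.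
  set (b := Cmod (z + RtoC r + RtoC del)) in *.
  assert (Hs0 : 0 < sqrt (a * a + r * r)) by (apply sqrt_lt_R0; nra).
  assert (Hab : a <= b).
  { eapply Rle_trans; [|exact Hs]. rewrite <- (sqrt_Rsqr a) at 1 by lra. apply sqrt_le_1_alt. unfold Rsqr. nra. }
  replace (-11/2) with (-1/2 + - INR 5) by (simpl; lra). rewrite Rpower_plus, Rpower_neg_nat by lra.
  apply Rmult_le_compat.
  + left; apply Rpower_pos.
  + left; apply Rinv_0_lt_compat, pow_lt; lra.
  + apply Rpower_anti; lra.
  + apply Rinv_le_contravar; [now apply pow_lt|]. apply pow_incr; lra.
Qed.

Lemma tail_wp (z : C) (r k : R) : Dp z -> 0 <= r -> 0 <= k ->
  k * Rpower (Cmod (z + RtoC r + RtoC del)) (-11/2) <= (2 * k) / (1 + r) ^ 2.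
Proof.
intros Hz Hr Hk. assert (Hz1 : - del < Re z) by apply Hz.
pose proof (shift_mod z r Hz1 Hr) as Hs. destruct Hz as [_ Ha]. unfold RR in Ha.
set (b := Cmod (z + RtoC r + RtoC del)) in *. set (a := Cmod (z + RtoC del)) in *.
assert (Hb : 1 <= b) by (assert (0 <= b) by apply Cmod_ge_0; nra).
apply Rle_trans with (k * / b ^ 2).
- apply Rmult_le_compat_l; [exact Hk|]. rewrite <- (Rpower_neg_nat b 2) by lra.
  unfold Rpower. apply exp_le_compat. assert (0 <= ln b) by (rewrite <- ln_1; apply ln_le; lra). simpl. nra.
- unfold Rdiv. rewrite (Rmult_comm 2), Rmult_assoc. apply Rmult_le_compat_l; [exact Hk|].
  apply (Rmult_le_reg_r (b ^ 2 * (1 + r) ^ 2)); [apply Rmult_lt_0_compat; apply pow_lt; lra|].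
  replace (/ b ^ 2 * (b ^ 2 * (1 + r) ^ 2)) with ((1 + r) ^ 2) by (field; lra).
  replace (2 * / (1 + r) ^ 2 * (b ^ 2 * (1 + r) ^ 2)) with (2 * b ^ 2) by (field; lra). assert (1 <= a * a) by nra. pose proof (Rle_0_sqr (1 - r)) as Hq. unfold Rsqr in Hq. simpl. lra.
Qed.

Lemma z_r1 (z : C) (r : R) : (z + RtoC r * 1)%C = (z + RtoC r)%C.
Proof. ring. Qed.

Lemma dom_NBp (z : C) : Dp z -> dom_int (fun r => NB alp bep gap wp Bp (z + RtoC r * 1)%C) (Bp * wp z).
Proof.
intros Hz. eapply dom_int_le; [apply (dom_int_wp z (111/10) (fun r => NB alp bep gap wp Bp (z + RtoC r * 1)%C) Hz); [lra|]|intros; apply Rle_refl|].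
- intros r Hr. rewrite z_r1. apply NBp_le. rewrite <- (z_r1 z r). now apply Dp_stable.
- assert (0 < wp z) by apply Rpower_pos. unfold Bp. nra.
Qed.

Lemma contr_p : contr Dp 1 sin alp bep gap wp Bp (1 / 10) (222 / 10) 1 0.
Proof.
assert (HP : forall p, p <= 0 -> hol2 Dp (fun z => Cpower z p)) by (intros; apply hol2_Cpower; auto using Dp_slit).
assert (Hsin : forall r, 0 <= Rabs (sin r) <= 1).
{ intros r. split; [apply Rabs_pos|]. apply Rabs_le. pose proof (SIN_bound r). lra. }
assert (PN : forall z, 0 <= NB alp bep gap wp Bp z /\ 0 <= LB bep gap wp Bp z).
{ intros z. assert (0 < wp z) by apply Rpower_pos. assert (0 < Bp) by (unfold Bp; lra).
  pose proof (Cmod_ge_0 (alp z)). pose proof (Cmod_ge_0 (bep z)). pose proof (Cmod_ge_0 (gap z)).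
  assert (0 < Bp * wp z) by nra. unfold NB, LB. split; repeat apply Rplus_le_le_0_compat; repeat apply Rmult_le_pos; try lra. }
split.
- apply Dp_open.
- apply Dp_stable.
- apply Cmod_1.
- apply hol2_plus; apply hol2_mult; try apply hol2_const; apply HP; lra.
- apply hol2_plus; apply hol2_mult; try apply hol2_const; apply HP; lra.
- apply hol2_mult; try apply hol2_const; apply HP; lra.
- unfold Bp; lra.
- intros z Hz. split; [left; apply Rpower_pos|]. apply Rpower_le_1; [|lra]. destruct Hz. unfold RR in *. lra.
- lra.
- intros z Hz. rewrite Cmod_0, Rminus_0_r. eapply dom_int_le; [apply (dom_NBp z Hz)| |apply Rle_refl].
  intros r Hr. cbv beta. destruct (PN (z + RtoC r * 1)%C). specialize (Hsin r). nra.
- intros z Hz. eapply dom_int_le; [apply (dom_int_wp z 1 (fun r => Rabs (sin r) * LB bep gap wp Bp (z + RtoC r * 1)%C) Hz); [lra|]|intros; apply Rle_refl|].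
  + intros r Hr. destruct (PN (z + RtoC r * 1)%C). specialize (Hsin r). rewrite <- (z_r1 z r).
    destruct (NBp_le (z + RtoC r * 1)%C) as [_ HL]; [now apply Dp_stable|]. nra.
  + assert (0 < wp z) by apply Rpower_pos. unfold Bp. nra.
- intros z r Hz Hr. eapply Rle_trans; [apply NBp_le; now apply Dp_stable|]. rewrite z_r1.
  eapply Rle_trans; [apply (tail_wp z r (111/10)); auto; lra|]. apply Req_le. field. lra.
- intros z r Hz Hr. eapply Rle_trans; [apply NBp_le; now apply Dp_stable|]. rewrite z_r1.
  pose proof (Rpower_pos (Cmod (z + RtoC r + RtoC del)) (-11/2)).
  eapply Rle_trans; [|eapply Rle_trans; [apply (tail_wp z r (111/10)); auto; lra|]]; [lra|]. apply Req_le. field. lra.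
Qed.

Lemma phi_plus_exists : exists phi phi1 phi2 : C -> C, hol2 Dp phi /\ forall z, Dp z ->
  Cd phi z (phi1 z) /\ Cd phi1 z (phi2 z) /\
  (phi2 z = G alp bep gap phi z - phi z)%C /\
  Cmod (phi z) <= Bp * wp z /\ Cmod (phi1 z) <= Bp * wp z.
Proof.
destruct (fixsol_exists Dp 1 sin cos (fun r => - sin r) 1 0 (-1) alp bep gap wp Bp (1/10) (222/10) 1 0 kernel_sin contr_p) as [phi Hphi].
destruct (fixsol_ode Dp 1 sin cos (fun r => - sin r) 1 0 (-1) alp bep gap wp Bp (1/10) (222/10) 1 0 kernel_sin contr_p phi Hphi) as [p1 [p2 H]].
exists phi, p1, p2. split; [apply Hphi|]. intros z Hz. destruct (H z Hz) as [H1 [H2 [H3 [H4 [H5 H6]]]]].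
split; [exact H1|]. split; [exact H2|]. split; [|split; [exact H4|apply H6; now apply dom_NBp]].
replace (p2 z) with (1 * 1 * p2 z)%C by ring. rewrite H3.
replace (RtoC (-1)) with (- (1))%C by (apply Ceq; Csimp). ring.
Qed.

Lemma Cpow_nat (z : C) (n : nat) : z <> RtoC 0 -> Cpower z (INR n) = (z ^ n)%C.
Proof.
intros Hz. induction n; [apply Cpower_0|].
rewrite S_INR, Cpower_add, IHn, Cpower_1 by exact Hz. simpl. ring.
Qed.

Lemma Cpower_sub_nat (z : C) (a : R) (n : nat) : z <> RtoC 0 -> Cpower z (a - INR n) = (Cpower z a / z ^ n)%C.
Proof.
intros Hz. replace (Cpower z a) with (Cpower z (a - INR n) * Cpower z (INR n))%C.
- rewrite Cpow_nat by exact Hz. field. apply Cpow_nz. exact Hz.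
- rewrite <- Cpower_add. f_equal. ring.
Qed.

Definition rs (z : C) : C := Cpower z (-1/2).

Lemma rs_neq_0 (z : C) : rs z <> RtoC 0.
Proof. apply Cpower_neq_0. Qed.

(** With this substitution every expression becomes rational in [rs z], so that identities mixing
    half-integer powers come within reach of [field]. *)
Lemma rs_inv (z : C) : z <> RtoC 0 -> z = (/ (rs z * rs z))%C.
Proof.
intros Hz. unfold rs. rewrite <- Cpower_add. replace (-1/2 + -1/2) with (0 - INR 1) by (simpl; lra).
rewrite Cpower_sub_nat, Cpower_0 by exact Hz. simpl. field. exact Hz.
Qed.

Lemma Cd_rs (z : C) : slit z -> Cd rs z (RtoC (-1/2) * rs z / z)%C.
Proof.
intros Hz. eapply Cd_eq; [|apply Cd_Cpower, Hz].
replace (-1/2 - 1) with (-1/2 - INR 1) by (simpl; lra).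
rewrite Cpower_sub_nat by now apply slit_neq_0. unfold rs. simpl. field. now apply slit_neq_0.
Qed.

Lemma Cd_inv4 (z : C) : z <> RtoC 0 -> Cd (fun w => / (w * w * w * w))%C z (- (4) / (z * z * z * z * z))%C.
Proof.
intros Hz. eapply Cd_eq; [|apply (Cd_inv (fun w => w * w * w * w)%C)].
3: { apply Cd_mult; [apply Cd_mult; [apply Cd_mult|]|]; apply Cd_id. }
- simpl. field. exact Hz.
- repeat apply Cmult_neq_0; exact Hz.
Qed.

Lemma Cd_inv5 (z : C) : z <> RtoC 0 -> Cd (fun w => / (w * w * w * w * w))%C z (- (5) / (z * z * z * z * z * z))%C.
Proof.
intros Hz. eapply Cd_eq; [|apply (Cd_inv (fun w => w * w * w * w * w)%C)].
3: { apply Cd_mult; [apply Cd_mult; [apply Cd_mult; [apply Cd_mult|]|]|]; apply Cd_id. }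
- simpl. field. exact Hz.
- repeat apply Cmult_neq_0; exact Hz.
Qed.

Definition Hode (D : C -> Prop) (H H1 H2 : C -> C) : Prop := forall z, D z ->
  Cd H z (H1 z) /\ Cd H1 z (H2 z) /\
  (H2 z + H1 z / z + H z = - (H z * H z) / 2 - RtoC cP / (z * z * z * z))%C.

Definition Hsol (D : C -> Prop) (H : C -> C) : Prop := exists H1 H2, Hode D H H1 H2.

Lemma RtoC_half (x : R) : RtoC (x / 2) = (RtoC x / 2)%C.
Proof. now rewrite RtoC_div by lra. Qed.

Lemma alp_rs (z : C) : z <> RtoC 0 -> alp z = (16 * RtoC cP * rs z / z ^ 5 - RtoC cP * RtoC cP / 2 * rs z / z ^ 7)%C.
Proof.
intros Hz. unfold alp. replace (-11/2) with (-1/2 - INR 5) by (simpl; lra). replace (-15/2) with (-1/2 - INR 7) by (simpl; lra).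
rewrite !Cpower_sub_nat by exact Hz. fold (rs z). rewrite RtoC_opp, RtoC_half, !RtoC_mult. simpl. field. exact Hz.
Qed.
Lemma bep_rs (z : C) : z <> RtoC 0 -> bep z = (- / 4 / z ^ 2 + RtoC cP / z ^ 4)%C.
Proof.
intros Hz. unfold bep. replace (-2) with (0 - INR 2) by (simpl; lra). replace (-4) with (0 - INR 4) by (simpl; lra).
rewrite !Cpower_sub_nat, Cpower_0 by exact Hz.
replace (RtoC (-1/4)) with (- / 4)%C by (rewrite RtoC_div by lra; replace (RtoC (-1)) with (- (1))%C by (apply Ceq; Csimp); field).
simpl. field. exact Hz.
Qed.
Lemma gap_rs (z : C) : gap z = (- / 2 * rs z)%C.
Proof.
unfold gap. fold (rs z). f_equal. rewrite RtoC_div by lra. replace (RtoC (-1)) with (- (1))%C by (apply Ceq; Csimp). field.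
Qed.
Lemma RtoC_mhalf : RtoC (-1/2) = (- / 2)%C.
Proof. rewrite RtoC_div by lra. replace (RtoC (-1)) with (- (1))%C by (apply Ceq; Csimp). field. Qed.

Lemma H_plus_exists : exists H H1 H2 phi phi1 : C -> C, Hode Dp H H1 H2 /\ hol2 Dp H /\
  forall z, Dp z -> H z = (rs z * phi z - RtoC cP * / (z * z * z * z))%C /\
    H1 z = (rs z * (phi1 z - phi z / (2 * z)) + 4 * RtoC cP / (z * z * z * z * z))%C /\
    Cmod (phi z) <= Bp * wp z /\ Cmod (phi1 z) <= Bp * wp z.
Proof.
destruct phi_plus_exists as [phi [phi1 [phi2 [Hh HP]]]].
exists (fun z => rs z * phi z - RtoC cP * / (z * z * z * z))%C,
 (fun z => rs z * (phi1 z - phi z / (2 * z)) + 4 * RtoC cP * / (z * z * z * z * z))%C,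
 (fun z => rs z * (phi2 z - phi1 z / z + 3 * phi z / (4 * z * z)) - 20 * RtoC cP / (z * z * z * z * z * z))%C, phi, phi1.
split; [|split].
- intros z Hz. destruct (HP z Hz) as [A1 [A2 [A3 _]]]. destruct (Dp_slit z Hz) as [Hs _].
  assert (Hn := slit_neq_0 z Hs).
  split; [|split].
  + eapply Cd_eq; [|apply Cd_minus; [apply Cd_mult; [apply Cd_rs, Hs|exact A1]|apply Cd_scal, Cd_inv4, Hn]].
    simpl. rewrite RtoC_mhalf. field. exact Hn.
  + eapply Cd_eq; [|apply Cd_plus; [apply Cd_mult; [apply Cd_rs, Hs|apply Cd_minus; [exact A2|]]|apply Cd_scal, Cd_inv5, Hn]].
    2: { apply Cd_mult; [exact A1|]. apply (Cd_inv (fun z => 2 * z)%C); [|apply Cd_scal, Cd_id].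
         apply Cmult_neq_0; [|exact Hn]. intros E. apply RtoC_inj in E. lra. }
    simpl. rewrite RtoC_mhalf. field. exact Hn.
  + rewrite A3. unfold G. rewrite alp_rs, bep_rs, gap_rs by exact Hn.
    assert (Hr := rs_neq_0 z). assert (Hp := rs_inv z Hn). revert Hr Hp.
    generalize (rs z), (phi z), (phi1 z). intros p a b Hr Hp. rewrite Hp.
    field. exact Hr.
- apply hol2_plus.
  + apply hol2_mult; [|exact Hh]. apply hol2_Cpower; [lra|]. apply Dp_slit.
  + destruct (hol2_mult Dp (fun _ => - RtoC cP)%C (fun z => Cpower z (-4)) (hol2_const _ _)) as [f1 [f2 [M HM]]].
    { apply hol2_Cpower; [lra|]. apply Dp_slit. }
    exists f1, f2, M. intros z Hz. destruct (HM z Hz) as [B1 [B2 [B3 B4]]].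
    assert (E : forall w, Dp w -> (- RtoC cP * Cpower w (-4) = - (RtoC cP * / (w * w * w * w)))%C).
    { intros w Hw. assert (Hn := slit_neq_0 w (proj1 (Dp_slit w Hw))). replace (-4) with (0 - INR 4) by (simpl; lra).
      rewrite Cpower_sub_nat, Cpower_0 by exact Hn. simpl. field. exact Hn. }
    split; [|split; [exact B2|split; [now rewrite <- E|exact B4]]].
    destruct (Dp_open z Hz) as [r [Hr Hb]]. apply (Cd_ext_loc (fun w => - RtoC cP * Cpower w (-4))%C _ z _ r Hr); [|exact B1].
    intros w Hw. apply E. now apply Hb.
- intros z Hz. destruct (HP z Hz) as [_ [_ [_ [B1 B2]]]]. split; [reflexivity|]. split; [reflexivity|]. now split.
Qed.

(** * Continuation to the left half-plane *)

(** Reflection in the imaginary axis. The equation has real coefficients and is invariant under a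
    change of sign of the variable, so [mirf] sends solutions to solutions; it preserves holomorphy
    because two conjugations are involved. *)
Definition mir (z : C) : C := (- Cconj z)%C.
Definition mirf (f : C -> C) (z : C) : C := Cconj (f (mir z)).

Lemma Cconj_minus (a b : C) : Cconj (a - b) = (Cconj a - Cconj b)%C.
Proof. apply Ceq; unfold Cconj; Csimp. Qed.

Lemma Cd_conj (f : C -> C) (z l : C) : Cd f (Cconj z) l -> Cd (fun w => Cconj (f (Cconj w))) z (Cconj l).
Proof.
intros H eps He. destruct (H eps He) as [d [Hd K]]. exists d. split; [exact Hd|].
intros w Hw. rewrite <- (Cmod_conj (w - z)), Cconj_minus in *. specialize (K (Cconj w) Hw).
eapply Rle_trans; [|exact K]. apply Req_le. rewrite <- Cmod_conj. f_equal. apply Ceq; unfold Cconj; Csimp.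
Qed.

Lemma Cd_mirf (f : C -> C) (z l : C) : Cd f (mir z) l -> Cd (mirf f) z (- Cconj l)%C.
Proof.
intros H. apply (Cd_ext (fun w => Cconj ((fun x => f (- x)%C) (Cconj w)))); [reflexivity|].
eapply Cd_eq; [|apply (Cd_conj (fun x => f (- x)%C) z (l * - (1)))].
- apply Ceq; unfold Cconj; Csimp.
- apply (Cd_comp f (fun x => - x)%C); [|exact H]. apply Cd_opp, Cd_id.
Qed.

Lemma Cconj_plus (a b : C) : Cconj (a + b) = (Cconj a + Cconj b)%C.
Proof. apply Ceq; unfold Cconj; Csimp. Qed.
Lemma Cconj_mult (a b : C) : Cconj (a * b) = (Cconj a * Cconj b)%C.
Proof. apply Ceq; unfold Cconj; Csimp. Qed.
Lemma Cconj_opp (a : C) : Cconj (- a) = (- Cconj a)%C.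
Proof. apply Ceq; unfold Cconj; Csimp. Qed.
Lemma Cconj_R (a : R) : Cconj (RtoC a) = RtoC a.
Proof. apply Ceq; unfold Cconj; Csimp. Qed.
Lemma Cconj_inv (a : C) : a <> RtoC 0 -> Cconj (/ a) = (/ Cconj a)%C.
Proof.
intros Ha. assert (Hc : Cconj a <> RtoC 0). { apply Cmod_gt_0. rewrite Cmod_conj. now apply Cmod_gt_0. }
replace (Cconj (/ a)) with (Cconj (/ a) * Cconj a * / Cconj a)%C by (field; exact Hc).
rewrite <- Cconj_mult. replace (/ a * a)%C with (RtoC 1) by (field; exact Ha). rewrite Cconj_R. ring.
Qed.

Lemma Hode_conj (D : C -> Prop) (H H1 H2 : C -> C) : (forall z, D z -> z <> RtoC 0) -> Hode D H H1 H2 ->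
  Hode (fun z => D (Cconj z)) (fun z => Cconj (H (Cconj z))) (fun z => Cconj (H1 (Cconj z))) (fun z => Cconj (H2 (Cconj z))).
Proof.
intros HD HH z Hz. destruct (HH _ Hz) as [A1 [A2 A3]]. split; [now apply Cd_conj|]. split; [now apply Cd_conj|].
assert (Hn := HD _ Hz). assert (Hn0 : z <> RtoC 0).
{ intros E. apply Hn. rewrite E. apply Cconj_R. }
apply (f_equal Cconj) in A3. unfold Cdiv, Cminus in *.
rewrite !Cconj_plus, !Cconj_mult, !Cconj_opp, !Cconj_mult, !Cconj_inv in A3.
2: repeat apply Cmult_neq_0; exact Hn. 2: intros E; apply RtoC_inj in E; lra. 2: exact Hn.
rewrite !Cconj_mult, !Cconj_R, !Cconj_conj in A3. exact A3.
Qed.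

Lemma Hode_opp (D : C -> Prop) (H H1 H2 : C -> C) : (forall z, D z -> z <> RtoC 0) -> Hode D H H1 H2 ->
  Hode (fun z => D (- z)%C) (fun z => H (- z)%C) (fun z => - H1 (- z))%C (fun z => H2 (- z)%C).
Proof.
intros HD HH z Hz. destruct (HH _ Hz) as [A1 [A2 A3]]. assert (Hn := HD _ Hz).
assert (Hn0 : z <> RtoC 0). { intros E. apply Hn. rewrite E. ring. }
split; [|split].
- eapply Cd_eq; [|apply (Cd_comp H (fun x => - x)%C); [apply Cd_opp, Cd_id|exact A1]]. ring.
- eapply Cd_eq; [|apply Cd_opp, (Cd_comp H1 (fun x => - x)%C); [apply Cd_opp, Cd_id|exact A2]]. ring.
- replace (- H1 (- z) / z)%C with (H1 (- z) / - z)%C by (field; try exact Hn0; split; exact Hn0 || exact Hn).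
  rewrite A3. field. try exact Hn0; split; exact Hn0 || exact Hn.
Qed.

Lemma Hode_mir (D : C -> Prop) (H H1 H2 : C -> C) : (forall z, D z -> z <> RtoC 0) -> Hode D H H1 H2 ->
  Hode (fun z => D (mir z)) (mirf H) (fun z => - mirf H1 z)%C (mirf H2).
Proof.
intros HD HH.
assert (HD2 : forall z, D (- z)%C -> z <> RtoC 0).
{ intros z Hz E. apply (HD _ Hz). rewrite E. ring. }
assert (K := Hode_conj _ _ _ _ HD2 (Hode_opp D H H1 H2 HD HH)).
cbv beta in K. intros z Hz. destruct (K z Hz) as [A1 [A2 A3]].
split; [exact A1|]. unfold mirf at 1. unfold mir.
split.
- eapply Cd_ext; [|exact A2]. intros w. unfold mirf, mir. apply Cconj_opp.
- rewrite Cconj_opp in A3. exact A3.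
Qed.

Lemma hol2_mir (D : C -> Prop) (f : C -> C) : hol2 D f -> hol2 (fun z => D (mir z)) (mirf f).
Proof.
intros [f1 [f2 [M HM]]]. exists (fun z => - mirf f1 z)%C, (mirf f2), M. intros z Hz.
destruct (HM _ Hz) as [A1 [A2 [A3 [A4 A5]]]]. split; [now apply Cd_mirf|]. split.
- eapply Cd_eq; [|apply Cd_opp, Cd_mirf; exact A2]. unfold mirf. ring.
- rewrite Cmod_opp. unfold mirf. rewrite !Cmod_conj. auto.
Qed.

Lemma hol2_conj (D : C -> Prop) (f : C -> C) : hol2 D f -> hol2 (fun z => D (Cconj z)) (fun z => Cconj (f (Cconj z))).
Proof.
intros [f1 [f2 [M HM]]]. exists (fun z => Cconj (f1 (Cconj z))), (fun z => Cconj (f2 (Cconj z))), M. intros z Hz.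
destruct (HM _ Hz) as [A1 [A2 A3]]. rewrite !Cmod_conj. split; [now apply Cd_conj|]. split; [now apply Cd_conj|exact A3].
Qed.

Lemma Cd_unique (f : C -> C) (z a b : C) : Cd f z a -> Cd f z b -> a = b.
Proof.
intros Ha Hb. destruct (excluded_middle_informative (a = b)) as [Heq|Hne]; [exact Heq|exfalso].
assert (Hp : 0 < Cmod (a - b)).
{ apply Cmod_gt_0. intros E. apply Hne. replace a with (a - b + b)%C by ring. rewrite E. ring. }
destruct (Ha (Cmod (a - b) / 4)) as [d1 [Hd1 H1]]; [lra|].
destruct (Hb (Cmod (a - b) / 4)) as [d2 [Hd2 H2]]; [lra|].
set (t := Rmin d1 d2 / 2). assert (Ht : 0 < t) by (unfold t; pose proof (Rmin_pos d1 d2 Hd1 Hd2); lra).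
assert (E : Cmod (z + RtoC t - z) = t).
{ replace (z + RtoC t - z)%C with (RtoC t) by ring. apply Cmod_RtoC_nonneg. lra. }
pose proof (Rmin_l d1 d2). pose proof (Rmin_r d1 d2).
specialize (H1 (z + RtoC t)%C). specialize (H2 (z + RtoC t)%C). rewrite E in H1, H2.
specialize (H1 ltac:(unfold t in *; lra)). specialize (H2 ltac:(unfold t in *; lra)).
assert (K : Cmod ((a - b) * RtoC t) <= Cmod (a - b) / 4 * t + Cmod (a - b) / 4 * t).
{ replace ((a - b) * RtoC t)%C with
   ((f (z + RtoC t)%C - f z - b * (z + RtoC t - z)) - (f (z + RtoC t)%C - f z - a * (z + RtoC t - z)))%C by ring.
  eapply Rle_trans; [apply Cmod_tri_minus|]. lra. }
rewrite Cmod_mult, Cmod_RtoC_nonneg in K by lra. nra.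
Qed.

Lemma contr_sub (D E : C -> Prop) (e : C) (K : R -> R) (al be ga : C -> C) (w : C -> R) (B q0 A Wb : R) (C0 : C) :
  contr D e K al be ga w B q0 A Wb C0 -> Copen E -> stable E e -> (forall z, E z -> D z) ->
  contr E e K al be ga w B q0 A Wb C0.
Proof.
intros [] HE Hs Hsub. split; auto; try (eapply hol2_sub; eassumption).
Qed.

Lemma fixsol_sub (D E : C -> Prop) (e : C) (K : R -> R) (al be ga : C -> C) (w : C -> R) (B : R) (C0 : C) (phi : C -> C) :
  fixsol D e K al be ga w B C0 phi -> (forall z, E z -> D z) -> fixsol E e K al be ga w B C0 phi.
Proof.
intros [[H1 H2] H3] Hs. split; [|auto]. split; [|auto]. eapply hol2_sub; eassumption.
Qed.

Lemma dom_int_sq (y : R) : 0 < y -> dom_int (fun r => / (y + r) ^ 2) (/ y).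
Proof.
intros Hy. exists (fun r => - / (y + r)), (fun r => / (y + r) ^ 2). split; [|split].
- intros r Hr. auto_derive; [lra|]. field. lra.
- intros; lra.
- intros r Hr. assert (0 < / (y + r)) by (apply Rinv_0_lt_compat; lra). rewrite Rplus_0_r. lra.
Qed.

(** In terms of [x = exp (- r)] the primitive is [- x/2 + x^3/6], and 1/3 is the exact value of the
    integral. *)
Lemma dom_int_kexp : dom_int (fun r => (1 - exp (- (2 * r))) / 2 * exp (- r)) (1 / 3).
Proof.
exists (fun r => - exp (- r) / 2 + exp (- (3 * r)) / 6), (fun r => (1 - exp (- (2 * r))) / 2 * exp (- r)). split; [|split].
- intros r Hr. auto_derive; [auto|]. replace (exp (- (3 * r))) with (exp (- (2 * r)) * exp (- r)) by (rewrite <- exp_plus; f_equal; ring). field.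
- intros; lra.
- intros r Hr. rewrite Rmult_0_r, Ropp_0, exp_0.
  replace (- (3 * r)) with (- r + (- r + - r)) by ring. rewrite !exp_plus.
  assert (0 < exp (- r) <= 1). { split; [apply exp_pos|]. rewrite <- exp_0. apply exp_le_compat. lra. }
  set (x := exp (- r)) in *. assert (x * (x * x) <= 1 * x) by nra. lra.
Qed.

Lemma exp_neg_sq (r : R) : 0 <= r -> exp (- r) <= 4 / (1 + r) ^ 2.
Proof.
intros Hr. assert (H : 1 + r / 2 <= exp (r / 2)) by (pose proof (exp_ineq1_le (r / 2)); lra).
assert (E : exp r = exp (r / 2) * exp (r / 2)) by (rewrite <- exp_plus; f_equal; field).
rewrite exp_Ropp. unfold Rdiv.
apply (Rmult_le_reg_r (exp r * (1 + r) ^ 2)); [apply Rmult_lt_0_compat; [apply exp_pos|apply pow_lt; lra]|].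
replace (/ exp r * (exp r * (1 + r) ^ 2)) with ((1 + r) ^ 2) by (field; apply Rgt_not_eq, exp_pos).
replace (4 * / (1 + r) ^ 2 * (exp r * (1 + r) ^ 2)) with (4 * exp r) by (field; lra).
rewrite E. nra.
Qed.

(* Kernel for [v'' + 2 i v' = ...] integrated in the direction [Ci]: [u = exp(i z) v] is the
   recessive branch. *)
Definition Kx (r : R) : R := (1 - exp (- (2 * r))) / 2.

Lemma Kx_bound (r : R) : 0 <= r -> 0 <= Kx r <= 1 / 2.
Proof.
intros Hr. unfold Kx. assert (0 < exp (- (2 * r)) <= 1); [|lra].
split; [apply exp_pos|]. rewrite <- exp_0. apply exp_le_compat. lra.
Qed.

(** The strip around the upper imaginary axis where [H] and its mirror image are both known; it is
    closed under upward translation. [Qd] is the region on the left to be reached, measured from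
    [del] since [mir] exchanges [del] and [- del]. *)
Definition Sd (z : C) : Prop := (- del < Re z /\ Re z < del) /\ RR < Im z.
Definition Qd (z : C) : Prop := (Re z < del /\ 0 < Im z) /\ RR < Cmod (z - RtoC del).

Lemma Sd_open : Copen Sd.
Proof. repeat apply Copen_and; [apply Copen_re_gt|apply Copen_re_lt|apply Copen_im_gt]. Qed.
Lemma Qd_open : Copen Qd.
Proof. repeat apply Copen_and; [apply Copen_re_lt|apply Copen_im_gt|apply Copen_mod_gt]. Qed.

Lemma re_zri (z : C) (r : R) : Re (z + RtoC r * Ci) = Re z.
Proof. unfold Ci; Csimp. Qed.
Lemma im_zri (z : C) (r : R) : Im (z + RtoC r * Ci) = Im z + r.
Proof. unfold Ci; Csimp. Qed.

Lemma Sd_stable : stable Sd Ci.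
Proof. intros z r [[H1 H2] H3] Hr. unfold Sd. rewrite re_zri, im_zri. repeat split; lra. Qed.

Lemma shift_i (z : C) (r : R) : 0 < Im z -> 0 <= r ->
  Cmod (z - RtoC del) * Cmod (z - RtoC del) + r * r <= Cmod (z + RtoC r * Ci - RtoC del) * Cmod (z + RtoC r * Ci - RtoC del).
Proof.
intros Hz Hr.
replace (Cmod (z - RtoC del) * Cmod (z - RtoC del)) with (Cmod (z - RtoC del) ^ 2) by ring.
replace (Cmod (z + RtoC r * Ci - RtoC del) * Cmod (z + RtoC r * Ci - RtoC del)) with (Cmod (z + RtoC r * Ci - RtoC del) ^ 2) by ring.
rewrite !Cmod2_alt.
replace (Re (z - RtoC del)) with (Re z - del) by Csimp. replace (Im (z - RtoC del)) with (Im z) by Csimp.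
replace (Re (z + RtoC r * Ci - RtoC del)) with (Re z - del) by (unfold Ci; Csimp).
replace (Im (z + RtoC r * Ci - RtoC del)) with (Im z + r) by (unfold Ci; Csimp). nra.
Qed.

Lemma Qd_stable : stable Qd Ci.
Proof.
intros z r [[H1 H2] H3] Hr. unfold Qd. rewrite re_zri, im_zri. repeat split; try lra.
pose proof (shift_i z r H2 Hr). pose proof (Cmod_ge_0 (z + RtoC r * Ci - RtoC del)). unfold RR in *. nra.
Qed.

Lemma mir_shift (z : C) : Cmod (mir z + RtoC del) = Cmod (z - RtoC del).
Proof.
rewrite <- Cmod_opp, <- Cmod_conj. f_equal. apply Ceq; unfold mir, Cconj; Csimp.
Qed.

Lemma im_le_shift (z : C) (t : R) : Im z <= Cmod (z + RtoC t).
Proof.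
pose proof (im_le_Cmod (z + RtoC t)) as H. replace (Im (z + RtoC t)) with (Im z) in H by Csimp.
pose proof (Rle_abs (Im z)). lra.
Qed.

Lemma Dp_mir (z : C) : Re z < del -> RR < Cmod (z - RtoC del) -> Dp (mir z).
Proof.
intros H1 H2. split; [|now rewrite mir_shift]. replace (Re (mir z)) with (- Re z) by (unfold mir, Cconj; Csimp). lra.
Qed.

Lemma Qd_mir (z : C) : Qd z -> Dp (mir z).
Proof. intros [[H1 H2] H3]. now apply Dp_mir. Qed.

Lemma Sd_Qd (z : C) : Sd z -> Qd z.
Proof.
intros [[H1 H2] H3]. unfold Qd. pose proof (im_le_shift z (- del)) as H. rewrite RtoC_opp in H.
change (z + - RtoC del)%C with (z - RtoC del)%C in H. unfold RR in *. repeat split; lra.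
Qed.

Lemma Sd_Dp (z : C) : Sd z -> Dp z.
Proof. intros [[H1 H2] H3]. split; [exact H1|]. pose proof (im_le_shift z del). lra. Qed.

Lemma Cmod_mir (z : C) : Cmod (mir z) = Cmod z.
Proof. unfold mir. now rewrite Cmod_opp, Cmod_conj. Qed.

Lemma Qd_slit (z : C) : Qd z -> slit z /\ 1 <= Cmod z.
Proof.
intros H. split; [right; destruct H as [[H1 H2] H3]; lra|]. rewrite <- Cmod_mir. now apply Dp_slit, Qd_mir.
Qed.

Definition decayH (H : C -> C) : Prop := forall z, Dp z ->
  Cmod (H z + RtoC cP * / (z * z * z * z)) <= Rpower (Cmod z) (-1/2) * (Bp * wp z).

Lemma Cmod_inv4 (z : C) : z <> RtoC 0 -> Cmod (/ (z * z * z * z)) = Rpower (Cmod z) (-4).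
Proof.
intros Hz. assert (0 < Cmod z) by now apply Cmod_gt_0.
replace (-4) with (- INR 4) by (simpl; lra). rewrite Rpower_neg_nat by assumption.
rewrite Cmod_inv, !Cmod_mult by (repeat apply Cmult_neq_0; exact Hz). f_equal. simpl. ring.
Qed.

Lemma decayH_bound (H : C -> C) (z : C) : decayH H -> Dp z ->
  Cmod (H z) <= 1023/1000 * (15/2 * / Cmod (z + RtoC del) ^ 5 + cP * / Cmod (z + RtoC del) ^ 4).
Proof.
intros HH Hz. specialize (HH z Hz). assert (Hn := slit_neq_0 z (proj1 (Dp_slit z Hz))).
pose proof (Dp_mod z Hz) as Hm. assert (HR : RR <= Cmod (z + RtoC del)) by (left; apply Hz). unfold wp, Bp in HH.
set (b := Cmod (z + RtoC del)) in *. assert (Hb : 0 < b) by (unfold RR in *; lra).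
replace (H z) with ((H z + RtoC cP * / (z * z * z * z)) - RtoC cP * / (z * z * z * z))%C by ring.
eapply Rle_trans; [apply Cmod_tri_minus|]. rewrite Cmod_mult, Cmod_inv4, Cmod_RtoC_nonneg by (exact Hn || (unfold cP; lra)).
assert (H4 := Rpower_shift b (Cmod z) (-4) HR Hm ltac:(lra)). assert (H1 := Rpower_shift b (Cmod z) (-1/2) HR Hm ltac:(lra)).
replace (-4) with (- INR 4) in H4 at 2 by (simpl; lra). rewrite Rpower_neg_nat in H4 by exact Hb.
rewrite <- (Rpower_neg_nat b 5) by exact Hb. replace (- INR 5) with (-1/2 + -9/2) by (simpl; lra). rewrite Rpower_plus.
pose proof (Rpower_pos b (-9/2)). pose proof (Rpower_pos (Cmod z) (-1/2)).
assert (Rpower (Cmod z) (-1/2) * (15/2 * Rpower b (-9/2)) <= 1023/1000 * Rpower b (-1/2) * (15/2 * Rpower b (-9/2))) by (apply Rmult_le_compat_r; lra).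
unfold cP in *. lra.
Qed.

(** The bound at 361/25600 comes from [exp (- x) >= 1 - x]; eight squarings with rounded constants
    lead to 3.61. *)
Lemma exp_361 : exp (361/100) <= 381/10.
Proof.
assert (H0 : exp (361/25600) <= 101431/100000).
{ pose proof (exp_ineq1_le (- (361/25600))) as H. rewrite exp_Ropp in H. pose proof (exp_pos (361/25600)) as Hp.
  apply (Rmult_le_compat_l (exp (361/25600))) in H; [|lra]. rewrite Rinv_r in H by lra. lra. }
assert (D : forall x a b, exp x <= a -> a * a <= b -> exp (2 * x) <= b).
{ intros x a b H1 H2. replace (2 * x) with (x + x) by ring. rewrite exp_plus. pose proof (exp_pos x). nra. }
assert (H1 := D _ _ (102883/100000) H0 ltac:(lra)).
assert (H2 := D _ _ (105850/100000) H1 ltac:(lra)).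
assert (H3 := D _ _ (112043/100000) H2 ltac:(lra)).
assert (H4 := D _ _ (125537/100000) H3 ltac:(lra)).
assert (H5 := D _ _ (157596/100000) H4 ltac:(lra)).
assert (H6 := D _ _ (248366/100000) H5 ltac:(lra)).
assert (H7 := D _ _ (616857/100000) H6 ltac:(lra)).
replace (361/100) with (2 * (361/200)) by field.
replace (361/200) with (2 * (2 * (2 * (2 * (2 * (2 * (2 * (361/25600)))))))) by field.
apply (D _ (616857/100000)); [exact H7|]. lra.
Qed.

Lemma hol2_expi (D : C -> Prop) : (forall z, D z -> 0 < Im z) -> hol2 D (fun z => cexp (Ci * z)).
Proof.
intros HD. exists (fun z => Ci * cexp (Ci * z))%C, (fun z => Ci * (Ci * cexp (Ci * z)))%C, 1. intros z Hz.
assert (E : forall w, Cd (fun z => cexp (Ci * z)) w (Ci * cexp (Ci * w))%C).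
{ intros w. eapply Cd_eq; [|apply (Cd_comp cexp (fun z => Ci * z)%C); [apply Cd_scal, Cd_id|apply Cd_cexp]]. ring. }
split; [apply E|]. split; [apply Cd_scal, E|].
rewrite !Cmod_mult, Cmod_Ci, !Rmult_1_l, Cmod_cexp.
assert (exp (Re (Ci * z)) <= 1); [|lra]. rewrite <- exp_0. apply exp_le_compat.
specialize (HD z Hz). replace (Re (Ci * z)) with (- Im z) by (unfold Ci; Csimp). lra.
Qed.

Lemma Cmod_expi (z : C) : Cmod (cexp (Ci * z)) = exp (- Im z).
Proof. rewrite Cmod_cexp. f_equal. unfold Ci; Csimp. Qed.

Lemma Cd_expi (z : C) : Cd (fun z => cexp (Ci * z)) z (Ci * cexp (Ci * z))%C.
Proof. eapply Cd_eq; [|apply (Cd_comp cexp (fun z => Ci * z)%C); [apply Cd_scal, Cd_id|apply Cd_cexp]]. ring. Qed.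

Section Left.
Variables (H H1 H2 : C -> C).
Hypothesis HH : Hode Dp H H1 H2.
Hypothesis Hh : hol2 Dp H.
Hypothesis Hd : decayH H.

Let Hm := mirf H.

(** The difference of two solutions satisfies a linear equation whose coefficient contains their
    mean, hence [bS]. Left of the strip only [mirf H] is known; substituting
    [H = mirf H + rs exp(i z) v] turns this coefficient into [bQ] plus [gQ v], so the equation for
    [v] becomes quadratic. *)
Definition bS (z : C) : C := (/ 4 / (z * z) + / 2 * (H z + mirf H z))%C.
Definition bQ (z : C) : C := (/ 4 / (z * z) + mirf H z)%C.
Definition gQ (z : C) : C := (/ 2 * (rs z * cexp (Ci * z)))%C.

Lemma quarter (z : C) : z <> RtoC 0 -> (/ 4 / (z * z) = / 4 * Cpower z (-2))%C.
Proof.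
intros Hn. replace (-2) with (0 - INR 2) by (simpl; lra). rewrite Cpower_sub_nat, Cpower_0 by exact Hn. simpl. field. exact Hn.
Qed.

Lemma hol2_ext_on (D : C -> Prop) (f g : C -> C) : Copen D -> (forall z, D z -> f z = g z) -> hol2 D f -> hol2 D g.
Proof.
intros HD E [f1 [f2 [M HM]]]. exists f1, f2, M. intros z Hz. destruct (HM z Hz) as [A1 [A2 [A3 A4]]].
split; [|split; [exact A2|split; [now rewrite <- E|exact A4]]].
destruct (HD z Hz) as [r [Hr Hb]]. apply (Cd_ext_loc f g z _ r Hr); auto.
Qed.

Lemma hol2_quarter (D : C -> Prop) : Copen D -> (forall z, D z -> slit z /\ 1 <= Cmod z) -> hol2 D (fun z => / 4 / (z * z))%C.
Proof.
intros HD Hs. apply (hol2_ext_on D (fun z => / 4 * Cpower z (-2))%C); [exact HD| |].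
- intros z Hz. symmetry. apply quarter, slit_neq_0, Hs, Hz.
- apply hol2_mult; [apply hol2_const|apply hol2_Cpower; [lra|exact Hs]].
Qed.

Lemma hol2_bS : hol2 Sd bS.
Proof.
apply hol2_plus; [apply hol2_quarter; [apply Sd_open|intros z Hz; apply Dp_slit, Sd_Dp, Hz]|].
apply hol2_mult; [apply hol2_const|]. apply hol2_plus.
- apply (hol2_sub Dp); [apply Sd_Dp|exact Hh].
- apply (hol2_sub (fun z => Dp (mir z))); [intros z Hz; apply Qd_mir, Sd_Qd, Hz|]. now apply hol2_mir.
Qed.

Lemma hol2_bQ : hol2 Qd bQ.
Proof.
apply hol2_plus; [apply hol2_quarter; [apply Qd_open|apply Qd_slit]|].
apply (hol2_sub (fun z => Dp (mir z))); [apply Qd_mir|]. now apply hol2_mir.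
Qed.

Lemma hol2_gQ : hol2 Qd gQ.
Proof.
apply hol2_mult; [apply hol2_const|]. apply hol2_mult.
- apply hol2_Cpower; [lra|apply Qd_slit].
- apply hol2_expi. intros z Hz. apply Hz.
Qed.

Lemma Cmod_quarter (z : C) : z <> RtoC 0 -> Cmod (/ 4 / (z * z)) = / 4 * Rpower (Cmod z) (-2).
Proof.
intros Hn. rewrite quarter, Cmod_mult, Cmod_Cpower by exact Hn. f_equal.
rewrite Cmod_inv by (intros E; apply RtoC_inj in E; lra). rewrite Cmod_RtoC_nonneg; lra.
Qed.

Lemma Cmod_half (z : C) : Cmod (/ 2 * z) = / 2 * Cmod z.
Proof.
rewrite Cmod_mult, Cmod_inv by (intros E; apply RtoC_inj in E; lra). rewrite Cmod_RtoC_nonneg; lra.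
Qed.

Lemma Hm_bound (z : C) : Dp (mir z) ->
  Cmod (mirf H z) <= 1023/1000 * (15/2 * / Cmod (z - RtoC del) ^ 5 + cP * / Cmod (z - RtoC del) ^ 4).
Proof. intros Hz. unfold mirf. rewrite Cmod_conj, <- mir_shift. now apply decayH_bound. Qed.

Lemma inv_pow_le (a b : R) (n : nat) : 0 < a <= b -> / b ^ n <= / a ^ n.
Proof. intros Hab. apply Rinv_le_contravar; [apply pow_lt; lra|apply pow_incr; lra]. Qed.

Lemma bS_bound (z : C) : Sd z -> Cmod (bS z) <= 47/100 * / Im z ^ 2.
Proof.
intros Hz. assert (HzD := Sd_Dp z Hz). assert (HzQ := Sd_Qd z Hz). assert (HzM := Qd_mir z HzQ).
assert (Hn := slit_neq_0 z (proj1 (Dp_slit z HzD))).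
set (y := Im z). assert (Hy : RR < y) by apply Hz. unfold RR in Hy.
assert (Y0 : y <= Cmod z) by (pose proof (im_le_Cmod z); pose proof (Rle_abs (Im z)); unfold y; lra).
assert (Yp : y <= Cmod (z + RtoC del)) by apply im_le_shift.
assert (Ym : y <= Cmod (z - RtoC del)).
{ pose proof (im_le_shift z (- del)) as E. rewrite RtoC_opp in E. exact E. }
assert (B1 : Rpower (Cmod z) (-2) <= / y ^ 2).
{ rewrite <- Rpower_neg_nat by lra. apply Rpower_anti; simpl; lra. }
assert (B2 := decayH_bound H z Hd HzD). assert (B3 := Hm_bound z HzM).
assert (Y1 : 0 < y) by lra.
assert (P5 := inv_pow_le y _ 5 (conj Y1 Yp)). assert (P4 := inv_pow_le y _ 4 (conj Y1 Yp)).
assert (M5 := inv_pow_le y _ 5 (conj Y1 Ym)). assert (M4 := inv_pow_le y _ 4 (conj Y1 Ym)).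
set (q := / y ^ 2). assert (Hq : 0 < q) by (apply Rinv_0_lt_compat, pow_lt; lra).
assert (I1 : / y <= 5/18) by (replace (5/18) with (/ (18/5)) by field; apply Rinv_le_contravar; lra).
assert (I0 : 0 < / y) by (apply Rinv_0_lt_compat; lra).
assert (E4 : / y ^ 4 <= q * (25/324)).
{ replace (/ y ^ 4) with (q * (/ y * / y)) by (unfold q; field; lra). apply Rmult_le_compat_l; [lra|nra]. }
assert (E5 : / y ^ 5 <= q * (125/5832)).
{ replace (/ y ^ 5) with (q * (/ y * / y * / y)) by (unfold q; field; lra). apply Rmult_le_compat_l; [lra|].
  assert (/ y * / y <= 25/324) by nra. nra. }
unfold bS. eapply Rle_trans; [apply Cmod_triangle|]. rewrite Cmod_quarter, Cmod_half by exact Hn.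
assert (Cmod (H z + mirf H z) <= Cmod (H z) + Cmod (mirf H z)) by apply Cmod_triangle.
fold y q in B1. unfold cP in *. lra.
Qed.

(** The integral of [|Kx bS|] is at most [1/2 * 47/100 * 5/18], about 0.065. This keeps the
    normalized recessive factor within 1/10 of its limit 1, in particular away from 0. *)
Lemma contr_S : contr Sd Ci Kx (fun _ => RtoC 0) bS (fun _ => RtoC 0) (fun _ => 1) (11/10) (1/10) 1 1 1.
Proof.
assert (NL : forall z, NB (fun _ => RtoC 0) bS (fun _ => RtoC 0) (fun _ => 1) (11/10) z = 11/10 * Cmod (bS z) /\
   LB bS (fun _ => RtoC 0) (fun _ => 1) (11/10) z = 11/10 * Cmod (bS z)).
{ intros z. unfold NB, LB. rewrite Cmod_0. split; ring. }
assert (BR : forall z r, Sd z -> 0 <= r -> Cmod (bS (z + RtoC r * Ci)%C) <= 47/100 * / (Im z + r) ^ 2).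
{ intros z r Hz Hr. rewrite <- im_zri. apply bS_bound. now apply Sd_stable. }
assert (DI : forall z, Sd z -> dom_int (fun r => Rabs (Kx r) * (11/10 * Cmod (bS (z + RtoC r * Ci)%C))) (1/10)).
{ intros z Hz. assert (Hy : RR < Im z) by apply Hz. unfold RR in Hy.
  eapply dom_int_le; [apply (dom_int_scal (1/2 * (11/10 * (47/100)))); [lra|apply (dom_int_sq (Im z)); lra]| |].
  - intros r Hr. specialize (BR z r Hz Hr). pose proof (Kx_bound r Hr). rewrite Rabs_pos_eq by lra.
    pose proof (Cmod_ge_0 (bS (z + RtoC r * Ci)%C)).
    assert (Kx r * (11 / 10 * Cmod (bS (z + RtoC r * Ci)%C)) <= 1/2 * (11 / 10 * Cmod (bS (z + RtoC r * Ci)%C))) by (apply Rmult_le_compat_r; lra). lra.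
  - assert (/ Im z <= 5/18) by (replace (5/18) with (/ (18/5)) by field; apply Rinv_le_contravar; lra). lra. }
assert (TB : forall z r, Sd z -> 0 <= r -> 11/10 * Cmod (bS (z + RtoC r * Ci)%C) <= 1 / (1 + r) ^ 2).
{ intros z r Hz Hr. specialize (BR z r Hz Hr). assert (Hy : RR < Im z) by apply Hz. unfold RR in Hy.
  assert (I : / (Im z + r) ^ 2 <= / (1 + r) ^ 2) by (apply inv_pow_le; lra). unfold Rdiv.
  assert (0 < / (1 + r) ^ 2) by (apply Rinv_0_lt_compat, pow_lt; lra). lra. }
split.
- apply Sd_open.
- apply Sd_stable.
- apply Cmod_Ci.
- apply hol2_const.
- apply hol2_bS.
- apply hol2_const.
- lra.
- intros; lra.
- lra.
- intros z Hz. rewrite Cmod_1. eapply dom_int_le; [apply (DI z Hz)| |lra]. intros r Hr. cbv beta. rewrite (proj1 (NL _)). lra.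
- intros z Hz. eapply dom_int_le; [apply (DI z Hz)| |lra]. intros r Hr. cbv beta. rewrite (proj2 (NL _)). lra.
- intros z r Hz Hr. rewrite (proj1 (NL _)). now apply TB.
- intros z r Hz Hr. rewrite (proj2 (NL _)). now apply TB.
Qed.

Lemma bQ_bound (z : C) : Qd z -> Cmod (bQ z) <= 1023/1000 *
  (/ 4 * / Cmod (z - RtoC del) ^ 2 + (15/2 * / Cmod (z - RtoC del) ^ 5 + cP * / Cmod (z - RtoC del) ^ 4)).
Proof.
intros Hz. assert (HzM := Qd_mir z Hz). assert (Hn := slit_neq_0 z (proj1 (Qd_slit z Hz))).
pose proof (Dp_mod _ HzM) as Hm1. rewrite mir_shift, Cmod_mir in Hm1.
assert (HR : RR <= Cmod (z - RtoC del)) by (left; apply Hz).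
assert (B2 := Rpower_shift _ _ (-2) HR Hm1 ltac:(lra)).
replace (-2) with (- INR 2) in B2 at 2 by (simpl; lra). rewrite Rpower_neg_nat in B2 by (unfold RR in *; lra).
assert (B3 := Hm_bound z HzM).
unfold bQ. eapply Rle_trans; [apply Cmod_triangle|]. rewrite Cmod_quarter by exact Hn. lra.
Qed.

Lemma gQ_bound (z : C) : Qd z -> Cmod (gQ z) <= 1023/2000 * Rpower (Cmod (z - RtoC del)) (-1/2) * exp (- Im z).
Proof.
intros Hz. assert (HzM := Qd_mir z Hz).
pose proof (Dp_mod _ HzM) as Hm1. rewrite mir_shift, Cmod_mir in Hm1.
assert (HR : RR <= Cmod (z - RtoC del)) by (left; apply Hz).
assert (B2 := Rpower_shift _ _ (-1/2) HR Hm1 ltac:(lra)).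
unfold gQ. rewrite Cmod_half, Cmod_mult, Cmod_expi. unfold rs. rewrite Cmod_Cpower.
pose proof (exp_pos (- Im z)).
assert (Rpower (Cmod z) (-1/2) * exp (- Im z) <= 1023/1000 * Rpower (Cmod (z - RtoC del)) (-1/2) * exp (- Im z)) by (apply Rmult_le_compat_r; lra). lra.
Qed.

Lemma Rpower_half_RR (b : R) : RR <= b -> Rpower b (-1/2) <= 5272/10000.
Proof.
intros Hb. unfold RR in Hb. eapply Rle_trans; [apply (Rpower_anti b (18/5)); lra|].
replace (-1/2) with (- / 2) by lra. rewrite Rpower_Ropp, Rpower_sqrt by lra.
replace (5272/10000) with (/ (10000/5272)) by field. apply Rinv_le_contravar; [lra|].
rewrite <- (sqrt_Rsqr (10000/5272)) by lra. apply sqrt_le_1_alt. unfold Rsqr. lra.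
Qed.

(** The budget is tight: [0.355 + 49/4 * 0.09 <= 7/2 - 2] for invariance and
    [0.355 + 49/2 * 0.09 <= 3/4 * 7/2] for contraction. The exponential in [gQ] need not be small
    near the negative axis, so the weight is constant; what counts is its decay upwards, integrated
    by [dom_int_kexp]. *)
Lemma contr_Q (c : C) : Cmod c <= 2 ->
  contr Qd Ci Kx (fun _ => RtoC 0) bQ gQ (fun _ => 1) (7/2) (3/4) 200 1 c.
Proof.
intros Hc.
assert (NL : forall z, NB (fun _ => RtoC 0) bQ gQ (fun _ => 1) (7/2) z = 7/2 * Cmod (bQ z) + 49/4 * Cmod (gQ z) /\
   LB bQ gQ (fun _ => 1) (7/2) z = 7/2 * Cmod (bQ z) + 49/2 * Cmod (gQ z)).
{ intros z. unfold NB, LB. rewrite Cmod_0. split; field. }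
assert (BG : forall z r, Qd z -> 0 <= r -> Cmod (gQ (z + RtoC r * Ci)%C) <= 27/100 * exp (- r)).
{ intros z r Hz Hr. assert (Hzr := Qd_stable z r Hz Hr). eapply Rle_trans; [now apply gQ_bound|].
  rewrite im_zri. assert (exp (- (Im z + r)) <= exp (- r)) by (apply exp_le_compat; destruct Hz as [[_ Hi] _]; lra).
  assert (HRb := Rpower_half_RR _ (Rlt_le _ _ (proj2 Hzr))). pose proof (Rpower_pos (Cmod (z + RtoC r * Ci - RtoC del)) (-1/2)).
  pose proof (exp_pos (- (Im z + r))). apply Rmult_le_compat; lra. }
assert (BB : forall z r, Qd z -> 0 <= r -> Cmod (bQ (z + RtoC r * Ci)%C) <=
   62/100 * / (Cmod (z - RtoC del) + r) ^ 2 + 768/100 * / sqrt (Cmod (z - RtoC del) * Cmod (z - RtoC del) + r * r) ^ 5).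
{ intros z r Hz Hr. assert (Hzr := Qd_stable z r Hz Hr). eapply Rle_trans; [now apply bQ_bound|].
  assert (Hi : 0 < Im z) by apply Hz. pose proof (shift_i z r Hi Hr) as Hs.
  assert (Ha : RR < Cmod (z - RtoC del)) by apply Hz. assert (Hb : RR < Cmod (z + RtoC r * Ci - RtoC del)) by apply Hzr.
  set (a := Cmod (z - RtoC del)) in *. set (b := Cmod (z + RtoC r * Ci - RtoC del)) in *. unfold RR in *.
  set (t := sqrt (a * a + r * r)).
  assert (Ht : 0 < t <= b).
  { split; [apply sqrt_lt_R0; nra|]. rewrite <- (sqrt_Rsqr b) by lra. apply sqrt_le_1_alt. exact Hs. }
  assert (B5 := inv_pow_le t b 5 Ht).
  (* From [b^2 >= a^2 + r^2 >= (a + r)^2 / 2]; the rational majorant has an elementary primitive. *)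
  assert (B2 : / b ^ 2 <= 2 * / (a + r) ^ 2).
  { apply (Rmult_le_reg_r (b ^ 2 * (a + r) ^ 2)); [apply Rmult_lt_0_compat; apply pow_lt; lra|].
    replace (/ b ^ 2 * (b ^ 2 * (a + r) ^ 2)) with ((a + r) ^ 2) by (field; lra).
    replace (2 * / (a + r) ^ 2 * (b ^ 2 * (a + r) ^ 2)) with (2 * b ^ 2) by (field; lra).
    pose proof (Rle_0_sqr (a - r)) as Q. unfold Rsqr in Q. simpl. lra. }
  assert (B4 : / b ^ 4 <= 25/324 * / b ^ 2).
  { replace (/ b ^ 4) with (/ b ^ 2 * / b ^ 2) by (field; lra). apply Rmult_le_compat_r; [left; apply Rinv_0_lt_compat, pow_lt; lra|].
    replace (25/324) with (/ (18/5) ^ 2) by field. apply inv_pow_le. lra. }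
  unfold cP. pose proof (Rinv_0_lt_compat _ (pow_lt b 2 ltac:(lra))). pose proof (Rinv_0_lt_compat _ (pow_lt (a + r) 2 ltac:(lra))).
  pose proof (Rinv_0_lt_compat _ (pow_lt t 5 ltac:(lra))). lra. }
assert (DI : forall z (k : R), Qd z -> 0 <= k -> dom_int (fun r => Rabs (Kx r) * (7/2 * Cmod (bQ (z + RtoC r * Ci)%C) + k * Cmod (gQ (z + RtoC r * Ci)%C))) (355/1000 + k * (9/100))).
{ intros z k Hz Hk. assert (Ha : RR < Cmod (z - RtoC del)) by apply Hz. unfold RR in Ha. set (a := Cmod (z - RtoC del)) in *.
  assert (D1 : 0 < a) by lra.
  assert (K1 : 0 <= 62/100) by lra. assert (K2 : 0 <= 768/100) by lra. assert (K3 : 0 <= 7/4) by lra. assert (K4 : 0 <= k * (27/100)) by nra.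
  assert (DD := dom_int_plus _ _ _ _ (dom_int_scal (7/4) _ _ K3 (dom_int_plus _ _ _ _ (dom_int_scal (62/100) _ _ K1 (dom_int_sq a D1))
    (dom_int_scal (768/100) _ _ K2 (dom_int_m5 a D1)))) (dom_int_scal (k * (27/100)) _ _ K4 dom_int_kexp)).
  eapply dom_int_le; [exact DD| |].
  - intros r Hr. specialize (BB z r Hz Hr). specialize (BG z r Hz Hr). fold a in BB. pose proof (Kx_bound r Hr) as HK. rewrite Rabs_pos_eq by lra.
    cbv beta. fold (Kx r). rewrite Rmult_plus_distr_l. apply Rplus_le_compat.
    + pose proof (Cmod_ge_0 (bQ (z + RtoC r * Ci)%C)).
      apply Rle_trans with (1/2 * (7/2 * Cmod (bQ (z + RtoC r * Ci)%C))); [apply Rmult_le_compat_r; lra|lra].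
    + pose proof (Cmod_ge_0 (gQ (z + RtoC r * Ci)%C)).
      apply Rle_trans with (Kx r * (k * (27/100 * exp (- r)))); [|lra].
      apply Rmult_le_compat_l; [lra|]. apply Rmult_le_compat_l; lra.
  - assert (I1 : / a <= 5/18) by (replace (5/18) with (/ (18/5)) by field; apply Rinv_le_contravar; lra).
    assert (I4 : / a ^ 4 <= 625/104976) by (replace (625/104976) with (/ (18/5) ^ 4) by field; apply inv_pow_le; lra).
    nra. }
assert (TB : forall z r k, Qd z -> 0 <= r -> 0 <= k <= 49/2 -> 7/2 * Cmod (bQ (z + RtoC r * Ci)%C) + k * Cmod (gQ (z + RtoC r * Ci)%C) <= 200 / (1 + r) ^ 2).
{ intros z r k Hz Hr Hk. specialize (BB z r Hz Hr). specialize (BG z r Hz Hr).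
  assert (Ha : RR < Cmod (z - RtoC del)) by apply Hz. unfold RR in Ha. set (a := Cmod (z - RtoC del)) in *.
  assert (I : / (a + r) ^ 2 <= / (1 + r) ^ 2) by (apply inv_pow_le; lra).
  set (q := / (1 + r) ^ 2) in *. assert (Hq : 0 < q) by (apply Rinv_0_lt_compat, pow_lt; lra).
  assert (E := exp_neg_sq r Hr). unfold Rdiv in E. fold q in E. pose proof (exp_pos (- r)).
  set (t := sqrt (a * a + r * r)) in *.
  assert (Ht : (1 + r) / 2 <= t).
  { unfold t. rewrite <- (sqrt_Rsqr ((1 + r) / 2)) by lra. apply sqrt_le_1_alt. unfold Rsqr.
    pose proof (Rle_0_sqr (1 - r)) as Q. unfold Rsqr in Q. nra. }
  assert (Ht1 : 1 <= t). { unfold t. rewrite <- sqrt_1. apply sqrt_le_1_alt. nra. }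
  assert (T5 : / t ^ 5 <= 4 * q).
  { apply Rle_trans with (/ ((1 + r) / 2) ^ 2).
    - apply Rle_trans with (/ t ^ 2); [|apply inv_pow_le; lra].
      apply Rinv_le_contravar; [apply pow_lt; lra|]. apply Rle_pow; [exact Ht1|lia].
    - unfold q. right. field. lra. }
  unfold Rdiv. fold q. pose proof (Cmod_ge_0 (gQ (z + RtoC r * Ci)%C)).
  assert (k * Cmod (gQ (z + RtoC r * Ci)%C) <= 49/2 * (27/100 * (4 * q))).
  { apply Rmult_le_compat; lra. }
  lra. }
split.
- apply Qd_open.
- apply Qd_stable.
- apply Cmod_Ci.
- apply hol2_const.
- apply hol2_bQ.
- apply hol2_gQ.
- lra.
- intros; lra.
- lra.
- intros z Hz. eapply dom_int_le; [apply (DI z (49/4) Hz); lra| |lra]. intros r Hr. cbv beta. rewrite (proj1 (NL _)). lra.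
- intros z Hz. eapply dom_int_le; [apply (DI z (49/2) Hz); lra| |lra]. intros r Hr. cbv beta. rewrite (proj2 (NL _)). lra.
- intros z r Hz Hr. rewrite (proj1 (NL _)). apply TB; auto; lra.
- intros z r Hz Hr. rewrite (proj2 (NL _)). apply TB; auto; lra.
Qed.
End Left.

Lemma kernel_Kx : kernel Kx (fun r => exp (- (2 * r))) (fun r => - 2 * exp (- (2 * r))) 2 (-2) 0.
Proof. exact kernel_exp. Qed.

Lemma Cd_zero_const (f : C -> C) (z w : C) :
  (forall t, 0 <= t <= 1 -> Cd f (z + RtoC t * (w - z))%C 0) -> f w = f z.
Proof.
intros Hd. assert (E := Cd_seg_bound f (fun _ => RtoC 0) z w 0 Hd).
assert (Z : Cmod (f w - f z) <= 0 * Cmod (w - z)).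
{ apply E. intros. rewrite Cmod_0. lra. }
rewrite Rmult_0_l in Z. assert (Z0 : Cmod (f w - f z) = 0) by (pose proof (Cmod_ge_0 (f w - f z)); lra).
apply Cmod_eq_0 in Z0. replace (f w) with (f w - f z + f z)%C by ring. rewrite Z0. ring.
Qed.

Lemma lt_convex (a x y t : R) : a < x -> a < y -> 0 <= t <= 1 -> a < x + t * (y - x).
Proof.
intros Hx Hy Ht. destruct (Rle_lt_dec x y) as [L|L].
- assert (0 <= t * (y - x)) by (apply Rmult_le_pos; lra). lra.
- assert (t * (x - y) <= 1 * (x - y)) by (apply Rmult_le_compat_r; lra). lra.
Qed.

Lemma Sd_convex (z w : C) (t : R) : Sd z -> Sd w -> 0 <= t <= 1 -> Sd (z + RtoC t * (w - z))%C.
Proof.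
intros [[A1 A2] A3] [[B1 B2] B3] Ht. unfold Sd.
replace (Re (z + RtoC t * (w - z))) with (Re z + t * (Re w - Re z)) by Csimp.
replace (Im (z + RtoC t * (w - z))) with (Im z + t * (Im w - Im z)) by Csimp.
pose proof (lt_convex _ _ _ _ A1 B1 Ht). pose proof (lt_convex _ _ _ _ A3 B3 Ht).
pose proof (lt_convex (- del) (- Re z) (- Re w) t ltac:(lra) ltac:(lra) Ht).
split; [split|]; lra.
Qed.

Lemma Cconj_inv4 (z : C) : z <> RtoC 0 ->
  Cconj (/ (z * z * z * z)) = (/ (Cconj z * Cconj z * Cconj z * Cconj z))%C.
Proof. intros Hz. rewrite Cconj_inv by (repeat apply Cmult_neq_0; exact Hz). now rewrite !Cconj_mult. Qed.

Lemma Ci2 : (Ci * Ci = - (1))%C.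
Proof. apply Ceq; unfold Ci; Csimp. Qed.

(** * Connection formula on the strip and continuation to the left quadrant *)

Section LeftExtension.
Variables (H H1 H2 : C -> C).
Hypothesis HH : Hode Dp H H1 H2.
Hypothesis Hh : hol2 Dp H.
Hypothesis Hd : decayH H.

(* [H] and its mirror image solve the same equation, so [d = z^(1/2) (H - mirf H)] solves a linear one;
   decay in the upper half-plane makes it a multiple of the recessive solution. *)
Definition dX (z : C) : C := (rs z * z * (H z - mirf H z))%C.
Definition dX1 (z : C) : C := (/ 2 * rs z * (H z - mirf H z) + rs z * z * (H1 z + mirf H1 z))%C.

Lemma Hm_ode (z : C) : Qd z -> Cd (mirf H) z (- mirf H1 z)%C /\ Cd (fun z => - mirf H1 z)%C z (mirf H2 z) /\
  (mirf H2 z + - mirf H1 z / z + mirf H z = - (mirf H z * mirf H z) / 2 - RtoC cP / (z * z * z * z))%C.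
Proof.
intros Hz. apply (Hode_mir Dp H H1 H2); [|exact HH|now apply Qd_mir].
intros w Hw. apply slit_neq_0, Dp_slit, Hw.
Qed.

Lemma dX_ode (z : C) : Sd z -> Cd dX z (dX1 z) /\ Cd dX1 z (- dX z - bS H z * dX z)%C.
Proof.
intros Hz. assert (HzD := Sd_Dp z Hz). assert (HzQ := Sd_Qd z Hz).
destruct (Dp_slit z HzD) as [Hs _]. assert (Hn := slit_neq_0 z Hs).
destruct (HH z HzD) as [A1 [A2 A3]]. destruct (Hm_ode z HzQ) as [B1 [B2 B3]].
assert (Er : Cd (fun z => rs z * z)%C z (/ 2 * rs z)%C).
{ eapply Cd_eq; [|apply Cd_mult; [apply Cd_rs, Hs|apply Cd_id]]. rewrite RtoC_mhalf. field. exact Hn. }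
assert (B2' : Cd (mirf H1) z (- mirf H2 z)%C).
{ apply (Cd_ext (fun z => - - mirf H1 z)%C); [intros; ring|]. now apply Cd_opp. }
split.
- eapply Cd_eq; [|apply Cd_mult; [exact Er|apply Cd_minus; [exact A1|exact B1]]]. unfold dX1. ring.
- eapply Cd_eq; [|apply Cd_plus; [apply Cd_mult; [apply Cd_scal, Cd_rs, Hs|apply Cd_minus; [exact A1|exact B1]]|
    apply Cd_mult; [exact Er|apply Cd_plus; [exact A2|exact B2']]]].
  unfold dX, bS. rewrite RtoC_mhalf.
  assert (E2 : (H2 z = - (H1 z / z) - H z + (- (H z * H z) / 2 - RtoC cP / (z * z * z * z)))%C) by (rewrite <- A3; ring).
  assert (E3 : (mirf H2 z = mirf H1 z / z - mirf H z + (- (mirf H z * mirf H z) / 2 - RtoC cP / (z * z * z * z)))%C) by (rewrite <- B3; field; exact Hn).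
  rewrite E2, E3. field. exact Hn.
Qed.

Lemma exp_lim0 (a : R) (u : R) : 0 <= a -> (forall n, u <= a * (INR n + 1) * exp (- INR n)) -> u <= 0.
Proof.
intros Ha Hu. apply (le_lim_0 u _ (lim_inv_S (4 * a))). intros n. eapply Rle_trans; [apply Hu|].
assert (E := exp_neg_sq (INR n) (pos_INR n)). pose proof (pos_INR n) as Hn. pose proof (exp_pos (- INR n)).
apply Rle_trans with (a * (INR n + 1) * (4 / (1 + INR n) ^ 2)).
- apply Rmult_le_compat_l; [nra|exact E].
- right. field. lra.
Qed.

(** The Wronskian of [dX] and the recessive solution is constant. As [H] and [H1] are bounded and
    the recessive solution decays exponentially, it is at most a multiple of
    [Cmod z * exp (- Im z)], hence zero; so the quotient of the two is constant on the convex
    strip. *)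
Lemma left_coefficient : exists v1 c, fixsol Sd Ci Kx (fun _ => RtoC 0) (bS H) (fun _ => RtoC 0) (fun _ => 1) (11/10) 1 v1 /\
  Cmod c <= 2 /\ forall z, Sd z -> dX z = (c * (cexp (Ci * z) * v1 z))%C.
Proof.
assert (CS := contr_S H Hh Hd).
destruct (fixsol_exists _ _ _ _ _ _ _ _ _ _ _ _ _ _ _ _ _ kernel_Kx CS) as [v1 Hv1].
destruct (fixsol_ode _ _ _ _ _ _ _ _ _ _ _ _ _ _ _ _ _ kernel_Kx CS v1 Hv1) as [v11 [v12 Hv]].
assert (Hc := fixsol_center _ _ _ _ _ _ _ _ _ _ _ _ _ _ _ _ _ kernel_Kx CS v1).
assert (Hlow : forall z, Sd z -> 9/10 <= Cmod (v1 z)).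
{ intros z Hz. specialize (Hc z Hv1 Hz). rewrite Cmod_1 in Hc.
  pose proof (Cmod_rev_tri 1 (1 - v1 z)) as T. rewrite Cmod_1 in T.
  replace (1 - (1 - v1 z))%C with (v1 z) in T by ring.
  rewrite (Cmod_minus_sym 1 (v1 z)) in T. lra. }
set (e1 z := (cexp (Ci * z) * v1 z)%C). set (e1' z := (cexp (Ci * z) * (Ci * v1 z + v11 z))%C).
assert (E1 : forall z, Sd z -> Cd e1 z (e1' z)).
{ intros z Hz. destruct (Hv z Hz) as [V1 _]. eapply Cd_eq; [|apply Cd_mult; [apply Cd_expi|exact V1]]. unfold e1'. ring. }
assert (E2 : forall z, Sd z -> Cd e1' z (- e1 z - bS H z * e1 z)%C).
{ intros z Hz. destruct (Hv z Hz) as [V1 [V2 [V3 _]]].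
  eapply Cd_eq; [|apply Cd_mult; [apply Cd_expi|apply Cd_plus; [apply Cd_scal, V1|exact V2]]].
  assert (V4 : v12 z = (- (bS H z * v1 z + 2 * Ci * v11 z))%C).
  { replace (v12 z) with (- (Ci * Ci * v12 z))%C by (rewrite Ci2; ring). rewrite V3. unfold G.
    replace (RtoC (-2)) with (- (2))%C by (apply Ceq; Csimp). ring. }
  rewrite V4. unfold e1. replace (Ci * cexp (Ci * z) * (Ci * v1 z + v11 z))%C with (cexp (Ci * z) * (Ci * Ci * v1 z + Ci * v11 z))%C by ring.
  rewrite Ci2. ring. }
assert (Hne : forall z, Sd z -> e1 z <> RtoC 0).
{ intros z Hz. apply Cmult_neq_0; [apply cexp_neq_0|]. apply Cmod_gt_0. specialize (Hlow z Hz). lra. }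
destruct Hh as [h1 [h2 [M HM]]].
assert (HMb : forall z, Dp z -> Cmod (H z) <= M /\ Cmod (H1 z) <= M).
{ intros z Hz. destruct (HM z Hz) as [K1 [_ [K3 [K4 _]]]]. split; [exact K3|].
  destruct (HH z Hz) as [K5 _]. now rewrite (Cd_unique _ _ _ _ K5 K1). }
set (Wr z := (dX z * e1' z - dX1 z * e1 z)%C).
assert (W0 : forall z, Sd z -> Cd Wr z 0%C).
{ intros z Hz. destruct (dX_ode z Hz) as [D1 D2].
  eapply Cd_eq; [|apply Cd_minus; apply Cd_mult; [exact D1|apply E2, Hz|exact D2|apply E1, Hz]]. ring. }
assert (WB : forall z, Sd z -> Cmod (Wr z) <= 8 * M * Cmod z * exp (- Im z)).
{ intros z Hz. assert (HzD := Sd_Dp z Hz). assert (HzM := Qd_mir z (Sd_Qd z Hz)).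
  destruct (HMb z HzD) as [M0 M1]. destruct (HMb _ HzM) as [N0 N1]. destruct (Dp_slit z HzD) as [_ Hz1].
  assert (R1 : Cmod (rs z) <= 1) by (unfold rs; rewrite Cmod_Cpower; apply Rpower_le_1; lra).
  assert (HM0 : 0 <= M) by (eapply Rle_trans; [apply Cmod_ge_0|exact M0]).
  assert (P0 : Cmod (H z - mirf H z) <= 2 * M).
  { eapply Rle_trans; [apply Cmod_tri_minus|]. unfold mirf. rewrite Cmod_conj. lra. }
  assert (P1 : Cmod (H1 z + mirf H1 z) <= 2 * M).
  { eapply Rle_trans; [apply Cmod_triangle|]. unfold mirf. rewrite Cmod_conj. lra. }
  assert (Hz0 : 0 <= Cmod z) by apply Cmod_ge_0. assert (R0 := Cmod_ge_0 (rs z)).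
  assert (Q0 : Cmod (rs z * z) <= Cmod z) by (rewrite Cmod_mult; nra).
  assert (DB : Cmod (dX z) <= Cmod z * (2 * M)).
  { unfold dX. rewrite Cmod_mult. apply Rmult_le_compat; auto using Cmod_ge_0. }
  assert (DB1 : Cmod (dX1 z) <= Cmod z * (3 * M)).
  { unfold dX1. eapply Rle_trans; [apply Cmod_triangle|].
    apply Rle_trans with (M + Cmod z * (2 * M)); [|nra]. apply Rplus_le_compat.
    - rewrite <- Cmult_assoc, Cmod_half, Cmod_mult.
      assert (Cmod (rs z) * Cmod (H z - mirf H z) <= 1 * (2 * M)) by (apply Rmult_le_compat; auto using Cmod_ge_0). lra.
    - rewrite Cmod_mult. apply Rmult_le_compat; auto using Cmod_ge_0. }
  destruct (Hv z Hz) as [_ [_ [_ [V4 [V5 _]]]]].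
  assert (EB : Cmod (e1 z) <= exp (- Im z) * (11/10)).
  { unfold e1. rewrite Cmod_mult, Cmod_expi. apply Rmult_le_compat_l; [left; apply exp_pos|]. lra. }
  assert (EB1 : Cmod (e1' z) <= exp (- Im z) * (21/10)).
  { unfold e1'. rewrite Cmod_mult, Cmod_expi. apply Rmult_le_compat_l; [left; apply exp_pos|].
    eapply Rle_trans; [apply Cmod_triangle|]. rewrite Cmod_mult, Cmod_Ci. lra. }
  unfold Wr. eapply Rle_trans; [apply Cmod_tri_minus|]. rewrite !Cmod_mult.
  apply Rle_trans with (Cmod z * (2 * M) * (exp (- Im z) * (21/10)) + Cmod z * (3 * M) * (exp (- Im z) * (11/10))).
  - apply Rplus_le_compat; apply Rmult_le_compat; auto using Cmod_ge_0.
  - pose proof (exp_pos (- Im z)). assert (0 <= M * Cmod z * exp (- Im z)) by (repeat apply Rmult_le_pos; lra). nra. }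
assert (W00 : forall z, Sd z -> Wr z = RtoC 0).
{ intros z Hz.
  assert (HM0 : 0 <= M) by (eapply Rle_trans; [apply Cmod_ge_0|apply (HMb z (Sd_Dp z Hz))]).
  assert (Z : Cmod (Wr z) <= 0).
  { apply (exp_lim0 (8 * M * (Cmod z + 1))). { pose proof (Cmod_ge_0 z). apply Rmult_le_pos; lra. }
    intros n. rewrite <- (Cd_zero_const Wr z (z + RtoC (INR n) * Ci)%C).
    - assert (Hzn := Sd_stable z (INR n) Hz (pos_INR n)). eapply Rle_trans; [apply WB, Hzn|].
      rewrite im_zri. pose proof (pos_INR n). assert (Hi : RR < Im z) by apply Hz. unfold RR in Hi.
      assert (exp (- (Im z + INR n)) <= exp (- INR n)) by (apply exp_le_compat; lra).
      assert (Cmod (z + RtoC (INR n) * Ci) <= Cmod z + INR n).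
      { eapply Rle_trans; [apply Cmod_triangle|]. rewrite Cmod_mult, Cmod_Ci, Cmod_RtoC_nonneg by lra. lra. }
      pose proof (Cmod_ge_0 z). pose proof (exp_pos (- (Im z + INR n))). pose proof (Cmod_ge_0 (z + RtoC (INR n) * Ci)).
      apply Rmult_le_compat; auto; [apply Rmult_le_pos; lra|lra|].
      replace (8 * M * (Cmod z + 1) * (INR n + 1)) with (8 * M * ((Cmod z + 1) * (INR n + 1))) by ring. apply Rmult_le_compat_l; [lra|]. nra.
    - intros t Ht. apply W0. replace (z + RtoC t * (z + RtoC (INR n) * Ci - z))%C with (z + RtoC (t * INR n) * Ci)%C by (rewrite RtoC_mult; ring).
      apply Sd_stable; [exact Hz|]. pose proof (pos_INR n). nra. }
  apply Cmod_eq_0. pose proof (Cmod_ge_0 (Wr z)). lra. }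
(* A point of the axis just above [RR], fixed by [mir], whose modulus 3.61 has the rational square
   root 1.9. *)
set (z0 := (RtoC (361/100) * Ci)%C).
assert (Hz0 : Sd z0).
{ unfold Sd, z0, del, RR. replace (Re (RtoC (361/100) * Ci)) with 0 by (unfold Ci; Csimp).
  replace (Im (RtoC (361/100) * Ci)) with (361/100) by (unfold Ci; Csimp). repeat split; lra. }
set (c := (dX z0 * / e1 z0)%C).
exists v1, c. split; [exact Hv1|]. split.
- unfold c. rewrite Cmod_mult, Cmod_inv by (apply Hne, Hz0).
  assert (Em : Cmod z0 = 361/100) by (unfold z0; rewrite Cmod_mult, Cmod_Ci, Cmod_RtoC_nonneg; lra).
  assert (Hzp := Hd z0 (Sd_Dp z0 Hz0)). assert (Hzm := Hd (mir z0) (Qd_mir z0 (Sd_Qd z0 Hz0))).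
  assert (Emir : mir z0 = z0). { unfold mir, z0. apply Ceq; unfold Cconj, Ci; Csimp. }
  rewrite Emir in Hzm.
  (* The fourth power of [z0] is real, so the terms [cP / z0^4] cancel between [H] and its mirror
     image and only the two remainders of [decayH] count. *)
  assert (DB : Cmod (dX z0) <= 2 * (Bp * wp z0)).
  { unfold dX. assert (Hn := slit_neq_0 _ (proj1 (Dp_slit z0 (Sd_Dp z0 Hz0)))).
    replace (H z0 - mirf H z0)%C with ((H z0 + RtoC cP * / (z0 * z0 * z0 * z0)) - Cconj (H z0 + RtoC cP * / (z0 * z0 * z0 * z0)))%C.
    - rewrite Cmod_mult. rewrite Cmod_mult.
      assert (Cmod ((H z0 + RtoC cP * / (z0 * z0 * z0 * z0)) - Cconj (H z0 + RtoC cP * / (z0 * z0 * z0 * z0))) <= 2 * (Rpower (Cmod z0) (-1/2) * (Bp * wp z0))).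
      { eapply Rle_trans; [apply Cmod_tri_minus|]. rewrite Cmod_conj. lra. }
      unfold rs. rewrite Cmod_Cpower. rewrite Em in *.
      set (p := Rpower (361/100) (-1/2)) in *. assert (Hp : p * p * (361/100) = 1).
      { unfold p. rewrite <- Rpower_plus. replace (-1/2 + -1/2) with (- INR 1) by (simpl; lra). rewrite Rpower_neg_nat by lra. simpl. field. }
      assert (0 < p) by apply Rpower_pos.
      apply Rle_trans with (p * (361/100) * (2 * (p * (Bp * wp z0)))); [apply Rmult_le_compat_l; [nra|assumption]|].
      replace (p * (361 / 100) * (2 * (p * (Bp * wp z0)))) with (2 * (p * p * (361/100)) * (Bp * wp z0)) by ring. rewrite Hp. lra.
    - unfold mirf. rewrite Emir. rewrite Cconj_plus, Cconj_mult, Cconj_R, Cconj_inv4 by exact Hn.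
      replace (Cconj z0) with (- z0)%C by (rewrite <- Emir at 1; unfold mir; ring).
      field. exact Hn. }
  assert (WBd : wp z0 <= / (361/100) ^ 4 * (10/19)).
  { unfold wp. eapply Rle_trans; [apply (Rpower_anti _ (361/100))|].
    - split; [lra|]. pose proof (im_le_shift z0 del) as I. replace (Im z0) with (361/100) in I by (unfold z0, Ci; Csimp). exact I.
    - lra.
    - replace (-9/2) with (- INR 4 + - / 2) by (simpl; lra). rewrite Rpower_plus, Rpower_neg_nat by lra.
      rewrite Rpower_Ropp, Rpower_sqrt by lra. replace (361/100) with ((19/10) * (19/10)) at 2 by field. rewrite sqrt_square by lra. lra. }
  assert (LB1 : / (381/10) * (9/10) <= Cmod (e1 z0)).
  { unfold e1. rewrite Cmod_mult, Cmod_expi. replace (Im z0) with (361/100) by (unfold z0, Ci; Csimp).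
    rewrite exp_Ropp. apply Rmult_le_compat; try lra; [|now apply Hlow].
    apply Rinv_le_contravar; [apply exp_pos|apply exp_361]. }
  (* Numerically [15 / (3.61^4 * 1.9) * 38.1 * 10/9] is about 1.97. *)
  apply (Rmult_le_reg_r (Cmod (e1 z0))); [lra|]. rewrite Rmult_assoc, Rinv_l by lra. unfold Bp in DB. lra.
- intros z Hz. unfold c. assert (Hr : (dX z * / e1 z = dX z0 * / e1 z0)%C).
  { apply (Cd_zero_const (fun z => dX z * / e1 z)%C z0 z). intros t Ht.
    assert (Ht1 := Sd_convex z0 z t Hz0 Hz Ht). set (x := (z0 + RtoC t * (z - z0))%C) in *.
    destruct (dX_ode x Ht1) as [D1 _].
    eapply Cd_eq; [|apply Cd_mult; [exact D1|apply Cd_inv; [apply Hne, Ht1|apply E1, Ht1]]].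
    assert (Wx : (dX x * e1' x - dX1 x * e1 x)%C = RtoC 0) by exact (W00 x Ht1).
    transitivity (- (dX x * e1' x - dX1 x * e1 x) * / (e1 x * e1 x))%C; [field; apply Hne, Ht1|].
    rewrite Wx. ring. }
  fold (e1 z). rewrite <- Hr. field. apply Hne, Hz.
Qed.

(** The quadratic equation on [Qd] with limit [c] has a solution [v], and [mirf H + rs exp(i z) v]
    is the candidate. On the strip [c v1] is a fixed point of the same operator, because there
    [bQ + gQ * (c v1) = bS]; uniqueness identifies it with [v], so the candidate extends [H]. *)
Theorem left_extension : exists L, Hsol Qd L /\ forall z, Sd z -> L z = H z.
Proof.
destruct left_coefficient as [v1 [c [Hv1 [Hc HX]]]].
assert (CQ := contr_Q H Hh Hd c Hc). assert (CS := contr_S H Hh Hd).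
destruct (fixsol_exists _ _ _ _ _ _ _ _ _ _ _ _ _ _ _ _ _ kernel_Kx CQ) as [v Hv].
destruct (fixsol_ode _ _ _ _ _ _ _ _ _ _ _ _ _ _ _ _ _ kernel_Kx CQ v Hv) as [w1 [w2 Hw]].
assert (CQS := contr_sub _ Sd _ _ _ _ _ _ _ _ _ _ _ CQ Sd_open Sd_stable Sd_Qd).
assert (HvS := fixsol_sub _ Sd _ _ _ _ _ _ _ _ _ Hv Sd_Qd).
assert (Hcv : fixsol Sd Ci Kx (fun _ => RtoC 0) (bQ H) gQ (fun _ => 1) (7/2) c (fun z => c * v1 z)%C).
{ destruct Hv1 as [[K1 K2] K3]. split; [split|].
  - apply hol2_mult; [apply hol2_const|exact K1].
  - intros z Hz. rewrite Cmod_mult. specialize (K2 z Hz). pose proof (Cmod_ge_0 (v1 z)). pose proof (Cmod_ge_0 c). nra.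
  - intros z Hz. unfold step. rewrite <- (K3 z Hz) at 1. unfold step.
    destruct (G_hol2 Sd (fun _ => RtoC 0) (bS H) (fun _ => RtoC 0) (hol2_const _ _) (ct_be _ _ _ _ _ _ _ _ _ _ _ _ CS) (hol2_const _ _) v1 K1) as [g1 [g2 [M HM]]].
    rewrite (J_ext Kx Ci _ (fun z => c * G (fun _ => RtoC 0) (bS H) (fun _ => RtoC 0) v1 z)%C z).
    + rewrite (J_scal Sd Ci Kx (fun r => exp (- (2 * r))) _ g1 1 c z Sd_open Sd_stable Cmod_Ci).
      * ring.
      * apply kernel_Kx.
      * intros x Hx. now apply HM.
      * exact Hz.
      * intros r Hr. rewrite Cmod_mult, Cmod_R. pose proof (Kx_bound r Hr). rewrite Rabs_pos_eq by lra.
        assert (Hzr := Sd_stable z r Hz Hr).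
        assert (T := ct_TNB _ _ _ _ _ _ _ _ _ _ _ _ CS z r Hz Hr).
        assert (Gb := G_bound Sd (fun _ => RtoC 0) (bS H) (fun _ => RtoC 0) (fun _ => 1) (11/10) v1 _ Hzr (K2 _ Hzr)).
        pose proof (Cmod_ge_0 (G (fun _ => RtoC 0) (bS H) (fun _ => RtoC 0) v1 (z + RtoC r * Ci)%C)). nra.
    + intros r Hr. set (x := (z + RtoC r * Ci)%C). assert (Hx : Sd x) by now apply Sd_stable.
      specialize (HX x Hx). unfold dX in HX. assert (Hn := slit_neq_0 _ (proj1 (Dp_slit x (Sd_Dp x Hx)))).
      assert (E : (H x = mirf H x + rs x * (c * (cexp (Ci * x) * v1 x)))%C).
      { rewrite <- HX. pose proof (rs_inv x Hn) as Er. pose proof (rs_neq_0 x).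
        replace (rs x * (rs x * x * (H x - mirf H x)))%C with ((rs x * rs x * x) * (H x - mirf H x))%C by ring.
        replace (rs x * rs x * x)%C with (RtoC 1) by (rewrite Er at 3; field; assumption). ring. }
      unfold G, bQ, bS, gQ. rewrite E. field. exact Hn. }
assert (Heq : forall z, Sd z -> v z = (c * v1 z)%C).
{ intros z Hz. exact (fixsol_unique _ _ _ _ _ _ _ _ _ _ _ _ _ _ _ _ _ kernel_Kx CQS v (fun z => c * v1 z)%C HvS Hcv z Hz). }
set (E z := (rs z * cexp (Ci * z))%C).
exists (fun z => mirf H z + E z * v z)%C. split.
- exists (fun z => - mirf H1 z + E z * ((Ci - / (2 * z)) * v z + w1 z))%C,
   (fun z => mirf H2 z + E z * ((Ci - / (2 * z)) * ((Ci - / (2 * z)) * v z + w1 z) + (/ (2 * z * z) * v z + (Ci - / (2 * z)) * w1 z + w2 z)))%C.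
  intros z Hz. destruct (Qd_slit z Hz) as [Hs _]. assert (Hn := slit_neq_0 z Hs).
  destruct (Hm_ode z Hz) as [B1 [B2 B3]]. destruct (Hw z Hz) as [V1 [V2 [V3 _]]].
  assert (H2n : (2 * z)%C <> RtoC 0) by (apply Cmult_neq_0; [intros F; apply RtoC_inj in F; lra|exact Hn]).
  assert (EE : Cd E z (E z * (Ci - / (2 * z)))%C).
  { unfold E. eapply Cd_eq; [|apply Cd_mult; [apply Cd_rs, Hs|apply Cd_expi]]. rewrite RtoC_mhalf. field. exact Hn. }
  split; [|split].
  + eapply Cd_eq; [|apply Cd_plus; [exact B1|apply Cd_mult; [exact EE|exact V1]]]. ring.
  + eapply Cd_eq; [|apply Cd_plus; [exact B2|apply Cd_mult; [exact EE|apply Cd_plus; [apply Cd_mult;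
      [apply Cd_minus; [apply Cd_const|apply (Cd_inv (fun z => 2 * z)%C); [exact H2n|apply Cd_scal, Cd_id]]|exact V1]|exact V2]]]].
    cbv beta. field. exact Hn.
  + assert (V4 : w2 z = (- (bQ H z * v z + gQ z * (v z * v z) + 2 * Ci * w1 z))%C).
    { replace (w2 z) with (- (Ci * Ci * w2 z))%C by (rewrite Ci2; ring). rewrite V3. unfold G.
      replace (RtoC (-2)) with (- (2))%C by (apply Ceq; Csimp). ring. }
    assert (E3 : (mirf H2 z = mirf H1 z / z - mirf H z + (- (mirf H z * mirf H z) / 2 - RtoC cP / (z * z * z * z)))%C) by (rewrite <- B3; field; exact Hn).
    rewrite V4, E3. unfold bQ, gQ. fold (E z).
    (* The square of [Ci] is isolated for rewriting, since [field] treats [Ci] as an atom. *)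
    replace ((Ci - / (2 * z)) * ((Ci - / (2 * z)) * v z + w1 z))%C with (Ci * Ci * v z + (- (Ci / z) + / (4 * z * z)) * v z + (Ci - / (2 * z)) * w1 z)%C by (field; exact Hn).
    rewrite Ci2. field. exact Hn.
- intros z Hz. rewrite (Heq z Hz). unfold E.
  specialize (HX z Hz). unfold dX in HX. assert (Hn := slit_neq_0 _ (proj1 (Dp_slit z (Sd_Dp z Hz)))).
  replace (rs z * cexp (Ci * z) * (c * v1 z))%C with (rs z * (c * (cexp (Ci * z) * v1 z)))%C by ring.
  rewrite <- HX. pose proof (rs_inv z Hn) as Er. pose proof (rs_neq_0 z).
  replace (rs z * (rs z * z * (H z - mirf H z)))%C with ((rs z * rs z * z) * (H z - mirf H z))%C by ring.
  replace (rs z * rs z * z)%C with (RtoC 1) by (rewrite Er at 3; field; assumption). ring.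
Qed.
End LeftExtension.

(** * The outer solution and its transplant to the s-plane *)

(** The equation is a parameter, so the same gluing lemmas serve [PH] in the variable [xi] and [PW]
    in the variable [s]. *)
Definition sol2 (P : C -> C -> C -> C -> Prop) (D : C -> Prop) (f : C -> C) : Prop :=
  exists f1 f2 : C -> C, forall z, D z -> Cd f z (f1 z) /\ Cd f1 z (f2 z) /\ P z (f z) (f1 z) (f2 z).

(* Junk value where [f] is not differentiable. *)
Definition Cder (f : C -> C) (z : C) : C := epsilon (inhabits (RtoC 0)) (fun l => Cd f z l).

Lemma Cder_eq (f : C -> C) (z l : C) : Cd f z l -> Cder f z = l.
Proof.
intros H. apply (Cd_unique f z); [|exact H]. unfold Cder. apply epsilon_spec. now exists l.
Qed.

Lemma sol2_Cder (P : C -> C -> C -> C -> Prop) (D : C -> Prop) (f : C -> C) : Copen D -> sol2 P D f ->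
  forall z, D z -> Cd f z (Cder f z) /\ Cd (Cder f) z (Cder (Cder f) z) /\ P z (f z) (Cder f z) (Cder (Cder f) z).
Proof.
intros HD [f1 [f2 H]] z Hz.
assert (E1 : forall w, D w -> Cder f w = f1 w) by (intros w Hw; apply Cder_eq, H, Hw).
assert (K : Cd (Cder f) z (f2 z)).
{ destruct (HD z Hz) as [r [Hr Hb]]. apply (Cd_ext_loc f1 (Cder f) z _ r Hr); [|apply H, Hz].
  intros w Hw. symmetry. apply E1. now apply Hb. }
rewrite (Cder_eq _ _ _ K), (E1 z Hz). destruct (H z Hz) as [A1 [A2 A3]]. auto.
Qed.

(** Derivatives are local and unique, so choosing them by [Cder] merges the local witnesses into
    global ones. Piecewise defined functions become solutions in this way. *)
Lemma sol2_local (P : C -> C -> C -> C -> Prop) (D : C -> Prop) (f : C -> C) :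
  (forall z, D z -> exists E g, Copen E /\ E z /\ sol2 P E g /\ forall w, E w -> f w = g w) -> sol2 P D f.
Proof.
intros H. exists (Cder f), (Cder (Cder f)). intros z Hz.
destruct (H z Hz) as [E [g [HE [Ez [[g1 [g2 Hg]] Hfg]]]]].
apply (sol2_Cder P E f HE); [|exact Ez]. exists g1, g2. intros w Hw. destruct (Hg w Hw) as [A1 [A2 A3]].
split; [|split; [exact A2|now rewrite Hfg]].
destruct (HE w Hw) as [r [Hr Hb]]. apply (Cd_ext_loc g f w _ r Hr); [|exact A1].
intros x Hx. symmetry. apply Hfg. now apply Hb.
Qed.

Lemma sol2_sub (P : C -> C -> C -> C -> Prop) (D E : C -> Prop) (f : C -> C) : (forall z, E z -> D z) -> sol2 P D f -> sol2 P E f.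
Proof. intros HE [f1 [f2 H]]. exists f1, f2. auto. Qed.

Definition PH (z h h1 h2 : C) : Prop := (h2 + h1 / z + h = - (h * h) / 2 - RtoC cP / (z * z * z * z))%C.

Definition Om (z : C) : Prop := slit z /\ 362/100 < Cmod z.

Lemma Om_open : Copen Om.
Proof.
apply (Copen_ext (fun z => slit z /\ 362/100 < Cmod (z - 0))).
- intros z. unfold Om. now replace (z - 0)%C with z by ring.
- apply Copen_and; [apply Copen_slit|apply Copen_mod_gt].
Qed.

(** The conjugate of [H] satisfies the same hypotheses as [H]; [left_extension] applied to it and
    conjugated back reaches the lower left quadrant. The negative axis stays a cut, as the two
    continuations need not match there. *)
Lemma outer_exists : exists H Ho : C -> C, sol2 PH Om Ho /\
  (forall z, 0 <= Re z -> Ho z = H z) /\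
  (exists H1 H2 phi phi1 : C -> C, Hode Dp H H1 H2 /\
    forall z, Dp z -> H z = (rs z * phi z - RtoC cP * / (z * z * z * z))%C /\
    H1 z = (rs z * (phi1 z - phi z / (2 * z)) + 4 * RtoC cP / (z * z * z * z * z))%C /\
    Cmod (phi z) <= Bp * wp z /\ Cmod (phi1 z) <= Bp * wp z).
Proof.
destruct H_plus_exists as [H [H1 [H2 [phi [phi1 [HH [Hh HP]]]]]]].
assert (Hd : decayH H).
{ intros z Hz. destruct (HP z Hz) as [E [_ [B _]]]. rewrite E.
  replace (rs z * phi z - RtoC cP * / (z * z * z * z) + RtoC cP * / (z * z * z * z))%C with (rs z * phi z)%C by ring.
  rewrite Cmod_mult. unfold rs at 1. rewrite Cmod_Cpower. apply Rmult_le_compat_l; [left; apply Rpower_pos|exact B]. }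
destruct (left_extension H H1 H2 HH Hh Hd) as [Lu [HLu ELu]].
assert (Dc : forall z, Dp (Cconj z) <-> Dp z).
{ intros z. unfold Dp. replace (Re (Cconj z)) with (Re z) by (unfold Cconj; Csimp).
  replace (Cconj z + RtoC del)%C with (Cconj (z + RtoC del)) by (rewrite Cconj_plus, Cconj_R; reflexivity). rewrite Cmod_conj. reflexivity. }
set (cj (f : C -> C) z := Cconj (f (Cconj z))).
assert (Hn : forall z, Dp z -> z <> RtoC 0) by (intros z Hz; apply slit_neq_0, Dp_slit, Hz).
assert (HHc : Hode Dp (cj H) (cj H1) (cj H2)).
{ intros z Hz. apply (Hode_conj Dp H H1 H2 Hn HH). now apply Dc. }
assert (Hhc : hol2 Dp (cj H)).
{ apply (hol2_sub (fun z => Dp (Cconj z))); [intros z; apply Dc|]. now apply hol2_conj. }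
assert (Hdc : decayH (cj H)).
{ intros z Hz. assert (Hz' := proj2 (Dc z) Hz). specialize (Hd _ Hz'). rewrite Cmod_conj in Hd.
  assert (Ew : wp (Cconj z) = wp z).
  { unfold wp. replace (Cconj z + RtoC del)%C with (Cconj (z + RtoC del)) by (rewrite Cconj_plus, Cconj_R; reflexivity). now rewrite Cmod_conj. }
  rewrite Ew in Hd. eapply Rle_trans; [|exact Hd]. apply Req_le. rewrite <- Cmod_conj. f_equal. unfold cj.
  rewrite Cconj_plus, Cconj_conj, Cconj_mult, Cconj_R, Cconj_inv4 by now apply Hn. reflexivity. }
destruct (left_extension (cj H) (cj H1) (cj H2) HHc Hhc Hdc) as [Ld [HLd ELd]].
(* Each piece is a solution near interior points; across the imaginary axis the strip [Sd], or its
   conjugate, is a neighbourhood on which the pieces coincide with [H]. *)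
set (Ho z := if Rle_dec 0 (Re z) then H z else if Rlt_dec 0 (Im z) then Lu z else cj Ld z).
exists H, Ho. split; [|split].
2:{ intros z Hz. unfold Ho. destruct (Rle_dec 0 (Re z)); [reflexivity|contradiction]. }
2:{ exists H1, H2, phi, phi1. split; [exact HH|exact HP]. }
assert (SH : sol2 PH Dp H) by (exists H1, H2; exact HH).
assert (SLd : sol2 PH (fun z => Qd (Cconj z)) (cj Ld)).
{ destruct HLd as [g1 [g2 Hg]]. exists (cj g1), (cj g2). intros z Hz. apply (Hode_conj Qd Ld g1 g2); auto.
  intros w Hw. apply slit_neq_0, Qd_slit, Hw. }
assert (Cco : forall E : C -> Prop, Copen E -> Copen (fun z => E (Cconj z))).
{ intros E HE z Hz. destruct (HE _ Hz) as [r [Hr Hb]]. exists r. split; [exact Hr|]. intros w Hw. apply Hb.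
  rewrite <- Cconj_minus, Cmod_conj. exact Hw. }
assert (Hshift : forall z, Re z <= 0 -> Cmod z <= Cmod (z - RtoC del)).
{ intros z Hz. assert (Cmod z ^ 2 <= Cmod (z - RtoC del) ^ 2).
  { rewrite !Cmod2_alt. replace (Re (z - RtoC del)) with (Re z - del) by Csimp. replace (Im (z - RtoC del)) with (Im z) by Csimp. unfold del. nra. }
  pose proof (Cmod_ge_0 z). pose proof (Cmod_ge_0 (z - RtoC del)). nra. }
apply sol2_local. intros z [Hs Hm].
destruct (Rle_dec 0 (Re z)) as [Hre|Hre].
- assert (HzD : Dp z).
  { split; [unfold del; lra|]. assert (Cmod z ^ 2 <= Cmod (z + RtoC del) ^ 2).
    { rewrite !Cmod2_alt. replace (Re (z + RtoC del)) with (Re z + del) by Csimp. replace (Im (z + RtoC del)) with (Im z) by Csimp. unfold del. nra. }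
    pose proof (Cmod_ge_0 z). pose proof (Cmod_ge_0 (z + RtoC del)). unfold RR. nra. }
  destruct (Rlt_dec 0 (Re z)) as [Hr|Hr].
  + exists (fun z => 0 < Re z /\ Dp z), H. split; [apply Copen_and; [apply Copen_re_gt|apply Dp_open]|]. split; [now split|].
    split; [apply (sol2_sub PH Dp); [intros w Hw; apply Hw|exact SH]|].
    intros w [Hw _]. unfold Ho. destruct (Rle_dec 0 (Re w)); [reflexivity|lra].
  + assert (Hr0 : Re z = 0) by lra.
    pose proof (Cmod_le_re_im z) as Hri. rewrite Hr0, Rabs_R0, Rplus_0_l in Hri.
    destruct (Rlt_dec 0 (Im z)) as [Hi|Hi].
    * rewrite Rabs_pos_eq in Hri by lra.
      exists Sd, H. split; [apply Sd_open|]. split; [unfold Sd, del, RR; repeat split; lra|].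
      split; [apply (sol2_sub PH Dp); [apply Sd_Dp|exact SH]|].
      intros w Hw. unfold Ho. destruct (Rle_dec 0 (Re w)); [reflexivity|].
      destruct (Rlt_dec 0 (Im w)); [now apply ELu|]. exfalso. destruct Hw as [_ Hw]. unfold RR in Hw. lra.
    * rewrite Rabs_left1 in Hri by lra.
      exists (fun z => Sd (Cconj z)), H. split; [apply Cco, Sd_open|].
      split; [unfold Sd, del, RR; replace (Re (Cconj z)) with (Re z) by (unfold Cconj; Csimp); replace (Im (Cconj z)) with (- Im z) by (unfold Cconj; Csimp); repeat split; lra|].
      split; [apply (sol2_sub PH Dp); [intros w Hw; apply Dc, Sd_Dp, Hw|exact SH]|].
      intros w Hw. unfold Ho. destruct (Rle_dec 0 (Re w)); [reflexivity|].
      destruct (Rlt_dec 0 (Im w)).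
      -- exfalso. destruct Hw as [_ Hw]. replace (Im (Cconj w)) with (- Im w) in Hw by (unfold Cconj; Csimp). unfold RR in Hw. lra.
      -- unfold cj. rewrite ELd by exact Hw. unfold cj. rewrite !Cconj_conj. reflexivity.
- assert (Hr : Re z < 0) by lra. assert (Hsh := Hshift z ltac:(lra)).
  destruct (Rlt_dec 0 (Im z)) as [Hi|Hi].
  + exists (fun z => Re z < 0 /\ Qd z), Lu. split; [apply Copen_and; [apply Copen_re_lt|apply Qd_open]|].
    split; [unfold Qd, del, RR in *; repeat split; lra|].
    split; [apply (sol2_sub PH Qd); [intros w Hw; apply Hw|exact HLu]|].
    intros w [Hw [[_ Hw2] _]]. unfold Ho. destruct (Rle_dec 0 (Re w)); [lra|]. destruct (Rlt_dec 0 (Im w)); [reflexivity|lra].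
  + assert (Hi0 : Im z < 0) by (destruct Hs as [Hs|Hs]; lra).
    exists (fun z => Re z < 0 /\ Qd (Cconj z)), (cj Ld). split; [apply Copen_and; [apply Copen_re_lt|apply Cco, Qd_open]|].
    split.
    { split; [exact Hr|]. unfold Qd. replace (Cconj z - RtoC del)%C with (Cconj (z - RtoC del)) by (rewrite Cconj_minus, Cconj_R; reflexivity).
      rewrite Cmod_conj. replace (Re (Cconj z)) with (Re z) by (unfold Cconj; Csimp). replace (Im (Cconj z)) with (- Im z) by (unfold Cconj; Csimp).
      unfold del, RR in *. repeat split; lra. }
    split; [apply (sol2_sub PH (fun z => Qd (Cconj z))); [intros w Hw; apply Hw|exact SLd]|].
    intros w [Hw [[_ Hw2] _]]. replace (Im (Cconj w)) with (- Im w) in Hw2 by (unfold Cconj; Csimp).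
    unfold Ho. destruct (Rle_dec 0 (Re w)); [lra|]. destruct (Rlt_dec 0 (Im w)); [lra|reflexivity].
Qed.

(* With [s = cis (-PI/5) z] and [y = - cis (-2 PI/5) W s], PI reads [W'' = s - 6 W^2] and the variable
   [x] is [Ci * xi s]; the ray [arg z = PI/5] is the positive [s]-axis. *)
Definition xi (s : C) : C := (Cpower (24 * s) (5 / 4) / 30)%C.
Definition sg (s : C) : C := Cpower (s / 6) (1 / 2).
(** The sign of the term with 4/25 is opposite to that in [y_of_h] because the square of [Ci * xi]
    is [- xi^2]. *)
Definition Wof (H : C -> C) (s : C) : C := (sg s * (1 + 4 / (25 * (xi s * xi s)) + H (xi s)))%C.
Definition PW (z w w1 w2 : C) : Prop := (w2 = z - 6 * (w * w))%C.

Lemma Carg_scal (r : R) (s : C) : 0 < r -> s <> RtoC 0 -> Carg (RtoC r * s) = Carg s.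
Proof.
intros Hr Hs. destruct (polar_form s Hs) as [E Hb]. rewrite E at 1.
rewrite Cmult_assoc, <- RtoC_mult. apply Carg_polar; [|exact Hb]. apply Rmult_lt_0_compat; [exact Hr|now apply Cmod_gt_0].
Qed.

Lemma Cpower_scal (r a : R) (s : C) : 0 < r -> s <> RtoC 0 -> Cpower (RtoC r * s) a = (RtoC (Rpower r a) * Cpower s a)%C.
Proof.
intros Hr Hs. unfold Cpower. rewrite Carg_scal, Cmod_mult, Cmod_RtoC_nonneg by (exact Hs || lra).
rewrite <- Rpower_mult_distr by (exact Hr || now apply Cmod_gt_0). rewrite RtoC_mult. ring.
Qed.

Lemma slit_scal (r : R) (s : C) : 0 < r -> slit s -> slit (RtoC r * s).
Proof.
intros Hr [H|H]; [left; replace (Re (RtoC r * s)) with (r * Re s) by Csimp|right; replace (Im (RtoC r * s)) with (r * Im s) by Csimp].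
- now apply Rmult_lt_0_compat.
- apply Rmult_integral_contrapositive_currified; lra.
Qed.

Lemma div6 (s : C) : (s / 6 = RtoC (/ 6) * s)%C.
Proof. rewrite RtoC_inv by lra. field. Qed.

Lemma xi_neq_0 (s : C) : xi s <> RtoC 0.
Proof.
unfold xi, Cdiv. apply Cmult_neq_0; [apply Cpower_neq_0|].
rewrite <- RtoC_inv by lra. intros E. apply RtoC_inj in E. lra.
Qed.

Lemma sg_neq_0 (s : C) : sg s <> RtoC 0.
Proof. apply Cpower_neq_0. Qed.

Lemma Cd_xi (s : C) : slit s -> Cd xi s (5 * xi s / (4 * s))%C.
Proof.
intros Hs. assert (Hn := slit_neq_0 s Hs). unfold xi at 1.
apply (Cd_ext (fun s => / 30 * Cpower (24 * s) (5/4))%C); [intros w; unfold Cdiv; ring|].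
eapply Cd_eq; [|apply Cd_scal, (Cd_comp (fun w => Cpower w (5/4)) (fun s => 24 * s)%C); [apply Cd_scal, Cd_id|apply Cd_Cpower, slit_scal; [lra|exact Hs]]].
assert (H24 : (24 * s)%C <> RtoC 0) by (apply slit_neq_0, slit_scal; [lra|exact Hs]).
replace (5/4 - 1) with (5/4 - INR 1) by (simpl; lra). rewrite Cpower_sub_nat by exact H24. unfold xi.
rewrite (RtoC_div 5 4) by lra. simpl. field. exact Hn.
Qed.

Lemma Cd_sg (s : C) : slit s -> Cd sg s (sg s / (2 * s))%C.
Proof.
intros Hs. assert (Hn := slit_neq_0 s Hs).
apply (Cd_ext (fun s => Cpower (RtoC (/ 6) * s) (1/2))); [intros w; unfold sg; now rewrite div6|].
eapply Cd_eq; [|apply (Cd_comp (fun w => Cpower w (1/2)) (fun s => RtoC (/ 6) * s)%C); [apply Cd_scal, Cd_id|apply Cd_Cpower, slit_scal; [lra|exact Hs]]].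
assert (H6 : (RtoC (/ 6) * s)%C <> RtoC 0) by (apply slit_neq_0, slit_scal; [lra|exact Hs]).
replace (1/2 - 1) with (1/2 - INR 1) by (simpl; lra). rewrite Cpower_sub_nat by exact H6. unfold sg. rewrite div6.
rewrite (RtoC_div 1 2) by lra. assert (H60 : RtoC (/ 6) <> RtoC 0) by (intros E; apply RtoC_inj in E; lra). simpl. field. split; assumption.
Qed.

Lemma sg_sq (s : C) : s <> RtoC 0 -> (s = 6 * (sg s * sg s))%C.
Proof.
intros Hs. unfold sg. rewrite <- Cpower_add. replace (1/2 + 1/2) with 1 by field.
rewrite Cpower_1; [field|]. rewrite div6. apply Cmult_neq_0; [|exact Hs]. intros E. apply RtoC_inj in E. lra.
Qed.

(** Both sides are multiples of s^(5/2), and 24^(5/2) / 900 = 192/25 * 6^(-1/2). Together with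
    [sg_sq] this eliminates the fractional powers. *)
Lemma xi_sq (s : C) : s <> RtoC 0 -> (xi s * xi s = RtoC (192/25) * sg s * s * s)%C.
Proof.
intros Hs. unfold xi, sg. rewrite div6, !Cpower_scal by (lra || exact Hs).
assert (E1 : (Cpower s (5/4) * Cpower s (5/4) = Cpower s (1/2) * s * s)%C).
{ rewrite <- Cpower_add. replace (5/4 + 5/4) with (1/2 + 1 + 1) by field. rewrite !Cpower_add, Cpower_1 by exact Hs. reflexivity. }
assert (E2 : Rpower 24 (5/4) * Rpower 24 (5/4) = 6912 * Rpower (/ 6) (1/2)).
{ rewrite <- Rpower_plus. replace (5/4 + 5/4) with (INR 2 + / 2) by (simpl; lra). rewrite Rpower_plus, Rpower_pow, Rpower_sqrt by lra.
  replace (1/2) with (/ 2) by lra. rewrite Rpower_sqrt by lra. replace 24 with ((/ 6) * (12 * 12)) at 2 by field.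
  rewrite sqrt_mult, sqrt_square by lra. simpl. field. }
replace (RtoC (Rpower 24 (5 / 4)) * Cpower s (5 / 4) / 30 * (RtoC (Rpower 24 (5 / 4)) * Cpower s (5 / 4) / 30))%C
  with (RtoC (Rpower 24 (5 / 4)) * RtoC (Rpower 24 (5 / 4)) * (Cpower s (5 / 4) * Cpower s (5 / 4)) / 900)%C by field.
rewrite E1, <- RtoC_mult, E2, RtoC_mult. rewrite RtoC_div by lra. field.
Qed.

Lemma Wof_sol (D : C -> Prop) (H : C -> C) : sol2 PH D H -> sol2 PW (fun s => slit s /\ D (xi s)) (Wof H).
Proof.
intros [H1 [H2 HH]].
exists (fun s => sg s / (2 * s) * (1 + 4 / (25 * (xi s * xi s)) + H (xi s)) + sg s * (5 * xi s / (4 * s)) * (- (8) / (25 * (xi s * xi s * xi s)) + H1 (xi s)))%C,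
 (fun s => - sg s / (4 * s * s) * (1 + 4 / (25 * (xi s * xi s)) + H (xi s))
   + 2 * (sg s / (2 * s)) * (5 * xi s / (4 * s)) * (- (8) / (25 * (xi s * xi s * xi s)) + H1 (xi s))
   + sg s * (5 * xi s / (16 * s * s) * (- (8) / (25 * (xi s * xi s * xi s)) + H1 (xi s))
     + (5 * xi s / (4 * s)) * (5 * xi s / (4 * s)) * (24 / (25 * (xi s * xi s * xi s * xi s)) + H2 (xi s))))%C.
intros s [Hs HD]. assert (Hn := slit_neq_0 s Hs). assert (Hx := xi_neq_0 s). assert (Hg := sg_neq_0 s).
destruct (HH _ HD) as [A1 [A2 A3]]. assert (Dx := Cd_xi s Hs). assert (Dg := Cd_sg s Hs).
assert (H2s : (2 * s)%C <> RtoC 0) by (apply Cmult_neq_0; [intros F; apply RtoC_inj in F; lra|exact Hn]).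
assert (H4s : (4 * s)%C <> RtoC 0) by (apply Cmult_neq_0; [intros F; apply RtoC_inj in F; lra|exact Hn]).
assert (H25 : RtoC 25 <> RtoC 0) by (intros F; apply RtoC_inj in F; lra).
assert (Hx2 : (25 * (xi s * xi s))%C <> RtoC 0) by (apply Cmult_neq_0; [exact H25|apply Cmult_neq_0; exact Hx]).
assert (Hx3 : (25 * (xi s * xi s * xi s))%C <> RtoC 0) by (apply Cmult_neq_0; [exact H25|apply Cmult_neq_0; [apply Cmult_neq_0; exact Hx|exact Hx]]).
assert (DH := Cd_comp H xi s _ _ Dx A1). assert (DH1 := Cd_comp H1 xi s _ _ Dx A2).
assert (Dk : Cd (fun s => 1 + 4 / (25 * (xi s * xi s)) + H (xi s))%C s ((5 * xi s / (4 * s)) * (- (8) / (25 * (xi s * xi s * xi s)) + H1 (xi s)))%C).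
{ eapply Cd_eq; [|apply Cd_plus; [apply Cd_plus; [apply Cd_const|apply Cd_scal, (Cd_inv (fun s => 25 * (xi s * xi s))%C); [exact Hx2|apply Cd_scal, Cd_mult; exact Dx]]|exact DH]].
  cbv beta. field. repeat split; assumption. }
assert (Dm : Cd (fun s => - (8) / (25 * (xi s * xi s * xi s)) + H1 (xi s))%C s ((5 * xi s / (4 * s)) * (24 / (25 * (xi s * xi s * xi s * xi s)) + H2 (xi s)))%C).
{ eapply Cd_eq; [|apply Cd_plus; [apply Cd_scal, (Cd_inv (fun s => 25 * (xi s * xi s * xi s))%C); [exact Hx3|apply Cd_scal, Cd_mult; [apply Cd_mult; exact Dx|exact Dx]]|exact DH1]].
  cbv beta. field. repeat split; assumption. }
split; [|split].
- eapply Cd_eq; [|apply Cd_mult; [exact Dg|exact Dk]]. cbv beta. ring.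
- eapply Cd_eq; [|apply Cd_plus; apply Cd_mult].
  2: { apply Cd_mult; [exact Dg|apply (Cd_inv (fun s => 2 * s)%C); [exact H2s|apply Cd_scal, Cd_id]]. }
  2: exact Dk.
  2: { apply Cd_mult; [exact Dg|]. apply Cd_mult; [apply Cd_scal, Dx|apply (Cd_inv (fun s => 4 * s)%C); [exact H4s|apply Cd_scal, Cd_id]]. }
  2: exact Dm.
  cbv beta. field. split; assumption.
- unfold PW, Wof. unfold PH in A3.
  assert (E2 : (H2 (xi s) = - (H1 (xi s) / xi s) - H (xi s) + (- (H (xi s) * H (xi s)) / 2 - RtoC cP / (xi s * xi s * xi s * xi s)))%C) by (rewrite <- A3; ring).
  rewrite E2. clear A3 E2 A1 A2 DH DH1 Dk Dm Dx Dg.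
  assert (S1 := sg_sq s Hn). assert (S2 := xi_sq s Hn). revert Hg Hx S1 S2.
  generalize (H (xi s)) (H1 (xi s)). intros h h1. generalize (xi s) (sg s). intros x g Hg Hx S1 S2.
  rewrite S1 in S2. rewrite RtoC_div in S2 by lra.
  (* A rational parametrization: [g = 25/6912 y^2], [x = y g^2] and [s = 6 g^2], so the equation
     turns into an identity of rational functions of [y]. *)
  set (y := (x / (g * g))%C). assert (Hy : y <> RtoC 0).
  { unfold y, Cdiv. apply Cmult_neq_0; [exact Hx|]. rewrite <- (Cmult_1_l (/ _)). intros F.
    assert (F2 : (1 * / (g * g) * (g * g))%C = RtoC 0) by (rewrite F; ring). rewrite <- Cmult_assoc, Cinv_l in F2 by (apply Cmult_neq_0; exact Hg).
    rewrite Cmult_1_l in F2. apply RtoC_inj in F2. lra. }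
  assert (Eg : (g = 25 / 6912 * (y * y))%C).
  { unfold y. replace (25 / 6912 * (x / (g * g) * (x / (g * g))))%C with (25 / 6912 * (x * x) / (g * g * g * g))%C by (field; exact Hg). rewrite S2. field. exact Hg. }
  assert (Ex : (x = y * (g * g))%C) by (unfold y; field; exact Hg).
  rewrite Ex, S1, Eg. unfold cP. rewrite RtoC_div by lra. field. exact Hy.
Qed.

(** * Complex series with geometric majorants *)

Fixpoint csum (f : nat -> C) (n : nat) : C :=
  match n with O => f O | S m => (csum f m + f (S m))%C end.

Lemma csum_re (f : nat -> C) (n : nat) : Re (csum f n) = sum_f_R0 (fun k => Re (f k)) n.
Proof. induction n; simpl; [reflexivity|]. rewrite <- IHn. Csimp. Qed.
Lemma csum_im (f : nat -> C) (n : nat) : Im (csum f n) = sum_f_R0 (fun k => Im (f k)) n.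
Proof. induction n; simpl; [reflexivity|]. rewrite <- IHn. Csimp. Qed.

Lemma csum_ext (f g : nat -> C) (n : nat) : (forall k, (k <= n)%nat -> f k = g k) -> csum f n = csum g n.
Proof. induction n; intros H; simpl; [apply H; lia|]. rewrite IHn, H by (intros; try apply H; lia). reflexivity. Qed.

Lemma csum_scal (c : C) (f : nat -> C) (n : nat) : (csum (fun k => c * f k) n = c * csum f n)%C.
Proof. induction n; simpl; [reflexivity|]. rewrite IHn. ring. Qed.

Lemma csum_bound (f : nat -> C) (b : nat -> R) (n : nat) : (forall k, (k <= n)%nat -> Cmod (f k) <= b k) ->
  Cmod (csum f n) <= sum_f_R0 b n.
Proof.
induction n; intros H; simpl; [apply H; lia|]. eapply Rle_trans; [apply Cmod_triangle|].
apply Rplus_le_compat; [apply IHn; intros; apply H; lia|apply H; lia].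
Qed.

Lemma csum_diff_geom (f : nat -> C) (K y : R) : 0 <= y < 1 -> 0 <= K -> (forall k, Cmod (f k) <= K * y ^ k) ->
  forall n, Cmod (csum f n - Clim (csum f)) <= K * y / (1 - y) * y ^ n.
Proof.
intros Hy HK H. apply geom_cauchy; [exact Hy|nra|]. intros n. simpl.
replace (csum f n + f (S n) - csum f n)%C with (f (S n)) by ring.
eapply Rle_trans; [apply H|]. simpl. lra.
Qed.

Lemma conv_seq_components (u : nat -> C) (l : C) (e : nat -> R) : is_lim_seq e 0 -> (forall n, Cmod (u n - l) <= e n) ->
  is_lim_seq (fun n => Re (u n)) (Re l) /\ is_lim_seq (fun n => Im (u n)) (Im l).
Proof.
intros He Hu.
assert (K : forall (x : nat -> R) a, (forall n, Rabs (x n - a) <= e n) -> is_lim_seq x a).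
{ intros x a Hx. apply (is_lim_seq_le_le (fun n => a - e n) _ (fun n => a + e n)).
  - intros n. specialize (Hx n). apply Rabs_le_between in Hx. lra.
  - replace (Finite a) with (Finite (a - 0)) by (f_equal; ring). apply is_lim_seq_minus'; [apply is_lim_seq_const|exact He].
  - replace (Finite a) with (Finite (a + 0)) by (f_equal; ring). apply is_lim_seq_plus'; [apply is_lim_seq_const|exact He]. }
split; apply K; intros n; (eapply Rle_trans; [|apply (Hu n)]).
- replace (Re (u n) - Re l) with (Re (u n - l)) by Csimp. apply re_le_Cmod.
- replace (Im (u n) - Im l) with (Im (u n - l)) by Csimp. apply im_le_Cmod.
Qed.

(** The powers of [z] decrease, so the left side is at most the geometric sum up to index [n]. *)
Lemma n_geom (z : R) (n : nat) : 0 <= z < 1 -> (INR n + 1) * z ^ n <= / (1 - z).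
Proof.
intros Hz.
assert (K : (INR n + 1) * z ^ n * (1 - z) <= 1 - z ^ S n).
{ induction n; [simpl; lra|]. rewrite S_INR.
  assert (0 <= z ^ n <= 1) by (split; [apply pow_le; lra|rewrite <- (pow1 n); apply pow_incr; lra]).
  assert (Hi : z * ((INR n + 1) * z ^ n * (1 - z)) <= z * (1 - z ^ S n)) by (apply Rmult_le_compat_l; lra).
  simpl in *. assert (0 <= (1 - z) * (1 - z * z ^ n)) by (apply Rmult_le_pos; nra). nra. }
apply (Rmult_le_reg_r (1 - z)); [lra|]. rewrite Rinv_l by lra.
assert (0 <= z ^ S n) by (apply pow_le; lra). lra.
Qed.

(** With the fourth root of [q], three of the four factors absorb the three factors [n + 1] by
    [n_geom], and the last one remains as majorant. *)
Lemma cube_geom (q : R) : 0 <= q < 1 -> exists K y, 0 <= y < 1 /\ 0 <= K /\ forall n, (INR n + 1) ^ 3 * q ^ n <= K * y ^ n.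
Proof.
intros Hq. set (z := sqrt (sqrt q)).
assert (Hz1 : 0 <= z < 1).
{ split; [apply sqrt_pos|]. unfold z. rewrite <- sqrt_1. apply sqrt_lt_1_alt. split; [apply sqrt_pos|].
  rewrite <- sqrt_1. apply sqrt_lt_1_alt. lra. }
assert (Hz4 : z * z * (z * z) = q) by (unfold z; rewrite !sqrt_sqrt; auto using sqrt_pos; lra).
exists (/ (1 - z) * / (1 - z) * / (1 - z)), z. split; [exact Hz1|]. split; [|].
{ assert (0 < / (1 - z)) by (apply Rinv_0_lt_compat; lra). repeat apply Rmult_le_pos; lra. }
intros n. rewrite <- Hz4, !Rpow_mult_distr. assert (G := n_geom z n Hz1).
assert (0 <= z ^ n) by (apply pow_le; lra). pose proof (pos_INR n).
set (m := (INR n + 1) * z ^ n) in *. assert (0 <= m) by (apply Rmult_le_pos; lra).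
replace ((INR n + 1) ^ 3 * (z ^ n * z ^ n * (z ^ n * z ^ n))) with (m * m * m * z ^ n) by (unfold m; ring).
apply Rmult_le_compat_r; [assumption|]. assert (m * m <= / (1 - z) * / (1 - z)) by (apply Rmult_le_compat; assumption).
apply Rmult_le_compat; auto. apply Rmult_le_pos; assumption.
Qed.

(** * Taylor discs *)

(* [|a_n| <= (n+1) / rho^(n+2)] reproduces itself under the recursion for the coefficients of
   [W'' = s - 6 W^2], because the Cauchy square of [(n+1)] is [C(n+3,3)]. *)
Section Taylor.
Variables (s0 a0 a1 : C) (rho : R).
Hypothesis Hrho : 0 < rho.
Hypothesis B0 : Cmod a0 <= / rho ^ 2.
Hypothesis B1 : Cmod a1 <= 2 / rho ^ 3.
Hypothesis B2 : Cmod (s0 - 6 * (a0 * a0)) <= 6 / rho ^ 4.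
Hypothesis B3 : Cmod (1 - 12 * (a0 * a1)) <= 24 / rho ^ 5.

Definition frc (n : nat) : C := match n with O => s0 | S O => RtoC 1 | _ => RtoC 0 end.
Definition nxt (n : nat) (f : nat -> C) : C :=
  ((frc n - 6 * csum (fun k => f k * f (n - k)%nat) n) / RtoC ((INR n + 2) * (INR n + 1)))%C.
(** A coefficient depends on all previous ones. The table [tab n] is correct up to index [n + 1],
    which makes this course-of-values recursion structural. *)
Fixpoint tab (n : nat) : nat -> C :=
  match n with
  | O => fun k => match k with O => a0 | _ => a1 end
  | S m => fun k => if Nat.leb k (S m) then tab m k else nxt m (tab m)
  end.
Definition co (n : nat) : C := tab n n.

Lemma tab_S (n k : nat) : (k <= S n)%nat -> tab (S n) k = tab n k.
Proof. intros H. simpl. apply Nat.leb_le in H. now rewrite H. Qed.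

Lemma tab_mono (n m k : nat) : (k <= S n)%nat -> (n <= m)%nat -> tab m k = tab n k.
Proof. intros Hk Hm. induction Hm; [reflexivity|]. rewrite tab_S by lia. exact IHHm. Qed.

Lemma tab_co (n k : nat) : (k <= S n)%nat -> tab n k = co k.
Proof.
intros H. unfold co. destruct (Nat.le_gt_cases k n).
- apply tab_mono; lia.
- replace k with (S n) by lia. symmetry. now rewrite tab_S by lia.
Qed.

Lemma co_rec (n : nat) : co (S (S n)) = nxt n co.
Proof.
unfold co at 1. rewrite tab_S by lia.
assert (E : tab (S n) (S (S n)) = nxt n (tab n)).
{ change (tab (S n) (S (S n))) with (if Nat.leb (S (S n)) (S n) then tab n (S (S n)) else nxt n (tab n)).
  destruct (Nat.leb (S (S n)) (S n)) eqn:L; [apply Nat.leb_le in L; lia|reflexivity]. }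
rewrite E. unfold nxt.
rewrite (csum_ext (fun k => tab n k * tab n (n - k)%nat)%C (fun k => co k * co (n - k)%nat)%C n); [reflexivity|].
intros k Hk. now rewrite !tab_co by lia.
Qed.

(** The upper end [m] is freed from [N] for the induction; at [m = N] the value is the binomial
    coefficient C(N+3,3). *)
Lemma conv_sum (N : R) (m : nat) :
  sum_f_R0 (fun k => (INR k + 1) * (N + 1 - INR k)) m = (INR m + 1) * (INR m + 2) * (3 * N + 3 - 2 * INR m) / 6.
Proof. induction m; [simpl; field|]. rewrite tech5, IHm, S_INR. field. Qed.

Lemma sum_f_scal (c : R) (f : nat -> R) (n : nat) : sum_f_R0 (fun k => c * f k) n = c * sum_f_R0 f n.
Proof. induction n; simpl; [reflexivity|]. rewrite IHn. ring. Qed.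

(** Indices 0 to 3 are the hypotheses [B0] to [B3], the forcing [s0] and 1 entering at 2 and 3. From
    index 4 on only the convolution is left, and 6 C(N+3,3) = (N+1)(N+2)(N+3) returns the majorant
    exactly. *)
Lemma co_bound (n : nat) : Cmod (co n) <= (INR n + 1) * / rho ^ (n + 2).
Proof.
assert (K : forall m, forall n, (n <= m)%nat -> Cmod (co n) <= (INR n + 1) * / rho ^ (n + 2)).
2: { apply (K n); lia. }
induction m as [|m IH]; intros k Hk.
- replace k with O by lia. change (co 0) with a0. simpl (INR 0). rewrite Rplus_0_l, Rmult_1_l. exact B0.
- destruct (Nat.le_gt_cases k m); [now apply IH|]. replace k with (S m) by lia. clear k Hk H.
  destruct m as [|m].
  + change (co 1) with a1. simpl (INR 1). replace (1 + 1) with 2 by ring. exact B1.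
  + rewrite co_rec. unfold nxt, Cdiv. rewrite Cmod_mult, <- RtoC_inv, Cmod_R, Rabs_pos_eq.
    3: { pose proof (pos_INR m). apply Rgt_not_eq. nra. }
    2: { pose proof (pos_INR m). left. apply Rinv_0_lt_compat. nra. }
    pose proof (pos_INR m) as Hm.
    apply (Rmult_le_reg_r ((INR m + 2) * (INR m + 1))); [nra|]. rewrite Rmult_assoc, Rinv_l, Rmult_1_r by (apply Rgt_not_eq; nra).
    rewrite !S_INR.
    destruct m as [|[|m]].
    * simpl csum. change (co (0 - 0)) with a0. change (co 0) with a0. simpl frc. eapply Rle_trans; [exact B2|].
      simpl. right. field. lra.
    * simpl csum. change (co (1 - 0)) with a1. change (co (1 - 1)) with a0. change (co 1) with a1. change (co 0) with a0. simpl frc.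
      replace (1 - 6 * (a0 * a1 + a1 * a0))%C with (1 - 12 * (a0 * a1))%C by ring. eapply Rle_trans; [exact B3|].
      simpl. right. field. lra.
    * set (N := S (S m)) in *. change (frc N) with (RtoC 0).
      replace (0 - 6 * csum (fun k => co k * co (N - k)%nat) N)%C with (- (6 * csum (fun k => co k * co (N - k)%nat) N))%C by ring.
      rewrite Cmod_opp, Cmod_mult, Cmod_RtoC_nonneg by lra.
      assert (Sb : Cmod (csum (fun k => co k * co (N - k)%nat)%C N) <= / rho ^ (N + 4) * ((INR N + 1) * (INR N + 2) * (3 * INR N + 3 - 2 * INR N) / 6)).
      { rewrite <- conv_sum, <- sum_f_scal. apply csum_bound. intros k Hk. rewrite Cmod_mult.
        assert (I1 := IH k ltac:(lia)). assert (I2 := IH (N - k)%nat ltac:(lia)). rewrite minus_INR in I2 by lia.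
        assert (Hk' : INR k <= INR N) by now apply le_INR. pose proof (pos_INR k).
        replace (/ rho ^ (N + 4) * ((INR k + 1) * (INR N + 1 - INR k))) with
          (((INR k + 1) * / rho ^ (k + 2)) * ((INR N - INR k + 1) * / rho ^ (N - k + 2))).
        - apply Rmult_le_compat; auto using Cmod_ge_0.
        - replace (N + 4)%nat with ((k + 2) + (N - k + 2))%nat by lia. rewrite (pow_add rho (k + 2) (N - k + 2)).
          field. split; apply pow_nonzero; lra. }
      replace (S (S N) + 2)%nat with (N + 4)%nat by lia.
      assert (0 < / rho ^ (N + 4)) by (apply Rinv_0_lt_compat, pow_lt; lra).
      eapply Rle_trans; [apply Rmult_le_compat_l; [lra|exact Sb]|]. right. field. apply pow_nonzero. lra.
Qed.

Definition Aterm (s : C) (n : nat) : C := (co n * (s - s0) ^ n)%C.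
Definition Bterm (s : C) (n : nat) : C := (RtoC (INR n + 1) * co (S n) * (s - s0) ^ n)%C.
Definition Cterm (s : C) (n : nat) : C := (RtoC ((INR n + 2) * (INR n + 1)) * co (S (S n)) * (s - s0) ^ n)%C.
Definition TW (s : C) : C := Clim (csum (Aterm s)).
Definition TW1 (s : C) : C := Clim (csum (Bterm s)).
Definition TW2 (s : C) : C := Clim (csum (Cterm s)).

(** The terms of the series and of its two derivatives grow at most like [(n+1)^3 (r/rho)^n], so one
    geometric majorant serves all three. *)
Lemma terms_bound (r : R) : 0 < r < rho -> exists K y, 0 <= y < 1 /\ 0 <= K /\ forall s, Cmod (s - s0) < r ->
  forall n, Cmod (Aterm s n) <= K * y ^ n /\ Cmod (Bterm s n) <= K * y ^ n /\ Cmod (Cterm s n) <= K * y ^ n.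
Proof.
intros Hr. assert (Hq : 0 <= r / rho < 1).
{ split; [apply Rmult_le_pos; [lra|left; apply Rinv_0_lt_compat; lra]|]. apply (Rmult_lt_reg_r rho); [lra|]. unfold Rdiv. rewrite Rmult_assoc, Rinv_l by lra. lra. }
destruct (cube_geom _ Hq) as [K [y [Hy [HK Hc]]]].
set (M := Rmax (/ rho ^ 2) (Rmax (2 * / rho ^ 3) (6 * / rho ^ 4))).
assert (M0 : / rho ^ 2 <= M) by apply Rmax_l.
assert (M1 : 2 * / rho ^ 3 <= M) by (eapply Rle_trans; [apply Rmax_l|apply Rmax_r]).
assert (M2 : 6 * / rho ^ 4 <= M) by (eapply Rle_trans; [apply Rmax_r|apply Rmax_r]).
assert (I2 : 0 < / rho ^ 2) by (apply Rinv_0_lt_compat, pow_lt; lra).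
assert (I3 : 0 < / rho ^ 3) by (apply Rinv_0_lt_compat, pow_lt; lra).
assert (I4 : 0 < / rho ^ 4) by (apply Rinv_0_lt_compat, pow_lt; lra).
exists (M * K), y. split; [exact Hy|]. split; [apply Rmult_le_pos; lra|]. intros s Hs n.
assert (Hn := pos_INR n).
assert (Ht : Cmod ((s - s0) ^ n) <= r ^ n).
{ rewrite Cmod_pow. apply pow_incr. split; [apply Cmod_ge_0|lra]. }
assert (Er : forall j, r ^ n * / rho ^ (n + j) = (r / rho) ^ n * / rho ^ j).
{ intros j. unfold Rdiv. rewrite Rpow_mult_distr, pow_inv, pow_add. field. split; apply pow_nonzero; lra. }
assert (ErA : forall c j, c * / rho ^ (n + j) * r ^ n = c * / rho ^ j * (r / rho) ^ n).
{ intros c j. rewrite Rmult_assoc, (Rmult_comm (/ _)), Er. ring. }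
assert (Q0 : 0 <= (r / rho) ^ n) by (apply pow_le; lra).
assert (GG : forall (c x : R), 0 <= x -> c <= M * (INR n + 1) ^ 3 -> c * (r / rho) ^ n <= M * K * y ^ n).
{ intros c x _ Hcx. apply Rle_trans with (M * ((INR n + 1) ^ 3 * (r / rho) ^ n)); [rewrite <- Rmult_assoc; apply Rmult_le_compat_r; lra|].
  rewrite Rmult_assoc. apply Rmult_le_compat_l; [lra|apply Hc]. }
assert (N1 : INR n + 1 <= (INR n + 1) ^ 3) by (simpl; nra).
assert (N2 : (INR n + 1) * (INR n + 2) <= 2 * (INR n + 1) ^ 3) by (simpl; nra).
assert (N3 : (INR n + 1) * (INR n + 2) * (INR n + 3) <= 6 * (INR n + 1) ^ 3) by (simpl; nra).
split; [|split].
- unfold Aterm. rewrite Cmod_mult. apply Rle_trans with ((INR n + 1) * / rho ^ (n + 2) * r ^ n).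
  + apply Rmult_le_compat; auto using Cmod_ge_0, co_bound.
  + replace ((INR n + 1) * / rho ^ (n + 2) * r ^ n) with ((INR n + 1) * / rho ^ 2 * (r / rho) ^ n) by (rewrite ErA; ring).
    apply (GG _ 0); [lra|]. nra.
- unfold Bterm. rewrite !Cmod_mult, Cmod_RtoC_nonneg by lra.
  apply Rle_trans with ((INR n + 1) * ((INR n + 2) * / rho ^ (n + 3)) * r ^ n).
  + apply Rmult_le_compat; auto using Cmod_ge_0; [apply Rmult_le_pos; [lra|apply Cmod_ge_0]|].
    apply Rmult_le_compat_l; [lra|]. assert (E := co_bound (S n)). rewrite S_INR in E. replace (S n + 2)%nat with (n + 3)%nat in E by lia. lra.
  + replace ((INR n + 1) * ((INR n + 2) * / rho ^ (n + 3)) * r ^ n) with ((INR n + 1) * (INR n + 2) * / rho ^ 3 * (r / rho) ^ n)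
      by (rewrite <- Rmult_assoc, ErA; ring).
    apply (GG _ 0); [lra|]. assert (0 <= (INR n + 1) ^ 3) by (apply pow_le; lra). nra.
- unfold Cterm. rewrite !Cmod_mult, Cmod_RtoC_nonneg by nra.
  apply Rle_trans with ((INR n + 2) * (INR n + 1) * ((INR n + 3) * / rho ^ (n + 4)) * r ^ n).
  + apply Rmult_le_compat; auto using Cmod_ge_0; [apply Rmult_le_pos; [nra|apply Cmod_ge_0]|].
    apply Rmult_le_compat_l; [nra|]. assert (E := co_bound (S (S n))). rewrite !S_INR in E. replace (S (S n) + 2)%nat with (n + 4)%nat in E by lia. lra.
  + replace ((INR n + 2) * (INR n + 1) * ((INR n + 3) * / rho ^ (n + 4)) * r ^ n) with ((INR n + 1) * (INR n + 2) * (INR n + 3) * / rho ^ 4 * (r / rho) ^ n)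
      by (rewrite <- Rmult_assoc, ErA; ring).
    apply (GG _ 0); [lra|]. assert (0 <= (INR n + 1) ^ 3) by (apply pow_le; lra). nra.
Qed.

Lemma Cd_pow (s : C) (n : nat) : Cd (fun s => (s - s0) ^ S n)%C s (RtoC (INR n + 1) * (s - s0) ^ n)%C.
Proof.
induction n.
- apply (Cd_ext (fun s => s - s0)%C); [intros; simpl; ring|]. eapply Cd_eq; [|apply Cd_minus; [apply Cd_id|apply Cd_const]].
  simpl. rewrite Rplus_0_l. ring.
- apply (Cd_ext (fun s => (s - s0) * (s - s0) ^ S n)%C); [reflexivity|].
  eapply Cd_eq; [|apply Cd_mult; [apply Cd_minus; [apply Cd_id|apply Cd_const]|exact IHn]].
  rewrite S_INR, !RtoC_plus. simpl. ring.
Qed.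

Lemma Cd_csum_A (n : nat) (s : C) : Cd (fun s => csum (Aterm s) (S n)) s (csum (Bterm s) n).
Proof.
assert (T : forall k, Cd (fun s => Aterm s (S k)) s (Bterm s k)).
{ intros k. unfold Aterm, Bterm. eapply Cd_eq; [|apply Cd_scal, Cd_pow]. ring. }
induction n.
- simpl. apply (Cd_ext (fun s => a0 + Aterm s 1)%C). { intros w. unfold Aterm at 2. simpl. change (co 0) with a0. ring. }
  eapply Cd_eq; [|apply Cd_plus; [apply Cd_const|apply T]]. ring.
- simpl csum at 2. apply (Cd_ext (fun s => csum (Aterm s) (S n) + Aterm s (S (S n)))%C); [reflexivity|].
  apply Cd_plus; [exact IHn|apply T].
Qed.

Lemma Cd_csum_B (n : nat) (s : C) : Cd (fun s => csum (Bterm s) (S n)) s (csum (Cterm s) n).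
Proof.
assert (T : forall k, Cd (fun s => Bterm s (S k)) s (Cterm s k)).
{ intros k. unfold Cterm, Bterm. eapply Cd_eq; [|apply Cd_scal, Cd_pow].
  rewrite S_INR, !RtoC_mult, !RtoC_plus. ring. }
induction n.
- simpl. apply (Cd_ext (fun s => a1 + Bterm s 1)%C).
  { intros w. unfold Bterm at 2. simpl. change (co 1) with a1. rewrite Rplus_0_l. ring. }
  eapply Cd_eq; [|apply Cd_plus; [apply Cd_const|apply T]]. ring.
- simpl csum at 2. apply (Cd_ext (fun s => csum (Bterm s) (S n) + Bterm s (S (S n)))%C); [reflexivity|].
  apply Cd_plus; [exact IHn|apply T].
Qed.

Lemma TW_Cd (s : C) : Cmod (s - s0) < rho -> Cd TW s (TW1 s) /\ Cd TW1 s (TW2 s).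
Proof.
intros Hs. assert (Hex : exists r, 0 < r < rho /\ Cmod (s - s0) < r).
{ exists ((Cmod (s - s0) + rho) / 2). pose proof (Cmod_ge_0 (s - s0)). lra. }
destruct Hex as [r [Hr Hsr]].
destruct (terms_bound r Hr) as [K [y [Hy [HK HT]]]].
assert (HD := Copen_mod_lt s0 r).
assert (L : is_lim_seq (fun n => K * y / (1 - y) * y ^ n) 0) by now apply lim_geom_scal.
assert (LC : forall (u : nat -> C) (l : C), (forall n, Cmod (u n - l) <= K * y / (1 - y) * y ^ n) ->
   forall eps, 0 < eps -> exists N, forall n, (N <= n)%nat -> Cmod (u (S n) - l) <= eps).
{ intros u l Hu eps Heps. assert (L' := L). apply is_lim_seq_spec in L'. destruct (L' (mkposreal eps Heps)) as [N HN].
  exists N. intros n Hn. specialize (HN (S n) ltac:(lia)). simpl in HN. rewrite Rminus_0_r in HN.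
  eapply Rle_trans; [apply Hu|]. simpl. match goal with |- ?a <= _ => pose proof (Rle_abs a) end. lra. }
split; clear Hs; revert s Hsr.
- apply (Cd_limit (fun s => Cmod (s - s0) < r) (fun n s => csum (Aterm s) (S n)) (fun n s => csum (Bterm s) n) TW TW1 _ HD L).
  + intros n z _. apply Cd_csum_A.
  + intros z Hz. apply (LC (csum (Aterm z))). apply csum_diff_geom; auto. intros k. now apply HT.
  + intros n z Hz. apply csum_diff_geom; auto. intros k. now apply HT.
- apply (Cd_limit (fun s => Cmod (s - s0) < r) (fun n s => csum (Bterm s) (S n)) (fun n s => csum (Cterm s) n) TW1 TW2 _ HD L).
  + intros n z _. apply Cd_csum_B.
  + intros z Hz. apply (LC (csum (Bterm z))). apply csum_diff_geom; auto. intros k. now apply HT.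
  + intros n z Hz. apply csum_diff_geom; auto. intros k. now apply HT.
Qed.

(** The square of the series is a Cauchy product, formed from real and imaginary parts separately;
    absolute convergence follows from the geometric majorant. *)
Lemma TW_ode (s : C) : Cmod (s - s0) < rho -> PW s (TW s) (TW1 s) (TW2 s).
Proof.
intros Hs. set (r := (Cmod (s - s0) + rho) / 2). pose proof (Cmod_ge_0 (s - s0)).
assert (Hr : 0 < r < rho) by (unfold r; lra). assert (Hsr : Cmod (s - s0) < r) by (unfold r; lra).
destruct (terms_bound r Hr) as [K [y [Hy [HK HT]]]].
assert (L : is_lim_seq (fun n => K * y / (1 - y) * y ^ n) 0) by now apply lim_geom_scal.
assert (GA := csum_diff_geom (Aterm s) K y Hy HK (fun k => proj1 (HT s Hsr k))).
assert (GC := csum_diff_geom (Cterm s) K y Hy HK (fun k => proj2 (proj2 (HT s Hsr k)))).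
fold (TW s) in GA. fold (TW2 s) in GC.
destruct (conv_seq_components _ _ _ L GA) as [RA IA]. destruct (conv_seq_components _ _ _ L GC) as [RC IC].
set (u k := Re (Aterm s k)). set (v k := Im (Aterm s k)).
assert (SU : is_series u (Re (TW s))).
{ change (is_lim_seq (sum_n u) (Re (TW s))). apply (is_lim_seq_ext (fun n => Re (csum (Aterm s) n))); [|exact RA]. intros n. rewrite csum_re, <- sum_n_Reals. reflexivity. }
assert (SV : is_series v (Im (TW s))).
{ change (is_lim_seq (sum_n v) (Im (TW s))). apply (is_lim_seq_ext (fun n => Im (csum (Aterm s) n))); [|exact IA]. intros n. rewrite csum_im, <- sum_n_Reals. reflexivity. }
assert (EG : ex_series (fun n => K * y ^ n)).
{ apply (ex_series_scal_l (V := R_NormedModule) K (fun n => y ^ n)). exists (/ (1 - y)). apply is_series_geom. rewrite Rabs_pos_eq; lra. }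
assert (AU : ex_series (fun n => Rabs (u n))).
{ apply (ex_series_le (V := R_CompleteNormedModule) _ (fun n => K * y ^ n)); [|exact EG]. intros n.
  change (Rabs (Rabs (u n)) <= K * y ^ n). rewrite Rabs_Rabsolu. eapply Rle_trans; [apply re_le_Cmod|]. now apply HT. }
assert (AV : ex_series (fun n => Rabs (v n))).
{ apply (ex_series_le (V := R_CompleteNormedModule) _ (fun n => K * y ^ n)); [|exact EG]. intros n.
  change (Rabs (Rabs (v n)) <= K * y ^ n). rewrite Rabs_Rabsolu. eapply Rle_trans; [apply im_le_Cmod|]. now apply HT. }
assert (MUU := is_series_mult u u _ _ SU SU AU AU). assert (MVV := is_series_mult v v _ _ SV SV AV AV).
assert (MUV := is_series_mult u v _ _ SU SV AU AV). assert (MVU := is_series_mult v u _ _ SV SU AV AU).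
set (Z n := csum (fun k => Aterm s k * Aterm s (n - k)%nat)%C n).
assert (RZ : is_series (fun n => Re (Z n)) (Re (TW s * TW s))).
{ replace (Re (TW s * TW s)) with (minus (Re (TW s) * Re (TW s)) (Im (TW s) * Im (TW s))) by (unfold minus, plus, opp; Csimp).
  eapply is_series_ext; [|apply (is_series_minus (V := R_NormedModule) _ _ _ _ MUU MVV)].
  intros n. unfold Z. rewrite csum_re. change (sum_f_R0 (fun k => u k * u (n - k)%nat) n + - sum_f_R0 (fun k => v k * v (n - k)%nat) n = sum_f_R0 (fun k => Re (Aterm s k * Aterm s (n - k)%nat)) n).
  replace (- sum_f_R0 (fun k => v k * v (n - k)%nat) n) with (sum_f_R0 (fun k => - 1 * (v k * v (n - k)%nat)) n) by (rewrite sum_f_scal; ring).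
  rewrite <- plus_sum. apply sum_eq. intros i _. unfold u, v. Csimp. }
assert (IZ : is_series (fun n => Im (Z n)) (Im (TW s * TW s))).
{ replace (Im (TW s * TW s)) with (plus (Re (TW s) * Im (TW s)) (Im (TW s) * Re (TW s))) by (unfold plus; unfold Re, Im; simpl; ring).
  eapply is_series_ext; [|apply (is_series_plus (V := R_NormedModule) _ _ _ _ MUV MVU)].
  intros n. unfold Z. rewrite csum_im. change (sum_f_R0 (fun k => u k * v (n - k)%nat) n + sum_f_R0 (fun k => v k * u (n - k)%nat) n = sum_f_R0 (fun k => Im (Aterm s k * Aterm s (n - k)%nat)) n).
  rewrite <- plus_sum. apply sum_eq. intros i _. unfold u, v. Csimp. }
(* Partial sums with at least two terms, so that the forcing contributes [s0 + (s - s0) = s]. *)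
assert (EC : forall n, csum (Cterm s) (S n) = (s - 6 * csum Z (S n))%C).
{ assert (TC : forall n, Cterm s n = (frc n * (s - s0) ^ n - 6 * Z n)%C).
  { intros n. unfold Cterm. rewrite co_rec. unfold nxt.
    assert (Hn : RtoC ((INR n + 2) * (INR n + 1)) <> RtoC 0). { intros E. apply RtoC_inj in E. pose proof (pos_INR n). nra. }
    assert (EZ : Z n = (csum (fun k => co k * co (n - k)%nat) n * (s - s0) ^ n)%C).
    { unfold Z. rewrite Cmult_comm, <- csum_scal. apply csum_ext. intros k Hk. unfold Aterm.
      replace n with (k + (n - k))%nat at 3 by lia. rewrite Cpow_add_r. ring. }
    rewrite EZ. field. exact Hn. }
  induction n.
  - simpl csum. rewrite !TC. simpl. ring.
  - change (csum (Cterm s) (S (S n))) with (csum (Cterm s) (S n) + Cterm s (S (S n)))%C. rewrite IHn, TC.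
    change (csum Z (S (S n))) with (csum Z (S n) + Z (S (S n)))%C. simpl frc. ring. }
unfold PW. apply Ceq.
- apply is_lim_seq_incr_1 in RC.
  assert (R2 : is_lim_seq (fun n => Re (csum (Cterm s) (S n))) (Re (s - 6 * (TW s * TW s)))).
  { apply (is_lim_seq_ext (fun n => Re s - 6 * sum_n (fun k => Re (Z k)) (S n))).
    - intros n. rewrite EC, sum_n_Reals, <- csum_re. Csimp.
    - replace (Re (s - 6 * (TW s * TW s))) with (Re s - 6 * Re (TW s * TW s)) by Csimp.
      apply is_lim_seq_minus'; [apply is_lim_seq_const|]. apply (is_lim_seq_scal_l _ 6 (Finite _)).
      apply (is_lim_seq_incr_1 (sum_n (fun k => Re (Z k)))). exact RZ. }
  apply is_lim_seq_unique in RC. apply is_lim_seq_unique in R2. rewrite RC in R2. now injection R2.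
- apply is_lim_seq_incr_1 in IC.
  assert (R2 : is_lim_seq (fun n => Im (csum (Cterm s) (S n))) (Im (s - 6 * (TW s * TW s)))).
  { apply (is_lim_seq_ext (fun n => Im s - 6 * sum_n (fun k => Im (Z k)) (S n))).
    - intros n. rewrite EC, sum_n_Reals, <- csum_im. Csimp.
    - replace (Im (s - 6 * (TW s * TW s))) with (Im s - 6 * Im (TW s * TW s)) by Csimp.
      apply is_lim_seq_minus'; [apply is_lim_seq_const|]. apply (is_lim_seq_scal_l _ 6 (Finite _)).
      apply (is_lim_seq_incr_1 (sum_n (fun k => Im (Z k)))). exact IZ. }
  apply is_lim_seq_unique in IC. apply is_lim_seq_unique in R2. rewrite IC in R2. now injection R2.
Qed.
End Taylor.

Definition Cdisc (c : C) (r : R) (s : C) : Prop := Cmod (s - c) < r.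

Lemma taylor_disc (s0 a0 a1 : C) (rho : R) : 0 < rho ->
  Cmod a0 <= / rho ^ 2 -> Cmod a1 <= 2 / rho ^ 3 -> Cmod (s0 - 6 * (a0 * a0)) <= 6 / rho ^ 4 ->
  Cmod (1 - 12 * (a0 * a1)) <= 24 / rho ^ 5 ->
  exists W, sol2 PW (Cdisc s0 rho) W /\ W s0 = a0 /\ Cder W s0 = a1.
Proof.
intros Hr B0 B1 B2 B3. exists (TW s0 a0 a1).
assert (HD : forall s, Cdisc s0 rho s -> Cd (TW s0 a0 a1) s (TW1 s0 a0 a1 s) /\ Cd (TW1 s0 a0 a1) s (TW2 s0 a0 a1 s))
  by (intros s Hs; apply (TW_Cd s0 a0 a1 rho Hr B0 B1 B2 B3 s Hs)).
assert (L0 : is_lim_seq (fun _ => 0) 0) by apply is_lim_seq_const.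
assert (Z : forall n, csum (fun n => (RtoC 0 ^ S n)%C) n = RtoC 0).
{ induction n; simpl; [ring|]. simpl in IHn. rewrite IHn. ring. }
assert (E : forall (f : nat -> C) n, csum (fun n => (f n * (s0 - s0) ^ n)%C) n = f O).
{ intros f n. replace (s0 - s0)%C with (RtoC 0) by ring. induction n; simpl; [ring|]. rewrite IHn. ring. }
split; [|split].
- exists (TW1 s0 a0 a1), (TW2 s0 a0 a1). intros s Hs. destruct (HD s Hs). split; [assumption|]. split; [assumption|].
  apply (TW_ode s0 a0 a1 rho Hr B0 B1 B2 B3 s Hs).
- apply (Clim_le _ _ _ L0). intros n. unfold Aterm. rewrite (E (co s0 a0 a1)). change (co s0 a0 a1 0) with a0.
  replace (a0 - a0)%C with (RtoC 0) by ring. rewrite Cmod_0. lra.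
- assert (D0 : Cdisc s0 rho s0). { unfold Cdisc. replace (s0 - s0)%C with (RtoC 0) by ring. rewrite Cmod_0. exact Hr. }
  rewrite (Cder_eq _ _ _ (proj1 (HD s0 D0))).
  apply (Clim_le _ _ _ L0). intros n. unfold Bterm. rewrite (E (fun n => RtoC (INR n + 1) * co s0 a0 a1 (S n))%C).
  change (co s0 a0 a1 1) with a1. simpl INR. replace (RtoC (0 + 1)) with (RtoC 1) by (f_equal; ring).
  replace (1 * a1 - a1)%C with (RtoC 0) by ring. rewrite Cmod_0. lra.
Qed.

(** [E = |x|^2 + |y|^2] satisfies [E' <= 4 L E], so [E exp(-4 L t)] is nonincreasing, and it starts
    at 0. *)
Lemma gronwall_zero (x y x' y' : R -> C) (L a b : R) : a <= b -> 0 <= L ->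
  (forall t, a <= t <= b -> Rd x t (x' t)) -> (forall t, a <= t <= b -> Rd y t (y' t)) ->
  (forall t, a <= t <= b -> Cmod (x' t) <= L * (Cmod (x t) + Cmod (y t))) ->
  (forall t, a <= t <= b -> Cmod (y' t) <= L * (Cmod (x t) + Cmod (y t))) ->
  x a = RtoC 0 -> y a = RtoC 0 -> x b = RtoC 0 /\ y b = RtoC 0.
Proof.
intros Hab HL Hx Hy Bx By X0 Y0.
set (E t := (Re (x t) * Re (x t) + Im (x t) * Im (x t)) + (Re (y t) * Re (y t) + Im (y t) * Im (y t))).
set (E' t := (Re (x' t) * Re (x t) + Re (x t) * Re (x' t) + (Im (x' t) * Im (x t) + Im (x t) * Im (x' t))) +
  (Re (y' t) * Re (y t) + Re (y t) * Re (y' t) + (Im (y' t) * Im (y t) + Im (y t) * Im (y' t)))).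
assert (HE : forall t, a <= t <= b -> is_derive E t (E' t)).
{ intros t Ht. destruct (Hx t Ht) as [D1 D2]. destruct (Hy t Ht) as [D3 D4]. unfold E, E'.
  apply @is_derive_plus; apply @is_derive_plus; apply is_derive_Rmult; assumption. }
assert (EE : forall t, E t = Cmod (x t) ^ 2 + Cmod (y t) ^ 2) by (intros t; unfold E; rewrite !Cmod2_alt; ring).
assert (BE : forall t, a <= t <= b -> E' t <= 4 * L * E t).
{ intros t Ht. specialize (Bx t Ht). specialize (By t Ht). rewrite EE.
  assert (K : forall z w, Re w * Re z + Re z * Re w + (Im w * Im z + Im z * Im w) <= 2 * (Cmod z * Cmod w)).
  { intros z w. replace (Re w * Re z + Re z * Re w + (Im w * Im z + Im z * Im w)) with (2 * Re (Cconj z * w)) by (unfold Cconj; Csimp).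
    pose proof (re_le_Cmod (Cconj z * w)) as H. rewrite Cmod_mult, Cmod_conj in H. pose proof (Rle_abs (Re (Cconj z * w))). lra. }
  unfold E'. pose proof (K (x t) (x' t)). pose proof (K (y t) (y' t)).
  pose proof (Cmod_ge_0 (x t)). pose proof (Cmod_ge_0 (y t)).
  assert (Cmod (x t) * Cmod (x' t) <= Cmod (x t) * (L * (Cmod (x t) + Cmod (y t)))) by (apply Rmult_le_compat_l; assumption).
  assert (Cmod (y t) * Cmod (y' t) <= Cmod (y t) * (L * (Cmod (x t) + Cmod (y t)))) by (apply Rmult_le_compat_l; assumption).
  assert (0 <= L * (Cmod (x t) - Cmod (y t)) ^ 2) by (apply Rmult_le_pos; [exact HL|apply pow2_ge_0]). nra. }
assert (F : - (E a * exp (- (4 * L) * a)) <= - (E b * exp (- (4 * L) * b))).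
{ apply (incr_der (fun t => - (E t * exp (- (4 * L) * t))) (fun t => - (E' t * exp (- (4 * L) * t) + E t * (- (4 * L) * exp (- (4 * L) * t)))) a b Hab).
  - intros t Ht. apply @is_derive_opp. apply (is_derive_Rmult E (fun t => exp (- (4 * L) * t))); [now apply HE|]. auto_derive; auto. ring.
  - intros t Ht. specialize (BE t Ht). pose proof (exp_pos (- (4 * L) * t)).
    replace (- (E' t * exp (- (4 * L) * t) + E t * (- (4 * L) * exp (- (4 * L) * t)))) with ((4 * L * E t - E' t) * exp (- (4 * L) * t)) by ring.
    apply Rmult_le_pos; lra. }
assert (Ea : E a = 0) by (rewrite EE, X0, Y0, Cmod_0; ring).
rewrite Ea, Rmult_0_l in F. pose proof (exp_pos (- (4 * L) * b)).
assert (Eb : E b <= 0) by nra. rewrite EE in Eb.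
pose proof (pow2_ge_0 (Cmod (x b))). pose proof (pow2_ge_0 (Cmod (y b))).
split; apply Cmod_eq_0; nra.
Qed.

Lemma der_cont (f : R -> R) (t l : R) : is_derive f t l -> continuity_pt f t.
Proof.
intros H. apply continuity_pt_filterlim, (@ex_derive_continuous R_AbsRing R_NormedModule). now exists l.
Qed.

Lemma Rd_bounded (f f' : R -> C) (a b : R) : a <= b -> (forall t, a <= t <= b -> Rd f t (f' t)) ->
  exists M, 0 <= M /\ forall t, a <= t <= b -> Cmod (f t) <= M.
Proof.
intros Hab Hf.
destruct (continuity_ab_maj (fun t => Re (f t) * Re (f t) + Im (f t) * Im (f t)) a b Hab) as [c [Hc _]].
{ intros t Ht. destruct (Hf t Ht) as [D1 D2].
  eapply (der_cont (fun t => Re (f t) * Re (f t) + Im (f t) * Im (f t))). apply (is_derive_plus (V := R_NormedModule) (fun t => Re (f t) * Re (f t)) (fun t => Im (f t) * Im (f t)));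
  [apply (is_derive_Rmult (fun t => Re (f t)) (fun t => Re (f t)))|apply (is_derive_Rmult (fun t => Im (f t)) (fun t => Im (f t)))]; eassumption. }
set (m := Re (f c) * Re (f c) + Im (f c) * Im (f c)) in *.
exists (Rabs m + 1). split; [pose proof (Rabs_pos m); lra|]. intros t Ht. specialize (Hc t Ht). cbv beta in Hc. fold m in Hc.
replace (Re (f t) * Re (f t) + Im (f t) * Im (f t)) with (Re (f t) ^ 2 + Im (f t) ^ 2) in Hc by ring.
rewrite <- Cmod2_alt in Hc. pose proof (Cmod_ge_0 (f t)). pose proof (Rle_abs m). pose proof (Rabs_pos m). nra.
Qed.

(** * Uniqueness along paths *)

Definition agree (f g : C -> C) (z : C) : Prop := f z = g z /\ Cder f z = Cder g z.

Lemma agree_trans (f g h : C -> C) (z : C) : agree f g z -> agree g h z -> agree f h z.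
Proof. intros [H1 H2] [H3 H4]. split; congruence. Qed.

(** The differences of the solutions and of their derivatives satisfy a linear system along the
    path; its coefficient [- 6 (W + Z)] is bounded by compactness, so equal first-order data
    propagate. *)
Lemma PW_path (D E : C -> Prop) (W Z : C -> C) (g g' : R -> C) (a b G : R) : Copen D -> Copen E ->
  sol2 PW D W -> sol2 PW E Z -> a <= b -> (forall t, a <= t <= b -> D (g t) /\ E (g t)) ->
  (forall t, a <= t <= b -> Rd g t (g' t)) -> (forall t, a <= t <= b -> Cmod (g' t) <= G) ->
  agree W Z (g a) -> agree W Z (g b).
Proof.
intros HD HE HW HZ Hab Hg Dg BG [A1 A2].
assert (SW := sol2_Cder PW D W HD HW). assert (SZ := sol2_Cder PW E Z HE HZ).
assert (HG : 0 <= G) by (eapply Rle_trans; [apply Cmod_ge_0|apply (BG a); lra]).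
destruct (Rd_bounded (fun t => W (g t) + Z (g t))%C (fun t => Cder W (g t) * g' t + Cder Z (g t) * g' t)%C a b Hab) as [M [HM BM]].
{ intros t Ht. destruct (Hg t Ht) as [H1 H2]. apply Rd_plus; apply Cd_Rd; auto; [now apply SW|now apply SZ]. }
destruct (gronwall_zero (fun t => W (g t) - Z (g t))%C (fun t => Cder W (g t) - Cder Z (g t))%C
  (fun t => Cder W (g t) * g' t - Cder Z (g t) * g' t)%C (fun t => Cder (Cder W) (g t) * g' t - Cder (Cder Z) (g t) * g' t)%C
  (G * (1 + 6 * M)) a b Hab) as [X Y].
- apply Rmult_le_pos; lra.
- intros t Ht. destruct (Hg t Ht) as [H1 H2]. apply Rd_minus; apply Cd_Rd; auto; [now apply SW|now apply SZ].
- intros t Ht. destruct (Hg t Ht) as [H1 H2]. apply Rd_minus; apply Cd_Rd; auto; [now apply SW|now apply SZ].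
- intros t Ht. specialize (BG t Ht). replace (Cder W (g t) * g' t - Cder Z (g t) * g' t)%C with (g' t * (Cder W (g t) - Cder Z (g t)))%C by ring.
  rewrite Cmod_mult. pose proof (Cmod_ge_0 (W (g t) - Z (g t))). pose proof (Cmod_ge_0 (Cder W (g t) - Cder Z (g t))).
  apply Rle_trans with (G * Cmod (Cder W (g t) - Cder Z (g t))); [apply Rmult_le_compat_r; assumption|].
  rewrite Rmult_assoc. apply Rmult_le_compat_l; [exact HG|]. nra.
- intros t Ht. specialize (BG t Ht). specialize (BM t Ht). destruct (Hg t Ht) as [H1 H2].
  destruct (SW _ H1) as [_ [_ P1]]. destruct (SZ _ H2) as [_ [_ P2]]. unfold PW in P1, P2. rewrite P1, P2.
  replace ((g t - 6 * (W (g t) * W (g t))) * g' t - (g t - 6 * (Z (g t) * Z (g t))) * g' t)%C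
    with (g' t * (- (6) * ((W (g t) + Z (g t)) * (W (g t) - Z (g t)))))%C by ring.
  rewrite !Cmod_mult, Cmod_opp, Cmod_RtoC_nonneg by lra.
  pose proof (Cmod_ge_0 (W (g t) - Z (g t))). pose proof (Cmod_ge_0 (Cder W (g t) - Cder Z (g t))). pose proof (Cmod_ge_0 (W (g t) + Z (g t))).
  pose proof (Cmod_ge_0 (g' t)). rewrite Rmult_assoc.
  apply Rmult_le_compat; [assumption| |assumption|]; nra.
- cbv beta. rewrite A1. ring.
- cbv beta. rewrite A2. ring.
- cbv beta in X, Y. split.
  + replace (W (g b)) with (W (g b) - Z (g b) + Z (g b))%C by ring. rewrite X. ring.
  + replace (Cder W (g b)) with (Cder W (g b) - Cder Z (g b) + Cder Z (g b))%C by ring. rewrite Y. ring.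
Qed.

Lemma PW_segment (D E : C -> Prop) (W Z : C -> C) (z w : C) : Copen D -> Copen E ->
  sol2 PW D W -> sol2 PW E Z -> (forall t, 0 <= t <= 1 -> D (z + RtoC t * (w - z))%C /\ E (z + RtoC t * (w - z))%C) ->
  agree W Z z -> agree W Z w.
Proof.
intros HD HE HW HZ Hs Ha.
assert (K := PW_path D E W Z (fun t => z + RtoC t * (w - z))%C (fun _ => w - z)%C 0 1 (Cmod (w - z)) HD HE HW HZ Rle_0_1 Hs).
cbv beta in K. replace (z + RtoC 1 * (w - z))%C with w in K by ring. replace (z + RtoC 0 * (w - z))%C with z in K by ring.
apply K; auto; intros t Ht; [apply Rd_line|lra].
Qed.

Lemma PW_real (D E : C -> Prop) (W Z : C -> C) (a b : R) : Copen D -> Copen E ->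
  sol2 PW D W -> sol2 PW E Z -> (forall t, Rmin a b <= t <= Rmax a b -> D (RtoC t) /\ E (RtoC t)) ->
  agree W Z (RtoC a) -> agree W Z (RtoC b).
Proof.
intros HD HE HW HZ Hs. apply (PW_segment D E); auto. intros t Ht.
replace (RtoC a + RtoC t * (RtoC b - RtoC a))%C with (RtoC (a + t * (b - a))) by (rewrite RtoC_plus, RtoC_mult, RtoC_minus; reflexivity).
apply Hs. unfold Rmin, Rmax. destruct (Rle_dec a b); nra.
Qed.

Lemma last_exit (V V' : R -> R) (a b E t0 : R) : (forall t, a <= t <= b -> is_derive V t (V' t)) ->
  V b < E -> a <= t0 <= b -> E <= V t0 -> exists c, a <= c < b /\ E <= V c /\ forall t, c <= t <= b -> V t <= Rmax E (V c) /\ (c < t -> V t < E).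
Proof.
intros HV Hb Ht0 HE.
destruct (completeness (fun t => a <= t <= b /\ E <= V t)) as [c [Hub Hlub]].
{ exists b. intros t [Ht _]. lra. }
{ exists t0. now split. }
assert (Hc : a <= c <= b).
{ split; [apply Rle_trans with t0; [lra|apply Hub; now split]|apply Hlub; intros t [Ht _]; lra]. }
assert (Hcont : continuity_pt V c).
{ apply continuity_pt_filterlim, (@ex_derive_continuous R_AbsRing R_NormedModule). eexists. now apply HV. }
assert (HVc : E <= V c).
{ destruct (Rle_lt_dec E (V c)) as [|Hlt]; [assumption|exfalso].
  destruct (Hcont (E - V c)) as [d [Hd K]]; [lra|].
  assert (c <= c - d / 2); [|lra]. apply Hlub. intros t [Ht HtE].
  destruct (Rle_lt_dec t (c - d / 2)) as [|Hgt]; [assumption|exfalso].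
  assert (Htc : t <= c) by (apply Hub; now split).
  destruct (Req_dec t c) as [->|Hne]; [lra|].
  specialize (K t). simpl in K. unfold D_x, no_cond, Rdist in K.
  assert (Rabs (V t - V c) < E - V c) by (apply K; split; [split; [exact I|lra]|apply Rabs_def1; lra]).
  apply Rabs_def2 in H. lra. }
exists c. split; [split; [lra|]|split; [exact HVc|]].
- destruct (Req_dec c b) as [->|Hne]; lra.
- assert (Hlt : forall t, c < t <= b -> V t < E).
  { intros t Ht. destruct (Rlt_le_dec (V t) E) as [|Hge]; [assumption|exfalso].
    assert (t <= c) by (apply Hub; split; [lra|exact Hge]). lra. }
  intros t Ht. split; [|intros; apply Hlt; lra].
  destruct (Req_dec t c) as [->|Hne]; [apply Rmax_r|]. left. eapply Rlt_le_trans; [apply Hlt; lra|apply Rmax_l].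
Qed.

(** A bootstrap run backwards in time, as the bound on [V'] is available only while [V <= E]. After
    the last time with [V >= E] it holds throughout, and integrating from [b] back to that time
    gives a value below [E], a contradiction. *)
Lemma barrier (V V' : R -> R) (a b E k : R) : a <= b -> 0 <= k -> (forall t, a <= t <= b -> is_derive V t (V' t)) ->
  (forall t, a <= t <= b -> V t <= E -> - k <= V' t) -> V b + k * (b - a) < E -> V a <= V b + k * (b - a).
Proof.
intros Hab Hk HV HV' Hb.
assert (Hint : forall c, a <= c <= b -> (forall t, c <= t <= b -> V t <= E) -> V c <= V b + k * (b - c)).
{ intros c Hc Hle. assert (G := incr_der (fun t => V t + k * t) (fun t => V' t + k * 1) c b (proj2 Hc)). cbv beta in G.
  assert (V c + k * c <= V b + k * b); [apply G|lra].
  - intros t Ht. apply @is_derive_plus; [apply HV; lra|]. apply is_derive_scal, @is_derive_id.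
  - intros t Ht. assert (- k <= V' t) by (apply HV'; [lra|now apply Hle]). lra. }
apply Hint; [lra|]. intros t0 Ht0. destruct (Rle_lt_dec (V t0) E) as [|Hgt]; [assumption|exfalso].
assert (Hb0 : V b < E) by nra.
destruct (last_exit V V' a b E t0 HV Hb0 Ht0 ltac:(lra)) as [c [Hc [HE HcE]]].
assert (Hcont : continuity_pt V c).
{ apply continuity_pt_filterlim, (@ex_derive_continuous R_AbsRing R_NormedModule). eexists. apply HV. lra. }
assert (HVcE : V c <= E).
{ destruct (Rle_lt_dec (V c) E) as [|Hg]; [assumption|exfalso].
  destruct (Hcont (V c - E)) as [d [Hd K]]; [lra|].
  set (u := c + Rmin (d / 2) ((b - c) / 2)). assert (Hm : 0 < Rmin (d / 2) ((b - c) / 2)) by (apply Rmin_pos; lra).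
  pose proof (Rmin_l (d / 2) ((b - c) / 2)). pose proof (Rmin_r (d / 2) ((b - c) / 2)).
  destruct (HcE u) as [_ Hu]; [unfold u; lra|]. specialize (Hu ltac:(unfold u; lra)).
  specialize (K u). simpl in K. unfold D_x, no_cond, Rdist in K.
  assert (Hk2 : Rabs (V u - V c) < V c - E) by (apply K; split; [split; [exact I|unfold u; lra]|apply Rabs_def1; unfold u; lra]).
  apply Rabs_def2 in Hk2. lra. }
assert (V c <= V b + k * (b - c)).
{ apply Hint; [lra|]. intros t Ht. destruct (HcE t Ht) as [H1 _]. rewrite Rmax_left in H1; lra. }
assert (k * (b - c) <= k * (b - a)) by (apply Rmult_le_compat_l; lra). lra.
Qed.

(** * The inner solution on the real segment *)

(* [S0 = (27/10)^4 / 24], so that [xi S0 = (27/10)^5 / 30 = X0] and [sg S0 = 243/400] are rational.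
   [PP] approximates numerically the solution on [0, S0]. *)
Definition S0 : R := 531441 / 240000.
Definition PP (t : R) : R := 469/2500 + 3049/10000 * t - 21/200 * t^2 + 481/10000 * t^3 - 179/10000 * t^4 + 41/10000 * t^5 - 1/2500 * t^6.
Definition PP1 (t : R) : R := 3049/10000 - 42/200 * t + 1443/10000 * t^2 - 716/10000 * t^3 + 205/10000 * t^4 - 6/2500 * t^5.
Definition PP2 (t : R) : R := - (42/200) + 2886/10000 * t - 2148/10000 * t^2 + 820/10000 * t^3 - 30/2500 * t^4.

(** One step of a Horner evaluation with absolute values. Splitting by the sign of [a] keeps the
    accumulated bound an explicit rational expression, which [lra] can compare. *)
Lemma horner_pos (a b h u x : R) : Rabs u <= h -> 0 <= a -> Rabs x <= b -> Rabs (a + u * x) <= a + h * b.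
Proof.
intros Hu Ha Hx. eapply Rle_trans; [apply Rabs_triang|]. rewrite (Rabs_pos_eq a) by exact Ha. rewrite Rabs_mult.
apply Rplus_le_compat_l, Rmult_le_compat; auto using Rabs_pos.
Qed.

Lemma horner_neg (a b h u x : R) : Rabs u <= h -> a <= 0 -> Rabs x <= b -> Rabs (a + u * x) <= - a + h * b.
Proof.
intros Hu Ha Hx. eapply Rle_trans; [apply Rabs_triang|]. rewrite (Rabs_left1 a) by exact Ha. rewrite Rabs_mult.
apply Rplus_le_compat_l, Rmult_le_compat; auto using Rabs_pos.
Qed.

Lemma lin_nonneg (a b h u x : R) : Rabs u <= h -> Rabs x <= b -> h * b <= a -> 0 <= a + u * x.
Proof.
intros Hu Hx Ha. assert (Rabs (u * x) <= h * b) by (rewrite Rabs_mult; apply Rmult_le_compat; auto using Rabs_pos).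
apply Rabs_le_between in H. lra.
Qed.

(** The residual of [PP] is a polynomial of degree 12. It is expanded around a centre in each of
    four subintervals, short enough that taking absolute values in the Horner form loses little. *)
Lemma PP_eta (t : R) : 0 <= t <= S0 -> Rabs (PP2 t + 6 * (PP t * PP t) - t) <= 33/10000.
Proof.
unfold S0. intros Ht.
destruct (Rle_lt_dec t (11/25)) as [L0|L0].
{ set (u := t - (11/50)). assert (Hu : Rabs u <= (11/50)) by (apply Rabs_le; unfold u; lra).
  replace (PP2 t + 6 * (PP t * PP t) - t) with ((-2607278098766258813407773/3051757812500000000000000000) + u * ((18493813564444726773217/30517578125000000000000000) + u * ((27993364821893049981867/1220703125000000000000000) + u * ((-90203946205727020513/1220703125000000000000) + u * ((4510378273529040789/48828125000000000000) + u * ((-158318243887643229/2441406250000000000) + u * ((2930101032699759/97656250000000000) + u * ((-624920593989/61035156250000) + u * ((46334922483/15625000000000) + u * ((-117309891/156250000000) + u * ((4444407/31250000000) + u * ((-2679/156250000) + u * (3/3125000))))))))))))) by (unfold u, PP, PP2; field).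
  eapply Rle_trans; [eapply (horner_neg _ _ _ _ _ Hu); [lra|]; eapply (horner_pos _ _ _ _ _ Hu); [lra|]; eapply (horner_pos _ _ _ _ _ Hu); [lra|]; eapply (horner_neg _ _ _ _ _ Hu); [lra|]; eapply (horner_pos _ _ _ _ _ Hu); [lra|]; eapply (horner_neg _ _ _ _ _ Hu); [lra|]; eapply (horner_pos _ _ _ _ _ Hu); [lra|]; eapply (horner_neg _ _ _ _ _ Hu); [lra|]; eapply (horner_pos _ _ _ _ _ Hu); [lra|]; eapply (horner_neg _ _ _ _ _ Hu); [lra|]; eapply (horner_pos _ _ _ _ _ Hu); [lra|]; eapply (horner_neg _ _ _ _ _ Hu); [lra|]; apply Req_le; apply Rabs_pos_eq; lra|lra]. }
destruct (Rle_lt_dec t (32/25)) as [L1|L1].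
{ set (u := t - (43/50)). assert (Hu : Rabs u <= (21/50)) by (apply Rabs_le; unfold u; lra).
  replace (PP2 t + 6 * (PP t * PP t) - t) with ((-692682523301776568872413/3051757812500000000000000000) + u * ((-94591886010058592763071/30517578125000000000000000) + u * ((-5886358649403118504917/1220703125000000000000000) + u * ((10160343916242675551/1220703125000000000000) + u * ((85590940329258069/48828125000000000000) + u * ((-16359825692258493/2441406250000000000) + u * ((569696707019631/97656250000000000) + u * ((-153818328777/61035156250000) + u * ((9382106163/15625000000000) + u * ((-26790627/156250000000) + u * ((1483383/31250000000) + u * ((-1527/156250000) + u * (3/3125000))))))))))))) by (unfold u, PP, PP2; field).
  eapply Rle_trans; [eapply (horner_neg _ _ _ _ _ Hu); [lra|]; eapply (horner_neg _ _ _ _ _ Hu); [lra|]; eapply (horner_neg _ _ _ _ _ Hu); [lra|]; eapply (horner_pos _ _ _ _ _ Hu); [lra|]; eapply (horner_pos _ _ _ _ _ Hu); [lra|]; eapply (horner_neg _ _ _ _ _ Hu); [lra|]; eapply (horner_pos _ _ _ _ _ Hu); [lra|]; eapply (horner_neg _ _ _ _ _ Hu); [lra|]; eapply (horner_pos _ _ _ _ _ Hu); [lra|]; eapply (horner_neg _ _ _ _ _ Hu); [lra|]; eapply (horner_pos _ _ _ _ _ Hu); [lra|]; eapply (horner_neg _ _ _ _ _ Hu); [lra|]; apply Req_le; apply Rabs_pos_eq; lra|lra]. }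
destruct (Rle_lt_dec t (46/25)) as [L2|L2].
{ set (u := t - (39/25)). assert (Hu : Rabs u <= (7/25)) by (apply Rabs_le; unfold u; lra).
  replace (PP2 t + 6 * (PP t * PP t) - t) with ((-391590138530412683037/186264514923095703125000) + u * ((6523639846118710579/7450580596923828125000) + u * ((40598968340060661843/4768371582031250000000) + u * ((68269443819172229/19073486328125000000) + u * ((-2566490689698063/1525878906250000000) + u * ((-37171249672293/152587890625000000) + u * ((-18042465396303/12207031250000000) + u * ((-213602328783/244140625000000) + u * ((249874341/1953125000000) + u * ((-294117/9765625000) + u * ((102003/31250000000) + u * ((-267/156250000) + u * (3/3125000))))))))))))) by (unfold u, PP, PP2; field).
  eapply Rle_trans; [eapply (horner_neg _ _ _ _ _ Hu); [lra|]; eapply (horner_pos _ _ _ _ _ Hu); [lra|]; eapply (horner_pos _ _ _ _ _ Hu); [lra|]; eapply (horner_pos _ _ _ _ _ Hu); [lra|]; eapply (horner_neg _ _ _ _ _ Hu); [lra|]; eapply (horner_neg _ _ _ _ _ Hu); [lra|]; eapply (horner_neg _ _ _ _ _ Hu); [lra|]; eapply (horner_neg _ _ _ _ _ Hu); [lra|]; eapply (horner_pos _ _ _ _ _ Hu); [lra|]; eapply (horner_neg _ _ _ _ _ Hu); [lra|]; eapply (horner_pos _ _ _ _ _ Hu); [lra|]; eapply (horner_neg _ _ _ _ _ Hu); [lra|]; apply Req_le; apply Rabs_pos_eq; lra|lra]. }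
set (u := t - (51/25)). assert (Hu : Rabs u <= (1/5)) by (apply Rabs_le; unfold u; lra).
  replace (PP2 t + 6 * (PP t * PP t) - t) with ((51882114144706587789/93132257461547851562500) + u * ((155254317940833918347/14901161193847656250000) + u * ((45139941428022506043/4768371582031250000000) + u * ((-94465337064054019/19073486328125000000) + u * ((-15832776298542423/1525878906250000000) + u * ((-1240066406346417/152587890625000000) + u * ((-46936999699623/12207031250000000) + u * ((-146653472367/244140625000000) + u * ((50222301/1953125000000) + u * ((-248961/19531250000) + u * ((276243/31250000000) + u * ((597/156250000) + u * (3/3125000))))))))))))) by (unfold u, PP, PP2; field).
  eapply Rle_trans; [eapply (horner_pos _ _ _ _ _ Hu); [lra|]; eapply (horner_pos _ _ _ _ _ Hu); [lra|]; eapply (horner_pos _ _ _ _ _ Hu); [lra|]; eapply (horner_neg _ _ _ _ _ Hu); [lra|]; eapply (horner_neg _ _ _ _ _ Hu); [lra|]; eapply (horner_neg _ _ _ _ _ Hu); [lra|]; eapply (horner_neg _ _ _ _ _ Hu); [lra|]; eapply (horner_neg _ _ _ _ _ Hu); [lra|]; eapply (horner_pos _ _ _ _ _ Hu); [lra|]; eapply (horner_neg _ _ _ _ _ Hu); [lra|]; eapply (horner_pos _ _ _ _ _ Hu); [lra|]; eapply (horner_pos _ _ _ _ _ Hu); [lra|]; apply Req_le; apply Rabs_pos_eq; lra|lra].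
Qed.

(** Around 41/25 the constant term, about 0.1526, just exceeds [41/25 * 93/1000], the bound for all
    the rest. *)
Lemma PP1_pos (t : R) : 0 <= t <= S0 -> 0 <= PP1 t.
Proof.
unfold S0. intros Ht.
set (u := t - (41/25)). assert (Hu : Rabs u <= (41/25)) by (apply Rabs_le; unfold u; lra).
  replace (PP1 t) with ((14903203801/97656250000) + u * ((-15442207/390625000) + u * ((530817/31250000) + u * ((-261/156250) + u * ((41/50000) + u * (-3/1250)))))) by (unfold u, PP1; field).
  assert (K : Rabs ((-15442207/390625000) + u * ((530817/31250000) + u * ((-261/156250) + u * ((41/50000) + u * (-3/1250))))) <= (93/1000)).
  { eapply Rle_trans; [eapply (horner_neg _ _ _ _ _ Hu); [lra|]; eapply (horner_pos _ _ _ _ _ Hu); [lra|]; eapply (horner_neg _ _ _ _ _ Hu); [lra|]; eapply (horner_pos _ _ _ _ _ Hu); [lra|]; apply Req_le; apply Rabs_left1; lra|lra]. }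
  apply (lin_nonneg _ _ _ _ _ Hu K); lra.
Qed.

Lemma PP_d (t : R) : is_derive PP t (PP1 t).
Proof. unfold PP, PP1. auto_derive; auto. simpl. field. Qed.
Lemma PP1_d (t : R) : is_derive PP1 t (PP2 t).
Proof. unfold PP1, PP2. auto_derive; auto. simpl. field. Qed.

Lemma PP_low (t : R) : 0 <= t <= S0 -> 469/2500 <= PP t.
Proof.
intros Ht. replace (469/2500) with (PP 0) by (unfold PP; field).
apply (incr_der PP PP1 0 t); [lra| |]; intros u Hu; [apply PP_d|apply PP1_pos; lra].
Qed.

Definition en (f f1 : R -> C) (t : R) : R :=
  (Re (f1 t) - PP1 t) * (Re (f1 t) - PP1 t) + Im (f1 t) * Im (f1 t)
  + 12 * PP t * ((Re (f t) - PP t) * (Re (f t) - PP t) + Im (f t) * Im (f t)).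

(* Backwards in [t] the weighted energy can only grow through the residual of [PP] and the
   cubic term, since [PP1 >= 0]; this is where the oscillatory character of the linearization is used. *)
Lemma en_step (f f1 : R -> C) (a b : R) : 0 <= a <= b -> b <= S0 ->
  (forall t, a <= t <= b -> Rd f t (f1 t) /\ Rd f1 t (RtoC t - 6 * (f t * f t))) ->
  en f f1 b + 345/1000000 * (b - a) < 9/10000 -> en f f1 a <= en f f1 b + 345/1000000 * (b - a).
Proof.
intros Hab Hb Hf HE.
set (x t := Re (f t) - PP t). set (y t := Im (f t)). set (x1 t := Re (f1 t) - PP1 t). set (y1 t := Im (f1 t)).
set (eta t := PP2 t + 6 * (PP t * PP t) - t).
set (V' t := 2 * x1 t * (- 6 * (x t * x t - y t * y t) - eta t) + 2 * y1 t * (- 12 * x t * y t)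
   + 12 * PP1 t * (x t * x t + y t * y t)).
apply (barrier (en f f1) V' a b (9/10000)); [lra|lra| | |exact HE].
- intros t Ht. destruct (Hf t Ht) as [[D1 D2] [D3 D4]].
  assert (Dx : is_derive x t (x1 t)) by (apply @is_derive_minus; [exact D1|apply PP_d]).
  assert (Dx1 : is_derive x1 t (Re (RtoC t - 6 * (f t * f t)) - PP2 t)) by (apply @is_derive_minus; [exact D3|apply PP1_d]).
  apply (is_derive_ext (fun t => (x1 t * x1 t + y1 t * y1 t) + 12 * PP t * (x t * x t + y t * y t))); [intros u; unfold en, x, y, x1, y1; simpl; match goal with |- ?a = ?b => change (@eq R a b) end; ring|].
  eapply is_derive_eq; [|apply (is_derive_plus (V := R_NormedModule) (fun t => x1 t * x1 t + y1 t * y1 t) (fun t => 12 * PP t * (x t * x t + y t * y t)));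
   [apply (is_derive_plus (V := R_NormedModule) (fun t => x1 t * x1 t) (fun t => y1 t * y1 t)); [apply (is_derive_Rmult x1 x1); exact Dx1|apply (is_derive_Rmult y1 y1); exact D4]
   |apply (is_derive_Rmult (fun t => 12 * PP t) (fun t => x t * x t + y t * y t)); [apply is_derive_scal, PP_d|
     apply (is_derive_plus (V := R_NormedModule) (fun t => x t * x t) (fun t => y t * y t)); [apply (is_derive_Rmult x x); exact Dx|apply (is_derive_Rmult y y); exact D2]]]].
  replace (Re (RtoC t - 6 * (f t * f t))) with (t - 6 * (Re (f t) * Re (f t) - Im (f t) * Im (f t))) by Csimp.
  replace (Im (RtoC t - 6 * (f t * f t))) with (- 12 * (Re (f t) * Im (f t))) by Csimp.
  fold (y t) (y1 t). replace (Re (f t)) with (PP t + x t) by (unfold x; ring). unfold plus; simpl. unfold V', eta. ring.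
- intros t Ht HV. assert (Ht0 : 0 <= t <= S0) by lra.
  assert (He := PP_eta t Ht0). fold (eta t) in He. assert (HP1 := PP1_pos t Ht0). assert (HP := PP_low t Ht0).
  assert (HV2 : (x1 t * x1 t + y1 t * y1 t) + 12 * PP t * (x t * x t + y t * y t) <= 9/10000).
  { eapply Rle_trans; [|exact HV]. apply Req_le. unfold en, x, y, x1, y1. ring. }
  unfold V'. generalize dependent (x t). generalize dependent (y t). generalize dependent (x1 t). generalize dependent (y1 t).
  generalize dependent (eta t). generalize dependent (PP1 t). generalize dependent (PP t). clear V' eta x y x1 y1 Hf HE HV.
  intros P HP P1 HP1 e He b1 a1 bb aa HV.
  set (T := aa * aa + bb * bb) in *. assert (HT0 : 0 <= T) by (unfold T; nra).
  assert (HS0 : 0 <= a1 * a1 + b1 * b1) by nra.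
  assert (HT : T <= 9/10000 / (12 * (469/2500))).
  { apply (Rmult_le_reg_l (12 * (469/2500))); [lra|]. field_simplify. nra. }
  assert (HS : a1 * a1 + b1 * b1 <= 9/10000) by nra.
  (* The real part of the conjugate derivative error times the square of the value error; by
     Cauchy-Schwarz at most [3/100 * T], where 3/100 is the square root of the energy threshold. *)
  set (m := a1 * (aa * aa - bb * bb) + b1 * (2 * aa * bb)).
  assert (Hm : Rabs m <= 3/100 * T).
  { rewrite <- (Rabs_pos_eq (3/100 * T)) by lra. apply Rsqr_le_abs_0. unfold Rsqr.
    assert (C1 : m * m <= (a1 * a1 + b1 * b1) * (T * T)).
    { pose proof (Rle_0_sqr (a1 * (2 * aa * bb) - b1 * (aa * aa - bb * bb))) as Q. unfold Rsqr in Q.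
      replace ((a1 * a1 + b1 * b1) * (T * T)) with (m * m + (a1 * (2 * aa * bb) - b1 * (aa * aa - bb * bb)) * (a1 * (2 * aa * bb) - b1 * (aa * aa - bb * bb))) by (unfold m, T; ring). lra. }
    assert (0 <= T * T) by nra. nra. }
  assert (Ha : Rabs a1 <= 3/100).
  { rewrite <- (Rabs_pos_eq (3/100)) by lra. apply Rsqr_le_abs_0. unfold Rsqr. nra. }
  assert (Hae : Rabs (a1 * e) <= 3/100 * (33/10000)) by (rewrite Rabs_mult; apply Rmult_le_compat; auto using Rabs_pos).
  apply Rabs_le_between in Hm. apply Rabs_le_between in Hae.
  assert (0 <= P1 * T) by (apply Rmult_le_pos; assumption).
  (* The cubic term costs at most 0.000144 and the residual 0.000198, together below the rate
     0.000345. *)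
  replace (2 * a1 * (-6 * (aa * aa - bb * bb) - e) + 2 * b1 * (-12 * aa * bb) + 12 * P1 * T) with (- 12 * m - 2 * (a1 * e) + 12 * (P1 * T)) by (unfold m; ring).
  lra.
Qed.

Lemma Carg_real (r : R) : 0 < r -> Carg (RtoC r) = 0.
Proof.
intros Hr. pose proof PI_RGT_0. rewrite <- (Carg_polar r 0) by lra. f_equal. rewrite cis_0. ring.
Qed.

Lemma Cpower_real (r a : R) : 0 < r -> Cpower (RtoC r) a = RtoC (Rpower r a).
Proof.
intros Hr. unfold Cpower. rewrite Carg_real, Rmult_0_r, cis_0, Cmod_RtoC_nonneg by lra. ring.
Qed.

Lemma xi_real (s : R) : 0 < s -> xi (RtoC s) = RtoC (Rpower (24 * s) (5/4) / 30).
Proof.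
intros Hs. unfold xi. rewrite <- RtoC_mult, Cpower_real by lra. rewrite RtoC_div by lra. reflexivity.
Qed.

Lemma sg_real (s : R) : 0 < s -> sg (RtoC s) = RtoC (Rpower (s / 6) (1/2)).
Proof.
intros Hs. unfold sg. rewrite <- RtoC_div, Cpower_real by lra. reflexivity.
Qed.

Definition X0 : R := 14348907 / 3000000.

Lemma Rpower_of_pow (x a b : R) (n : nat) : 0 < x -> INR n * a = b -> Rpower (x ^ n) a = Rpower x b.
Proof. intros Hx E. rewrite <- Rpower_pow by exact Hx. rewrite Rpower_mult. now rewrite E. Qed.

Lemma xi_S0 : xi (RtoC S0) = RtoC X0.
Proof.
rewrite xi_real by (unfold S0; lra). f_equal.
replace (24 * S0) with ((27/10) ^ 4) by (unfold S0; field).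
rewrite (Rpower_of_pow _ _ (INR 5)) by (simpl; lra). rewrite Rpower_pow by lra. unfold X0. field.
Qed.

Lemma sg_S0 : sg (RtoC S0) = RtoC (243/400).
Proof.
rewrite sg_real by (unfold S0; lra). f_equal.
replace (S0 / 6) with ((243/400) ^ 2) by (unfold S0; field).
rewrite (Rpower_of_pow _ _ (INR 1)) by (simpl; lra). rewrite Rpower_pow by lra. field.
Qed.

Lemma en_Cmod (f f1 : R -> C) (t : R) :
  en f f1 t = Cmod (f1 t - RtoC (PP1 t)) ^ 2 + 12 * PP t * Cmod (f t - RtoC (PP t)) ^ 2.
Proof.
assert (K : forall (z : C) (r : R), Cmod (z - RtoC r) ^ 2 = (Re z - r) * (Re z - r) + Im z * Im z).
{ intros z r. unfold Cmod. rewrite pow2_sqrt by (apply Rplus_le_le_0_compat; apply pow2_ge_0). Csimp. }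
rewrite !K. unfold en. ring.
Qed.

Lemma wp_le (r : R) : 0 < r -> wp (RtoC r) <= Rpower r (-9/2).
Proof.
intros Hr. unfold wp. rewrite <- RtoC_plus, Cmod_RtoC_nonneg by (unfold del; lra).
apply Rpower_anti; unfold del; lra.
Qed.

Lemma Wof_Cder (H : C -> C) (s h1 : C) : slit s -> Cd H (xi s) h1 ->
  Cder (Wof H) s = (sg s / (2 * s) * (1 + 4 / (25 * (xi s * xi s)) + H (xi s))
    + sg s * (5 * xi s / (4 * s)) * (- (8) / (25 * (xi s * xi s * xi s)) + h1))%C.
Proof.
intros Hs D. assert (Hn := slit_neq_0 s Hs). assert (Hx := xi_neq_0 s).
assert (Dx := Cd_xi s Hs). assert (Dg := Cd_sg s Hs). assert (DH := Cd_comp H xi s _ _ Dx D).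
assert (H25 : RtoC 25 <> RtoC 0) by (intros F; apply RtoC_inj in F; lra).
assert (Hx2 : (25 * (xi s * xi s))%C <> RtoC 0) by (apply Cmult_neq_0; [exact H25|apply Cmult_neq_0; exact Hx]).
apply Cder_eq. eapply Cd_eq; [|apply Cd_mult; [exact Dg|]; apply Cd_plus; [apply Cd_plus; [apply Cd_const|apply Cd_scal, (Cd_inv (fun s => 25 * (xi s * xi s))%C); [exact Hx2|apply Cd_scal, Cd_mult; exact Dx]]|exact DH]].
cbv beta. field. repeat split; assumption.
Qed.

Lemma rs_decay (r : R) (f : C) : 0 < r -> Cmod f <= Bp * wp (RtoC r) -> Cmod (rs (RtoC r) * f) <= Bp / r ^ 5.
Proof.
intros Hr Hf. rewrite Cmod_mult. unfold rs. rewrite Cpower_real, Cmod_RtoC_nonneg by (exact Hr || (left; apply Rpower_pos)).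
apply Rle_trans with (Rpower r (-1/2) * (Bp * Rpower r (-9/2))).
- apply Rmult_le_compat_l; [left; apply Rpower_pos|]. eapply Rle_trans; [exact Hf|].
  apply Rmult_le_compat_l; [unfold Bp; lra|now apply wp_le].
- replace (Rpower r (-1/2) * (Bp * Rpower r (-9/2))) with (Bp * (Rpower r (-1/2) * Rpower r (-9/2))) by ring.
  rewrite <- Rpower_plus. replace (-1/2 + -9/2) with (- INR 5) by (simpl; lra). rewrite Rpower_neg_nat by exact Hr.
  unfold Rdiv. lra.
Qed.

(** At [S0] all algebraic factors are rational, so the distance to [PP] splits into an exact
    rational part and the remainders [e0], [e1] of the asymptotics, of the order of [Bp / X0^5],
    which dominate the estimate. *)
Lemma en_S0 (H Ho : C -> C) (H1 H2 phi phi1 : C -> C) : (forall z, 0 <= Re z -> Ho z = H z) -> Hode Dp H H1 H2 ->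
  (forall z, Dp z -> H z = (rs z * phi z - RtoC cP / (z * z * z * z))%C /\
     H1 z = (rs z * (phi1 z - phi z / (2 * z)) + 4 * RtoC cP / (z * z * z * z * z))%C /\
     Cmod (phi z) <= Bp * wp z /\ Cmod (phi1 z) <= Bp * wp z) ->
  en (fun t => Wof Ho (RtoC t)) (fun t => Cder (Wof Ho) (RtoC t)) S0 <= 13/100000.
Proof.
intros EH HD HB. assert (HX : 0 < X0) by (unfold X0; lra).
assert (DX : Dp (RtoC X0)).
{ split; [simpl; unfold del, X0; lra|]. rewrite <- RtoC_plus, Cmod_RtoC_nonneg; unfold RR, del, X0; lra. }
destruct (HB _ DX) as [E0 [E1 [B0 B1]]]. destruct (HD _ DX) as [D0 _].
assert (D0' : Cd Ho (RtoC X0) (H1 (RtoC X0))).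
{ apply (Cd_ext_loc H Ho _ _ X0); [exact HX| |exact D0]. intros w Hw. symmetry. apply EH.
  assert (K := re_le_Cmod (w - RtoC X0)). replace (Re (w - RtoC X0)) with (Re w - X0) in K by Csimp. apply Rabs_le_between in K. lra. }
assert (HX5 : Bp / X0 ^ 5 <= 3/1000) by (unfold Bp, X0; lra).
assert (K0 := Rle_trans _ _ _ (rs_decay _ _ HX B0) HX5). set (e0 := (rs (RtoC X0) * phi (RtoC X0))%C) in *.
assert (K1 : Cmod (rs (RtoC X0) * (phi1 (RtoC X0) - phi (RtoC X0) / (2 * RtoC X0))) <= 34/10000).
{ assert (HXn : RtoC X0 <> RtoC 0) by (intros F; apply RtoC_inj in F; lra).
  replace (rs (RtoC X0) * (phi1 (RtoC X0) - phi (RtoC X0) / (2 * RtoC X0)))%C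
    with (rs (RtoC X0) * phi1 (RtoC X0) - RtoC (/ (2 * X0)) * (rs (RtoC X0) * phi (RtoC X0)))%C.
  - eapply Rle_trans; [apply Cmod_tri_minus|]. rewrite (Cmod_mult (RtoC (/ (2 * X0)))), Cmod_RtoC_nonneg by (unfold X0; lra).
    assert (K2 := Rle_trans _ _ _ (rs_decay _ _ HX B1) HX5). fold e0. assert (/ (2 * X0) <= 11/100) by (unfold X0; lra).
    assert (0 <= / (2 * X0)) by (unfold X0; lra). pose proof (Cmod_ge_0 e0). nra.
  - rewrite RtoC_inv by lra. rewrite RtoC_mult. field. exact HXn. }
set (e1 := (rs (RtoC X0) * (phi1 (RtoC X0) - phi (RtoC X0) / (2 * RtoC X0)))%C) in *.
rewrite en_Cmod.
assert (F0 : (Wof Ho (RtoC S0) - RtoC (PP S0))%C = (RtoC (243/400 * (1 + 4 / (25 * (X0 * X0)) - cP / (X0 * X0 * X0 * X0)) - PP S0) + RtoC (243/400) * e0)%C).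
{ unfold Wof. rewrite xi_S0, sg_S0, EH, E0 by (simpl; lra).
  rewrite RtoC_minus, RtoC_mult, RtoC_minus, RtoC_plus, (RtoC_div 4), (RtoC_div cP), !RtoC_mult; try (unfold X0; lra). ring. }

assert (F1 : (Cder (Wof Ho) (RtoC S0) - RtoC (PP1 S0))%C =
  (RtoC (243/400 / (2 * S0) * (1 + 4 / (25 * (X0 * X0)) - cP / (X0 * X0 * X0 * X0))
     + 243/400 * (27/10) * (- (8) / (25 * (X0 * X0 * X0)) + 4 * cP / (X0 * X0 * X0 * X0 * X0)) - PP1 S0)
   + (RtoC (243/400 / (2 * S0)) * e0 + RtoC (243/400 * (27/10)) * e1))%C).
{ rewrite (Wof_Cder Ho (RtoC S0) (H1 (RtoC X0))); [|left; simpl; unfold S0; lra|rewrite xi_S0; exact D0'].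
  rewrite xi_S0, sg_S0, EH, E0, E1 by (simpl; lra). fold e0 e1.
  replace (5 * RtoC X0 / (4 * RtoC S0))%C with (RtoC (27/10)).
  2: { rewrite <- !RtoC_mult, <- RtoC_div by (unfold S0; lra). f_equal. unfold X0, S0. lra. }
  rewrite RtoC_minus, RtoC_plus, !RtoC_mult, RtoC_minus, !RtoC_plus, !RtoC_div, !RtoC_mult, !RtoC_opp; try (unfold X0, S0; lra). ring. }
rewrite F0, F1.
assert (N0 : Cmod (RtoC (243/400 * (1 + 4 / (25 * (X0 * X0)) - cP / (X0 * X0 * X0 * X0)) - PP S0) + RtoC (243/400) * e0) <= 25/10000).
{ eapply Rle_trans; [apply Cmod_triangle|]. rewrite Cmod_mult, !Cmod_R.
  assert (Q : Rabs (243/400 * (1 + 4 / (25 * (X0 * X0)) - cP / (X0 * X0 * X0 * X0)) - PP S0) <= 5/10000) by (apply Rabs_le; unfold PP, S0, X0, cP; lra).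
  rewrite (Rabs_pos_eq (243/400)) by lra. lra. }
assert (N1 : Cmod (RtoC (243/400 / (2 * S0) * (1 + 4 / (25 * (X0 * X0)) - cP / (X0 * X0 * X0 * X0))
     + 243/400 * (27/10) * (- (8) / (25 * (X0 * X0 * X0)) + 4 * cP / (X0 * X0 * X0 * X0 * X0)) - PP1 S0)
   + (RtoC (243/400 / (2 * S0)) * e0 + RtoC (243/400 * (27/10)) * e1)) <= 72/10000).
{ eapply Rle_trans; [apply Cmod_triangle|].
  assert (Q : Cmod (RtoC (243/400 / (2 * S0)) * e0 + RtoC (243/400 * (27/10)) * e1) <= 6/10000 + 57/10000).
  { eapply Rle_trans; [apply Cmod_triangle|]. rewrite !Cmod_mult, !Cmod_R.
    rewrite (Rabs_pos_eq (243/400 / (2 * S0))), (Rabs_pos_eq (243/400 * (27/10))) by (unfold S0; lra).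
    assert (243/400 / (2 * S0) <= 14/100) by (unfold S0; lra). assert (0 <= 243/400 / (2 * S0)) by (unfold S0; lra).
    pose proof (Cmod_ge_0 e0). nra. }
  rewrite Cmod_R. assert (Q2 : Rabs (243/400 / (2 * S0) * (1 + 4 / (25 * (X0 * X0)) - cP / (X0 * X0 * X0 * X0))
     + 243/400 * (27/10) * (- (8) / (25 * (X0 * X0 * X0)) + 4 * cP / (X0 * X0 * X0 * X0 * X0)) - PP1 S0) <= 6/10000) by (apply Rabs_le; unfold PP1, S0, X0, cP; lra).
  lra. }
assert (HP : 0 <= 12 * PP S0 <= 734/100) by (unfold PP, S0; lra).
pose proof (Cmod_ge_0 (RtoC (243/400 * (1 + 4 / (25 * (X0 * X0)) - cP / (X0 * X0 * X0 * X0)) - PP S0) + RtoC (243/400) * e0)) as G0.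
match goal with |- ?a ^ 2 + _ * ?b ^ 2 <= _ => set (x := a) in *; set (y := b) in * end.
assert (Gx : 0 <= x) by apply Cmod_ge_0.
assert (x ^ 2 <= (72/10000) ^ 2) by (apply pow_incr; lra).
assert (y ^ 2 <= (25/10000) ^ 2) by (apply pow_incr; lra).
assert (12 * PP S0 * y ^ 2 <= 734/100 * (25/10000) ^ 2) by (apply Rmult_le_compat; [lra|apply pow2_ge_0|lra|lra]).
lra.
Qed.

Lemma PW_restrict (D : C -> Prop) (W : C -> C) (t : R) : Copen D -> sol2 PW D W -> D (RtoC t) ->
  Rd (fun u => W (RtoC u)) t (Cder W (RtoC t)) /\
  Rd (fun u => Cder W (RtoC u)) t (RtoC t - 6 * (W (RtoC t) * W (RtoC t)))%C.
Proof.
intros HD HW Ht. destruct (sol2_Cder PW D W HD HW _ Ht) as [D1 [D2 E]].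
assert (DR : Rd RtoC t 1%C) by (apply (Rd_real (fun u => u) t 1), (@is_derive_id R_AbsRing)).
unfold PW in E. rewrite <- E.
split; (eapply Rd_eq; [|apply (Cd_Rd _ RtoC); [eassumption|exact DR]]; ring).
Qed.

Definition enW (W : C -> C) (t : R) : R := en (fun u => W (RtoC u)) (fun u => Cder W (RtoC u)) t.

Lemma enW_agree (V W : C -> C) (t : R) : agree V W (RtoC t) -> enW V t = enW W t.
Proof. intros [H1 H2]. unfold enW, en. now rewrite H1, H2. Qed.

Lemma enW_step (D : C -> Prop) (W : C -> C) (a b : R) : Copen D -> sol2 PW D W -> 0 <= a <= b -> b <= S0 ->
  (forall t, a <= t <= b -> D (RtoC t)) ->
  enW W b + 345/1000000 * (b - a) < 9/10000 -> enW W a <= enW W b + 345/1000000 * (b - a).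
Proof.
intros HD HW Hab Hb Hs HE. apply en_step; [exact Hab|exact Hb| |exact HE].
intros t Ht. now apply (PW_restrict D W t HD HW), Hs.
Qed.

(** Since [PP >= 469/2500], the value error is at most the square root of
    [9/10000 / (12 * 469/2500)], just below 2/100. *)
Lemma enW_bound (W : C -> C) (t : R) : 0 <= t <= S0 -> enW W t <= 9/10000 ->
  Cmod (W (RtoC t) - RtoC (PP t)) <= 2/100 /\ Cmod (Cder W (RtoC t) - RtoC (PP1 t)) <= 3/100.
Proof.
intros Ht. unfold enW. rewrite en_Cmod. assert (HP := PP_low t Ht). intros HE.
pose proof (Cmod_ge_0 (W (RtoC t) - RtoC (PP t))) as Gx. pose proof (Cmod_ge_0 (Cder W (RtoC t) - RtoC (PP1 t))) as Gy.
revert HE Gx Gy. generalize (Cmod (W (RtoC t) - RtoC (PP t))) (Cmod (Cder W (RtoC t) - RtoC (PP1 t))). intros x y HE Gx Gy.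
assert (0 <= x ^ 2) by apply pow2_ge_0. assert (0 <= y ^ 2) by apply pow2_ge_0.
assert (12 * (469/2500) * x ^ 2 <= 12 * PP t * x ^ 2) by (apply Rmult_le_compat_r; lra).
split; apply Rnot_lt_le; intros L; [assert ((2/100) ^ 2 < x ^ 2)|assert ((3/100) ^ 2 < y ^ 2)]; try lra; simpl; nra.
Qed.

(** The four inequalities are the hypotheses of [taylor_disc] for [PP] and [PP1], enlarged by what
    errors of 2/100 and 3/100 can contribute. A radius is thus checked on rational data, although
    the values at the centre are known only approximately. *)
Lemma disc_restart (W : C -> C) (t rho : R) : 0 <= t <= S0 -> enW W t <= 9/10000 -> 0 < rho ->
  PP t + 2/100 <= / rho ^ 2 -> PP1 t + 3/100 <= 2 / rho ^ 3 ->
  Rabs (t - 6 * (PP t * PP t)) + 6 * (4/100 * PP t + 4/10000) <= 6 / rho ^ 4 ->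
  Rabs (1 - 12 * (PP t * PP1 t)) + 12 * (3/100 * PP t + 2/100 * PP1 t + 6/10000) <= 24 / rho ^ 5 ->
  exists V, sol2 PW (Cdisc (RtoC t) rho) V /\ agree V W (RtoC t).
Proof.
intros Ht HE Hr B0 B1 B2 B3. destruct (enW_bound W t Ht HE) as [K0 K1].
assert (HP := PP_low t Ht). assert (HP1 := PP1_pos t Ht).
revert K0 K1. set (e := (W (RtoC t) - RtoC (PP t))%C). set (e1 := (Cder W (RtoC t) - RtoC (PP1 t))%C). intros K0 K1.
assert (E0 : W (RtoC t) = (RtoC (PP t) + e)%C) by (unfold e; ring).
assert (E1 : Cder W (RtoC t) = (RtoC (PP1 t) + e1)%C) by (unfold e1; ring).
pose proof (Cmod_ge_0 e). pose proof (Cmod_ge_0 e1).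
destruct (taylor_disc (RtoC t) (W (RtoC t)) (Cder W (RtoC t)) rho Hr) as [V [HV [V0 V1]]].
- rewrite E0. eapply Rle_trans; [apply Cmod_triangle|]. rewrite Cmod_RtoC_nonneg by lra. lra.
- rewrite E1. eapply Rle_trans; [apply Cmod_triangle|]. rewrite Cmod_RtoC_nonneg by lra. lra.
- rewrite E0. replace (RtoC t - 6 * ((RtoC (PP t) + e) * (RtoC (PP t) + e)))%C
    with (RtoC (t - 6 * (PP t * PP t)) - (RtoC (12 * PP t) * e + RtoC 6 * (e * e)))%C by (rewrite RtoC_minus, !RtoC_mult; ring).
  eapply Rle_trans; [apply Cmod_tri_minus|]. rewrite Cmod_R. eapply Rle_trans; [|exact B2]. apply Rplus_le_compat_l.
  eapply Rle_trans; [apply Cmod_triangle|]. rewrite !Cmod_mult, !Cmod_RtoC_nonneg by lra.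
  assert (Cmod e * Cmod e <= 2/100 * (2/100)) by (apply Rmult_le_compat; lra).
  assert (12 * PP t * Cmod e <= 12 * PP t * (2/100)) by (apply Rmult_le_compat_l; lra). lra.
- rewrite E0, E1. replace (1 - 12 * ((RtoC (PP t) + e) * (RtoC (PP1 t) + e1)))%C
    with (RtoC (1 - 12 * (PP t * PP1 t)) - (RtoC (12 * PP t) * e1 + RtoC (12 * PP1 t) * e + RtoC 12 * (e * e1)))%C by (rewrite RtoC_minus, !RtoC_mult; ring).
  eapply Rle_trans; [apply Cmod_tri_minus|]. rewrite Cmod_R. eapply Rle_trans; [|exact B3]. apply Rplus_le_compat_l.
  eapply Rle_trans; [apply Cmod_triangle|]. eapply Rle_trans; [apply Rplus_le_compat_r, Cmod_triangle|].
  rewrite !Cmod_mult, !Cmod_RtoC_nonneg by lra.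
  assert (Cmod e * Cmod e1 <= 2/100 * (3/100)) by (apply Rmult_le_compat; lra).
  assert (12 * PP t * Cmod e1 <= 12 * PP t * (3/100)) by (apply Rmult_le_compat_l; lra).
  assert (12 * PP1 t * Cmod e <= 12 * PP1 t * (2/100)) by (apply Rmult_le_compat_l; lra). lra.
- exists V. split; [exact HV|]. now split.
Qed.

Lemma Cdisc_open (c : C) (r : R) : Copen (Cdisc c r).
Proof. apply Copen_mod_lt. Qed.

Lemma Cdisc_real (a r t : R) : Rabs (t - a) < r -> Cdisc (RtoC a) r (RtoC t).
Proof. intros H. unfold Cdisc. now rewrite <- RtoC_minus, Cmod_R. Qed.

(** The energy budget is 0.00013 at [S0], 0.00055 at 1 and 0.0009 at 0, growing by 0.000345 per unit
    length. The radius 5/4 exceeds both gaps, [S0 - 1] and 1. *)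
Lemma inner_chain (W : C -> C) : enW W S0 <= 13/100000 ->
  exists A B Z, sol2 PW (Cdisc (RtoC S0) (5/4)) A /\ sol2 PW (Cdisc (RtoC 1) (5/4)) B /\ sol2 PW (Cdisc (RtoC 0) (9/5)) Z /\
  agree A W (RtoC S0) /\ agree B A (RtoC 1) /\ agree Z B (RtoC 0).
Proof.
intros HE.
destruct (disc_restart W S0 (5/4)) as [A [HA GA]]; [unfold S0; lra|lra|lra|unfold PP, S0; lra|unfold PP1, S0; lra| | |].
{ assert (Rabs (S0 - 6 * (PP S0 * PP S0)) <= 3/100) by (apply Rabs_le; unfold PP, S0; lra). unfold PP at 3. unfold S0 in *; lra. }
{ assert (Rabs (1 - 12 * (PP S0 * PP1 S0)) <= 1) by (apply Rabs_le; unfold PP, PP1, S0; lra). unfold PP at 2, PP1 at 2. unfold S0 in *; lra. }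
assert (EA : enW A 1 <= 55/100000).
{ assert (K := enW_step (Cdisc (RtoC S0) (5/4)) A 1 S0 (Cdisc_open _ _) HA). rewrite (enW_agree A W S0 GA) in K.
  eapply Rle_trans; [apply K|]; try (unfold S0; lra); [|unfold S0 in *; lra|unfold S0 in *; lra].
  intros t Ht. apply Cdisc_real, Rabs_def1; unfold S0 in *; lra. }
destruct (disc_restart A 1 (5/4)) as [B [HB GB]]; [unfold S0; lra|lra|lra|unfold PP; lra|unfold PP1; lra| | |].
{ assert (Rabs (1 - 6 * (PP 1 * PP 1)) <= 1) by (apply Rabs_le; unfold PP; lra). unfold PP at 3. lra. }
{ assert (Rabs (1 - 12 * (PP 1 * PP1 1)) <= 1) by (apply Rabs_le; unfold PP, PP1; lra). unfold PP at 2, PP1 at 2. lra. }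
assert (EB : enW B 0 <= 9/10000).
{ assert (K := enW_step (Cdisc (RtoC 1) (5/4)) B 0 1 (Cdisc_open _ _) HB). rewrite (enW_agree B A 1 GB) in K.
  eapply Rle_trans; [apply K|]; try (unfold S0; lra); try lra. intros t Ht. apply Cdisc_real, Rabs_def1; lra. }
destruct (disc_restart B 0 (9/5)) as [Z [HZ GZ]]; [unfold S0; lra|lra|lra|unfold PP; lra|unfold PP1; lra| | |].
{ assert (Rabs (0 - 6 * (PP 0 * PP 0)) <= 22/100) by (apply Rabs_le; unfold PP; lra). unfold PP at 3. lra. }
{ assert (Rabs (1 - 12 * (PP 0 * PP1 0)) <= 1/2) by (apply Rabs_le; unfold PP, PP1; lra). unfold PP at 2, PP1 at 2. lra. }
exists A, B, Z. repeat split; try assumption; first [apply GA|apply GB|apply GZ].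
Qed.

(** * Gluing in the sector *)

Definition Ws (s : C) : Prop := slit s /\ Om (xi s).

Lemma Ws_open : Copen Ws.
Proof.
apply Copen_preim; [apply Om_open|apply Copen_slit|]. intros s Hs. eexists. now apply Cd_xi.
Qed.

Definition Sec (s : C) : Prop := s <> RtoC 0 /\ - (4/5 * PI) < Carg s < 4/5 * PI.

Lemma Sec_slit (s : C) : Sec s -> slit s.
Proof. intros [H1 H2]. pose proof PI_RGT_0. apply slit_Carg. split; [exact H1|lra]. Qed.

Lemma Sec_polar (r t : R) : 0 < r -> - (4/5 * PI) < t < 4/5 * PI -> Sec (RtoC r * cis t).
Proof.
intros Hr Ht. pose proof PI_RGT_0. split; [|rewrite Carg_polar by lra; exact Ht].
apply Cmult_neq_0; [intros F; apply RtoC_inj in F; lra|apply cis_neq_0].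
Qed.

(** The power 5/8 maps the sector to the right half-plane, since [5/8 * 4/5 PI = PI/2], and openness
    is pulled back through it. *)
Lemma Sec_open : Copen Sec.
Proof.
assert (Hr : Copen (fun w => 0 < Re w)) by apply Copen_re_gt.
apply (Copen_ext (fun s => slit s /\ 0 < Re (Cpower s (5/8)))).
- intros s. pose proof PI_RGT_0.
  assert (E : Re (Cpower s (5/8)) = Rpower (Cmod s) (5/8) * cos (5/8 * Carg s)) by (unfold Cpower, cis; Csimp).
  assert (Hp := Rpower_pos (Cmod s) (5/8)). rewrite E. split.
  + intros [H1 H2]. apply slit_Carg in H1. destruct H1 as [Hn Ha]. split; [exact Hn|].
    assert (Hc : 0 < cos (5/8 * Carg s)) by (apply Rnot_le_lt; intros F; nra).
    split; apply Rnot_le_lt; intros F.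
    * rewrite <- cos_neg in Hc. assert (cos (- (5/8 * Carg s)) <= 0) by (apply cos_le_0; lra). lra.
    * assert (cos (5/8 * Carg s) <= 0) by (apply cos_le_0; lra). lra.
  + intros HS. split; [now apply Sec_slit|]. destruct HS as [_ Ha]. apply Rmult_lt_0_compat; [exact Hp|]. apply cos_gt_0; lra.
- apply (Copen_preim (fun w => 0 < Re w)); [exact Hr|apply Copen_slit|]. intros s Hs. eexists. now apply Cd_Cpower.
Qed.

Lemma xi_polar (s : C) : s <> RtoC 0 -> xi s = (RtoC (Rpower (24 * Cmod s) (5/4) / 30) * cis (5/4 * Carg s))%C.
Proof.
intros Hs. unfold xi, Cpower. rewrite Carg_scal, Cmod_mult, Cmod_RtoC_nonneg by (exact Hs || lra).
rewrite (RtoC_div _ 30) by lra. unfold Cdiv. ring.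
Qed.

Lemma Rpower_base_lt (x y a : R) : 0 < a -> 0 < x < y -> Rpower x a < Rpower y a.
Proof. intros Ha H. unfold Rpower. apply exp_increasing, Rmult_lt_compat_l; [exact Ha|]. now apply ln_increasing. Qed.

(** Here 42.6 = 24 * 1.775 and 108.6 = 30 * 3.62; the claim is 42.6^5 > 108.6^4 under a fourth
    root. *)
Lemma xi_large (r : R) : 1775/1000 < r -> 362/100 < Rpower (24 * r) (5/4) / 30.
Proof.
intros Hr. assert (K : 1086/10 < Rpower (24 * r) (5/4)); [|lra].
apply Rlt_trans with (Rpower (426/10) (5/4)); [|apply Rpower_base_lt; lra].
replace (1086/10) with (Rpower ((1086/10) ^ 4) (/ 4)).
2: { rewrite (Rpower_of_pow _ _ (INR 1)) by (simpl; lra). rewrite Rpower_pow by lra. ring. }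
rewrite <- (Rpower_of_pow (426/10) (/ 4) (5/4) 5) by (simpl; lra). apply Rpower_base_lt; lra.
Qed.

Lemma Sec_Ws (s : C) : Sec s -> 1775/1000 < Cmod s -> Ws s.
Proof.
intros HS Hm. split; [now apply Sec_slit|]. destruct HS as [Hn Ha]. pose proof PI_RGT_0. assert (L := xi_large _ Hm).
rewrite xi_polar by exact Hn. split.
- apply slit_Carg. rewrite Carg_polar by lra. split; [|lra].
  apply Cmult_neq_0; [intros F; apply RtoC_inj in F; lra|apply cis_neq_0].
- rewrite Cmod_mult, Cmod_cis, Cmod_RtoC_nonneg, Rmult_1_r by lra. exact L.
Qed.

Lemma Rd_arc (r th t : R) : Rd (fun u => RtoC r * cis (u * th))%C t (RtoC (r * th) * (Ci * cis (t * th)))%C.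
Proof.
split; unfold cis, Re, Im; simpl; (auto_derive; [auto|ring]).
Qed.

Lemma PW_arc (D E : C -> Prop) (W Z : C -> C) (r th : R) : Copen D -> Copen E -> sol2 PW D W -> sol2 PW E Z -> 0 < r ->
  (forall t, 0 <= t <= 1 -> D (RtoC r * cis (t * th))%C /\ E (RtoC r * cis (t * th))%C) ->
  agree W Z (RtoC r) -> agree W Z (RtoC r * cis th)%C.
Proof.
intros HD HE HW HZ Hr Hs Ha.
assert (K := PW_path D E W Z (fun u => RtoC r * cis (u * th))%C (fun t => RtoC (r * th) * (Ci * cis (t * th)))%C 0 1 (Rabs (r * th))
  HD HE HW HZ Rle_0_1 Hs).
cbv beta in K. rewrite Rmult_1_l, Rmult_0_l, cis_0, Cmult_1_r in K. apply K; [| |exact Ha].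
- intros t Ht. apply Rd_arc.
- intros t Ht. rewrite !Cmod_mult, Cmod_Ci, Cmod_cis, Cmod_R. lra.
Qed.

(** The discs link [Z] to [Wo] on the real interval from 1.775 to 1.8 only. An arc starting there
    stays in the sector and in the annulus, where both are solutions, so agreement spreads to the
    whole annular sector; the switch radius 1.785 lies inside it. *)
Lemma glue_exists (Wo : C -> C) : sol2 PW Ws Wo -> enW Wo S0 <= 13/100000 ->
  exists W, sol2 PW Sec W /\ forall s, Sec s -> 1785/1000 < Cmod s -> W s = Wo s.
Proof.
intros HWo HE. destruct (inner_chain Wo HE) as [A [B [Z [HA [HB [HZ [GA [GB GZ]]]]]]]].
assert (real_Ws : forall t, 1775/1000 < t -> Ws (RtoC t)).
{ intros t Ht. pose proof PI_RGT_0. apply Sec_Ws; [|rewrite Cmod_RtoC_nonneg by lra; exact Ht].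
  replace (RtoC t) with (RtoC t * cis 0)%C by (rewrite cis_0; ring). apply Sec_polar; lra. }
assert (Greal : forall t, 1775/1000 < t < 9/5 -> agree Z Wo (RtoC t)).
{ intros t Ht.
  assert (G1 : agree Z B (RtoC 1)).
  { apply (PW_real _ _ Z B 0 1 (Cdisc_open _ _) (Cdisc_open _ _) HZ HB); [|exact GZ].
    intros u. rewrite Rmin_left, Rmax_right by lra. intros Hu. split; apply Cdisc_real, Rabs_def1; lra. }
  assert (G2 : agree Z A (RtoC t)).
  { apply (PW_real _ _ Z A 1 t (Cdisc_open _ _) (Cdisc_open _ _) HZ HA); [|eapply agree_trans; [exact G1|exact GB]].
    intros u. rewrite Rmin_left, Rmax_right by lra. intros Hu. split; apply Cdisc_real, Rabs_def1; unfold S0; lra. }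
  apply (agree_trans _ _ _ _ G2).
  apply (PW_real _ _ A Wo S0 t (Cdisc_open _ _) Ws_open HA HWo); [|exact GA].
  intros u. rewrite Rmin_right, Rmax_left by (unfold S0; lra). intros Hu. split; [apply Cdisc_real, Rabs_def1; unfold S0 in *; lra|apply real_Ws; lra]. }
assert (Garc : forall s, Sec s -> 1775/1000 < Cmod s < 9/5 -> Z s = Wo s).
{ intros s [Hn Ha] Hs. destruct (polar_form s Hn) as [Ep _]. rewrite Ep.
  refine (proj1 (PW_arc (Cdisc (RtoC 0) (9/5)) Ws Z Wo (Cmod s) (Carg s) (Cdisc_open _ _) Ws_open HZ HWo _ _ (Greal _ Hs))); [lra|].
  intros t Ht. assert (M : Cmod (RtoC (Cmod s) * cis (t * Carg s)) = Cmod s) by (rewrite Cmod_mult, Cmod_cis, Cmod_RtoC_nonneg; lra).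
  split.
  - unfold Cdisc. replace (RtoC (Cmod s) * cis (t * Carg s) - RtoC 0)%C with (RtoC (Cmod s) * cis (t * Carg s))%C by ring. lra.
  - apply Sec_Ws; [|lra]. apply Sec_polar; [lra|]. pose proof PI_RGT_0. nra. }
exists (fun s => if Rlt_dec (Cmod s) (1785/1000) then Z s else Wo s). split.
2: { intros s _ Hs. destruct (Rlt_dec (Cmod s) (1785/1000)); [lra|reflexivity]. }
apply sol2_local. intros s HS. destruct (Rlt_dec (Cmod s) (1785/1000)) as [L|L].
(* The radii 1.79 here and 1.78 below lie on either side of the switch, still within the annulus
   where [Z] and [Wo] agree. *)
- exists (fun s => Sec s /\ Cdisc (RtoC 0) (179/100) s), Z. split; [apply Copen_and; [apply Sec_open|apply Cdisc_open]|].
  split; [split; [exact HS|unfold Cdisc; replace (s - RtoC 0)%C with s by ring; lra]|]. split.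
  + apply (sol2_sub PW (Cdisc (RtoC 0) (9/5))); [|exact HZ]. unfold Cdisc. intros z [_ Hz]. lra.
  + intros w [Sw Hw]. unfold Cdisc in Hw. replace (w - RtoC 0)%C with w in Hw by ring.
    destruct (Rlt_dec (Cmod w) (1785/1000)); [reflexivity|]. symmetry. apply Garc; [exact Sw|lra].
- exists (fun s => Sec s /\ 178/100 < Cmod (s - 0)), Wo. split; [apply Copen_and; [apply Sec_open|apply Copen_mod_gt]|].
  split; [split; [exact HS|replace (s - RtoC 0)%C with s by ring; lra]|]. split.
  + apply (sol2_sub PW Ws); [|exact HWo]. intros z [Sz Hz]. replace (z - 0)%C with z in Hz by ring. apply Sec_Ws; [exact Sz|lra].
  + intros w [Sw Hw]. replace (w - 0)%C with w in Hw by ring.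
    destruct (Rlt_dec (Cmod w) (1785/1000)); [|reflexivity]. apply Garc; [exact Sw|lra].
Qed.

(** * Return to the variables of the statement *)

Definition mu : C := cis (- (PI / 5)).
Definition lam : C := cis (- (2 * PI / 5)).

Lemma mu_inv (s : C) : (mu * (cis (PI / 5) * s))%C = s.
Proof. unfold mu. rewrite Cmult_assoc, <- cis_add. replace (- (PI / 5) + PI / 5) with 0 by ring. rewrite cis_0. ring. Qed.

Lemma mu_sq : (mu * mu)%C = lam.
Proof. unfold mu, lam. rewrite <- cis_add. f_equal. field. Qed.

(** For [y = - lam W(mu z)] the linear term of the second derivative is [- lam mu^3 z], which this
    identity turns into [z]; [mu_sq] matches the quadratic term. *)
Lemma lam_mu3 : (lam * (mu * mu * mu))%C = (- (1))%C.
Proof.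
unfold mu, lam. rewrite <- !cis_add. replace (- (2 * PI / 5) + (- (PI / 5) + - (PI / 5) + - (PI / 5))) with (- PI) by field.
unfold cis. rewrite cos_neg, sin_neg, cos_PI, sin_PI. apply Ceq; Csimp.
Qed.

(** In this sector the rotated argument does not leave (-PI, PI], so principal branches before and
    after the rotation differ by a constant factor. *)
Lemma sector_Carg (z : C) : sector (- (3/5) * PI) PI z -> Carg z = Carg (mu * z) + PI / 5 /\ Cmod (mu * z) = Cmod z.
Proof.
intros [Hn Ha]. pose proof PI_RGT_0. split; [|unfold mu; rewrite Cmod_mult, Cmod_cis; ring].
destruct (polar_form z Hn) as [Ep _]. assert (0 < Cmod z) by now apply Cmod_gt_0.
replace (mu * z)%C with (RtoC (Cmod z) * cis (Carg z - PI / 5))%C.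
- rewrite Carg_polar by lra. ring.
- rewrite Ep at 3. replace (Carg z - PI / 5) with (Carg z + - (PI / 5)) by ring. rewrite cis_add. unfold mu. ring.
Qed.

Lemma sector_Sec (z : C) : sector (- (3/5) * PI) PI z <-> Sec (mu * z).
Proof.
pose proof PI_RGT_0. split.
- intros Hz. destruct (sector_Carg z Hz) as [E _]. destruct Hz as [Hn Ha]. split; [|lra].
  apply Cmult_neq_0; [apply cis_neq_0|exact Hn].
- intros [Hn Ha].
  assert (Hz : z = (cis (PI / 5) * (mu * z))%C) by (rewrite Cmult_assoc, (Cmult_comm (cis _)), <- Cmult_assoc; symmetry; apply mu_inv).
  destruct (polar_form _ Hn) as [Ep _]. assert (0 < Cmod (mu * z)) by now apply Cmod_gt_0.
  split; [intros F; apply Hn; rewrite F; ring|].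
  replace z with (RtoC (Cmod (mu * z)) * cis (Carg (mu * z) + PI / 5))%C.
  + rewrite Carg_polar by lra. lra.
  + transitivity (cis (PI / 5) * (mu * z))%C; [|symmetry; exact Hz]. rewrite Ep at 3. rewrite cis_add. ring.
Qed.

Lemma sector_open : Copen (sector (- (3/5) * PI) PI).
Proof.
apply (Copen_ext (fun z => True /\ Sec (mu * z))).
- intros z. rewrite sector_Sec. tauto.
- apply (Copen_preim Sec (fun z => mu * z)%C (fun _ => True)); [apply Sec_open|intros z _; exists 1; split; [lra|auto]|].
  intros z _. eexists. apply Cd_scal, Cd_id.
Qed.

(** The power 5/4 turns the shift PI/5 into PI/4, which with the factor [cis (PI / 4)] makes
    [Ci]. *)
Lemma x_of_z_xi (z : C) : sector (- (3/5) * PI) PI z -> x_of_z z = (Ci * xi (mu * z))%C.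
Proof.
intros Hz. destruct (sector_Carg z Hz) as [E1 E2]. destruct Hz as [Hn _].
assert (Hn2 : (mu * z)%C <> RtoC 0) by (apply Cmult_neq_0; [apply cis_neq_0|exact Hn]).
unfold x_of_z. rewrite (xi_polar _ Hn2), E2. unfold Cpower. rewrite Carg_scal, Cmod_mult, Cmod_RtoC_nonneg, E1 by (exact Hn || lra).
replace (5/4 * (Carg (mu * z) + PI / 5)) with (5/4 * Carg (mu * z) + PI / 4) by field. rewrite cis_add.
replace Ci with (cis (PI / 4) * cis (PI / 4))%C; [rewrite RtoC_div by lra; field|].
rewrite <- cis_add. replace (PI / 4 + PI / 4) with (PI / 2) by field. unfold cis. now rewrite cos_PI2, sin_PI2.
Qed.

Lemma y_of_h_Wof (h : C -> C) (z : C) : sector (- (3/5) * PI) PI z ->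
  y_of_h h z = (- lam * Wof (fun x => h (Ci * x)%C) (mu * z))%C.
Proof.
intros Hz. unfold y_of_h, Wof. rewrite (x_of_z_xi z Hz). destruct (sector_Carg z Hz) as [E1 E2]. destruct Hz as [Hn _].
assert (Hn2 : (mu * z)%C <> RtoC 0) by (apply Cmult_neq_0; [apply cis_neq_0|exact Hn]).
assert (Eg : (Ci * Cpower (z / 6) (1/2) = - lam * sg (mu * z))%C).
{ unfold sg. rewrite !div6. unfold Cpower. rewrite !Carg_scal, !Cmod_mult, E1 by (assumption || lra).
  replace (Cmod mu) with 1 by (unfold mu; now rewrite Cmod_cis). rewrite Rmult_1_l.
  replace (1/2 * (Carg (mu * z) + PI / 5)) with (1/2 * Carg (mu * z) + PI / 10) by field. rewrite cis_add.
  (* In angles: PI/2 + PI/10 = PI - 2 PI/5. *)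
  assert (K : (Ci * cis (PI / 10) = - lam)%C).
  { replace Ci with (cis (PI / 2)) by (unfold cis; now rewrite cos_PI2, sin_PI2).
    replace (- lam)%C with (cis PI * lam)%C by (unfold cis at 1; rewrite cos_PI, sin_PI; apply Ceq; Csimp).
    unfold lam. rewrite <- !cis_add. f_equal. field. }
  rewrite <- K. ring. }
rewrite <- Cmult_assoc, Cmult_assoc, Eg. rewrite <- !Cmult_assoc. f_equal. f_equal. f_equal.
assert (Ei : ((Ci * xi (mu * z)) ^ 2 = - (xi (mu * z) * xi (mu * z)))%C).
{ simpl. replace (Ci * xi (mu * z) * (Ci * xi (mu * z) * 1))%C with (Ci * Ci * (xi (mu * z) * xi (mu * z)))%C by ring. rewrite Ci2. ring. }
rewrite Ei. assert (Hx := xi_neq_0 (mu * z)). field. exact Hx.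
Qed.

Lemma Ci_cancel (x : C) : (- Ci * (Ci * x))%C = x.
Proof. replace (- Ci * (Ci * x))%C with (- (Ci * Ci) * x)%C by ring. rewrite Ci2. ring. Qed.

Lemma PI_of_PW (W : C -> C) : sol2 PW Sec W -> solves_PI (sector (- (3/5) * PI) PI) (fun z => - lam * W (mu * z))%C.
Proof.
intros [W1 [W2 HW]]. split; [apply open_Copen, sector_open|].
exists (fun z => - lam * (W1 (mu * z) * mu))%C, (fun z => - lam * (W2 (mu * z) * mu * mu))%C.
intros z Hz. apply sector_Sec in Hz. destruct (HW _ Hz) as [D1 [D2 E]].
assert (Dm : Cd (fun z => mu * z)%C z mu) by (eapply Cd_eq; [|apply Cd_scal, Cd_id]; ring).
split; [|split].
- apply Cd_is_derive, Cd_scal, (Cd_comp W (fun z => mu * z)%C); assumption.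
- apply Cd_is_derive, Cd_scal. eapply Cd_eq; [|apply Cd_mult; [apply (Cd_comp W1 (fun z => mu * z)%C); eassumption|apply Cd_const]]. cbv beta. ring.
- unfold PW in E. rewrite E. simpl.
  replace (- lam * ((mu * z - 6 * (W (mu * z) * W (mu * z))) * mu * mu))%C
    with (- (lam * (mu * mu * mu)) * z + 6 * lam * (mu * mu) * (W (mu * z) * W (mu * z)))%C by ring.
  rewrite lam_mu3, mu_sq. ring.
Qed.

Lemma normalized_of_PH (Ho : C -> C) : sol2 PH Om Ho ->
  solves_normalized_PI (fun x => Om (- Ci * x)) (fun x => Ho (- Ci * x)%C).
Proof.
intros [H1 [H2 HH]]. split.
{ apply open_Copen. apply (Copen_ext (fun z => True /\ Om (- Ci * z))); [intros; tauto|].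
  apply (Copen_preim Om (fun z => - Ci * z)%C (fun _ => True)); [apply Om_open|intros z _; exists 1; split; [lra|auto]|].
  intros z _. eexists. apply Cd_scal, Cd_id. }
exists (fun x => H1 (- Ci * x) * (- Ci))%C, (fun x => H2 (- Ci * x) * (- Ci) * (- Ci))%C.
intros x Hx. destruct (HH _ Hx) as [D1 [D2 E]].
assert (Dm : Cd (fun z => - Ci * z)%C x (- Ci)) by (eapply Cd_eq; [|apply Cd_scal, Cd_id]; ring).
assert (Hn : (- Ci * x)%C <> RtoC 0) by (apply slit_neq_0, Hx).
assert (Hx0 : x <> RtoC 0) by (intros F; apply Hn; rewrite F; ring).
split; [exact Hx0|split; [|split]].
- apply Cd_is_derive, (Cd_comp Ho (fun z => - Ci * z)%C); assumption.
- apply Cd_is_derive. eapply Cd_eq; [|apply Cd_mult; [apply (Cd_comp H1 (fun z => - Ci * z)%C); eassumption|apply Cd_const]]. cbv beta. ring.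
- unfold PH in E. set (w := (- Ci * x)%C) in *. assert (Ex : x = (Ci * w)%C).
  { unfold w. replace (Ci * (- Ci * x))%C with (- Ci * (Ci * x))%C by ring. now rewrite Ci_cancel. }
  assert (E4 : (x ^ 4 = w * w * w * w)%C).
  { rewrite Ex. simpl. replace (Ci * w * (Ci * w * (Ci * w * (Ci * w * 1))))%C with ((Ci * Ci) * (Ci * Ci) * (w * w * w * w))%C by ring. rewrite Ci2. ring. }
  rewrite E4.
  assert (E5 : (1 / x * (H1 w * - Ci) = - (H1 w / w))%C).
  { assert (HCi : Ci <> RtoC 0) by (intros F; apply (f_equal Im) in F; simpl in F; lra). rewrite Ex. field. split; assumption. }
  rewrite E5. replace (H2 w * - Ci * - Ci)%C with (Ci * Ci * H2 w)%C by ring. rewrite Ci2.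
  replace (- (1) * H2 w + - (H1 w / w) - Ho w)%C with (- (H2 w + H1 w / w + Ho w))%C by ring. rewrite E.
  unfold cP. rewrite RtoC_div by lra. simpl. field. exact Hn.
Qed.

(** * Uniqueness of the decaying solution *)

(** Over a step of length 1 the derivative varies by at most [m], so [f1 t] differs from
    [f (t + 1) - f t] by at most [m]. With the equation this gives decay of the derivative from
    decay of the function. *)
Lemma landau (f f1 f2 : R -> C) (t m : R) : (forall u, t <= u -> Rd f u (f1 u) /\ Rd f1 u (f2 u)) ->
  (forall u, t <= u -> Cmod (f u) <= m /\ Cmod (f2 u) <= m) -> Cmod (f1 t) <= 3 * m.
Proof.
intros Hd Hb.
assert (K1 : forall u, t <= u <= t + 1 -> Cmod (f1 u - f1 t) <= m).
{ intros u Hu. assert (K := Rd_bound f1 f2 (fun u => m * u) (fun _ => m) t u (proj1 Hu)). cbv beta in K.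
  assert (0 <= m) by (eapply Rle_trans; [apply Cmod_ge_0|apply (proj1 (Hb t (Rle_refl t)))]).
  eapply Rle_trans; [apply K|nra].
  - intros v Hv. apply Hd; lra.
  - intros v Hv. auto_derive; auto; ring.
  - intros v Hv. apply Hb; lra. }
assert (K2 := Rd_bound (fun u => f u - RtoC u * f1 t)%C (fun u => f1 u - f1 t)%C (fun u => m * u) (fun _ => m) t (t + 1)). cbv beta in K2.
assert (K3 : Cmod (f (t + 1) - RtoC (t + 1) * f1 t - (f t - RtoC t * f1 t)) <= m * (t + 1) - m * t).
{ apply K2; [lra| | |exact K1].
  - intros u Hu. apply Rd_minus; [apply Hd; lra|].
    eapply Rd_eq; [|apply (Rd_mult (fun u => RtoC u) (fun _ => f1 t) u 1%C 0%C); [apply (Rd_real (fun u => u) u 1), (@is_derive_id R_AbsRing)|apply Rd_const]]. ring.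
  - intros v Hv. auto_derive; auto; ring. }
replace (f (t + 1)%R - RtoC (t + 1) * f1 t - (f t - RtoC t * f1 t))%C with (- (f1 t - (f (t + 1)%R - f t)))%C in K3 by (rewrite RtoC_plus; ring).
rewrite Cmod_opp in K3. assert (K4 := Cmod_rev_tri (f1 t) (f (t + 1)%R - f t)). assert (K5 := Cmod_tri_minus (f (t + 1)) (f t)).
destruct (Hb t) as [B0 _]; [lra|]. destruct (Hb (t + 1)) as [B1 _]; [lra|]. lra.
Qed.

Definition nrm2 (z w : C) : R := Re z * Re z + Im z * Im z + (Re w * Re w + Im w * Im w).

Lemma Cmod_sqr (z : C) : Re z * Re z + Im z * Im z = Cmod z * Cmod z.
Proof. unfold Cmod. rewrite sqrt_sqrt; [unfold Re, Im; simpl; ring|apply Rplus_le_le_0_compat; apply pow2_ge_0]. Qed.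

Lemma nrm2_eq (z w : C) : nrm2 z w = Cmod z * Cmod z + Cmod w * Cmod w.
Proof. unfold nrm2. now rewrite !Cmod_sqr. Qed.

(* The energy times [exp (-K/t)] is nondecreasing, and it tends to 0. *)
Lemma decaying_oscillator (d d1 q : R -> C) (K a c : R) : 1 <= a -> 0 <= K -> 0 <= c ->
  (forall t, a <= t -> Rd d t (d1 t) /\ Rd d1 t (- d t + q t * d t)%C) ->
  (forall t, a <= t -> Cmod (q t) <= K / (t * t)) -> (forall t, a <= t -> Cmod (d t) <= c / t) ->
  forall t, a <= t -> d t = RtoC 0 /\ d1 t = RtoC 0.
Proof.
intros Ha HK Hc Hd Hq Hs t Ht.
assert (Hd1 : forall u, a <= u -> Cmod (d1 u) <= 3 * ((1 + K) * c / u)).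
{ intros u Hu. apply (landau d d1 (fun t => - d t + q t * d t)%C); [intros v Hv; apply Hd; lra|].
  intros v Hv. assert (Hcv : c / v <= c / u) by (apply Rmult_le_compat_l; [exact Hc|apply Rinv_le_contravar; lra]).
  assert (H1 := Hs v ltac:(lra)). assert (H0 : 0 <= c / u) by (apply Rmult_le_pos; [exact Hc|left; apply Rinv_0_lt_compat; lra]).
  assert (Hq1 : Cmod (q v) <= K).
  { eapply Rle_trans; [apply Hq; lra|]. rewrite <- (Rmult_1_r K) at 2. apply Rmult_le_compat_l; [exact HK|].
    rewrite <- Rinv_1. apply Rinv_le_contravar; nra. }
  replace ((1 + K) * c / u) with (c / u + K * (c / u)) by (unfold Rdiv; ring).
  assert (0 <= K * (c / u)) by (apply Rmult_le_pos; assumption). split; [lra|].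
  eapply Rle_trans; [apply Cmod_triangle|]. rewrite Cmod_opp, Cmod_mult.
  assert (Cmod (q v) * Cmod (d v) <= K * (c / u)) by (apply Rmult_le_compat; try apply Cmod_ge_0; lra). lra. }
set (M := c * c + 9 * ((1 + K) * c) * ((1 + K) * c)).
assert (HM : 0 <= M) by (unfold M; nra).
set (N u := nrm2 (d u) (d1 u)).
assert (HNb : forall u, a <= u -> N u <= M / u).
{ intros u Hu. unfold N. rewrite nrm2_eq. assert (B0 := Hs u Hu). assert (B1 := Hd1 u Hu).
  pose proof (Cmod_ge_0 (d u)). pose proof (Cmod_ge_0 (d1 u)).
  assert (Hi : 0 < / u <= 1) by (split; [apply Rinv_0_lt_compat; lra|rewrite <- Rinv_1; apply Rinv_le_contravar; lra]).
  apply Rle_trans with (c / u * (c / u) + 3 * ((1 + K) * c / u) * (3 * ((1 + K) * c / u))).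
  - apply Rplus_le_compat; apply Rmult_le_compat; assumption.
  - unfold Rdiv, M. replace (c * / u * (c * / u) + 3 * ((1 + K) * c * / u) * (3 * ((1 + K) * c * / u)))
      with ((c * c + 9 * ((1 + K) * c) * ((1 + K) * c)) * / u * / u) by ring. fold M.
    rewrite <- (Rmult_1_r (M * / u)) at 2. apply Rmult_le_compat_l; [apply Rmult_le_pos; lra|lra]. }
assert (Hmono : forall u, t <= u -> N t * exp (- K / t) <= N u * exp (- K / u)).
{ intros u Hu. set (N' v := 2 * (Re (d1 v) * Re (q v * d v) + Im (d1 v) * Im (q v * d v))).
  apply (incr_der (fun v => N v * exp (- K / v)) (fun v => N' v * exp (- K / v) + N v * (exp (- K / v) * (K / (v * v)))) t u Hu).
  - intros v Hv. destruct (Hd v) as [[D1 D2] [D3 D4]]; [lra|].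
    apply (is_derive_Rmult N (fun v => exp (- K / v))).
    + eapply is_derive_eq; [|apply (is_derive_plus (V := R_NormedModule) (fun v => Re (d v) * Re (d v) + Im (d v) * Im (d v)) (fun v => Re (d1 v) * Re (d1 v) + Im (d1 v) * Im (d1 v)));
        [apply (is_derive_plus (V := R_NormedModule) (fun v => Re (d v) * Re (d v)) (fun v => Im (d v) * Im (d v)))
        |apply (is_derive_plus (V := R_NormedModule) (fun v => Re (d1 v) * Re (d1 v)) (fun v => Im (d1 v) * Im (d1 v)))];
        [apply (is_derive_Rmult (fun v => Re (d v)) (fun v => Re (d v)))|apply (is_derive_Rmult (fun v => Im (d v)) (fun v => Im (d v)))
        |apply (is_derive_Rmult (fun v => Re (d1 v)) (fun v => Re (d1 v)))|apply (is_derive_Rmult (fun v => Im (d1 v)) (fun v => Im (d1 v)))]; eassumption].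
      unfold plus; simpl. unfold N'. Csimp.
    + auto_derive; [lra|]. unfold Rdiv. field. lra.
  - intros v Hv. assert (Hq' := Hq v ltac:(lra)).
    assert (Hb : - N' v <= K / (v * v) * N v).
    { assert (H1 : - N' v <= 2 * (Cmod (d1 v) * Cmod (q v * d v))).
      { unfold N'. assert (0 <= Cmod (d1 v) * Cmod (q v * d v)) by (apply Rmult_le_pos; apply Cmod_ge_0).
        assert (Hcs : Rabs (Re (d1 v) * Re (q v * d v) + Im (d1 v) * Im (q v * d v)) <= Cmod (d1 v) * Cmod (q v * d v)).
        { rewrite <- (Rabs_pos_eq (Cmod (d1 v) * Cmod (q v * d v))) by assumption. apply Rsqr_le_abs_0. unfold Rsqr.
          replace (Cmod (d1 v) * Cmod (q v * d v) * (Cmod (d1 v) * Cmod (q v * d v))) with ((Cmod (d1 v) * Cmod (d1 v)) * (Cmod (q v * d v) * Cmod (q v * d v))) by ring.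
          rewrite <- !Cmod_sqr. generalize (q v * d v)%C. intros w. pose proof (Rle_0_sqr (Re (d1 v) * Im w - Im (d1 v) * Re w)) as Q. unfold Rsqr in Q.
          match goal with |- ?l <= ?r => replace r with (l + (Re (d1 v) * Im w - Im (d1 v) * Re w) * (Re (d1 v) * Im w - Im (d1 v) * Re w)) by ring end. lra. }
        apply Rabs_le_between in Hcs. lra. }
      eapply Rle_trans; [exact H1|]. rewrite Cmod_mult. unfold N. rewrite nrm2_eq.
      pose proof (Cmod_ge_0 (d v)). pose proof (Cmod_ge_0 (d1 v)). pose proof (Cmod_ge_0 (q v)).
      apply Rle_trans with (Cmod (q v) * (Cmod (d v) * Cmod (d v) + Cmod (d1 v) * Cmod (d1 v))).
      - replace (2 * (Cmod (d1 v) * (Cmod (q v) * Cmod (d v)))) with (Cmod (q v) * (2 * (Cmod (d v) * Cmod (d1 v)))) by ring.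
        apply Rmult_le_compat_l; [assumption|]. pose proof (Rle_0_sqr (Cmod (d v) - Cmod (d1 v))) as Q. unfold Rsqr in Q. lra.
      - apply Rmult_le_compat_r; [nra|exact Hq']. }
    pose proof (exp_pos (- K / v)).
    replace (N' v * exp (- K / v) + N v * (exp (- K / v) * (K / (v * v)))) with (exp (- K / v) * (N' v + K / (v * v) * N v)) by ring.
    apply Rmult_le_pos; lra. }
assert (HN0 : 0 <= N t) by (unfold N; rewrite nrm2_eq; pose proof (Cmod_ge_0 (d t)); pose proof (Cmod_ge_0 (d1 t)); nra).
assert (HNt : N t = 0).
{ apply Rle_antisym; [|exact HN0]. apply Rnot_lt_le. intros F.
  set (e := N t * exp (- K / t)). assert (He : 0 < e) by (apply Rmult_lt_0_compat; [exact F|apply exp_pos]).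
  (* Far enough that the decay bound [M / u] falls below the positive constant [e]. *)
  set (u := Rmax t ((M + 1) / e)). assert (Hu1 : t <= u) by apply Rmax_l. assert (Hu2 : (M + 1) / e <= u) by apply Rmax_r.
  assert (B := Hmono u Hu1). fold e in B. assert (B2 := HNb u ltac:(lra)).
  assert (Hex : exp (- K / u) <= 1).
  { rewrite <- exp_0. apply exp_le_compat. unfold Rdiv. assert (0 < / u) by (apply Rinv_0_lt_compat; lra). nra. }
  assert (0 <= M / u) by (apply Rmult_le_pos; [exact HM|left; apply Rinv_0_lt_compat; lra]).
  pose proof (exp_pos (- K / u)).
  assert (B3 : e <= M / u) by (eapply Rle_trans; [exact B|]; rewrite <- (Rmult_1_r (M / u)); apply Rmult_le_compat; try lra; unfold N; rewrite nrm2_eq; pose proof (Cmod_ge_0 (d u)); pose proof (Cmod_ge_0 (d1 u)); nra).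
  assert (B4 : e * u <= M) by (replace M with (M / u * u) by (field; lra); apply Rmult_le_compat_r; lra).
  assert (B5 : M + 1 <= u * e) by (replace (M + 1) with ((M + 1) / e * e) by (field; lra); apply Rmult_le_compat_r; lra). lra. }
unfold N in HNt. rewrite nrm2_eq in HNt.
pose proof (Cmod_ge_0 (d t)). pose proof (Cmod_ge_0 (d1 t)).
split; apply Cmod_eq_0; nra.
Qed.

(* Liouville's substitution [d = sqrt t (H - G)] removes the first-order term. *)
Lemma PH_unique (D E : C -> Prop) (H G : C -> C) (T M : R) : Copen D -> Copen E -> sol2 PH D H -> sol2 PH E G ->
  (forall t, T < t -> D (RtoC t) /\ E (RtoC t)) ->
  (forall t, T < t -> Cmod (H (RtoC t)) <= M / t ^ 4 /\ Cmod (G (RtoC t)) <= M / t ^ 4) ->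
  exists T', forall t, T' < t -> agree H G (RtoC t).
Proof.
intros HD HE SH SG Hin HB. assert (SH' := sol2_Cder PH D H HD SH). assert (SG' := sol2_Cder PH E G HE SG).
set (a := Rmax 1 (T + 1)). assert (Ha1 : 1 <= a) by apply Rmax_l. assert (HaT : T + 1 <= a) by apply Rmax_r.
assert (Hin' : forall t, a <= t -> D (RtoC t) /\ E (RtoC t)) by (intros; apply Hin; lra).
assert (HM : 0 <= M).
{ destruct (HB a) as [B _]; [lra|]. assert (0 < a ^ 4) by (apply pow_lt; lra).
  assert (0 <= M / a ^ 4) by (eapply Rle_trans; [apply Cmod_ge_0|exact B]).
  replace M with (M / a ^ 4 * a ^ 4) by (field; lra). apply Rmult_le_pos; lra. }
assert (HB' : forall t, a <= t -> Cmod (H (RtoC t)) <= M / (t * t) /\ Cmod (G (RtoC t)) <= M / (t * t)).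
{ intros t Ht. assert (M / t ^ 4 <= M / (t * t)).
  { apply Rmult_le_compat_l; [exact HM|]. apply Rinv_le_contravar; [nra|]. replace (t ^ 4) with (t * t * (t * t)) by ring. assert (1 <= t * t) by nra. nra. }
  destruct (HB t) as [B1 B2]; lra. }
set (s t := sqrt t).
assert (Hs : forall t, a <= t -> 0 < s t /\ s t * s t = t) by (intros t Ht; split; [apply sqrt_lt_R0; lra|apply sqrt_sqrt; lra]).
set (d t := (RtoC (s t) * (H (RtoC t) - G (RtoC t)))%C).
set (d1 t := (RtoC (/ (2 * s t)) * (H (RtoC t) - G (RtoC t)) + RtoC (s t) * (Cder H (RtoC t) - Cder G (RtoC t)))%C).
set (q t := (RtoC (- / 2) * (H (RtoC t) + G (RtoC t)) - RtoC (/ (4 * t * t)))%C).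
assert (DR : forall t, Rd RtoC t 1%C) by (intros t; apply (Rd_real (fun u => u) t 1), (@is_derive_id R_AbsRing)).
assert (K := decaying_oscillator d d1 q (M + / 4) a (2 * M) Ha1).
assert (Hz : forall t, a <= t -> d t = RtoC 0 /\ d1 t = RtoC 0).
{ apply K; [lra|lra| | |]; intros t Ht; destruct (Hs t Ht) as [S1 S2].
  - destruct (Hin' t Ht) as [HDt HEt]. destruct (SH' _ HDt) as [A1 [A2 A3]]. destruct (SG' _ HEt) as [B1 [B2 B3]].
    assert (C1 : Rd (fun t => H (RtoC t) - G (RtoC t))%C t (Cder H (RtoC t) - Cder G (RtoC t))%C).
    { eapply Rd_eq; [|apply Rd_minus; apply (Cd_Rd _ RtoC); try apply DR; eassumption]. ring. }
    assert (C2 : Rd (fun t => Cder H (RtoC t) - Cder G (RtoC t))%C t (Cder (Cder H) (RtoC t) - Cder (Cder G) (RtoC t))%C).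
    { eapply Rd_eq; [|apply Rd_minus; apply (Cd_Rd _ RtoC); try apply DR; eassumption]. ring. }
    assert (C3 : Rd (fun t => RtoC (s t)) t (RtoC (/ (2 * s t)))).
    { apply Rd_real. unfold s in *. auto_derive; [lra|]. field. lra. }
    assert (C4 : Rd (fun t => RtoC (/ (2 * s t))) t (RtoC (- / (4 * t * s t)))).
    { apply Rd_real. assert (S3 := S2). unfold s in *. auto_derive; [split; [lra|split; [apply Rgt_not_eq; nra|auto]]|].
      clear - S1 S3. revert S1 S3. generalize (sqrt t). intros x S1 S3. rewrite <- S3. field. lra. }
    assert (Hsn : RtoC (s t) <> RtoC 0) by (intros F; apply RtoC_inj in F; lra).
    split.
    + unfold d. eapply Rd_eq; [|apply Rd_mult; [exact C3|exact C1]]. reflexivity.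
    + unfold d1. eapply Rd_eq; [|apply Rd_plus; apply Rd_mult; [exact C4|exact C1|exact C3|exact C2]].
      unfold PH in A3, B3. assert (Htn : RtoC t <> RtoC 0) by (intros F; apply RtoC_inj in F; lra).
      replace (Cder (Cder H) (RtoC t)) with (- (Cder H (RtoC t) / RtoC t) - H (RtoC t) + (- (H (RtoC t) * H (RtoC t)) / 2 - RtoC cP / (RtoC t * RtoC t * RtoC t * RtoC t)))%C by (rewrite <- A3; ring).
      replace (Cder (Cder G) (RtoC t)) with (- (Cder G (RtoC t) / RtoC t) - G (RtoC t) + (- (G (RtoC t) * G (RtoC t)) / 2 - RtoC cP / (RtoC t * RtoC t * RtoC t * RtoC t)))%C by (rewrite <- B3; ring).
      unfold d, q. clear - S1 S2 Hsn Htn.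
      assert (Htp : 0 < t) by nra. rewrite !RtoC_opp, !RtoC_inv by (repeat apply Rmult_integral_contrapositive_currified; lra). rewrite !RtoC_mult.
      assert (Et : RtoC t = (RtoC (s t) * RtoC (s t))%C) by (rewrite <- RtoC_mult; now rewrite S2).
      (* Everything becomes rational in the square root [w] of the parameter. *)
      generalize dependent (RtoC (s t)). generalize dependent (RtoC t). intros z Hz w Hw ->.
      generalize (H (w * w)%C) (G (w * w)%C) (Cder H (w * w)%C) (Cder G (w * w)%C). intros. field. exact Hw.
  - destruct (HB' t Ht) as [B1 B2]. unfold q. eapply Rle_trans; [apply Cmod_tri_minus|]. rewrite Cmod_mult, !Cmod_R.
    rewrite (Rabs_left (- / 2)) by lra. assert (Ht2 : 0 < / (4 * t * t)) by (apply Rinv_0_lt_compat; nra). rewrite (Rabs_pos_eq (/ (4 * t * t))) by lra.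
    assert (B3 := Cmod_triangle (H (RtoC t)) (G (RtoC t))).
    replace ((M + / 4) / (t * t)) with (M / (t * t) + / (4 * t * t)) by (field; lra). lra.
  - destruct (HB' t Ht) as [B1 B2]. unfold d. rewrite Cmod_mult, Cmod_RtoC_nonneg by lra.
    assert (B3 := Cmod_tri_minus (H (RtoC t)) (G (RtoC t))).
    apply Rle_trans with (t * (2 * M / (t * t))).
    + apply Rmult_le_compat; [lra|apply Cmod_ge_0| |]; [|unfold Rdiv in *; lra].
      rewrite <- S2 at 2. assert (1 <= s t) by (unfold s; rewrite <- sqrt_1; apply sqrt_le_1_alt; lra). nra.
    + apply Req_le. field. lra. }
exists a. intros t Ht. destruct (Hz t) as [E0 E1]; [lra|]. destruct (Hs t) as [S1 S2]; [lra|].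
assert (Hsn : RtoC (s t) <> RtoC 0) by (intros F; apply RtoC_inj in F; lra).
assert (F0 : (H (RtoC t) - G (RtoC t))%C = RtoC 0).
{ replace (H (RtoC t) - G (RtoC t))%C with (/ RtoC (s t) * d t)%C by (unfold d; field; exact Hsn). rewrite E0. ring. }
assert (F1 : (Cder H (RtoC t) - Cder G (RtoC t))%C = RtoC 0).
{ unfold d1 in E1. rewrite F0 in E1. replace (Cder H (RtoC t) - Cder G (RtoC t))%C with (/ RtoC (s t) * (RtoC (/ (2 * s t)) * RtoC 0 + RtoC (s t) * (Cder H (RtoC t) - Cder G (RtoC t))))%C by (field; exact Hsn). rewrite E1. ring. }
assert (Cz : forall x y : C, (x - y)%C = RtoC 0 -> x = y) by (intros x y Hxy; replace x with (x - y + y)%C by ring; rewrite Hxy; ring).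
split; now apply Cz.
Qed.

(** * Decaying solutions on the ray and the final comparison *)

Lemma Cmod_inv_Ci4 (t : R) : 0 < t -> Cmod (/ (Ci * t) ^ 4)%C = / t ^ 4.
Proof.
intros Ht. assert (E : ((Ci * t) ^ 4)%C = RtoC (t ^ 4)).
{ simpl. rewrite !RtoC_mult. replace (Ci * t * (Ci * t * (Ci * t * (Ci * t * 1))))%C with ((Ci * Ci) * (Ci * Ci) * (t * t * t * t))%C by ring. rewrite Ci2. ring. }
assert (0 < t ^ 4) by now apply pow_lt.
rewrite E, <- RtoC_inv, Cmod_RtoC_nonneg by (try (left; apply Rinv_0_lt_compat); lra). reflexivity.
Qed.

Lemma PH_of_normalized (E : C -> Prop) (h : C -> C) : solves_normalized_PI E h ->
  sol2 PH (fun x => E (Ci * x)%C) (fun x => h (Ci * x)%C).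
Proof.
intros [_ [h1 [h2 Hh]]]. exists (fun x => h1 (Ci * x) * Ci)%C, (fun x => h2 (Ci * x) * Ci * Ci)%C.
intros x Hx. destruct (Hh _ Hx) as [Hn [D1 [D2 Eq]]]. apply Cd_is_derive in D1. apply Cd_is_derive in D2.
assert (Dm : Cd (fun x => Ci * x)%C x Ci) by (eapply Cd_eq; [|apply Cd_scal, Cd_id]; ring).
assert (Hx0 : x <> RtoC 0) by (intros F; apply Hn; rewrite F; ring).
split; [|split].
- apply (Cd_comp h (fun x => Ci * x)%C); assumption.
- eapply Cd_eq; [|apply Cd_mult; [apply (Cd_comp h1 (fun x => Ci * x)%C); eassumption|apply Cd_const]]. cbv beta. ring.
- unfold PH. assert (HCi : Ci <> RtoC 0) by (intros F; apply (f_equal Im) in F; simpl in F; lra).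
  assert (E4 : ((Ci * x) ^ 4 = x * x * x * x)%C).
  { simpl. replace (Ci * x * (Ci * x * (Ci * x * (Ci * x * 1))))%C with ((Ci * Ci) * (Ci * Ci) * (x * x * x * x))%C by ring. rewrite Ci2. ring. }
  assert (E5 : (h1 (Ci * x) * Ci / x = - (1 / (Ci * x) * h1 (Ci * x)))%C).
  { replace (h1 (Ci * x) * Ci / x)%C with (Ci * Ci * (1 / (Ci * x) * h1 (Ci * x)))%C by (field; split; assumption). rewrite Ci2. ring. }
  rewrite E4 in Eq. rewrite E5. replace (h2 (Ci * x) * Ci * Ci)%C with (Ci * Ci * h2 (Ci * x))%C by ring. rewrite Ci2.
  replace (- (1) * h2 (Ci * x) + - (1 / (Ci * x) * h1 (Ci * x)) + h (Ci * x))%C with (- (h2 (Ci * x) + 1 / (Ci * x) * h1 (Ci * x) - h (Ci * x)))%C by ring.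
  rewrite Eq. unfold cP. rewrite RtoC_div by lra. simpl. field. exact Hx0.
Qed.

Lemma mu_ray (t : R) : (mu * ray (PI / 5) t)%C = RtoC t.
Proof. unfold ray. rewrite (Cmult_comm (RtoC t)). apply mu_inv. Qed.

Lemma Sec_real (t : R) : 0 < t -> Sec (RtoC t).
Proof.
intros Ht. pose proof PI_RGT_0. replace (RtoC t) with (RtoC t * cis 0)%C by (rewrite cis_0; ring). apply Sec_polar; lra.
Qed.

Lemma ray_sector (t : R) : 0 < t -> sector (- (3/5) * PI) PI (ray (PI / 5) t).
Proof. intros Ht. apply sector_Sec. rewrite mu_ray. now apply Sec_real. Qed.

(** A crude linear bound is enough to translate thresholds in [xi] into thresholds on the ray. *)
Lemma xi_real_ge (t : R) : 1 <= t -> exists x, xi (RtoC t) = RtoC x /\ 8/10 * t <= x.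
Proof.
intros Ht. exists (Rpower (24 * t) (5/4) / 30). split; [apply xi_real; lra|].
assert (24 * t <= Rpower (24 * t) (5/4)); [|lra].
rewrite <- (Rpower_1 (24 * t)) at 1 by lra. apply Rle_Rpower; lra.
Qed.

Lemma outer_decay (H Ho : C -> C) (phi : C -> C) : (forall z, 0 <= Re z -> Ho z = H z) ->
  (forall z, Dp z -> H z = (rs z * phi z - RtoC cP / (z * z * z * z))%C /\ Cmod (phi z) <= Bp * wp z) ->
  forall t, 4 < t -> Cmod (Ho (RtoC t)) <= 9 / t ^ 4.
Proof.
intros EH HB t Ht. rewrite EH by (simpl; lra).
destruct (HB (RtoC t)) as [E B].
{ split; [simpl; unfold del; lra|]. rewrite <- RtoC_plus, Cmod_RtoC_nonneg; unfold RR, del; lra. }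
rewrite E. eapply Rle_trans; [apply Cmod_tri_minus|].
assert (K := rs_decay t (phi (RtoC t)) ltac:(lra) B).
assert (Ht4 : 0 < / t ^ 4) by (apply Rinv_0_lt_compat, pow_lt; lra).
assert (K2 : Bp / t ^ 5 <= Bp * / t ^ 4).
{ apply Rmult_le_compat_l; [unfold Bp; lra|]. apply Rinv_le_contravar; [apply pow_lt; lra|]. assert (0 < t ^ 4) by (apply pow_lt; lra). simpl in *. nra. }
replace (RtoC cP / (RtoC t * RtoC t * RtoC t * RtoC t))%C with (RtoC (cP * / t ^ 4)).
- rewrite Cmod_RtoC_nonneg by (unfold cP; lra). unfold Rdiv. unfold Bp, cP in *. lra.
- rewrite RtoC_mult, RtoC_inv by (apply Rgt_not_eq, pow_lt; lra). simpl. rewrite !RtoC_mult. unfold Cdiv. f_equal. f_equal. ring.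
Qed.

Lemma Wof_ext (H G : C -> C) (s : C) : H (xi s) = G (xi s) -> Wof H s = Wof G s.
Proof. intros E. unfold Wof. now rewrite E. Qed.

Lemma Wof_agree (D E : C -> Prop) (H G : C -> C) (s : C) : Copen D -> Copen E -> sol2 PH D H -> sol2 PH E G ->
  slit s -> D (xi s) -> E (xi s) -> agree H G (xi s) -> agree (Wof H) (Wof G) s.
Proof.
intros HD HE SH SG Hs Ds Es [A1 A2]. split; [now apply Wof_ext|].
destruct (sol2_Cder PH D H HD SH _ Ds) as [D1 _]. destruct (sol2_Cder PH E G HE SG _ Es) as [D2 _].
rewrite (Wof_Cder H s _ Hs D1), (Wof_Cder G s _ Hs D2), A1, A2. reflexivity.
Qed.

Lemma near_ray_locally (P : C -> Prop) (Q : C -> Prop) (t : R) : Copen Q -> Q (RtoC t) ->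
  (forall z, Q (mu * z)%C -> P z) -> @locally C_UniformSpace (ray (PI / 5) t) P.
Proof.
intros HQ Qt HP. destruct (HQ _ Qt) as [r [Hr Hb]]. apply locally_Cmod. exists r. split; [exact Hr|].
intros w Hw. apply HP, Hb. rewrite <- (mu_ray t). replace (mu * w - mu * ray (PI / 5) t)%C with (mu * (w - ray (PI / 5) t))%C by ring.
unfold mu. rewrite Cmod_mult, Cmod_cis. lra.
Qed.

Theorem corollary1 :
  exists yt : C -> C,
    is_tritronquee (sector (- (3 / 5) * PI) PI) yt /\
    (forall (D : C -> Prop) (y : C -> C),
        is_tritronquee D y -> same_near_ray_end y yt).
Proof.
destruct outer_exists as [H [Ho [SH [EH [H1 [H2 [phi [phi1 [HD HB]]]]]]]]].
assert (SW : sol2 PW Ws (Wof Ho)) by apply (Wof_sol Om Ho SH).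
(* [W] lives on the whole sector and coincides with [Wof Ho] for |s| > 1.785, so it inherits the
   asymptotics on the ray. *)
destruct (glue_exists (Wof Ho) SW (en_S0 H Ho H1 H2 phi phi1 EH HD HB)) as [W [HW EW]].
assert (Dec : forall t, 4 < t -> Cmod (Ho (RtoC t)) <= 9 / t ^ 4).
{ apply (outer_decay H Ho phi EH). intros z Hz. destruct (HB z Hz) as [B1 [_ [B2 _]]]. now split. }
set (h0 x := Ho (- Ci * x)%C).
assert (Eyt : forall z, Sec (mu * z) /\ 1785/1000 < Cmod (mu * z - 0) -> (- lam * W (mu * z))%C = y_of_h h0 z).
{ intros z [HS Hm]. rewrite y_of_h_Wof by now apply sector_Sec. f_equal. replace (mu * z - 0)%C with (mu * z)%C in Hm by ring.
  rewrite EW by assumption. apply Wof_ext. unfold h0. now rewrite Ci_cancel. }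
assert (HOm : forall t, 4 < t -> Om (RtoC t)) by (intros t Ht; split; [left; simpl; lra|rewrite Cmod_RtoC_nonneg; lra]).
exists (fun z => - lam * W (mu * z))%C. split.
- split; [now apply PI_of_PW|]. exists (fun x => Om (- Ci * x)), h0. split.
  + split; [now apply normalized_of_PH|]. exists 9, 4. split; [lra|]. intros t Ht. unfold h0. rewrite Ci_cancel, Cmod_inv_Ci4 by lra.
    split; [now apply HOm|now apply Dec].
  + exists 2. split; [lra|]. intros t Ht. split; [apply ray_sector; lra|].
    apply (near_ray_locally _ (fun s => Sec s /\ 1785/1000 < Cmod (s - 0))); [apply Copen_and; [apply Sec_open|apply Copen_mod_gt]| |exact Eyt].
    split; [apply Sec_real; lra|]. replace (RtoC t - 0)%C with (RtoC t) by ring. rewrite Cmod_RtoC_nonneg; lra.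
- intros D y [_ [E [h [[Hnorm [M [T1 [HT1 Hdec]]]] [T2 [HT2 Hy]]]]]].
  assert (Sh := PH_of_normalized E h Hnorm). set (G x := h (Ci * x)%C). set (DE x := E (Ci * x)%C).
  change (sol2 PH DE G) in Sh.
  assert (ODE : Copen DE).
  { destruct Hnorm as [HE _]. apply open_Copen in HE. apply (Copen_ext (fun x => True /\ E (Ci * x)%C)); [unfold DE; tauto|].
    apply (Copen_preim E (fun x => Ci * x)%C (fun _ => True)); [exact HE|intros z _; exists 1; split; [lra|auto]|].
    intros z _. eexists. apply Cd_scal, Cd_id. }
  (* The two solutions are compared on the positive [xi]-axis; the larger threshold and the larger
     constant serve both decay bounds. *)
  destruct (PH_unique DE Om G Ho (Rmax T1 4) (Rmax M 9) ODE Om_open Sh SH) as [T3 Ha].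
  { intros t Ht. pose proof (Rmax_l T1 4). pose proof (Rmax_r T1 4). split; [apply Hdec; lra|apply HOm; lra]. }
  { intros t Ht. pose proof (Rmax_l T1 4). pose proof (Rmax_r T1 4).
    assert (0 < / t ^ 4) by (apply Rinv_0_lt_compat, pow_lt; lra).
    pose proof (Rmax_l M 9). pose proof (Rmax_r M 9). split.
    - destruct (Hdec t) as [_ B]; [lra|]. rewrite Cmod_inv_Ci4 in B by lra. eapply Rle_trans; [exact B|]. apply Rmult_le_compat_r; lra.
    - eapply Rle_trans; [apply Dec; lra|]. apply Rmult_le_compat_r; lra. }
  (* The factor 2 beats the constant 8/10 of [xi_real_ge], so that [xi] is past every threshold. *)
  exists (Rmax T2 (2 * Rmax (Rmax T1 4) T3)). split; [eapply Rlt_le_trans; [exact HT2|apply Rmax_l]|]. intros t Ht.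
  pose proof (Rmax_l T2 (2 * Rmax (Rmax T1 4) T3)). pose proof (Rmax_r T2 (2 * Rmax (Rmax T1 4) T3)).
  pose proof (Rmax_l (Rmax T1 4) T3). pose proof (Rmax_r (Rmax T1 4) T3). pose proof (Rmax_l T1 4). pose proof (Rmax_r T1 4).
  destruct (xi_real_ge t) as [x [Ex Hx]]; [lra|].
  assert (Hslit : slit (RtoC t)) by (left; simpl; lra).
  assert (Dx : DE (xi (RtoC t))) by (rewrite Ex; apply Hdec; lra).
  assert (Ox : Om (xi (RtoC t))) by (rewrite Ex; apply HOm; lra).
  assert (A0 : agree (Wof G) (Wof Ho) (RtoC t)).
  { apply (Wof_agree DE Om); try assumption; [apply Om_open|]. rewrite Ex. apply Ha. lra. }
  assert (SWG := Wof_sol DE G Sh).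
  set (DW s := slit s /\ DE (xi s)) in *.
  assert (ODW : Copen DW) by (apply Copen_preim; [exact ODE|apply Copen_slit|intros s Hs; eexists; now apply Cd_xi]).
  destruct (ODW (RtoC t)) as [r1 [Hr1 B1]]; [now split|]. destruct (Ws_open (RtoC t)) as [r2 [Hr2 B2]]; [now split|].
  (* Agreement of value and derivative at the single point [t] spreads to a disc on which both
     solutions are defined; [same_near_ray_end] asks for equality on a neighbourhood. *)
  assert (Heq : forall s, Cmod (s - RtoC t) < Rmin r1 r2 -> Wof G s = Wof Ho s).
  { intros s Hs. refine (proj1 (PW_segment DW Ws (Wof G) (Wof Ho) (RtoC t) s ODW Ws_open SWG SW _ A0)).
    intros u Hu. assert (K := ball_seg (RtoC t) s _ u Hs Hu). split; [apply B1|apply B2]; (eapply Rlt_le_trans; [exact K|]); [apply Rmin_l|apply Rmin_r]. }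
  assert (Hloc : @locally C_UniformSpace (ray (PI / 5) t) (fun z => y_of_h h z = - lam * W (mu * z))%C).
  { apply (near_ray_locally _ (fun s => (Sec s /\ 1785/1000 < Cmod (s - 0)) /\ Cmod (s - RtoC t) < Rmin r1 r2)).
    - apply Copen_and; [apply Copen_and; [apply Sec_open|apply Copen_mod_gt]|apply Copen_mod_lt].
    - split; [split; [apply Sec_real; lra|replace (RtoC t - 0)%C with (RtoC t) by ring; rewrite Cmod_RtoC_nonneg; lra]|].
      replace (RtoC t - RtoC t)%C with (RtoC 0) by ring. rewrite Cmod_0. now apply Rmin_pos.
    - intros z [Hz Hr]. rewrite (Eyt z Hz). rewrite !y_of_h_Wof by apply sector_Sec, Hz.
      f_equal. change (Wof G (mu * z) = Wof (fun x => h0 (Ci * x)%C) (mu * z)). rewrite Heq by exact Hr. apply Wof_ext. unfold h0. now rewrite Ci_cancel. }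
  destruct (Hy t) as [_ Hyt]; [lra|].
  generalize (filter_and _ _ Hyt Hloc). apply filter_imp. intros z [-> Hz]. exact Hz.
Qed.
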